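(* Let $\mathbb{K}$ be an algebraically closed field of characteristic $p>0$ and let $\mathfrak{g}=\mathfrak{g}_{\bar 0}\oplus\mathfrak{g}_{\bar 1}$ be a finite-dimensional restricted Lie superalgebra over $\mathbb{K}$ which admits a triangular decomposition $\mathfrak{g}=\mathfrak{g}_{\bar 1}^-\oplus\mathfrak{n}^-\oplus\mathfrak{h}\oplus\mathfrak{n}^+\oplus\mathfrak{g}_{\bar 1}^+$, $\mathfrak{g}_{\bar 0}=\mathfrak{n}^-\oplus\mathfrak{h}\oplus\mathfrak{n}^+$, relative to a maximal torus $\mathfrak{h}$ of $\mathfrak{g}_{\bar 0}$. Assume that at least one of the following (A), (B) holds. (A) The triangular decomposition of $\mathfrak{g}$ is long, and $\mathfrak{g}$ has a restricted subalgebra $\mathfrak{l}=\mathfrak{l}_{\bar 0}\oplus\mathfrak{l}_{\bar 1}$ with a triangular decomposition $\mathfrak{l}=\mathfrak{l}_{\bar 1}^-\oplus\mathfrak{n}_{\mathfrak{l}}^-\oplus\mathfrak{h}\oplus\mathfrak{n}_{\mathfrak{l}}^+\oplus\mathfrak{l}_{\bar 1}^+$, $\mathfrak{l}_{\bar 0}=\mathfrak{n}_{\mathfrak{l}}^-\oplus\mathfrak{h}\oplus\mathfrak{n}_{\mathfrak{l}}^+$, such that: 1. $\mathfrak{l}_{\bar 1}^-\oplus\mathfrak{n}_{\mathfrak{l}}^-\oplus\mathfrak{n}_{\mathfrak{l}}^+\oplus\mathfrak{l}_{\bar 1}^+$ is a $p$-nilpotent $\mathbb{Z}_2$-graded ideal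 of $\mathfrak{l}$, and $\mathfrak{n}_{\mathfrak{l}}^+$ contains $\dim(\mathfrak{h})$ linearly independent weight vectors having linearly independent weights in $\Lambda$; 2. $\mathfrak{b}_{\mathfrak{l}}^-=\mathfrak{b}_{\mathfrak{g}}^-$; 3. $\mathfrak{n}_{\mathfrak{l}}^-=\mathfrak{n}^-$ has at least $\dim(\mathfrak{h})$ linearly independent vectors having linearly independent weights in $\Lambda$. (B) There exists a restricted subalgebra $\mathfrak{l}$ of $\mathfrak{g}$ such that: 1. $\mathfrak{b}_{\mathfrak{l}}^-=\mathfrak{b}_{\mathfrak{g}}^-$; 2. $\mathfrak{l}$ is a classical Lie superalgebra and there is a bijection $\psi:\Lambda\to\Lambda$ such that $[u(\mathfrak{l})\otimes_{u(\mathfrak{b}_{\mathfrak{l}}^-)}\mathbb{K}_\lambda]=[u(\mathfrak{l})\otimes_{u(\mathfrak{b}_{\mathfrak{l}}^+)}\mathbb{K}_{\psi(\lambda)}]$ for all $\lambda\in\Lambda$; 3. a vector space complementary to $\mathfrak{l}$ in $\mathfrak{g}$ has at least $\dim(\mathfrak{h})$ linearly independent vectors having linearly independent weights in $\Lambda$. Then $u(\mathfrak{g})$ is of one block.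
   Context: **Restricted Lie superalgebras.** A Lie superalgebra $\mathfrak{g}=\mathfrak{g}_{\bar 0}\oplus\mathfrak{g}_{\bar 1}$ over $\mathbb{K}$ is restricted if $(\mathfrak{g}_{\bar 0},[p])$ is a restricted Lie algebra and $\mathfrak{g}_{\bar 1}$ is a restricted $\mathfrak{g}_{\bar 0}$-module under the adjoint action. (In characteristics 2 and 3 the usual additional axioms for Lie superalgebras are understood, so that the PBW theorem holds.) The restricted enveloping superalgebra is $u(\mathfrak{g})=U(\mathfrak{g})/I_p$, where $I_p$ is the $\mathbb{Z}_2$-graded two-sided ideal generated by $\{x^p-x^{[p]}\mid x\in\mathfrak{g}_{\bar 0}\}$; restricted $\mathfrak{g}$-supermodules are the same as $u(\mathfrak{g})$-supermodules. **Triangular decompositions.** In a triangular decomposition of $\mathfrak{g}$ relative to a maximal torus $\mathfrak{h}$ of $\mathfrak{g}_{\bar 0}$ as displayed, $\mathfrak{n}^\pm$ are $p$-nilpotent subalgebras of $\mathfrak{g}_{\bar 0}$, $\mathfrak{g}_{\bar 1}=\mathfrak{g}_{\bar 1}^-\oplus\mathfrak{g}_{\bar 1}^+$, all summands are $\mathfrak{h}$-stable, $\mathfrak{b}_{\mathfrak{g}}^\pm:=\mathfrak{g}_{\bar 1}^\pm\oplus\mathfrak{n}^\pm\oplus\mathfrak{h}$ are restricted subalgebras, and $\mathfrak{g}_{\bar 1}^\pm\oplus\mathfrak{n}^\pm$ is an ideal of $\mathfrak{b}_{\mathfrak{g}}^\pm$. The decomposition is long if $\dim\mathfrak{n}^-<\dim\mathfrak{n}^+$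 and $\dim\mathfrak{g}_{\bar 1}^-<\dim\mathfrak{g}_{\bar 1}^+$. For a subalgebra $\mathfrak{l}$ with such a decomposition relative to $\mathfrak{h}$, $\mathfrak{b}_{\mathfrak{l}}^\pm:=\mathfrak{l}_{\bar 1}^\pm\oplus\mathfrak{n}_{\mathfrak{l}}^\pm\oplus\mathfrak{h}$; in case (B) the triangular decomposition of $\mathfrak{l}$ is the one induced from $\mathfrak{g}$, i.e. $\mathfrak{n}_{\mathfrak{l}}^\pm=\mathfrak{l}\cap\mathfrak{n}^\pm$, $\mathfrak{l}_{\bar 1}^\pm=\mathfrak{l}\cap\mathfrak{g}_{\bar 1}^\pm$. A $\mathbb{Z}_2$-graded subalgebra or ideal is $p$-nilpotent if every element $x$ of its even part satisfies $x^{[p]^r}=0$ for some $r$. A Lie superalgebra $\mathfrak{l}$ is classical if $\mathfrak{l}_{\bar 0}$ is reductive and $\mathfrak{l}_{\bar 1}$ is a completely reducible $\mathfrak{l}_{\bar 0}$-module (Kac's terminology; e.g. $\mathfrak{pgl}(m+1|n)$). **Weights and modules.** $\Lambda=\{\lambda\in\mathfrak{h}^*\mid\lambda(h^{[p]})=\lambda(h)^p\ \forall h\in\mathfrak{h}\}$ is the set of restricted weights, an $\mathbb{F}_p$-vector space of dimension $\dim\mathfrak{h}$. For $\lambda\in\Lambda$, $\mathbb{K}_\lambda$ is the one-dimensional module over $u(\mathfrak{b}_{\mathfrak{g}}^\pm)$ (resp. $u(\mathfrak{b}_{\mathfrak{l}}^\pm)$) on which $\mathfrak{h}$ acts via $\lambda$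 and the nilpotent part $\mathfrak{g}_{\bar 1}^\pm\oplus\mathfrak{n}^\pm$ (resp. $\mathfrak{l}_{\bar 1}^\pm\oplus\mathfrak{n}_{\mathfrak{l}}^\pm$) acts by zero. ''Vectors having weights'' means $\mathfrak{h}$-weight vectors. $[M]$ denotes the formal sum of the composition factors of $M$ (with multiplicity) in the Grothendieck group of restricted supermodules, where supermodules differing by a parity change are identified. **One block.** The simple $u(\mathfrak{g})$-supermodules, up to isomorphism and parity change, are parametrized by $\lambda\in\Lambda$: $L(\lambda)$ is the simple head of $u(\mathfrak{g})\otimes_{u(\mathfrak{b}_{\mathfrak{g}}^+)}\mathbb{K}_\lambda$. ''$u(\mathfrak{g})$ is of one block'' means that the finest equivalence relation on the set of these simple supermodules in which two simple supermodules are equivalent whenever both are composition factors of a common indecomposable (finite-dimensional) $u(\mathfrak{g})$-supermodule has exactly one class. *)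

(* Defs.v *)
From HB Require Import structures.
From mathcomp Require Import all_boot all_order all_algebra perm.
From mathcomp Require Import boolp monalg.

Set Implicit Arguments.
Unset Strict Implicit.
Unset Printing Implicit Defensive.

Import GRing.Theory.
Local Open Scope ring_scope.
Local Open Scope quotient_scope.

(* Algebra operations and maps are locked so that failing unification problems *)
(* do not unfold them.                                                        *)
Fact quot_key : unit. Proof. by []. Qed.

Section QuotAlg.
Variables (K : comNzRingType) (A : algType K) (S : A -> Prop).

Inductive ideal_gen : A -> Prop :=
| ig_in a : S a -> ideal_gen a
| ig_0 : ideal_gen 0
| ig_B a b : ideal_gen a -> ideal_gen b -> ideal_gen (a - b)
| ig_Ml a b : ideal_gen b -> ideal_gen (a * b)
| ig_Mr a b : ideal_gen a -> ideal_gen (a * b).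

Definition ideal_pred : {pred A} := fun a => `[< ideal_gen a >].

Fact ideal_pred_zmod_closed : zmod_closed ideal_pred.
Proof.
split=> [|a b]; first by apply/asboolP; exact: ig_0.
by move=> /asboolP ha /asboolP hb; apply/asboolP; exact: ig_B.
Qed.

HB.instance Definition _ :=
  GRing.isZmodClosed.Build A ideal_pred ideal_pred_zmod_closed.

Definition quot_alg : Type := Quotient.quot ideal_pred.

HB.instance Definition _ := GRing.Zmodule.on quot_alg.

Definition quo : A -> quot_alg := locked_with quot_key (fun a => \pi_(Quotient.quot ideal_pred) a).
Canonical quo_unlockable := [unlockable fun quo].

Lemma quo_eq a b : quo a = quo b <-> ideal_gen (a - b).
Proof.
split.
  by move=> /eqP; rewrite unlock -Quotient.idealrBE => /asboolP.
move=> h; apply/eqP; rewrite unlock -Quotient.idealrBE; exact/asboolP.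
Qed.

Definition quo_repr (q : quot_alg) : A := repr (q : Quotient.quot ideal_pred).

Lemma quo_reprK : cancel quo_repr quo.
Proof. by move=> q; rewrite unlock; exact: reprK. Qed.

Lemma ideal_repr a : ideal_gen (quo_repr (quo a) - a).
Proof. by apply/quo_eq; rewrite quo_reprK. Qed.

Fact quo_is_zmod_morphism : zmod_morphism quo.
Proof. rewrite unlock; exact: (raddfB \pi_(Quotient.quot ideal_pred)). Qed.

HB.instance Definition _ :=
  GRing.isZmodMorphism.Build A quot_alg quo quo_is_zmod_morphism.

Definition quo_mul : quot_alg -> quot_alg -> quot_alg := locked_with quot_key (fun x y =>
  quo (quo_repr x * quo_repr y)).
Canonical quo_mul_unlockable := [unlockable fun quo_mul].

Lemma quo_mulE a b : quo_mul (quo a) (quo b) = quo (a * b).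
Proof.
rewrite [quo_mul]unlock; apply/quo_eq; set a' := quo_repr _; set b' := quo_repr _.
have -> : a' * b' - a * b = (a' - a) * b' - a * (b - b').
  by rewrite mulrBl mulrBr opprB addrA subrK.
apply: ig_B; first by apply: ig_Mr; exact: ideal_repr.
apply: ig_Ml; rewrite -opprB -sub0r; apply: ig_B; first exact: ig_0.
exact: ideal_repr.
Qed.

Definition quo_scale : K -> quot_alg -> quot_alg := locked_with quot_key (fun c x =>
  quo (c *: quo_repr x)).
Canonical quo_scale_unlockable := [unlockable fun quo_scale].

Lemma quo_scaleE c a : quo_scale c (quo a) = quo (c *: a).
Proof.
rewrite [quo_scale]unlock; apply/quo_eq; rewrite -scalerBr -mulr_algl; apply: ig_Ml; exact: ideal_repr.
Qed.

Lemma quo_ind (P : quot_alg -> Prop) : (forall a, P (quo a)) -> forall q, P q.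
Proof. by move=> h q; rewrite -[q]quo_reprK. Qed.

Fact quo_mulA : associative quo_mul.
Proof.
elim/quo_ind=> x; elim/quo_ind=> y; elim/quo_ind=> z.
by rewrite !quo_mulE mulrA.
Qed.
Fact quo_mul1l : left_id (quo 1) quo_mul.
Proof. by elim/quo_ind=> x; rewrite quo_mulE mul1r. Qed.
Fact quo_mul1r : right_id (quo 1) quo_mul.
Proof. by elim/quo_ind=> x; rewrite quo_mulE mulr1. Qed.
Fact quo_mulDl : left_distributive quo_mul +%R.
Proof.
elim/quo_ind=> x; elim/quo_ind=> y; elim/quo_ind=> z.
by rewrite -(raddfD quo) !quo_mulE -(raddfD quo) mulrDl.
Qed.
Fact quo_mulDr : right_distributive quo_mul +%R.
Proof.
elim/quo_ind=> x; elim/quo_ind=> y; elim/quo_ind=> z.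
by rewrite -(raddfD quo) !quo_mulE -(raddfD quo) mulrDr.
Qed.

HB.instance Definition _ := GRing.Zmodule_isPzRing.Build quot_alg
  quo_mulA quo_mul1l quo_mul1r quo_mulDl quo_mulDr.

Fact quo_scaleA a b v : quo_scale a (quo_scale b v) = quo_scale (a * b) v.
Proof. by elim/quo_ind: v => v; rewrite !quo_scaleE scalerA. Qed.
Fact quo_scale1 : left_id 1 quo_scale.
Proof. by elim/quo_ind=> v; rewrite quo_scaleE scale1r. Qed.
Fact quo_scaleDr : right_distributive quo_scale +%R.
Proof.
move=> c; elim/quo_ind=> x; elim/quo_ind=> y.
by rewrite -(raddfD quo) !quo_scaleE -(raddfD quo) scalerDr.
Qed.
Fact quo_scaleDl v : {morph quo_scale^~ v : a b / a + b}.
Proof.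
move=> a b; elim/quo_ind: v => v.
by rewrite !quo_scaleE -(raddfD quo) scalerDl.
Qed.

HB.instance Definition _ := GRing.Zmodule_isLmodule.Build K quot_alg
  quo_scaleA quo_scale1 quo_scaleDr quo_scaleDl.

Fact quo_is_monoid_morphism : monoid_morphism quo.
Proof. by split=> // x y; rewrite -quo_mulE. Qed.
HB.instance Definition _ :=
  GRing.isMonoidMorphism.Build A quot_alg quo quo_is_monoid_morphism.

Fact quo_is_scalable : scalable quo.
Proof. by move=> c x; rewrite -quo_scaleE. Qed.
HB.instance Definition _ :=
  GRing.isScalable.Build K A quot_alg *:%R quo quo_is_scalable.

Fact quot_scalerAl (c : K) (u v : quot_alg) : c *: (u * v) = (c *: u) * v.
Proof.
elim/quo_ind: u => u; elim/quo_ind: v => v.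
by rewrite -(rmorphM quo) -!linearZ /= -rmorphM /= scalerAl.
Qed.

Fact quot_scalerAr (c : K) (u v : quot_alg) : c *: (u * v) = u * (c *: v).
Proof.
elim/quo_ind: u => u; elim/quo_ind: v => v.
by rewrite -(rmorphM quo) -!linearZ /= -rmorphM /= scalerAr.
Qed.

Variables (B : algType K) (f : {lrmorphism A -> B}).
Hypothesis fS : forall a, S a -> f a = 0.

Lemma ideal_gen_ker a : ideal_gen a -> f a = 0.
Proof.
elim=> {a} [a /fS //||a b _ ha _ hb|a b _ hb|a b _ ha].
- exact: rmorph0.
- by rewrite rmorphB /= ha hb subr0.
- by rewrite rmorphM /= hb mulr0.
- by rewrite rmorphM /= ha mul0r.
Qed.

Definition quot_lift_fun (_ : forall a, S a -> f a = 0) (q : quot_alg) : B :=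
  f (quo_repr q).
Local Notation quot_lift := (quot_lift_fun fS).

Lemma quot_liftE a : quot_lift (quo a) = f a.
Proof.
apply/eqP; rewrite -subr_eq0 /quot_lift_fun -raddfB.
by apply/eqP/ideal_gen_ker/ideal_repr.
Qed.

Fact quot_lift_is_zmod_morphism : zmod_morphism quot_lift.
Proof.
elim/quo_ind=> x; elim/quo_ind=> y.
by rewrite -(raddfB quo) !quot_liftE raddfB.
Qed.
HB.instance Definition _ :=
  GRing.isZmodMorphism.Build quot_alg B quot_lift quot_lift_is_zmod_morphism.

Fact quot_lift_is_monoid_morphism : monoid_morphism quot_lift.
Proof.
split; first by rewrite -(rmorph1 quo) quot_liftE rmorph1.
elim/quo_ind=> x; elim/quo_ind=> y.
by rewrite -(rmorphM quo) !quot_liftE rmorphM.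
Qed.
HB.instance Definition _ := GRing.isMonoidMorphism.Build quot_alg B quot_lift
  quot_lift_is_monoid_morphism.

Fact quot_lift_is_scalable : scalable quot_lift.
Proof.
move=> c; elim/quo_ind=> x.
by rewrite -quo_is_scalable !quot_liftE linearZ.
Qed.
HB.instance Definition _ := GRing.isScalable.Build K quot_alg B *:%R quot_lift
  quot_lift_is_scalable.

Lemma quot_alg_nz : (1 : quot_alg) != 0.
Proof.
apply/eqP=> h; have /eqP := oner_neq0 B; apply.
by rewrite -(rmorph1 quot_lift) h rmorph0.
Qed.

End QuotAlg.

Section QuotMod.
Variables (A : pzRingType) (M : lmodType A) (S : M -> Prop).

Inductive submod_gen : M -> Prop :=
| sg_in x : S x -> submod_gen x
| sg_0 : submod_gen 0
| sg_B x y : submod_gen x -> submod_gen y -> submod_gen (x - y)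
| sg_Z a x : submod_gen x -> submod_gen (a *: x).

Definition submod_pred : {pred M} := fun x => `[< submod_gen x >].

Fact submod_pred_zmod_closed : zmod_closed submod_pred.
Proof.
split=> [|a b]; first by apply/asboolP; exact: sg_0.
by move=> /asboolP ha /asboolP hb; apply/asboolP; exact: sg_B.
Qed.

HB.instance Definition _ :=
  GRing.isZmodClosed.Build M submod_pred submod_pred_zmod_closed.

Definition quot_mod : Type := Quotient.quot submod_pred.

HB.instance Definition _ := GRing.Zmodule.on quot_mod.

Definition mquo : M -> quot_mod := locked_with quot_key (fun x => \pi_(Quotient.quot submod_pred) x).
Canonical mquo_unlockable := [unlockable fun mquo].

Lemma mquo_eq x y : mquo x = mquo y <-> submod_gen (x - y).
Proof.
split.
  by move=> /eqP; rewrite unlock -Quotient.idealrBE => /asboolP.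
move=> h; apply/eqP; rewrite unlock -Quotient.idealrBE; exact/asboolP.
Qed.

Definition mquo_repr (q : quot_mod) : M := repr (q : Quotient.quot submod_pred).

Lemma mquo_reprK : cancel mquo_repr mquo.
Proof. by move=> q; rewrite unlock; exact: reprK. Qed.

Fact mquo_is_zmod_morphism : zmod_morphism mquo.
Proof. rewrite unlock; exact: (raddfB \pi_(Quotient.quot submod_pred)). Qed.

HB.instance Definition _ :=
  GRing.isZmodMorphism.Build M quot_mod mquo mquo_is_zmod_morphism.

Definition mquo_scale : A -> quot_mod -> quot_mod := locked_with quot_key (fun a x =>
  mquo (a *: mquo_repr x)).
Canonical mquo_scale_unlockable := [unlockable fun mquo_scale].

Lemma mquo_scaleE a x : mquo_scale a (mquo x) = mquo (a *: x).
Proof.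
rewrite [mquo_scale]unlock; apply/mquo_eq; rewrite -scalerBr; apply: sg_Z.
by apply/mquo_eq; rewrite mquo_reprK.
Qed.

Lemma mquo_ind (P : quot_mod -> Prop) : (forall x, P (mquo x)) -> forall q, P q.
Proof. by move=> h q; rewrite -[q]mquo_reprK. Qed.

Fact mquo_scaleA a b v : mquo_scale a (mquo_scale b v) = mquo_scale (a * b) v.
Proof. by elim/mquo_ind: v => v; rewrite !mquo_scaleE scalerA. Qed.
Fact mquo_scale1 : left_id 1 mquo_scale.
Proof. by elim/mquo_ind=> v; rewrite mquo_scaleE scale1r. Qed.
Fact mquo_scaleDr : right_distributive mquo_scale +%R.
Proof.
move=> c; elim/mquo_ind=> x; elim/mquo_ind=> y.
by rewrite -(raddfD mquo) !mquo_scaleE -(raddfD mquo) scalerDr.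
Qed.
Fact mquo_scaleDl v : {morph mquo_scale^~ v : a b / a + b}.
Proof.
move=> a b; elim/mquo_ind: v => v.
by rewrite !mquo_scaleE -(raddfD mquo) scalerDl.
Qed.

HB.instance Definition _ := GRing.Zmodule_isLmodule.Build A quot_mod
  mquo_scaleA mquo_scale1 mquo_scaleDr mquo_scaleDl.

Fact mquo_is_scalable : scalable mquo.
Proof. by move=> c x; rewrite -mquo_scaleE. Qed.
HB.instance Definition _ :=
  GRing.isScalable.Build A M quot_mod *:%R mquo mquo_is_scalable.

End QuotMod.

Section TensorProduct.
Variables (A : nzRingType) (B : pzRingType) (phi : {rmorphism B -> A}).
Variable N : lmodType B.

(* A (x)_B N is the free left A-module on the set N, where [a *: << n >>]       *)
(* stands for a (x) n, modulo additivity in n and balancedness; additivity in *)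
(* a is built in.                                                             *)
Inductive tensor_rel : {malg A[N]} -> Prop :=
| tensor_relD n n' : tensor_rel (<< n + n' >> - << n >> - << n' >>)
| tensor_relZ b n : tensor_rel (<< b *: n >> - phi b *: << n >>).

Definition tensor_prod : lmodType A := quot_mod tensor_rel.

Definition tens (a : A) (n : N) : tensor_prod :=
  mquo tensor_rel (a *: << n >>).

End TensorProduct.

Lemma malg_scalerAr (R : comNzRingType) (M : monomType) (c : R)
  (x y : {malg R[M]}) : c *: (x * y) = x * (c *: y).
Proof.
rewrite [RHS](malgMEw (d1 := msupp x) (d2 := msupp y)) ?msuppZ_le //.
rewrite malgME scaler_sumr; apply: eq_bigr => i _.
rewrite scaler_sumr; apply: eq_bigr => j _.
by apply/malgP=> k; rewrite mcoeffZ !mcoeffU mcoeffZ mulrCA mulrnAr.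
Qed.

Section TensorAlgebra.
Variables (K : fieldType) (V : vectType K).

(* T(V), as the algebra of noncommutative polynomials in a basis of V.        *)
Definition tensor_alg : Type := {malg K[{fmonom 'I_(\dim {:V})}]}.

HB.instance Definition _ := GRing.Lmodule.on tensor_alg.

Definition tmul : tensor_alg -> tensor_alg -> tensor_alg :=
  locked_with quot_key (fun x y : {malg K[{fmonom 'I_(\dim {:V})}]} => x * y).
Canonical tmul_unlockable := [unlockable fun tmul].

Lemma tmulE (x y : {malg K[{fmonom 'I_(\dim {:V})}]}) : tmul x y = x * y.
Proof. by rewrite unlock. Qed.

Fact tmulA : associative tmul.
Proof. by rewrite unlock; exact: mulrA. Qed.
Fact tmul1l : left_id (1 : {malg K[{fmonom 'I_(\dim {:V})}]}) tmul.
Proof. by rewrite unlock; exact: mul1r. Qed.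
Fact tmul1r : right_id (1 : {malg K[{fmonom 'I_(\dim {:V})}]}) tmul.
Proof. by rewrite unlock; exact: mulr1. Qed.
Fact tmulDl : left_distributive tmul +%R.
Proof. by rewrite unlock; exact: mulrDl. Qed.
Fact tmulDr : right_distributive tmul +%R.
Proof. by rewrite unlock; exact: mulrDr. Qed.

HB.instance Definition _ := GRing.Zmodule_isNzRing.Build tensor_alg
  tmulA tmul1l tmul1r tmulDl tmulDr
  (oner_neq0 {malg K[{fmonom 'I_(\dim {:V})}]}).

Fact tensor_alg_scalerAl (c : K) (x y : tensor_alg) :
  c *: tmul x y = tmul (c *: x) y.
Proof.
rewrite !tmulE; exact: (@scalerAl _ {malg K[_]}).
Qed.

HB.instance Definition _ :=
  GRing.Lmodule_isLalgebra.Build K tensor_alg tensor_alg_scalerAl.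

Fact tensor_alg_scalerAr (c : K) (x y : tensor_alg) :
  c *: tmul x y = tmul x (c *: y).
Proof.
rewrite !tmulE; exact: malg_scalerAr.
Qed.

HB.instance Definition _ :=
  GRing.Lalgebra_isAlgebra.Build K tensor_alg tensor_alg_scalerAr.

Definition tvar : V -> tensor_alg := locked_with quot_key (fun x =>
  \sum_i coord (vbasis {:V}) i x *: << fmu i >>).
Canonical tvar_unlockable := [unlockable fun tvar].

Fact tvar_is_linear : linear tvar.
Proof.
move=> c x y; rewrite unlock scaler_sumr -big_split; apply: eq_bigr => i _ /=.
by rewrite linearP scalerDl scalerA.
Qed.

HB.instance Definition _ :=
  GRing.isLinear.Build K V tensor_alg *:%R tvar tvar_is_linear.

Variables (A : algType K) (f : {linear V -> A}).

Definition tword (m : {fmonom 'I_(\dim {:V})}) : A :=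
  \prod_(i <- (m : seq _)) f (vbasis {:V})`_i.

Fact tword_mmorphism : mmorphism tword.
Proof.
by split=> [x y|]; rewrite /tword ?fmM ?fm1 ?big_cat ?big_nil.
Qed.

HB.instance Definition _ := isMultiplicative.Build _ A tword tword_mmorphism.

Definition tlift : tensor_alg -> A :=
  locked_with quot_key (mmap (in_alg A) tword).
Canonical tlift_unlockable := [unlockable of tlift].

Fact tlift_is_zmod_morphism : zmod_morphism tlift.
Proof. rewrite unlock; exact: (raddfB (mmap (in_alg A) tword)). Qed.
HB.instance Definition _ :=
  GRing.isZmodMorphism.Build tensor_alg A tlift tlift_is_zmod_morphism.

Fact tlift_is_monoid_morphism : monoid_morphism tlift.
Proof.
have C (g : {malg K[{fmonom 'I_(\dim {:V})}]}) m m' :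
    GRing.comm (in_alg A g@_m) (tword m').
  by rewrite /GRing.comm /= mulr_algl mulr_algr.
case: (commr_mmap_is_multiplicative C) => fM f1; rewrite unlock.
split; first exact: f1.
by move=> x y; rewrite -fM -tmulE.
Qed.
HB.instance Definition _ :=
  GRing.isMonoidMorphism.Build tensor_alg A tlift tlift_is_monoid_morphism.

Fact tlift_is_scalable : scalable tlift.
Proof.
by move=> c x; rewrite unlock mmapZ /= mulr_algl.
Qed.
HB.instance Definition _ :=
  GRing.isScalable.Build K tensor_alg A *:%R tlift tlift_is_scalable.

Lemma tlift_tvar x : tlift (tvar x) = f x.
Proof.
rewrite [in RHS](coord_vbasis (memvf x)) [tvar]unlock !linear_sum /=.
apply: eq_bigr => i _; rewrite tlift_is_scalable linearZ /=; congr (_ *: _).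
by rewrite unlock mmapU /= scale1r mul1r /tword fmU big_seq1.
Qed.

End TensorAlgebra.

Section JacobsonCoefficients.
Variables (K : fieldType) (V : lmodType K) (br : V -> V -> V).

(* Coefficient of T^j in (ad (T x + y))^n (x).                                *)
Fixpoint ad_coef (x y : V) (n j : nat) : V :=
  match n with
  | 0 => if j is 0 then x else 0
  | m.+1 => (if j is j'.+1 then br x (ad_coef x y m j') else 0)
            + br y (ad_coef x y m j)
  end.

(* Jacobson's s_i(x, y):  (ad (T x + y))^(p-1) (x) = \sum_i i s_i(x, y) T^(i-1) *)
Definition jacobson_s (p i : nat) (x y : V) : V :=
  i%:R^-1 *: ad_coef x y p.-1 i.-1.

End JacobsonCoefficients.

(* [gr false] and [gr true] are the even and the odd part.                    *)
(* [sq] is the squaring of odd elements: it is (1/2)[x, x] outside            *)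
(* characteristic 2, and an additional datum in characteristic 2; [br_alt],   *)
(* [br_cube] and the [sq] axioms are the usual extra axioms that are needed   *)
(* for PBW in characteristics 2 and 3, and follow from the other ones         *)
(* elsewhere.  The values of [sq] off the odd part and of the p-map [pm] off  *)
(* the even part are irrelevant.                                              *)
Record is_restrictedLSA (K : fieldType) (p : nat) (V : vectType K)
    (gr : bool -> {vspace V}) (br : V -> V -> V) (sq pm : V -> V) : Prop := {
  gr_sum : (gr false + gr true = fullv)%VS;
  gr_cap : (gr false :&: gr true = 0)%VS;
  br_linl : forall a x y z, br (a *: x + y) z = a *: br x z + br y z;
  br_linr : forall a x y z, br z (a *: x + y) = a *: br z x + br z y;
  br_gr : forall i j x y,
    x \in gr i -> y \in gr j -> br x y \in gr (i (+) j);
  br_skew : forall i j x y, x \in gr i -> y \in gr j ->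
    br x y = - ((-1) ^+ (i && j) *: br y x);
  br_jacobi : forall i j x y z, x \in gr i -> y \in gr j ->
    br x (br y z) = br (br x y) z + (-1) ^+ (i && j) *: br y (br x z);
  br_alt : forall x, x \in gr false -> br x x = 0;
  br_cube : forall x, x \in gr true -> br x (br x x) = 0;
  sq_gr : forall x, x \in gr true -> sq x \in gr false;
  sqZ : forall a x, x \in gr true -> sq (a *: x) = a ^+ 2 *: sq x;
  sqD : forall x y, x \in gr true -> y \in gr true ->
    sq (x + y) = sq x + sq y + br x y;
  ad_sq : forall x y, x \in gr true -> br (sq x) y = br x (br x y);
  pm_gr : forall x, x \in gr false -> pm x \in gr false;
  pmZ : forall a x, x \in gr false -> pm (a *: x) = a ^+ p *: pm x;
  pmD : forall x y, x \in gr false -> y \in gr false ->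
    pm (x + y) = pm x + pm y + \sum_(1 <= i < p) jacobson_s br p i x y;
  ad_pm : forall x y, x \in gr false -> br (pm x) y = iter p (br x) y
}.

Record restrictedLSA (K : fieldType) (p : nat) := RestrictedLSA {
  lsa_sort :> vectType K;
  gr : bool -> {vspace lsa_sort};
  br : lsa_sort -> lsa_sort -> lsa_sort;
  sq : lsa_sort -> lsa_sort;
  pm : lsa_sort -> lsa_sort;
  lsa_pchar : p \in [pchar K];
  lsaP : is_restrictedLSA p gr br sq pm
}.

Section Subalgebras.
Variables (K : fieldType) (p : nat) (g : restrictedLSA K p).
Implicit Types (U I h : {vspace g}) (x y : g).

Definition graded U : Prop := (U = U :&: gr g false + U :&: gr g true)%VS.

Record is_rsubalg U : Prop := {
  rs_graded : graded U;
  rs_br : forall x y, x \in U -> y \in U -> br x y \in U;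
  rs_sq : forall x, x \in (U :&: gr g true)%VS -> sq x \in U;
  rs_pm : forall x, x \in (U :&: gr g false)%VS -> pm x \in U
}.

Record rsubalg := Rsubalg {
  rs_space :> {vspace g};
  rsP : is_rsubalg rs_space
}.

Record is_ideal U I : Prop := {
  id_sub : (I <= U)%VS;
  id_graded : graded I;
  id_br : forall x y, x \in U -> y \in I -> br x y \in I;
  id_sq : forall x, x \in (I :&: gr g true)%VS -> sq x \in I
}.

Definition p_nilpotent U : Prop :=
  forall x, x \in (U :&: gr g false)%VS -> exists r, iter r (@pm _ _ g) x = 0.

Lemma full_is_rsubalg : is_rsubalg fullv.
Proof.
split=> *; rewrite ?memvf // /graded !capfv (gr_sum (lsaP g)) //.
Qed.

Definition rs_full : rsubalg := Rsubalg full_is_rsubalg.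

Section SubLSA.
Variable U : rsubalg.
Implicit Types u v w : subvs_of U.

Definition sub_gr (i : bool) : {vspace subvs_of U} :=
  (linfun (@vsval _ _ U) @^-1: gr g i)%VS.
Definition sub_br u v : subvs_of U := vsproj U (br (vsval u) (vsval v)).
Definition sub_sq u : subvs_of U := vsproj U (sq (vsval u)).
Definition sub_pm u : subvs_of U := vsproj U (pm (vsval u)).

Lemma sub_grE i u : (u \in sub_gr i) = (vsval u \in gr g i).
Proof. by rewrite -memv_preim lfunE. Qed.

Lemma val_sub_br u v : vsval (sub_br u v) = br (vsval u) (vsval v).
Proof. by rewrite vsprojK // (rs_br (rsP U)) ?subvsP. Qed.

Lemma val_sub_sq u : u \in sub_gr true -> vsval (sub_sq u) = sq (vsval u).
Proof.
by rewrite sub_grE => hu; rewrite vsprojK // (rs_sq (rsP U)) // memv_cap subvsP.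
Qed.

Lemma val_sub_pm u : u \in sub_gr false -> vsval (sub_pm u) = pm (vsval u).
Proof.
by rewrite sub_grE => hu; rewrite vsprojK // (rs_pm (rsP U)) // memv_cap subvsP.
Qed.

Lemma val_ad_coef u v n j :
  vsval (ad_coef sub_br u v n j) = ad_coef (@br _ _ g) (vsval u) (vsval v) n j.
Proof.
elim: n j => [|n IH] [|j] //=; rewrite ?linear0 //.
all: by rewrite !val_sub_br !IH.
Qed.

Lemma sub_is_restrictedLSA : is_restrictedLSA p sub_gr sub_br sub_sq sub_pm.
Proof.
have inj := @subvs_inj _ _ U; have G := lsaP g; split.
- apply/eqP; rewrite eqEsubv subvf /=; apply/subvP=> u _.
  have := subvsP u; rewrite {2}(rs_graded (rsP U)).
  case/memv_addP=> x /[!memv_cap]/andP[xU x0] [y /[!memv_cap]/andP[yU y1] e].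
  have -> : u = vsproj U x + vsproj U y.
    by apply: inj; rewrite linearD /= !vsprojK.
  by apply: memv_add; rewrite sub_grE vsprojK.
- apply/eqP; rewrite -subv0; apply/subvP=> u; rewrite memv_cap !sub_grE.
  rewrite -memv_cap (gr_cap G) !memv0 => /eqP e.
  by apply/eqP/inj; rewrite e linear0.
- by move=> a x y z; apply: inj; rewrite linearP /= !val_sub_br linearP (br_linl G).
- by move=> a x y z; apply: inj; rewrite linearP /= !val_sub_br linearP (br_linr G).
- by move=> i j x y; rewrite !sub_grE val_sub_br; apply: (br_gr G).
- move=> i j x y; rewrite !sub_grE => hx hy; apply: inj.
  by rewrite linearN linearZ /= !val_sub_br scalerN; exact: (br_skew G hx hy).
- move=> i j x y z; rewrite !sub_grE => hx hy; apply: inj.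
  by rewrite linearD linearZ /= !val_sub_br; exact: (br_jacobi G _ hx hy).
- by move=> x; rewrite sub_grE => hx; apply: inj; rewrite val_sub_br (br_alt G) ?linear0.
- by move=> x; rewrite sub_grE => hx; apply: inj; rewrite !val_sub_br (br_cube G) ?linear0.
- by move=> x hx; rewrite sub_grE val_sub_sq //; apply: (sq_gr G); rewrite -sub_grE.
- move=> a x hx; apply: inj; rewrite linearZ /= !val_sub_sq ?memvZ //.
  by rewrite linearZ; apply: (sqZ G); rewrite -sub_grE.
- move=> x y hx hy; apply: inj; rewrite !linearD /= !val_sub_sq ?memvD //.
  by rewrite val_sub_br linearD; apply: (sqD G); rewrite -sub_grE.
- move=> x y hx; apply: inj; rewrite !val_sub_br val_sub_sq //.
  by apply: (ad_sq G); rewrite -sub_grE.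
- by move=> x hx; rewrite sub_grE val_sub_pm //; apply: (pm_gr G); rewrite -sub_grE.
- move=> a x hx; apply: inj; rewrite linearZ /= !val_sub_pm ?memvZ //.
  by rewrite linearZ; apply: (pmZ G); rewrite -sub_grE.
- move=> x y hx hy; apply: inj; rewrite !linearD /= !val_sub_pm ?memvD //.
  rewrite linearD (pmD G) -?sub_grE //; congr (_ + _); rewrite linear_sum.
  by apply: eq_bigr => i _; rewrite /jacobson_s linearZ /= val_ad_coef.
- move=> x y hx; apply: inj; rewrite val_sub_br val_sub_pm //.
  rewrite (ad_pm G) -?sub_grE //.
  have H n : vsval (iter n (sub_br x) y) = iter n (br (vsval x)) (vsval y).
    by elim: n => //= n IH; rewrite val_sub_br IH.
  by rewrite H.
Qed.

Definition sub_lsa : restrictedLSA K p := RestrictedLSA (lsa_pchar g) sub_is_restrictedLSA.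

End SubLSA.
End Subalgebras.

Section EnvelopingAlgebras.
Variables (K : fieldType) (p : nat) (g : restrictedLSA K p).

(* U(g) is T(g) modulo xy - (-1)^{|x||y|}yx - [x, y] and, for odd x,           *)
(* x^2 - sq x (a consequence of the former outside characteristic 2).         *)
Inductive Uenv_rel : tensor_alg g -> Prop :=
| Uenv_rel_br i j x y : x \in gr g i -> y \in gr g j ->
    Uenv_rel (tvar x * tvar y - (-1) ^+ (i && j) *: (tvar y * tvar x)
              - tvar (br x y))
| Uenv_rel_sq x : x \in gr g true -> Uenv_rel (tvar x ^+ 2 - tvar (sq x)).

Definition Uenv : Type := quot_alg Uenv_rel.

HB.instance Definition _ := GRing.PzRing.on Uenv.
HB.instance Definition _ := GRing.Lmodule.on Uenv.

Section Lift.
Variables (A : algType K) (f : {linear g -> A}).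

Definition Uenv_compat : Prop :=
  (forall i j x y, x \in gr g i -> y \in gr g j ->
    f x * f y - (-1) ^+ (i && j) *: (f y * f x) = f (br x y)) /\
  (forall x, x \in gr g true -> f x ^+ 2 = f (sq x)).

Lemma Uenv_rel_ker : Uenv_compat -> forall t, Uenv_rel t -> tlift f t = 0.
Proof.
have fB a b : tlift f (a - b) = tlift f a - tlift f b by exact: rmorphB.
have fM a b : tlift f (a * b) = tlift f a * tlift f b by exact: rmorphM.
case=> fbr fsq t [i j x y hx hy | x hx].
  by rewrite 2!fB tlift_is_scalable 2!fM !tlift_tvar (fbr i j) // subrr.
by rewrite fB expr2 fM !tlift_tvar -expr2 fsq // subrr.
Qed.

End Lift.

Lemma Uenv_compat0 : Uenv_compat (\0 : {linear g -> K^o}).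
Proof.
by split=> [i j x y _ _|x _] /=; rewrite ?expr2 !mulr0 ?scaler0 ?subrr.
Qed.

Fact Uenv_nz : (1 : Uenv) != 0.
Proof. exact: (quot_alg_nz (Uenv_rel_ker Uenv_compat0)). Qed.

HB.instance Definition _ := GRing.PzSemiRing_isNonZero.Build Uenv Uenv_nz.
HB.instance Definition _ :=
  GRing.Lmodule_isLalgebra.Build K Uenv (@quot_scalerAl _ _ Uenv_rel).
HB.instance Definition _ :=
  GRing.Lalgebra_isAlgebra.Build K Uenv (@quot_scalerAr _ _ Uenv_rel).


Definition Uiota (x : g) : Uenv := quo Uenv_rel (tvar x).

Fact Uiota_is_linear : linear Uiota.
Proof. by move=> c x y; rewrite /Uiota !linearP. Qed.
HB.instance Definition _ := GRing.isLinear.Build K g Uenv *:%R Uiota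
  Uiota_is_linear.

Section ULift.
Variables (A : algType K) (f : {linear g -> A}) (fU : Uenv_compat f).

Definition Ulift : Uenv -> A := quot_lift_fun (Uenv_rel_ker fU).
HB.instance Definition _ := GRing.RMorphism.on Ulift.
HB.instance Definition _ := GRing.isScalable.Build K Uenv A *:%R Ulift
  (quot_lift_is_scalable (Uenv_rel_ker fU)).

Lemma Ulift_Uiota x : Ulift (Uiota x) = f x.
Proof. by rewrite /Ulift /Uiota quot_liftE /= tlift_tvar. Qed.
End ULift.

(* u(g) = U(g) / I_p *)
Inductive renv_rel : Uenv -> Prop :=
| renv_rel_pm x : x \in gr g false -> renv_rel (Uiota x ^+ p - Uiota (pm x)).

Definition renv : Type := quot_alg renv_rel.

HB.instance Definition _ := GRing.PzRing.on renv.
HB.instance Definition _ := GRing.Lmodule.on renv.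

Lemma renv_rel_ker (A : algType K) (f : {linear g -> A})
    (fU : Uenv_compat f) (fp : forall x, x \in gr g false -> f x ^+ p = f (pm x)) :
  forall t, renv_rel t -> Ulift fU t = 0.
Proof. by move=> t [x hx]; rewrite rmorphB rmorphXn /= !Ulift_Uiota fp // subrr. Qed.


Fact renv_nz : (1 : renv) != 0.
Proof.
have fp x : x \in gr g false ->
    (\0 : {linear g -> K^o}) x ^+ p = (\0 : {linear g -> K^o}) (pm x).
  have := prime_gt0 (pcharf_prime (lsa_pchar g)).
  by rewrite lt0n /= expr0n => /negbTE->.
exact: (quot_alg_nz (renv_rel_ker Uenv_compat0 fp)).
Qed.

HB.instance Definition _ := GRing.PzSemiRing_isNonZero.Build renv renv_nz.
HB.instance Definition _ :=
  GRing.Lmodule_isLalgebra.Build K renv (@quot_scalerAl _ _ renv_rel).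
HB.instance Definition _ :=
  GRing.Lalgebra_isAlgebra.Build K renv (@quot_scalerAr _ _ renv_rel).

Definition uiota (x : g) : renv := quo renv_rel (Uiota x).

Fact uiota_is_linear : linear uiota.
Proof. by move=> c x y; rewrite /uiota !linearP. Qed.
HB.instance Definition _ := GRing.isLinear.Build K g renv *:%R uiota
  uiota_is_linear.

(* The least grading compatible with that of g.                               *)
Inductive renv_gr : bool -> renv -> Prop :=
| renv_gr0 i : renv_gr i 0
| renv_gr1 : renv_gr false 1
| renv_grD i a b : renv_gr i a -> renv_gr i b -> renv_gr i (a + b)
| renv_grZ i (c : K) a : renv_gr i a -> renv_gr i (c *: a)
| renv_grM i j a b : renv_gr i a -> renv_gr j b -> renv_gr (i (+) j) (a * b)
| renv_gr_uiota i x : x \in gr g i -> renv_gr i (uiota x).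

Section RLift.
Variables (A : algType K) (f : {linear g -> A}) (fU : Uenv_compat f).
Hypothesis fp : forall x, x \in gr g false -> f x ^+ p = f (pm x).

Definition rlift : renv -> A := quot_lift_fun (renv_rel_ker fU fp).
HB.instance Definition _ := GRing.RMorphism.on rlift.
HB.instance Definition _ := GRing.isScalable.Build K renv A *:%R rlift
  (quot_lift_is_scalable (renv_rel_ker fU fp)).

Lemma rlift_uiota x : rlift (uiota x) = f x.
Proof. by rewrite /rlift /uiota quot_liftE /= Ulift_Uiota. Qed.
End RLift.

Lemma uiota_br i j x y : x \in gr g i -> y \in gr g j ->
  uiota x * uiota y - (-1) ^+ (i && j) *: (uiota y * uiota x) = uiota (br x y).
Proof.
move=> hx hy; rewrite /uiota -!(rmorphM (quo renv_rel)) -quo_is_scalable -(raddfB (quo renv_rel)).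
congr (quo _ _); apply/eqP; rewrite -subr_eq0; apply/eqP.
rewrite /Uiota -!(rmorphM (quo Uenv_rel)) -quo_is_scalable -!(raddfB (quo Uenv_rel)).
rewrite -[RHS](raddf0 (quo Uenv_rel)); apply/quo_eq; rewrite subr0.
exact/ig_in/Uenv_rel_br.
Qed.

Lemma uiota_sq x : x \in gr g true -> uiota x ^+ 2 = uiota (sq x).
Proof.
move=> hx; rewrite /uiota -(rmorphXn (quo renv_rel)); congr (quo _ _).
rewrite /Uiota -(rmorphXn (quo Uenv_rel)); apply/quo_eq; exact/ig_in/Uenv_rel_sq.
Qed.

Lemma uiota_pm x : x \in gr g false -> uiota x ^+ p = uiota (pm x).
Proof.
move=> hx; rewrite /uiota -(rmorphXn (quo renv_rel)); apply/quo_eq; exact/ig_in/renv_rel_pm.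
Qed.

End EnvelopingAlgebras.

Section Functoriality.
Variables (K : fieldType) (p : nat) (g : restrictedLSA K p).
Variables (b l : rsubalg g).
Hypothesis bl : (b <= l)%VS.

Definition sub_incl (x : sub_lsa b) : sub_lsa l := vsproj l (vsval x).

Fact sub_incl_is_linear : linear sub_incl.
Proof. by move=> c x y; rewrite /sub_incl !linearP. Qed.
HB.instance Definition _ := GRing.isLinear.Build K _ _ *:%R sub_incl
  sub_incl_is_linear.


Lemma val_sub_incl x : vsval (sub_incl x) = vsval x.
Proof. by rewrite vsprojK // (subvP bl) ?subvsP. Qed.

Lemma sub_incl_gr i x : x \in gr (sub_lsa b) i -> sub_incl x \in gr (sub_lsa l) i.
Proof. by rewrite !sub_grE val_sub_incl. Qed.

Definition uiota_incl (x : sub_lsa b) : renv (sub_lsa l) := uiota (sub_incl x).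

Fact uiota_incl_is_linear : linear uiota_incl.
Proof. by move=> c x y; rewrite /uiota_incl !linearP. Qed.
HB.instance Definition _ := GRing.isLinear.Build K _ _ *:%R uiota_incl
  uiota_incl_is_linear.

Lemma uiota_incl_compat : Uenv_compat uiota_incl.
Proof.
split=> [i j x y hx hy | x hx].
  rewrite [LHS](uiota_br (sub_incl_gr hx) (sub_incl_gr hy)); congr uiota.
  by apply: subvs_inj; rewrite val_sub_incl !val_sub_br !val_sub_incl.
rewrite [LHS](uiota_sq (sub_incl_gr hx)); congr uiota; apply: subvs_inj.
by rewrite val_sub_incl !val_sub_sq ?sub_incl_gr // val_sub_incl.
Qed.

Lemma uiota_incl_pm x : x \in gr (sub_lsa b) false ->
  uiota_incl x ^+ p = uiota_incl (pm x).
Proof.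
move=> hx; rewrite [LHS](uiota_pm (sub_incl_gr hx)); congr uiota.
apply: subvs_inj.
by rewrite val_sub_incl !val_sub_pm ?sub_incl_gr // val_sub_incl.
Qed.

Definition renv_incl : {lrmorphism renv (sub_lsa b) -> renv (sub_lsa l)} :=
  rlift uiota_incl_compat uiota_incl_pm.

Lemma renv_incl_uiota x : renv_incl (uiota x) = uiota (sub_incl x).
Proof. exact: rlift_uiota. Qed.

End Functoriality.

Record superalg (K : fieldType) := Superalg {
  sa_alg :> algType K;
  sa_gr : bool -> sa_alg -> Prop
}.

Definition usuper (K : fieldType) (p : nat) (g : restrictedLSA K p) : superalg K :=
  Superalg (@renv_gr K p g).

(* A module with a candidate Z_2-grading.  The supermodule axioms are kept     *)
(* apart so that an induced module can be formed before they are proved.      *)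
Record gmodule (K : fieldType) (A : superalg K) := Gmodule {
  gm_mod :> lmodType A;
  gm_gr : bool -> gm_mod -> Prop
}.

Section Supermodules.
Variables (K : fieldType) (A : superalg K).
Implicit Types (M N S T : gmodule A).

Record is_supermodule M : Prop := {
  gm_gr0 : forall i, gm_gr i (0 : M);
  gm_grB : forall i (x y : M), gm_gr i x -> gm_gr i y -> gm_gr i (x - y);
  gm_sum : forall x : M,
    exists x0 x1, [/\ gm_gr false x0, gm_gr true x1 & x = x0 + x1];
  gm_cap : forall x : M, gm_gr false x -> gm_gr true x -> x = 0;
  gm_act : forall i j (a : A) (x : M),
    sa_gr i a -> gm_gr j x -> gm_gr (i (+) j) (a *: x)
}.

Record is_subsupermodule M (P : M -> Prop) : Prop := {
  ss_0 : P 0;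
  ss_B : forall x y, P x -> P y -> P (x - y);
  ss_Z : forall (a : A) x, P x -> P (a *: x);
  ss_gr : forall x, P x -> exists x0 x1,
    [/\ P x0, P x1, gm_gr false x0, gm_gr true x1 & x = x0 + x1]
}.

Definition simple M : Prop :=
  [/\ is_supermodule M, exists x : M, x != 0
    & forall P : M -> Prop, is_subsupermodule P ->
        (forall x, P x -> x = 0) \/ (forall x, P x)].

Definition finite_dim M : Prop :=
  exists n (v : 'I_n -> M), forall x, exists c : 'I_n -> K,
    x = \sum_i ((c i)%:A : A) *: v i.

Definition indecomposable M : Prop :=
  [/\ is_supermodule M, exists x : M, x != 0
    & forall P Q : M -> Prop, is_subsupermodule P -> is_subsupermodule Q ->
        (forall x, exists y z, [/\ P y, Q z & x = y + z]) ->
        (forall x, P x -> Q x -> x = 0) ->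
        (forall x, P x -> x = 0) \/ (forall x, Q x -> x = 0)].

(* Isomorphic up to parity change: [e = true] for an odd isomorphism.  The    *)
(* sign (-1)^|a| that some authors put in the action on the parity shift of M *)
(* is irrelevant, being absorbed by x |-> (-1)^|x| x.                         *)
Definition iso_par M N : Prop :=
  exists (f : {linear M -> N}) (e : bool), bijective f /\
    forall i x, gm_gr i x -> gm_gr (i (+) e) (f x).

(* S is isomorphic, up to parity change, to the submodule P / Q of M / Q      *)
(* (Q is included in P).                                                      *)
Definition iso_subquot S M (P Q : M -> Prop) : Prop :=
  exists (f : {linear S -> quot_mod Q}) (e : bool),
    [/\ injective f,
        forall x, P x -> exists s, f s = mquo Q x
      & forall i s, gm_gr i s ->
          exists x, [/\ P x, gm_gr (i (+) e) x & f s = mquo Q x]].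

(* [F 0], ..., [F n.-1] are the successive factors of a composition series.   *)
Definition comp_series M n (F : 'I_n -> gmodule A) : Prop :=
  exists P : nat -> M -> Prop,
    [/\ forall x, P 0%N x <-> x = 0, forall x, P n x,
        forall i, (i <= n)%N -> is_subsupermodule (P i)
      & forall i : 'I_n, [/\ forall x, P i x -> P i.+1 x, simple (F i)
                           & iso_subquot (F i) (P i.+1) (P i)]].

Definition comp_factor M S : Prop :=
  exists n (F : 'I_n -> gmodule A) (i : 'I_n),
    comp_series M F /\ iso_par (F i) S.

(* [M] = [N]                                                                  *)
Definition same_comp_factors M N : Prop :=
  exists n (F G : 'I_n -> gmodule A) (s : {perm 'I_n}),
    [/\ comp_series M F, comp_series N G & forall i, iso_par (F i) (G (s i))].

(* The equivalence relation on simple supermodules generated by isomorphism up *)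
(* to parity change and by sharing a finite-dimensional indecomposable.       *)
Inductive linked : gmodule A -> gmodule A -> Prop :=
| linked_iso S T : simple S -> simple T -> iso_par S T -> linked S T
| linked_indec S T M : simple S -> simple T ->
    indecomposable M -> finite_dim M -> comp_factor M S -> comp_factor M T ->
    linked S T
| linked_sym S T : linked S T -> linked T S
| linked_trans S T R : linked S T -> linked T R -> linked S R.

Definition one_block : Prop :=
  (exists S, simple S) /\ (forall S T, simple S -> simple T -> linked S T).

End Supermodules.

Section Induction.
Variables (K : fieldType) (B A : superalg K) (phi : {lrmorphism B -> A}).
Variable N : gmodule B.

Inductive tensor_gr : bool -> tensor_prod phi N -> Prop :=
| tensor_gr0 i : tensor_gr i 0
| tensor_grB i x y : tensor_gr i x -> tensor_gr i y -> tensor_gr i (x - y)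
| tensor_gr_tens i j (a : A) (n : N) :
    sa_gr i a -> gm_gr j n -> tensor_gr (i (+) j) (tens phi a n).

Definition induced : gmodule A := Gmodule tensor_gr.

End Induction.

Section Triangular.
Variables (K : fieldType) (p : nat) (g : restrictedLSA K p).
Implicit Types (U V I L h n : {vspace g}) (l b : rsubalg g).

Definition br_closed U : Prop :=
  forall x y, x \in U -> y \in U -> br x y \in U.

Definition stable L U : Prop :=
  forall x y, x \in L -> y \in U -> br x y \in U.

(* x lies in the p-subalgebra generated by pm x.                              *)
Definition semisimple_elt (x : g) : Prop :=
  exists r, x \in <<[seq iter i.+1 (@pm _ _ g) x | i <- iota 0 r]>>%VS.

Record is_torus h : Prop := {
  torus_even : (h <= gr g false)%VS;
  torus_pm : forall x, x \in h -> pm x \in h;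
  torus_abelian : forall x y, x \in h -> y \in h -> br x y = 0;
  torus_semisimple : forall x, x \in h -> semisimple_elt x
}.

Definition maximal_torus L h : Prop :=
  [/\ is_torus h, (h <= L)%VS
    & forall h', is_torus h' -> (h' <= L)%VS -> (h <= h')%VS -> h' = h].

Record triangular_decomposition l h := TriangularDecomposition {
  om : {vspace g};
  nm : {vspace g};
  np : {vspace g};
  op : {vspace g};
  bm : rsubalg g;
  bp : rsubalg g;
  td_sum : (om + nm + h + np + op)%VS = l;
  td_direct : directv (om + nm + h + np + op)%VS;
  td_even : (nm + h + np = l :&: gr g false)%VS;
  td_odd : (om + op = l :&: gr g true)%VS;
  td_torus : maximal_torus (l :&: gr g false)%VS h;
  td_nm : br_closed nm /\ p_nilpotent nm;
  td_np : br_closed np /\ p_nilpotent np;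
  td_stable : [/\ stable h om, stable h nm, stable h np & stable h op];
  td_bm : (om + nm + h)%VS = bm;
  td_bp : (op + np + h)%VS = bp;
  td_bm_ideal : is_ideal bm (om + nm)%VS;
  td_bp_ideal : is_ideal bp (op + np)%VS
}.

Lemma bm_sub l h (T : triangular_decomposition l h) : (bm T <= l)%VS.
Proof.
rewrite -(td_bm T) -(td_sum T) -[X in (_ <= X)%VS]addvA; exact: addvSl.
Qed.

Lemma bp_sub l h (T : triangular_decomposition l h) : (bp T <= l)%VS.
Proof.
rewrite -(td_bp T) -(td_sum T); apply/subvP=> x.
case/memv_addP=> y /memv_addP[o ho [n hn ->]] [t ht ->].
by rewrite addrC addrA [t + o]addrC -addrA addrC; apply: memv_add => //;
   apply: memv_add => //; rewrite -[t]add0r; apply: memv_add => //; rewrite mem0v.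
Qed.

Definition long l h (T : triangular_decomposition l h) : Prop :=
  (\dim (nm T) < \dim (np T))%N /\ (\dim (om T) < \dim (op T))%N.

(* Weights are linear forms on h; for t in h, [wt lam t] is lam(t).           *)
Definition wt h (lam : 'Hom(subvs_of h, K^o)) (t : g) : K := lam (vsproj h t).

Definition Lambda h : Type :=
  { lam : 'Hom(subvs_of h, K^o)
  | forall t, t \in h -> wt lam (pm t) = wt lam t ^+ p }.

Definition weight_vector h (lam : Lambda h) (x : g) : Prop :=
  forall t, t \in h -> br t x = wt (sval lam) t *: x.

Definition Fp_independent h d (lam : 'I_d -> Lambda h) : Prop :=
  forall c : 'I_d -> 'F_p,
    \sum_i ((c i : nat)%:R : K) *: sval (lam i) = 0 -> forall i, c i = 0.

Definition has_independent_weights h V : Prop :=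
  exists (x : (\dim h).-tuple g) (lam : 'I_(\dim h) -> Lambda h),
    [/\ free x, forall i, tnth x i \in V,
        forall i, weight_vector (lam i) (tnth x i)
      & Fp_independent lam].

(* N is a model of K_lam over u(b), for b = n (+) h with nilpotent part n.    *)
Definition is_Klam b n h (lam : Lambda h)
    (N : gmodule (usuper (sub_lsa b))) : Prop :=
  is_supermodule N /\ exists v : N,
    [/\ v != 0,
        forall x, exists c : K, x = (c%:A : usuper (sub_lsa b)) *: v,
        forall t, t \in h ->
          (uiota (vsproj b t : sub_lsa b) : usuper (sub_lsa b)) *: v
          = ((wt (sval lam) t)%:A : usuper (sub_lsa b)) *: v
      & forall t, t \in n ->
          (uiota (vsproj b t : sub_lsa b) : usuper (sub_lsa b)) *: v = 0].

Definition Ind_minus l h (T : triangular_decomposition l h)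
    (N : gmodule (usuper (sub_lsa (bm T)))) : gmodule (usuper (sub_lsa l)) :=
  @induced K (usuper (sub_lsa (bm T))) (usuper (sub_lsa l))
    (renv_incl (bm_sub T)) N.

Definition Ind_plus l h (T : triangular_decomposition l h)
    (N : gmodule (usuper (sub_lsa (bp T)))) : gmodule (usuper (sub_lsa l)) :=
  @induced K (usuper (sub_lsa (bp T))) (usuper (sub_lsa l))
    (renv_incl (bp_sub T)) N.

Definition lie_prod U V : {vspace g} :=
  <<[seq br x y | x <- vbasis U, y <- vbasis V]>>%VS.

Definition derived r U : {vspace g} := iter r (fun W => lie_prod W W) U.

(* The radical of L is its centre: every solvable ideal of L is central.      *)
Definition reductive L : Prop :=
  forall I, (I <= L)%VS -> stable L I -> (exists r, derived r I = 0%VS) ->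
    forall x y, x \in L -> y \in I -> br x y = 0.

Definition completely_reducible L V : Prop :=
  forall W, (W <= V)%VS -> stable L W ->
    exists W', [/\ stable L W', (W + W' = V)%VS & (W :&: W' = 0)%VS].

Definition classical l : Prop :=
  reductive (l :&: gr g false)%VS /\
  completely_reducible (l :&: gr g false)%VS (l :&: gr g true)%VS.

End Triangular.

(* Main.v *)
(* A diamond lemma argument for a reduction system on words gives PBW bases, so
   u(g) is free over u(l) for restricted subalgebras l, and induction from l to
   g is exact.  By Engel's theorem products of sufficiently many elements of a
   p-nilpotent ideal vanish in u(g).  Hence a module generated by a highest
   weight vector v is indecomposable: in a sum of two submodules one summand
   contains an element (c + n) v with c <> 0 and n nilpotent, so it contains v.
   Every simple module has a highest weight vector and is determined by its
   weight, and dim h independent weights in Lambda generate Lambda, so it is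
   enough to link the weights lam and lam + al for each of the given weights al.
   (A) Let M be induced from l to g from E, which is induced from b_l^- to l
   from K_lam.  If x in n_l^+ has weight al then x v <> 0 in E, so the
   one-dimensional l-module K_(lam + al) is a subquotient of E, and M has
   simple subquotients of highest weights lam and lam + al.
   (B) The modules induced from l to g from u(l) (x) K_lam over b_l^- and from
   u(l) (x) K_psi(lam) over b_l^+ have the same composition factors; the former
   is indecomposable, and the latter, which is also induced from b_g^+, has
   simple subquotients of highest weights psi(lam) and psi(lam) + al because
   g / l contains a vector of weight al. *)

Require Import Defs.
From HB Require Import structures.
From mathcomp Require Import all_boot all_order all_algebra perm.
From mathcomp Require Import boolp monalg ring zify finmap.

Set Implicit Arguments.
Unset Strict Implicit.
Unset Printing Implicit Defensive.

Import GRing.Theory.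
Local Open Scope ring_scope.

(** * Jacobson's formula *)

Section JacobsonFormula.

(** The obstacle is that the size of u(g) is unknown: it is a quotient of a quotient of a tensor
    algebra. Instead of normal forms, the rewriting computes values of linear forms: every function
    on normal words determines one, confluence makes it vanish on the defining ideal, and these
    forms separate the normal monomials. The defining relations range over all of g while the rules
    only see a basis; Jacobson's formula bridges this gap for the p-map. Modules have arbitrary
    carriers, so subquotients are handled as relations and freeness as a dual basis with values in
    the subalgebra, and both are compatible with induction. Highest weights are taken relative to an
    abstract sum of g from two nilpotent parts and the torus, whose signs are left open. This
    matters: in (A) vectors killed by the negative part serve throughout, whereas in (B) the simple
    modules are labelled by vectors killed by the positive part while the linking module is
    generated by one killed by the negative part. Coefficients of weights lift from F_p to natural
    numbers, so that steps in one direction reach every weight. *)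

Lemma bin_pred_prime (K : nzRingType) p (hp : p \in [pchar K]) k : (k < p)%N ->
  'C(p.-1, k)%:R * (-1) ^+ k = 1 :> K.
Proof.
have pr := pcharf_prime hp.
elim: k => [|k IH] hk; first by rewrite bin0 mulr1.
have hp0 : ('C(p, k.+1))%:R = 0 :> K.
  apply/eqP; rewrite -(dvdn_pcharf hp); apply: prime_dvd_bin => //.
have e : p = p.-1.+1 by rewrite prednK // prime_gt0.
move: hp0; rewrite {1}e binS natrD => /eqP; rewrite addr_eq0 => /eqP ->.
by rewrite exprS mulN1r mulrNN IH // ltnW.
Qed.

Variables (B : nzRingType).
Implicit Types a b x y : B.

(** Left and right multiplication by a commute, so this is the binomial expansion of a power of
    their difference. *)
Lemma iter_commutator a b n :
  iter n (fun z => a * z - z * a) b =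
  \sum_(k < n.+1) ((-1) ^+ k * 'C(n, k)%:R) * (a ^+ (n - k) * b * a ^+ k).
Proof.
elim: n => [|n IH].
  by rewrite big_ord_recl big_ord0 /= !expr0 !mul1r mulr1 addr0.
rewrite iterS IH mulr_sumr mulr_suml.
have cm (k : nat) (m : nat) z : z * ((-1) ^+ k * m%:R) = ((-1) ^+ k * m%:R) * z.
  by rewrite -signr_odd; case: (odd k); rewrite ?expr0 ?expr1 ?mulN1r ?mul1r ?mulrN ?mulNr mulr_natr mulr_natl.
have -> : \sum_(i < n.+1) a * ((-1) ^+ i * 'C(n, i)%:R * (a ^+ (n - i) * b * a ^+ i)) =
   \sum_(i < n.+2) ((-1) ^+ i * 'C(n, i)%:R * (a ^+ (n.+1 - i) * b * a ^+ i)).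
  rewrite [RHS]big_ord_recr /= bin_small // mulr0 mul0r addr0.
  by apply: eq_bigr => i _; rewrite mulrA cm -!mulrA (mulrA a) -exprS subSn // -ltnS.
(* The index moves up by one and the new term at 0 gets the coefficient 0, so that Pascal's rule
   adds the two sums. *)
have -> : \sum_(i < n.+1) (-1) ^+ i * 'C(n, i)%:R * (a ^+ (n - i) * b * a ^+ i) * a =
   - \sum_(i < n.+2) ((-1) ^+ i * (if (i : nat) is j.+1 then 'C(n, j) else 0%N)%:R * (a ^+ (n.+1 - i) * b * a ^+ i)).
  rewrite [in RHS]big_ord_recl /= mulr0 mul0r add0r -sumrN.
  by apply: eq_bigr => i _; rewrite /bump /= add1n subSS exprS mulN1r -!mulrA -exprSr !mulNr opprK !mulrA.
rewrite opprK -big_split; apply: eq_bigr => [[[|i] hi]] _ /=.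
  by rewrite !bin0 mulr0 mul0r addr0.
by rewrite binS natrD mulrDr mulrDl.
Qed.

(** In characteristic p every coefficient (-1)^k C(p - 1, k) in the expansion of ad(a)^(p - 1)
    equals 1. *)
Lemma sum_conj_powers p (hp : p \in [pchar B]) a b :
  \sum_(k < p) a ^+ k * b * a ^+ (p.-1 - k) = iter p.-1 (fun z => a * z - z * a) b.
Proof.
have pr := pcharf_prime hp.
have e : p = p.-1.+1 by rewrite prednK // prime_gt0.
rewrite iter_commutator -e [RHS](reindex_inj rev_ord_inj).
apply: eq_bigr => i _ /=.
have h1 : (p.-1 - (p - i.+1) = i)%N by have := ltn_ord i; lia.
have h2 : (p - i.+1 = p.-1 - i)%N by lia.
rewrite h1 h2; have : (p.-1 - i < p)%N by lia.
move=> /(bin_pred_prime hp) h3.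
have -> : (-1) ^+ (p.-1 - i) * 'C(p.-1, p.-1 - i)%:R = 1 :> B.
  by rewrite mulr_natr -[RHS]h3 mulr_natl.
by rewrite mul1r.
Qed.

Lemma deriv_exp_nc (P : {poly B}) n :
  (P ^+ n)^`() = \sum_(k < n) P ^+ k * P^`() * P ^+ (n.-1 - k).
Proof.
elim: n => [|n IH]; first by rewrite expr0 -polyC1 derivC big_ord0.
rewrite exprSr derivM IH big_ord_recr /= subnn expr0 mulr1; congr (_ + _).
rewrite mulr_suml; apply: eq_bigr => i _.
by rewrite -mulrA -exprSr; congr (_ * _ ^+ _); have := ltn_ord i; lia.
Qed.

End JacobsonFormula.

Section JacobsonAlgebra.
Variables (K : fieldType) (A : algType K).
Implicit Types x y : A.

Definition comm_br x y := x * y - y * x.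

Lemma coef_iter_comm x y n j :
  (iter n (fun z => (x%:P * 'X + y%:P) * z - z * (x%:P * 'X + y%:P)) (x%:P))`_j
  = ad_coef comm_br x y n j.
Proof.
elim: n j => [|n IH] j; first by rewrite /= coefC; case: j.
rewrite iterS; set z := iter n _ _ in IH *.
have -> : (x%:P * 'X + y%:P) * z - z * (x%:P * 'X + y%:P)
  = (x%:P * z - z * x%:P) * 'X + (y%:P * z - z * y%:P).
  rewrite mulrDl mulrDr mulrBl -!mulrA -(commr_polyX z) !mulrA.
  by rewrite opprD addrACA.
rewrite coefD coefMX !coefB !coefCM !coefMC !IH; by case: j.
Qed.

(** Expand (x T + y)^p and put T = 1. The extreme coefficients are y^p and x^p. The derivative is
    ad(x T + y)^(p - 1) (x), so i times the coefficient of T^i is the coefficient of T^(i - 1)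
    there, and i is invertible for 0 < i < p. *)
Lemma Jacobson_formula p (hp : p \in [pchar K]) x y :
  (x + y) ^+ p = x ^+ p + y ^+ p + \sum_(1 <= i < p) jacobson_s comm_br p i x y.
Proof.
have hA : p \in [pchar A] by rewrite (pchar_lalg A).
have hB : p \in [pchar {poly A}] by rewrite pchar_poly.
have pr := pcharf_prime hp.
have p0 := prime_gt0 pr.
pose P : {poly A} := x%:P * 'X + y%:P.
have dP : P^`() = x%:P by rewrite derivD derivM derivC mul0r add0r derivX mulr1 derivC addr0.
have sP n : (size (P ^+ n) <= n.+1)%N.
  elim: n => [|n IH]; first by rewrite expr0 size_poly1.
  rewrite exprS (leq_trans (size_polyMleq _ _)) //.
  have h : (size P <= 2)%N.
    rewrite (leq_trans (size_polyD _ _)) // geq_max; apply/andP; split; last first.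
      exact: leq_trans (size_polyC_leq1 _) _.
    rewrite (leq_trans (size_polyMleq _ _)) // size_polyX addn2 /=.
    by rewrite ltnS size_polyC_leq1.
  lia.
have ev n : (P ^+ n).[1] = (x + y) ^+ n.
  elim: n => [|n IH]; first by rewrite !expr0 hornerC.
  rewrite exprSr hornerM_comm; last by rewrite /comm_poly mulr1 mul1r.
  rewrite IH exprSr; congr (_ * _).
  by rewrite /P hornerD hornerMX !hornerC mulr1.
have c0 n : (P ^+ n)`_0 = y ^+ n.
  elim: n => [|n IH]; first by rewrite !expr0 coef1.
  by rewrite exprS coef0M IH coefD coefMX !coefC eqxx add0r -exprS.
have cn n : (P ^+ n)`_n = x ^+ n.
  elim: n => [|n IH]; first by rewrite !expr0 coef1.
  rewrite exprSr /P mulrDr mulrA coefD coefMX /= coefMC IH coefMC -exprSr.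
  by rewrite nth_default ?mul0r ?addr0 // -ltnS.
have ci i : (0 < i < p)%N -> (P ^+ p)`_i = jacobson_s comm_br p i x y.
  move=> /andP[i0 ip]; rewrite /jacobson_s -coef_iter_comm -/P.
  have := deriv_exp_nc P p; rewrite dP (sum_conj_powers hB) => /(congr1 (fun q : {poly A} => q`_i.-1)).
  rewrite coef_deriv prednK // => <-.
  rewrite -scaler_nat scalerA mulVf ?scale1r //.
  by rewrite -(dvdn_pcharf hp) gtnNdvd.
rewrite -ev (horner_coef_wide _ (sP p)).
rewrite big_ord_recr /= expr1n mulr1 cn addrC -addrA; congr (_ + _).
rewrite -(big_mkord xpredT (fun i => (P ^+ p)`_i * 1 ^+ i)) big_ltn // expr0 mulr1 c0.
congr (_ + _); rewrite !big_nat; apply: eq_bigr => i /ci ->.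
by rewrite expr1n mulr1.
Qed.
End JacobsonAlgebra.

(** * The Poincare-Birkhoff-Witt theorem for u(g) *)

Section Words.
Variables (K : fieldType) (V : vectType K).
Local Notation I := 'I_(\dim {:V}).
Local Notation T := (tensor_alg V).
Implicit Types (u v w : seq I) (t : T) (f : seq I -> K).

Definition word : seq I -> T := locked_with quot_key (fun w =>
  (<< FMonom w >> : {malg K[{fmonom I}]})).
Canonical word_unlockable := [unlockable fun word].

Section AlgebraIdentities.
Variables (A : algType K).
Implicit Types (c : K) (a x y z b : A).

Lemma mul_lcomb c a x y b : a * (c *: x + y) * b = c *: (a * x * b) + a * y * b.
Proof. by rewrite mulrDr mulrDl -scalerAr -scalerAl. Qed.
Lemma mul_lcomb1 c x y z : (c *: x + y) * z = c *: (x * z) + y * z.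
Proof. by rewrite mulrDl -scalerAl. Qed.
Lemma mul_lcomb2 c x y z : z * (c *: x + y) = c *: (z * x) + z * y.
Proof. by rewrite mulrDr -scalerAr. Qed.
Lemma mul_lcombl c a x y z b :
  a * ((c *: x + y) * z) * b = c *: (a * (x * z) * b) + a * (y * z) * b.
Proof. by rewrite mulrDl -scalerAl mul_lcomb. Qed.
Lemma mul_lcombr c a x y z b :
  a * (z * (c *: x + y)) * b = c *: (a * (z * x) * b) + a * (z * y) * b.
Proof. by rewrite mulrDr -scalerAr mul_lcomb. Qed.
Lemma mul_subm a x y b : a * (x - y) * b = a * x * b - a * y * b.
Proof. by rewrite mulrBr mulrBl. Qed.
Lemma mul_comb3 a x y z b c : a * (x * y - c *: (y * x) - z) * b =
  a * ((x * y) * b) - c *: (a * ((y * x) * b)) - a * z * b.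
Proof. by rewrite !mul_subm -scalerAr -scalerAl !mulrA. Qed.

Lemma scaler_lcomb (M : lmodType K) (e c : K) (x y : M) :
  e *: (c *: x + y) = c *: (e *: x) + e *: y.
Proof. by rewrite scalerDr !scalerA mulrC. Qed.
Lemma sub_lcomb (M : lmodType K) (c : K) (x y x' y' : M) :
  c *: x + y - (c *: x' + y') = c *: (x - x') + (y - y').
Proof. by rewrite scalerBr opprD addrACA. Qed.
End AlgebraIdentities.

Lemma word_cat u v : word (u ++ v) = word u * word v.
Proof.
rewrite [RHS]tmulE [word]unlock malgM_def fgmulUU mulr1; congr (<< _ *g _ >>).
by apply/eqP; rewrite fmP fmM.
Qed.

Lemma word_nil : word [::] = 1.
Proof. by rewrite unlock; congr (<< _ *g _ >>); apply/eqP; rewrite fmP fm1. Qed.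

Lemma word_fmu i : (<< fmu i >> : {malg K[{fmonom I}]}) = word [:: i].
Proof. by rewrite unlock; congr (<< _ *g _ >>); apply/eqP; rewrite fmP fmU. Qed.

Lemma word_cons i w : word (i :: w) = word [:: i] * word w.
Proof. by rewrite -word_cat. Qed.

Lemma tensor_ind (P : T -> Prop) : P 0 -> (forall s t, P s -> P t -> P (s + t)) ->
  (forall c t, P t -> P (c *: t)) -> (forall w, P (word w)) -> forall t, P t.
Proof.
move=> P0 PD PZ PW t; rewrite (monalgE (t : {malg K[{fmonom I}]})).
elim/big_ind: _ => // m _.
suff -> : (<< (t : {malg K[{fmonom I}]})@_m *g m >> : T)
   = (t : {malg K[{fmonom I}]})@_m *: word m by exact: PZ.
rewrite unlock; apply/malgP=> k; rewrite [in RHS]mcoeffZ !mcoeffU.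
by rewrite fmK mulrnAr mulr1.
Qed.

Definition ext f : T -> K^o := mmap (idfun : K -> K) (fun m : {fmonom I} => f m).

Fact ext_is_linear f : linear (ext f).
Proof.
move=> c x y; rewrite /ext (raddfD (mmap (idfun : K -> K) _)) /=; congr (_ + _).
rewrite /GRing.scale /= (mmapEw (f := idfun) (msuppZ_le _ _)) mmapE mulr_sumr.
by apply: eq_bigr => k _; rewrite /= mcoeffZ mulrA.
Qed.
HB.instance Definition _ f := GRing.isLinear.Build K T K^o *:%R (ext f) (ext_is_linear f).

Lemma ext_word f w : ext f (word w) = f w.
Proof. by rewrite /ext [word]unlock mmapU /= mul1r. Qed.

End Words.

(** * A termination measure for sorting words *)

Section WordMeasure.
Variable n : nat.
Local Notation I := 'I_n.
Implicit Types (u v w : seq I).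

Fixpoint inversions w : nat :=
  if w is i :: s then count (fun j : I => j < i)%N s + inversions s else 0.

Lemma inversions_le w : (inversions w <= size w * size w)%N.
Proof.
elim: w => //= i w IH; have := count_size (fun j : I => j < i)%N w; nia.
Qed.

Lemma inversions_swap u v (i j : I) : (i < j)%N ->
  inversions (u ++ [:: j; i] ++ v) = (inversions (u ++ [:: i; j] ++ v)).+1.
Proof.
move=> ij; elim: u => [|k u IH] /=.
  by rewrite ij ltnNge (ltnW ij) /=; lia.
rewrite IH addnS; congr (_ + _).+1.
by rewrite !count_cat /=; lia.
Qed.

(* Swapping decreases the inversions at constant size; the cube dominates any *)
(* increase of the inversions when the size drops.                            *)
Definition mu w : nat := (size w * size w * size w + inversions w)%N.

Lemma mu_size u v : (size u < size v)%N -> (mu u < mu v)%N.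
Proof. by move=> h; have := leq_mul (leq_mul h h) h; rewrite /mu; have := inversions_le u; lia. Qed.

Lemma mu_swap u v (i j : I) : (i < j)%N ->
  (mu (u ++ [:: i; j] ++ v) < mu (u ++ [:: j; i] ++ v))%N.
Proof.
move=> ij; rewrite /mu (inversions_swap _ _ ij) !size_cat addnS ltnS.
exact: leqnn.
Qed.

End WordMeasure.

(** * Rewriting rules and the values of linear forms on words *)

Section Rewriting.
Variables (K : fieldType) (p : nat) (g : restrictedLSA K p).
Local Notation I := 'I_(\dim {:g}).
Local Notation T := (tensor_alg g).
Variables (X : (\dim {:g}).-tuple g) (d : I -> bool).
Hypothesis X_basis : basis_of {:g} X.
Hypothesis X_gr : forall i : I, X`_i \in gr g (d i).
Implicit Types (u v w : seq I) (t : T) (f : seq I -> K) (x y : g).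

Lemma lsa_prime : prime p.
Proof. exact: pcharf_prime (lsa_pchar g). Qed.

Lemma coord_delta (i j : I) : coord X i X`_j = (i == j)%:R.
Proof. by rewrite coord_free ?(basis_free X_basis) // eq_sym. Qed.

Lemma coord_gr_eq0 i j x : x \in gr g j -> d i != j -> coord X i x = 0.
Proof.
move=> hx hij.
have ex := coord_basis X_basis (memvf x).
pose y := \sum_(k | d k != j) coord X k x *: X`_k.
have hy : y \in gr g (~~ j).
  apply: memv_suml => k hk; apply: memvZ.
  by have := X_gr k; case: (d k) hk; case: (j).
have hy' : y \in gr g j.
  have -> : y = x - \sum_(k | d k == j) coord X k x *: X`_k.
    by rewrite [X in X - _]ex (bigID (fun k => d k == j)) /= addrAC subrr add0r.
  apply: memvB => //; apply: memv_suml => k /eqP hk; apply: memvZ.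
  by rewrite -hk; exact: X_gr.
have y0 : y = 0.
  apply/eqP; rewrite -memv0 -(gr_cap (lsaP g)) memv_cap.
  by case: (j) hy hy' => /= -> ->.
move/(congr1 (coord X i)): y0; rewrite linear_sum linear0 (bigD1 i) //=.
rewrite linearZ /= coord_delta eqxx mulr1 big1 ?addr0 // => k /andP[_ ki].
by rewrite linearZ /= coord_delta eq_sym (negPf ki) mulr0.
Qed.

Definition lin : g -> T := locked_with quot_key (fun x =>
  \sum_i coord X i x *: word [:: i]).
Canonical lin_unlockable := [unlockable fun lin].

Fact lin_is_linear : linear lin.
Proof.
move=> c x y; rewrite unlock scaler_sumr -big_split; apply: eq_bigr => i _ /=.
by rewrite linearP scalerDl scalerA.
Qed.
HB.instance Definition _ := GRing.isLinear.Build K g T *:%R lin lin_is_linear.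

Lemma lin_letter (i : I) : lin X`_i = word [:: i].
Proof.
rewrite unlock (bigD1 i) //= coord_delta eqxx scale1r big1 ?addr0 // => k ki.
by rewrite coord_delta (negPf ki) scale0r.
Qed.

(** The exponent at which a power of a basis vector becomes linear in u(g): x^2 = [sq] x for odd x
    and x^p = [pm] x for even x. Exponents in normal words stay below it. *)
Definition cap (i : I) := if d i then 2 else p.
Definition pow_val (i : I) : g := if d i then sq X`_i else pm X`_i.

Lemma cap_ge2 i : (2 <= cap i)%N.
Proof. by rewrite /cap; case: (d i) => //; exact: prime_gt1 lsa_prime. Qed.

Lemma pow_val_even i : pow_val i \in gr g false.
Proof.
rewrite /pow_val; have := X_gr i; case: (d i) => h.
  exact: (sq_gr (lsaP g)).
exact: (pm_gr (lsaP g)).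
Qed.

(** The exchange of an odd letter with itself is covered by [rule_pow], since [x, x] = 2 [sq] x. *)
Inductive rule : seq I -> T -> Prop :=
| rule_swap (i j : I) : (i < j)%N ->
    rule [:: j; i] ((-1) ^+ (d j && d i) *: word [:: i; j] + lin (br X`_j X`_i))
| rule_pow (i : I) : rule (nseq (cap i) i) (lin (pow_val i)).

Inductive redex w t : Prop :=
  Redex u l r v of rule l r & w = u ++ l ++ v & t = word u * r * word v.

Definition normal w := forall t, ~ redex w t.

Lemma ext_lin f u v y :
  ext f (word u * lin y * word v) = \sum_k coord X k y * f (u ++ [:: k] ++ v).
Proof.
rewrite [lin]unlock mulr_sumr mulr_suml linear_sum; apply: eq_bigr => k _.
by rewrite -scalerAr -scalerAl linearZ /= -!word_cat -catA ext_word.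
Qed.

Lemma ext_word_ctx f u l v : ext f (word u * word l * word v) = f (u ++ l ++ v).
Proof. by rewrite -!word_cat ext_word catA. Qed.

(** One step replaces w by words of smaller [mu]: a swap removes an inversion, and the linear terms
    are shorter because [cap] is at least 2. *)
Lemma redex_ext_eq f f' w t : redex w t ->
  (forall w', (mu w' < mu w)%N -> f w' = f' w') -> ext f t = ext f' t.
Proof.
case=> u l r v hr -> -> hf.
case: l r / hr hf => [i j ij|i] hf.
  rewrite mul_lcomb !linearD !linearZ /=.
  rewrite !ext_word_ctx hf; last exact: mu_swap.
  congr (_ + _); rewrite !ext_lin; apply: eq_bigr => k _; rewrite hf //.
  by apply: mu_size; rewrite !size_cat /= ltn_add2l.
rewrite !ext_lin; apply: eq_bigr => k _; rewrite hf //.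
apply: mu_size; rewrite !size_cat size_nseq ltn_add2l ltn_add2r.
exact: cap_ge2.
Qed.

Section NormalForm.
Variable tau : seq I -> K.

(** The intended value at w of the linear form that is [tau] on normal words and invariant under
    reduction. The reduct is an arbitrary choice, which confluence justifies afterwards; k is fuel,
    and any amount above [mu w] gives the same value. *)
Fixpoint nf_rec (k : nat) w : K :=
  if k is k'.+1 then
    match pselect (exists t, redex w t) with
    | left h => ext (nf_rec k') (projT1 (cid h))
    | right _ => tau w
    end
  else 0.

Definition nf w := nf_rec (mu w).+1 w.

Lemma nf_recE k w : (mu w < k)%N -> nf_rec k w = nf w.
Proof.
rewrite /nf; have [m] := ubnP (mu w); elim: m w k => // m IH w k hm hk.
case: k hk => // k hk /=.
case: pselect => // h; apply: (redex_ext_eq (projT2 (cid h))) => w' hw'.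
rewrite (IH _ k) ?(IH _ (mu w)) //; lia.
Qed.

Lemma nf_normal w : normal w -> nf w = tau w.
Proof. by move=> h; rewrite /nf /=; case: pselect => // h1; have [t /h] := h1. Qed.

Lemma nf_redex w : (exists t, redex w t) -> exists2 t, redex w t & nf w = ext nf t.
Proof.
move=> h; rewrite -(nf_recE (ltnSn (mu w))) /=; case: pselect => // h'.
exists (projT1 (cid h')); first exact: projT2 (cid h').
by apply: (redex_ext_eq (projT2 (cid h'))) => w' hw'; rewrite nf_recE.
Qed.

End NormalForm.
End Rewriting.

Section Bracket.
Variables (K : fieldType) (p : nat) (g : restrictedLSA K p).
Implicit Types (x y z : g).

Definition brr z x : g := br x z.
Lemma br_linear_l z : linear (brr z).
Proof. by move=> c x y; rewrite /brr (br_linl (lsaP g)). Qed.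
Lemma br_linear_r x : linear (@br _ _ g x).
Proof. by move=> c y z; rewrite (br_linr (lsaP g)). Qed.
HB.instance Definition _ z := GRing.isLinear.Build K g g *:%R (brr z) (br_linear_l z).
HB.instance Definition _ x := GRing.isLinear.Build K g g *:%R (@br _ _ g x) (br_linear_r x).

Lemma br0l z : br 0 z = 0 :> g. Proof. exact: (linear0 (brr z)). Qed.
Lemma br0r z : br z 0 = 0 :> g. Proof. exact: (linear0 (@br _ _ g z)). Qed.
Lemma brDl x y z : br (x + y) z = br x z + br y z.
Proof. exact: (linearD (brr z)). Qed.
Lemma brDr x y z : br z (x + y) = br z x + br z y.
Proof. exact: (linearD (@br _ _ g z)). Qed.
Lemma brNl y z : br (- y) z = - br y z.
Proof. exact: (linearN (brr z)). Qed.
Lemma brZl c y z : br (c *: y) z = c *: br y z.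
Proof. exact: (linearZ_LR (brr z)). Qed.
Lemma brZr c y z : br y (c *: z) = c *: br y z.
Proof. exact: (linearZ_LR (@br _ _ g y)). Qed.

(** Apply [sqD] to x + x = 2 x and subtract, which works in characteristic 2 as well. *)
Lemma br_odd_self x : x \in gr g true -> br x x = sq x *+ 2.
Proof.
move=> hx; have := sqD (lsaP g) hx hx.
rewrite -mulr2n -scaler_nat (sqZ (lsaP g)) // => h.
have e : br x x = (2%:R ^+ 2 : K) *: sq x - (sq x + sq x) by rewrite h addrAC subrr add0r.
by rewrite e -natrX scaler_nat -mulr2n -mulrnBr.
Qed.

(** The mirror image of [ad_sq]: for y of parity i the two exchanges give the sign (-1)^i (-1)^(i +
    1) = -1, the same as one exchange of y with the even element [sq] x. *)
Lemma br_br_odd i x y : x \in gr g true -> y \in gr g i -> br (br y x) x = br y (sq x).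
Proof.
move=> hx hy.
rewrite (br_skew (lsaP g) hy (sq_gr (lsaP g) hx)) andbF scale1r (ad_sq (lsaP g)) //.
rewrite (br_skew (lsaP g) hy hx) brNl brZl.
rewrite (br_skew (lsaP g) (br_gr (lsaP g) hx hy) hx).
rewrite scalerN opprK scalerA -signr_addb.
by case: i {hy}; rewrite /= ?expr0 ?expr1 ?scaleN1r.
Qed.

(** The mirror image of [ad_pm]: p exchanges give (-1)^p, which is -1 in K even for p = 2. *)
Lemma iter_br_even x y : x \in gr g false -> (exists i, y \in gr g i) ->
  iter p (fun z => br z x) y = br y (pm x).
Proof.
move=> hx [i hy].
have hi n : iter n (br x) y \in gr g i.
  by elim: n => //= n IH; rewrite -[i]addFb; exact: (br_gr (lsaP g)).
have e n : iter n (fun z => br z x) y = (-1) ^+ n *: iter n (br x) y.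
  elim: n => [|n IH]; first by rewrite scale1r.
  by rewrite !iterS IH brZl (br_skew (lsaP g) (hi n) hx) andbF scale1r exprS mulN1r scaleNr scalerN.
rewrite e -(ad_pm (lsaP g)) // (br_skew (lsaP g) hy (pm_gr (lsaP g) hx)) andbF scale1r.
suff -> : (-1) ^+ p = -1 :> K by rewrite scaleN1r.
by have := pFrobenius_autN (lsa_pchar g) 1; rewrite !pFrobenius_autE expr1n.
Qed.

End Bracket.

(** Read G a m b as x^a y_m x^b, with y_m the m-fold bracket of y with x. Carrying one x to the left
    across y_m either passes it or absorbs it into a bracket; the sum counts the ways of carrying
    all b of them. *)
Lemma binomial_walk (R : nzRingType) (G : nat -> nat -> nat -> R) n :
  (forall a m b, (a + m + b.+1 = n)%N -> G a m b.+1 = G a.+1 m b + G a m.+1 b) ->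
  forall b a m, (a + m + b = n)%N ->
  G a m b = \sum_(k < b.+1) 'C(b, k)%:R * G (a + b - k)%N (m + k)%N 0%N.
Proof.
move=> h; elim=> [|b IH] a m e.
  by rewrite big_ord_recl big_ord0 addr0 bin0 mul1r addn0 subn0 addn0.
rewrite h // IH; last by lia.
rewrite IH; last by lia.
rewrite [in RHS]big_ord_recl bin0 mul1r [X in X + _ = _]big_ord_recl bin0 mul1r -addrA.
rewrite !addn0.
congr (_ + _); first by congr (G _ _ _); rewrite /= addSnnS.
rewrite [in X in _ = X](eq_bigr (fun i : 'I_b.+1 =>
   'C(b, i.+1)%:R * G (a.+1 + b - i.+1)%N (m + i.+1)%N 0%N +
   'C(b, i)%:R * G (a + b - i)%N (m.+1 + i)%N 0%N)); last first.
  move=> i _; rewrite lift0 binS natrD mulrDl.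
  by congr (_ * G _ _ _ + _ * G _ _ _); lia.
rewrite big_split /=; congr (_ + _).
rewrite [in RHS]big_ord_recr /= bin_small // mul0r addr0.
by apply: eq_bigr => i _; rewrite /bump leq0n add1n.
Qed.

(** The inner binomial coefficients vanish in characteristic p. What remains is the pattern y x^p =
    x^p y + [[y, x], ..., x]. *)
Lemma binomial_walk_prime (R : nzRingType) p (hp : p \in [pchar R])
    (G : nat -> nat -> nat -> R) :
  (forall a m b, (a + m + b.+1 = p)%N -> G a m b.+1 = G a.+1 m b + G a m.+1 b) ->
  G 0%N 0%N p = G p 0%N 0%N + G 0%N p 0%N.
Proof.
move=> h; have pr := pcharf_prime hp.
rewrite (binomial_walk h) //; case: p pr hp {h} => // p' pr hp.
rewrite big_ord_recl /= bin0 mul1r /bump.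
rewrite big_ord_recr /= big1 ?add0r; last first.
  move=> i _; suff -> : 'C(p'.+1, 1 + i)%:R = 0 :> R by rewrite mul0r.
  apply/eqP; rewrite -(dvdn_pcharf hp); apply: prime_dvd_bin => //.
  by have := ltn_ord i; lia.
by rewrite add1n binn mul1r !add0n subn0 subnn.
Qed.

(** * Resolution of the overlaps of two rules *)

Section CriticalPairs.
Variables (K : fieldType) (p : nat) (g : restrictedLSA K p).
Local Notation I := 'I_(\dim {:g}).
Variables (A : algType K) (word : seq I -> A) (lin : {linear g -> A}).
Hypothesis word_cat : forall u v, word (u ++ v) = word u * word v.
Hypothesis word_nil : word [::] = 1.
Variables (X : (\dim {:g}).-tuple g) (d : I -> bool).
Hypothesis X_basis : basis_of {:g} X.
Hypothesis X_gr : forall i : I, X`_i \in gr g (d i).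
Implicit Types (u v w B C : seq I) (t : A) (x y : g).
Hypothesis lin_letter : forall i : I, lin X`_i = word [:: i].

Lemma gr_ind (j : bool) (P : g -> Prop) : P 0 ->
  (forall c (k : I) y, d k = j -> P y -> P (c *: X`_k + y)) ->
  forall x, x \in gr g j -> P x.
Proof.
move=> P0 PD x hx; rewrite (coord_basis X_basis (memvf x)).
elim/big_rec: _ => // k y _ Py.
have [dk|dk] := eqVneq (d k) j; first exact: PD.
by rewrite (coord_gr_eq0 X_basis X_gr hx dk) scale0r add0r.
Qed.

Variables (Phi : {linear A -> K^o}) (lt : seq I -> Prop) (s : nat).
Hypothesis lt_size : forall w, (size w < s)%N -> lt w.
Hypothesis Phi_swap : forall C B (a b : I), (b < a)%N -> lt (C ++ [:: a; b] ++ B) ->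
  Phi (word (C ++ [:: a; b] ++ B)) =
  (-1) ^+ (d a && d b) * Phi (word (C ++ [:: b; a] ++ B))
  + Phi (word C * lin (br X`_a X`_b) * word B).
Hypothesis Phi_pow : forall C B (a : I), lt (C ++ nseq (cap d a) a ++ B) ->
  Phi (word (C ++ nseq (cap d a) a ++ B)) =
  Phi (word C * lin (pow_val X d a) * word B).

(** [Phi] is known to respect the rules only on [lt] words, which will be those below an ambiguous
    word of length s; all shorter words are of this kind. Equal letters are included: for an even
    one the bracket vanishes, for an odd one the identity reads 2 x^2 = [x, x]. *)
Lemma Phi_comm_letters C B (a b : I) : (size C + size B + 2 < s)%N ->
  Phi (word (C ++ [:: a; b] ++ B)) =
  (-1) ^+ (d a && d b) * Phi (word (C ++ [:: b; a] ++ B))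
  + Phi (word C * lin (br X`_a X`_b) * word B).
Proof.
move=> hs.
have lt2 c e : lt (C ++ [:: c; e] ++ B).
  by apply: lt_size; rewrite !size_cat /=; lia.
case: (ltngtP a b) => hab; last first.
- have {hab} -> : a = b by exact: val_inj.
  have hb := X_gr b; move: (lt2 b b) => l2.
  case db: (d b) hb => hb /=.
    have := @Phi_pow C B b; rewrite /cap /pow_val db => ->; last exact: l2.
    by rewrite br_odd_self // linearMn mulrnAr mulrnAl linearMn expr1 mulN1r mulr2n addrA addNr add0r.
  by rewrite (br_alt (lsaP g)) // linear0 mulr0 mul0r linear0 mul1r addr0.
- by rewrite Phi_swap.
rewrite (Phi_swap hab) // (br_skew (lsaP g) (X_gr a) (X_gr b)) andbC.
rewrite linearN linearZ /= mulrN mulNr linearN -scalerAr -scalerAl linearZ /=.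
rewrite mulrDr mulrA -signr_addb addbb expr0 mul1r.
exact: esym (addrK _ _).
Qed.

Lemma linP c x y : lin (c *: x + y) = c *: lin x + lin y.
Proof. exact: linearP. Qed.

Lemma linDZ c x y : lin (y + c *: x) = lin y + c *: lin x.
Proof. by rewrite addrC linP addrC. Qed.

Lemma PhiD t t' : Phi (t + t') = Phi t + Phi t'.
Proof. exact: linearD. Qed.

Lemma PhiZ c t : Phi (c *: t) = c * Phi t.
Proof. by rewrite linearZ. Qed.

Lemma Phi_comm C B x y i j : x \in gr g i -> y \in gr g j ->
  (size C + size B + 2 < s)%N ->
  Phi (word C * (lin x * lin y) * word B) =
  (-1) ^+ (i && j) * Phi (word C * (lin y * lin x) * word B)
  + Phi (word C * lin (br x y) * word B).
Proof.
move=> hx hy hs; move: x hx; apply: gr_ind => [|c k x dk IHx].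
  by rewrite br0l !linear0 !(mul0r, mulr0) !linear0 mulr0 addr0.
have -> : Phi (word C * (lin (c *: X`_k + x) * lin y) * word B) =
  c * Phi (word C * (lin X`_k * lin y) * word B) + Phi (word C * (lin x * lin y) * word B).
  by rewrite linP mul_lcombl PhiD PhiZ.
have -> : Phi (word C * (lin y * lin (c *: X`_k + x)) * word B) =
  c * Phi (word C * (lin y * lin X`_k) * word B) + Phi (word C * (lin y * lin x) * word B).
  by rewrite linP mul_lcombr PhiD PhiZ.
have -> : Phi (word C * lin (br (c *: X`_k + x) y) * word B) =
  c * Phi (word C * lin (br X`_k y) * word B) + Phi (word C * lin (br x y) * word B).
  by rewrite brDl brZl linP mul_lcomb PhiD PhiZ.
rewrite IHx; suff -> : Phi (word C * (lin X`_k * lin y) * word B) =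
  (-1) ^+ (i && j) * Phi (word C * (lin y * lin X`_k) * word B)
  + Phi (word C * lin (br X`_k y) * word B) by ring.
move: y hy {IHx}; apply: gr_ind => [|e l y dl IHy].
  by rewrite br0r !linear0 !(mul0r, mulr0) !linear0 mulr0 addr0.
have -> : Phi (word C * (lin (e *: X`_l + y) * lin X`_k) * word B) =
  e * Phi (word C * (lin X`_l * lin X`_k) * word B) + Phi (word C * (lin y * lin X`_k) * word B).
  by rewrite linP mul_lcombl PhiD PhiZ.
have -> : Phi (word C * (lin X`_k * lin (e *: X`_l + y)) * word B) =
  e * Phi (word C * (lin X`_k * lin X`_l) * word B) + Phi (word C * (lin X`_k * lin y) * word B).
  by rewrite linP mul_lcombr PhiD PhiZ.
have -> : Phi (word C * lin (br X`_k (e *: X`_l + y)) * word B) =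
  e * Phi (word C * lin (br X`_k X`_l) * word B) + Phi (word C * lin (br X`_k y) * word B).
  by rewrite brDr brZr linP mul_lcomb PhiD PhiZ.
rewrite IHy !lin_letter // -!word_cat -!catA Phi_comm_letters // dk dl.
ring.
Qed.

(** The two ways of sorting k j i leave brackets that agree by the Jacobi identity. The terms with
    one bracket have length 2, where [Phi_comm] applies; the signs are checked parity by parity. *)
Lemma crit_swap_swap (i j k : I) : (i < j)%N -> (j < k)%N -> s = 3%N ->
  lt [:: j; k; i] -> lt [:: j; i; k] -> lt [:: k; i; j] -> lt [:: i; k; j] ->
  Phi (((-1) ^+ (d k && d j) *: word [:: j; k] + lin (br X`_k X`_j)) * word [:: i]) =
  Phi (word [:: k] * ((-1) ^+ (d j && d i) *: word [:: i; j] + lin (br X`_j X`_i))).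
Proof.
move=> ij jk s3 h1 h2 h3 h4; have ik := ltn_trans ij jk.
have := @Phi_swap [:: j] [::] k i ik h1.
have := @Phi_swap [::] [:: k] j i ij h2.
have := @Phi_swap [::] [:: j] k i ik h3.
have := @Phi_swap [:: i] [::] k j jk h4.
have hs : (size (nil : seq I) + size (nil : seq I) + 2 < s)%N by rewrite s3.
have bg (a b : I) : br X`_a X`_b \in gr g (d a (+) d b) by apply: (br_gr (lsaP g)).
have := Phi_comm (X_gr k) (bg j i) hs.
have := Phi_comm (X_gr j) (bg k i) hs.
have := Phi_comm (bg k j) (X_gr i) hs.
rewrite (br_jacobi (lsaP g) X`_i (X_gr k) (X_gr j)).
rewrite !word_nil !mul1r !mulr1 !lin_letter //=.
rewrite mul_lcomb1 mul_lcomb2 -!word_cat /= !PhiD !PhiZ linDZ PhiD PhiZ => e1 e2 e3 e4 e5 e6 e7.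
rewrite e7 e6 e5 e4 e1 e2 e3.
by case: (d i); case: (d j); case: (d k); rewrite /= ?expr0 ?expr1; ring.
Qed.

Lemma word_nseqS a (i : I) B : word (nseq a.+1 i ++ B) = word (nseq a i ++ i :: B).
Proof. by rewrite -addn1 nseqD -catA. Qed.

(** For odd x the bracket is [x, [x, x]], which vanishes by [br_cube]; for even x it is an iterated
    bracket starting with [x, x] = 0. *)
Lemma pow_val_comm i : br (pow_val X d i) X`_i = 0.
Proof.
have := X_gr i; rewrite /pow_val; case: (d i) => h.
  by rewrite (ad_sq (lsaP g)) // (br_cube (lsaP g)).
rewrite (ad_pm (lsaP g)) //.
suff it n : (0 < n)%N -> iter n (br X`_i) X`_i = 0.
  by rewrite it // prime_gt0 // (lsa_prime g).
elim: n => // q IH _; rewrite iterS; case: q IH => [|q] IH.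
  exact: (br_alt (lsaP g)).
by rewrite IH // br0r.
Qed.

(** The two reductions of a power of one letter leave its [pow_val] at opposite ends of the m
    remaining letters, with which it commutes. *)
Lemma crit_pow_pow (i : I) m : (m.+1 < s)%N ->
  Phi (lin (pow_val X d i) * word (nseq m i)) = Phi (word (nseq m i) * lin (pow_val X d i)).
Proof.
move=> hm; suff h a b : (a + b = m)%N ->
    Phi (word (nseq a i) * lin (pow_val X d i) * word (nseq b i)) =
    Phi (word (nseq m i) * lin (pow_val X d i)).
  by rewrite -(h 0%N m) // word_nil mul1r.
elim: b a => [|b IH] a e; first by rewrite word_nil mulr1 -e addn0.
rewrite -(IH a.+1); last by lia.
rewrite -[nseq b.+1 i]/([:: i] ++ nseq b i) word_cat mulrA -[_ * word [:: i]]mulrA.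
rewrite -(lin_letter) (Phi_comm (pow_val_even X_gr i) (X_gr i)); last first.
  by rewrite !size_nseq; lia.
rewrite pow_val_comm linear0 mulr0 mul0r linear0 mul1r addr0 lin_letter // mulrA.
by rewrite -word_cat -[nseq a.+1 i]cats0 word_nseqS.
Qed.

(** The overlap is j followed by i^c. Reducing the power leaves j times its value; reducing the
    descent lets j wander across the letters i one by one. Up to sign both give i^c j plus a
    bracket, and the brackets agree by the mirror images of [ad_sq] and [ad_pm]. *)
Lemma crit_swap_pow (i j : I) : (i < j)%N -> s = (cap d i).+1 ->
  (forall a b, (a.+1 + b)%N = cap d i -> lt (nseq a.+1 i ++ [:: j] ++ nseq b i)) ->
  Phi (((-1) ^+ (d j && d i) *: word [:: i; j] + lin (br X`_j X`_i))
       * word (nseq (cap d i).-1 i)) =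
  Phi (word [:: j] * lin (pow_val X d i)).
Proof.
move=> ij es hlt; set D1 := LHS.
have hP : Phi (word (nseq (cap d i) i ++ [:: j])) = Phi (lin (pow_val X d i) * word [:: j]).
  have := cap_ge2 d i; case ec: (cap d i) => [//|c] _.
  rewrite -ec -(mul1r (lin _)) -word_nil -Phi_pow //.
  by rewrite /= ec; apply: (hlt c 0%N); rewrite ec addn0.
rewrite -[word [:: j]](lin_letter).
have := @Phi_comm [::] [::] _ _ _ _ (X_gr j) (pow_val_even X_gr i).
rewrite !word_nil !mul1r !mulr1 andbF mul1r => -> //; last first.
  by rewrite es /=; have := cap_ge2 d i; lia.
rewrite lin_letter // -hP /D1 {hP D1}.
move: (X_gr i) (es); rewrite /cap /pow_val; case di: (d i) => hi es'.
- rewrite andbT mul_lcomb1 -word_cat /= PhiD PhiZ.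
  have hl a b : (a.+1 + b = 2)%N -> lt (nseq a.+1 i ++ [:: j] ++ nseq b i).
    by move=> e; apply: hlt; rewrite e /cap di.
  rewrite (@Phi_swap [:: i] [::] j i ij (hl 0%N 1%N erefl)) di andbT /= word_nil mulr1.
  have := @Phi_comm [::] [::] _ _ _ _ (br_gr (lsaP g) (X_gr j) (X_gr i)) (X_gr i).
  rewrite !word_nil !mul1r !mulr1 !lin_letter // => -> //; last by rewrite es'.
  rewrite (br_br_odd hi (X_gr j)) di.
  by case: (d j); rewrite /= ?expr0 ?expr1; ring.
- rewrite andbF expr0 scale1r.
  have hl a b : (a.+1 + b = p)%N -> lt (nseq a.+1 i ++ [:: j] ++ nseq b i).
    by move=> e; apply: hlt; rewrite e /cap di.
  pose y m := iter m (fun z => br z X`_i) X`_j.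
  have hy m : y m \in gr g (d j).
    rewrite /y; elim: m => [|m IH]; first exact: X_gr.
    by rewrite iterS -[d j]addbF; exact: (br_gr (lsaP g)).
  set D1 := LHS.
  (* For a = m = 0 the word would be the ambiguous one, on which [Phi] is not yet known to respect
     the rules; the value of its reduct by the swap takes its place. *)
  pose G a m b : K := if (a + m == 0)%N then D1 else
     Phi (word (nseq a i) * lin (y m) * word (nseq b i)).
  have p1 := prime_gt1 (lsa_prime g).
  suff : G 0%N 0%N p = G p 0%N 0%N + G 0%N p 0%N.
    have p0 : (p == 0)%N = false by lia.
    rewrite /G !addn0 add0n eqxx p0.
    rewrite word_nil !mulr1 mul1r (_ : y 0%N = X`_j) // lin_letter -word_cat => ->.
    by rewrite -(iter_br_even hi) //; exists (d j); exact: X_gr.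
  apply: (@binomial_walk_prime K p (lsa_pchar g) G) => a m b e; rewrite /G addnS addSn /=.
  case: eqP => am.
    have [-> ->] : a = 0%N /\ m = 0%N by lia.
    rewrite /D1 mulrDl PhiD word_nil mul1r -!word_cat.
    have -> : b = p.-1 by lia.
    by rewrite /y /= lin_letter // -!word_cat.
  case: m e am => [|m] e am.
    case: a e am => // a e _.
    rewrite (_ : y 0%N = X`_j) // lin_letter -!word_cat -!catA.
    have := @Phi_swap (nseq a.+1 i) (nseq b i) j i ij; rewrite di andbF mul1r.
    rewrite -word_nseqS; apply; apply: (hl a b.+1); lia.
  rewrite -[i :: nseq b i]cat1s word_cat mulrA -[_ * word [:: i]]mulrA.
  rewrite -(lin_letter) (Phi_comm (hy _) (X_gr i)); last first.
    by rewrite !size_nseq; lia.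
  rewrite di andbF mul1r lin_letter // mulrA.
  by rewrite -word_cat -[i :: nseq a i]/(nseq a.+1 i) -[nseq a.+1 i]cats0 word_nseqS.
Qed.

(** The mirror overlap k^c followed by i: the letters k now act from the left, and [ad_sq] and
    [ad_pm] apply as they stand. *)
Lemma crit_pow_swap (i k : I) : (i < k)%N -> s = (cap d k).+1 ->
  (forall a b, (a.+1 + b)%N = cap d k -> lt (nseq b k ++ [:: i] ++ nseq a.+1 k)) ->
  Phi (word (nseq (cap d k).-1 k) *
       ((-1) ^+ (d k && d i) *: word [:: i; k] + lin (br X`_k X`_i))) =
  Phi (lin (pow_val X d k) * word [:: i]).
Proof.
move=> ik es hlt; set D1 := LHS.
have hP : Phi (word ([:: i] ++ nseq (cap d k) k)) = Phi (word [:: i] * lin (pow_val X d k)).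
  have := cap_ge2 d k; case ec: (cap d k) => [//|c] _.
  rewrite -ec -(mulr1 (_ * _)) -word_nil -Phi_pow ?cats0 //.
  by rewrite ec; apply: (hlt c 0%N); rewrite ec addn0.
rewrite -[word [:: i]](lin_letter).
have := @Phi_comm [::] [::] _ _ _ _ (pow_val_even X_gr k) (X_gr i).
rewrite !word_nil !mul1r !mulr1 ?mul1r => -> //; last first.
  by rewrite es /=; have := cap_ge2 d k; lia.
rewrite lin_letter // -hP /D1 {hP D1}.
move: (X_gr k) (es); rewrite /cap /pow_val; case dk: (d k) => hk es'.
- rewrite mul_lcomb2 -word_cat /= PhiD PhiZ.
  have hl a b : (a.+1 + b = 2)%N -> lt (nseq b k ++ [:: i] ++ nseq a.+1 k).
    by move=> e; apply: hlt; rewrite e /cap dk.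
  rewrite (@Phi_swap [::] [:: k] k i ik (hl 0%N 1%N erefl)) dk /= word_nil mul1r.
  have := @Phi_comm [::] [::] _ _ _ _ (X_gr k) (br_gr (lsaP g) (X_gr k) (X_gr i)).
  rewrite !word_nil !mul1r !mulr1 !lin_letter // => -> //; last by rewrite es'.
  rewrite (ad_sq (lsaP g)) // dk.
  by case: (d i); rewrite /= ?expr0 ?expr1; ring.
- rewrite expr0 scale1r.
  have hl a b : (a.+1 + b = p)%N -> lt (nseq b k ++ [:: i] ++ nseq a.+1 k).
    by move=> e; apply: hlt; rewrite e /cap dk.
  pose y m := iter m (br X`_k) X`_i.
  have hy m : y m \in gr g (d i).
    rewrite /y; elim: m => [|m IH]; first exact: X_gr.
    by rewrite iterS -[d i]addFb; exact: (br_gr (lsaP g)).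
  set D1 := LHS.
  pose G a m b : K := if (a + m == 0)%N then D1 else
     Phi (word (nseq b k) * lin (y m) * word (nseq a k)).
  have p1 := prime_gt1 (lsa_prime g).
  suff : G 0%N 0%N p = G p 0%N 0%N + G 0%N p 0%N.
    have p0 : (p == 0)%N = false by lia.
    rewrite /G !addn0 add0n eqxx p0.
    rewrite word_nil !mulr1 !mul1r (_ : y 0%N = X`_i) // lin_letter -word_cat => ->.
    by rewrite (ad_pm (lsaP g)).
  apply: (@binomial_walk_prime K p (lsa_pchar g) G) => a m b e; rewrite /G addnS addSn /=.
  case: eqP => am.
    have [-> ->] : a = 0%N /\ m = 0%N by lia.
    rewrite /D1 mulrDr PhiD word_nil mulr1 -!word_cat.
    have -> : b = p.-1 by lia.
    by rewrite /y /= lin_letter // -!word_cat -catA.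
  case: m e am => [|m] e am.
    case: a e am => // a e _.
    rewrite (_ : y 0%N = X`_i) // lin_letter -!word_cat -!catA word_nseqS.
    have := @Phi_swap (nseq b k) (nseq a.+1 k) k i ik; rewrite dk mul1r; apply.
    have := hl a b.+1; rewrite -(addn1 b) nseqD -catA; apply; lia.
  rewrite -[k :: nseq b k]/(nseq b.+1 k) -[nseq b.+1 k]cats0 word_nseqS word_cat -[_ * word [:: k] * _]mulrA.
  rewrite -(lin_letter) (Phi_comm (X_gr k) (hy _)); last first.
    by rewrite !size_nseq; lia.
  rewrite dk mul1r lin_letter // !mulrA.
  by rewrite -[_ * word [:: k] * _]mulrA -word_cat.
Qed.

End CriticalPairs.

Section LinearForm.
Variables (K : fieldType) (A : algType K).

Definition sandwich (f : A -> K^o) (a b t : A) : K^o := f (a * t * b).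

Fact sandwich_is_linear (f : {linear A -> K^o}) a b : linear (sandwich f a b).
Proof. by move=> c x y; rewrite /sandwich mul_lcomb linearP. Qed.
HB.instance Definition _ (f : {linear A -> K^o}) a b :=
  GRing.isLinear.Build K A K^o *:%R (sandwich f a b) (sandwich_is_linear f a b).

End LinearForm.

(** * Confluence of the rewriting system *)

Section Confluence.
Variables (K : fieldType) (p : nat) (g : restrictedLSA K p).
Local Notation I := 'I_(\dim {:g}).
Local Notation T := (tensor_alg g).
Variables (X : (\dim {:g}).-tuple g) (d : I -> bool).
Hypothesis X_basis : basis_of {:g} X.
Hypothesis X_gr : forall i : I, X`_i \in gr g (d i).
Variable tau : seq I -> K.
Implicit Types (u v w l : seq I) (t r : T) (x y : g).
Local Notation N := (nf X d tau).

Lemma linear_lin_eq (Psi Psi' : {linear T -> K^o}) x :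
  (forall k : I, Psi (word [:: k]) = Psi' (word [:: k])) -> Psi (lin X x) = Psi' (lin X x).
Proof.
move=> h; rewrite [lin X]unlock !linear_sum; apply: eq_bigr => k _.
by rewrite !linearZ /= h.
Qed.

(** Every word of the right-hand side r is below l in every context, so a linear form sees r only
    through such words. *)
Lemma rule_eq (Psi Psi' : {linear T -> K^o}) l r : rule X d l r ->
  (forall w, (forall u v, (mu (u ++ w ++ v) < mu (u ++ l ++ v))%N) ->
     Psi (word w) = Psi' (word w)) -> Psi r = Psi' r.
Proof.
case=> [i j ij|i] h.
  rewrite !linearD !linearZ /=; congr (_ * _ + _).
    by apply: h => u v; exact: mu_swap.
  apply: linear_lin_eq => k; apply: h => u v; apply: mu_size.
  by rewrite !size_cat /= ltn_add2l.
apply: linear_lin_eq => k; apply: h => u v; apply: mu_size.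
by rewrite !size_cat size_nseq ltn_add2l ltn_add2r; exact: cap_ge2.
Qed.

Section Joinable.
Variable w : seq I.
Hypothesis IH : forall u l r v, rule X d l r -> (mu (u ++ l ++ v) < mu w)%N ->
  N (u ++ l ++ v) = ext N (word u * r * word v).

(** Each reduct still contains the other redex, inside words below w, so [IH] allows the other rule
    to be applied as well. Both sides become the value with l1 and l2 replaced. *)
Lemma join_disjoint u l1 r1 m l2 r2 v : w = u ++ l1 ++ m ++ l2 ++ v ->
  rule X d l1 r1 -> rule X d l2 r2 ->
  ext N (word u * r1 * word (m ++ l2 ++ v)) = ext N (word (u ++ l1 ++ m) * r2 * word v).
Proof.
move=> ew h1 h2; transitivity (sandwich (ext N) (word u) (word m * r2 * word v) r1).
  rewrite -[LHS]/(sandwich (ext N) (word u) _ r1); apply: (rule_eq h1) => w' hw'.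
  rewrite /= /sandwich ext_word_ctx !mulrA -!word_cat.
  have := @IH ((u ++ w') ++ m) l2 r2 v h2; rewrite -!catA; apply.
  by rewrite ew; exact: hw'.
transitivity (sandwich (ext N) (word u * r1 * word m) (word v) r2).
  by rewrite /sandwich !mulrA.
rewrite -[RHS]/(sandwich (ext N) _ (word v) r2); apply: (rule_eq h2) => w' hw'.
rewrite /= /sandwich ext_word_ctx -!mulrA -!word_cat mulrA.
rewrite -(@IH u l1 r1 (m ++ w' ++ v) h1) -?catA //.
by rewrite ew; have := hw' (u ++ l1 ++ m) v; rewrite -!catA.
Qed.

Section Overlap.
Variables (u v : seq I) (c : seq I).
Hypothesis ew : w = u ++ c ++ v.
Local Notation Phi := (sandwich (ext N) (word u) (word v)).
Definition below (c' : seq I) : Prop := (mu (u ++ c' ++ v) < mu w)%N.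

Lemma below_size c' : (size c' < size c)%N -> below c'.
Proof. by move=> h; rewrite /below ew; apply: mu_size; rewrite !size_cat ltn_add2l ltn_add2r. Qed.

Lemma below_swap C B (i j : I) : (i < j)%N -> c = C ++ [:: j; i] ++ B ->
  below (C ++ [:: i; j] ++ B).
Proof.
move=> ij ec; rewrite /below ew ec; have := mu_swap (u ++ C) (B ++ v) ij.
by rewrite -!catA.
Qed.

Lemma below_trans C B (i j : I) : (i < j)%N -> below (C ++ [:: j; i] ++ B) ->
  below (C ++ [:: i; j] ++ B).
Proof.
move=> ij; apply: ltn_trans; have := mu_swap (u ++ C) (B ++ v) ij.
by rewrite -!catA.
Qed.

Lemma Phi_word C : Phi (word C) = N (u ++ C ++ v).
Proof. exact: ext_word_ctx. Qed.

Lemma Phi_rule C l r B : rule X d l r -> below (C ++ l ++ B) ->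
  Phi (word (C ++ l ++ B)) = Phi (word C * r * word B).
Proof.
move=> hr hb; rewrite Phi_word; have := @IH (u ++ C) l r (B ++ v) hr.
rewrite -!catA => -> //; last by move: hb; rewrite /below -!catA.
by rewrite /sandwich !word_cat !mulrA.
Qed.

Lemma Phi_swap C B (a b : I) : (b < a)%N -> below (C ++ [:: a; b] ++ B) ->
  Phi (word (C ++ [:: a; b] ++ B)) =
  (-1) ^+ (d a && d b) * Phi (word (C ++ [:: b; a] ++ B))
  + Phi (word C * lin X (br X`_a X`_b) * word B).
Proof.
move=> ba /(Phi_rule (rule_swap X d ba)) ->.
by rewrite mul_lcomb linearD linearZ /= -!word_cat -!catA.
Qed.

Lemma Phi_pow C B (a : I) : below (C ++ nseq (cap d a) a ++ B) ->
  Phi (word (C ++ nseq (cap d a) a ++ B)) =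
  Phi (word C * lin X (pow_val X d a) * word B).
Proof. exact: (Phi_rule (rule_pow X d a)). Qed.

Local Notation LL := (lin_letter X_basis).

Lemma join_swap_swap (i j k : I) : (i < j)%N -> (j < k)%N -> c = [:: k; j; i] ->
  Phi (((-1) ^+ (d k && d j) *: word [:: j; k] + lin X (br X`_k X`_j)) * word [:: i]) =
  Phi (word [:: k] * ((-1) ^+ (d j && d i) *: word [:: i; j] + lin X (br X`_j X`_i))).
Proof.
move=> ij jk ec.
have b1 : below [:: j; k; i] by apply: (@below_swap [::] [:: i] j k).
have b2 : below [:: k; i; j] by apply: (@below_swap [:: k] [::] i j).
have ik := ltn_trans ij jk.
apply: (crit_swap_swap (@word_cat K g) (word_nil g) X_basis X_gr LL below_size Phi_swap Phi_pow
  ij jk _ b1 _ b2) => //; first by rewrite ec.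
  by apply: (@below_trans [:: j] [::] i k).
by apply: (@below_trans [::] [:: j] i k).
Qed.

Lemma below_pow_l (i j : I) : (i < j)%N -> c = j :: nseq (cap d i) i ->
  forall a b, (a.+1 + b)%N = cap d i -> below (nseq a.+1 i ++ [:: j] ++ nseq b i).
Proof.
move=> ij ec; elim=> [|a IHa] b eb.
  by apply: (@below_swap [::] (nseq b i) i j) => //; rewrite ec -eb.
have := @below_trans (nseq a.+1 i) (nseq b i) i j ij.
rewrite -[nseq a.+2 i ++ _]/(i :: (nseq a.+1 i ++ [:: j] ++ nseq b i)).
have -> : i :: nseq a.+1 i ++ [:: j] ++ nseq b i = nseq a.+1 i ++ [:: i; j] ++ nseq b i.
  by rewrite -(cat1s i (_ ++ _)) catA -[[:: i] ++ nseq a.+1 i]/(nseq a.+2 i) -(addn1 a.+1) nseqD -!catA.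
by apply; apply: (IHa b.+1); rewrite -eb; lia.
Qed.

Lemma below_pow_r (i k : I) : (i < k)%N -> c = nseq (cap d k) k ++ [:: i] ->
  forall a b, (a.+1 + b)%N = cap d k -> below (nseq b k ++ [:: i] ++ nseq a.+1 k).
Proof.
move=> ik ec; elim=> [|a IHa] b eb.
  have := @below_swap (nseq b k) [::] i k ik; apply.
  by rewrite ec -eb addnC nseqD -catA.
have := @below_trans (nseq b k) (nseq a.+1 k) i k ik; apply.
have := IHa b.+1; rewrite -(addn1 b) nseqD -catA; apply; lia.
Qed.

Lemma join_swap_pow (i j : I) : (i < j)%N -> c = j :: nseq (cap d i) i ->
  Phi (((-1) ^+ (d j && d i) *: word [:: i; j] + lin X (br X`_j X`_i))
       * word (nseq (cap d i).-1 i)) =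
  Phi (word [:: j] * lin X (pow_val X d i)).
Proof.
move=> ij ec; apply: (crit_swap_pow (@word_cat K g) (word_nil g) X_basis X_gr LL below_size
  Phi_swap Phi_pow ij); first by rewrite ec /= size_nseq.
exact: below_pow_l.
Qed.

Lemma join_pow_swap (i k : I) : (i < k)%N -> c = nseq (cap d k) k ++ [:: i] ->
  Phi (word (nseq (cap d k).-1 k) *
       ((-1) ^+ (d k && d i) *: word [:: i; k] + lin X (br X`_k X`_i))) =
  Phi (lin X (pow_val X d k) * word [:: i]).
Proof.
move=> ij ec; apply: (crit_pow_swap (@word_cat K g) (word_nil g) X_basis X_gr LL below_size
  Phi_swap Phi_pow ij); first by rewrite ec size_cat size_nseq addn1.
exact: below_pow_r.
Qed.

Lemma join_pow_pow (i : I) m : c = nseq (cap d i + m) i ->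
  Phi (lin X (pow_val X d i) * word (nseq m i)) = Phi (word (nseq m i) * lin X (pow_val X d i)).
Proof.
move=> ec; apply: (crit_pow_pow (@word_cat K g) (word_nil g) X_basis X_gr LL below_size
  Phi_swap Phi_pow).
by rewrite ec size_nseq; have := cap_ge2 d i; lia.
Qed.

End Overlap.

Lemma ext_ctxR f u r c v :
  ext f (word u * r * word (c ++ v)) = sandwich (ext f) (word u) (word v) (r * word c).
Proof. by rewrite /sandwich word_cat !mulrA. Qed.

Lemma ext_ctxL f u r c v :
  ext f (word (u ++ c) * r * word v) = sandwich (ext f) (word u) (word v) (word c * r).
Proof. by rewrite /sandwich word_cat !mulrA. Qed.

(** The stretch m between the two starting points decides the case: the redexes are disjoint when m
    covers l1, and otherwise each pair of rule types has its own overlap. *)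
Lemma joinable u1 l1 r1 v1 u2 l2 r2 v2 : (size u1 <= size u2)%N ->
  rule X d l1 r1 -> rule X d l2 r2 -> w = u1 ++ l1 ++ v1 -> w = u2 ++ l2 ++ v2 ->
  ext N (word u1 * r1 * word v1) = ext N (word u2 * r2 * word v2).
Proof.
move=> hs h1 h2 e1 e2.
have {hs} [m em] : exists m, u2 = u1 ++ m.
  exists (drop (size u1) u2); have := congr1 (take (size u1)) e1.
  rewrite e2 [RHS]take_size_cat // takel_cat // => {1}<-.
  by rewrite cat_take_drop.
have e3 : l1 ++ v1 = m ++ l2 ++ v2.
  by move: e2; rewrite e1 em -catA => /eqP; rewrite eqseq_cat // eqxx => /eqP.
have [hm|hm] := leqP (size l1) (size m).
  have [m' em'] : exists m', m = l1 ++ m'.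
    exists (drop (size l1) m); have := congr1 (take (size l1)) e3.
    by rewrite take_size_cat // takel_cat // => {1}->; rewrite cat_take_drop.
  have ev : v1 = m' ++ l2 ++ v2.
    by move: e3; rewrite em' -catA => /eqP; rewrite eqseq_cat // eqxx => /eqP.
  rewrite em em' ev; apply: join_disjoint => //.
  by rewrite e1 ev.
subst u2; case: h1 e1 e3 hm => [i j ij|i] e1 e3 hm; case: h2 e2 e3 => [i' j' ij'|i'] e2 e3.
- case: m hm e2 e3 => [|a [|//]] _ e2 [].
    by move=> -> -> ->; rewrite cats0.
  move=> ea; subst a => ei ev; subst i v1.
  rewrite (ext_ctxR _ _ _ [:: i']) ext_ctxL.
  apply: (@join_swap_swap u1 v2 [:: j; j'; i'] _ i' j' j ij' ij (erefl _)).
  by rewrite e1.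
(* At offset 0 the descent j i would consist of equal letters; at offset 1 the word is j followed by
   a power of i. *)
- case: m hm e2 e3 => [|a [|//]] _ e2.
    have := cap_ge2 d i'; case: (cap d i') => [|[|n]] // _ [] ej ei; move: ij.
    by rewrite ei ej ltnn.
  rewrite /= => -[ea]; subst a => ev.
  have hc := cap_ge2 d i'.
  have ei : i = i' by move: ev; case: (cap d i') hc => // n _ [].
  subst i'; have ev1 : v1 = nseq (cap d i).-1 i ++ v2.
    by move: ev; case: (cap d i) hc => // n _ [].
  subst v1; rewrite ext_ctxR ext_ctxL.
  apply: (@join_swap_pow u1 v2 (j :: nseq (cap d i) i) _ i j ij (erefl _)).
  by rewrite e1; case: (cap d i) hc.
- have hc := cap_ge2 d i; rewrite size_nseq in hm.
  have em : m = nseq (size m) i.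
    have := congr1 (take (size m)) e3.
    rewrite [RHS]take_size_cat // takel_cat ?size_nseq; last exact: ltnW.
    by rewrite take_nseq //; exact: ltnW.
  have : nseq (cap d i - size m) i ++ v1 = [:: j'; i'] ++ v2.
    have := congr1 (drop (size m)) e3; rewrite [RHS]drop_size_cat //.
    by rewrite drop_cat size_nseq hm drop_nseq.
  (* A descent cannot lie inside a power of a single letter, so it starts at the last letter of the
     power. *)
  have [h1|hm'] : (cap d i - size m = 1)%N \/ (1 < cap d i - size m)%N by lia.
    rewrite h1 /= => -[ej ev]; subst j' v1.
    have -> : m = nseq (cap d i).-1 i by rewrite [LHS]em; congr nseq; lia.
    rewrite (ext_ctxR _ _ _ [:: i']) ext_ctxL; apply/esym.
    apply: (@join_pow_swap u1 v2 (nseq (cap d i) i ++ [:: i']) _ i' i ij' (erefl _)).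
    by rewrite e1 -catA.
  case: (_ - _)%N hm' => [|[|n]] //= _ [] e4 e5; move: ij'.
  by rewrite -e4 -e5 ltnn.
- have hc := cap_ge2 d i; rewrite size_nseq in hm.
  have hc' := cap_ge2 d i'.
  have em : m = nseq (size m) i.
    have := congr1 (take (size m)) e3.
    rewrite [RHS]take_size_cat // takel_cat ?size_nseq; last exact: ltnW.
    by rewrite take_nseq //; exact: ltnW.
  have e4 : nseq (cap d i - size m) i ++ v1 = nseq (cap d i') i' ++ v2.
    have := congr1 (drop (size m)) e3; rewrite [RHS]drop_size_cat //.
    by rewrite drop_cat size_nseq hm drop_nseq.
  have ei : i = i'.
    move: e4; case: (cap d i') hc' => // n' _; case: (_ - _)%N hm (subn_gt0 (size m) (cap d i)) => [->//|n _ _].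
    by case.
  subst i'.
  have ev : v1 = nseq (size m) i ++ v2.
    have := congr1 (drop (cap d i - size m)) e4.
    rewrite [LHS]drop_size_cat ?size_nseq // drop_cat size_nseq.
    case: ltnP => h; first by rewrite drop_nseq => ->; congr (nseq _ _ ++ _); lia.
    have -> : size m = 0%N by lia.
    by rewrite subn0 subnn drop0.
  rewrite em ev ext_ctxR ext_ctxL.
  apply: (@join_pow_pow u1 v2 (nseq (cap d i + size m) i) _ i (size m) (erefl _)).
  by rewrite e1 ev nseqD -catA.
Qed.

Lemma redex_joinable t1 t2 : redex X d w t1 -> redex X d w t2 -> ext N t1 = ext N t2.
Proof.
case=> u1 l1 r1 v1 h1 e1 ->; case=> u2 l2 r2 v2 h2 e2 ->.
by case: (leqP (size u1) (size u2)) => hs; [|apply/esym];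
  apply: joinable h1 h2 e1 e2 || apply: joinable (ltnW hs) h2 h1 e2 e1.
Qed.

End Joinable.

(** Induction on [mu], as in Newman's lemma: the rules hold below w, which makes any two reducts of
    w take the same value, in particular t and the chosen one. *)
Lemma nf_confluent w t : redex X d w t -> N w = ext N t.
Proof.
have [m] := ubnP (mu w); elim: m w t => // m IHm w t hw ht.
have [t' ht' ->] := nf_redex X_basis tau (ex_intro _ t ht).
apply: (@redex_joinable w) ht' ht => u l r v hr hlt.
by apply: IHm; [lia|exists u l r v].
Qed.

Lemma nf_rule u l r v : rule X d l r -> N (u ++ l ++ v) = ext N (word u * r * word v).
Proof. by move=> hr; apply: nf_confluent; exists u l r v. Qed.

End Confluence.

(** * Normal words *)

Section NormalWords.
Variables (n : nat) (cp : 'I_n -> nat).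
Local Notation I := 'I_n.
Implicit Types (u v w : seq I).

Definition nrm w := sorted (fun i j : I => i <= j)%N w && [forall i, count_mem i w < cp i]%N.

Definition ord_le (i j : I) := (i <= j)%N.

Lemma ord_le_trans : transitive ord_le.
Proof. by move=> y x z; exact: leq_trans. Qed.

Lemma not_sorted_descent w : ~~ sorted (fun i j : I => i <= j)%N w ->
  exists u v (i j : I), (i < j)%N /\ w = u ++ [:: j; i] ++ v.
Proof.
elim: w => // a [|b w] IH //=; rewrite negb_and -ltnNge; case: ltnP => [ba _|ab /= h].
  by exists [::], w, b, a.
have [u [v [i [j [ij ->]]]]] := IH h.
by exists (a :: u), v, i, j.
Qed.

Lemma sorted_split (P : pred I) w :
  (forall i j : I, (i <= j)%N -> P j -> P i) ->
  sorted (fun i j : I => i <= j)%N w -> w = filter P w ++ filter (predC P) w.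
Proof.
move=> hP; elim: w => // a w IH hs /=.
have hs' := path_sorted hs.
case: ifP => Pa /=; first by rewrite -IH.
have hm : all (fun j : I => a <= j)%N w by apply: (order_path_min ord_le_trans hs).
have hw : all (predC P) w.
  by apply/allP => j /(allP hm) aj /=; apply/negP => /(hP _ _ aj); rewrite Pa.
rewrite (all_filterP hw) (_ : filter P w = [::]) //.
by apply/eqP; rewrite -[_ == _]negbK -has_filter -all_predC.
Qed.

Lemma sorted_count w (i : I) : sorted (fun i j : I => i <= j)%N w ->
  exists u v, w = u ++ nseq (count_mem i w) i ++ v.
Proof.
move=> hs.
pose P1 : pred I := fun j : I => (j < i)%N; pose P2 : pred I := fun j : I => (j <= i)%N.
have e1 : w = filter P1 w ++ filter (predC P1) w.
  by apply: sorted_split => // a b ab; exact: leq_ltn_trans.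
have e2 : filter (predC P1) w = filter P2 (filter (predC P1) w) ++ filter (predC P2) (filter (predC P1) w).
  apply: sorted_split; first by move=> a b ab; exact: leq_trans.
  by apply: sorted_filter => //; exact: ord_le_trans.
exists (filter P1 w), (filter (predC P2) (filter (predC P1) w)).
rewrite {1}e1 {1}e2; congr (_ ++ _ ++ _).
rewrite -filter_predI -size_filter; set s := filter (pred1 i) w.
have -> : filter (predI P2 (predC P1)) w = s.
  apply: eq_filter => j; rewrite /= /P1 /P2 -leqNgt -eqn_leq; exact: val_eqE.
by apply/all_pred1P; apply/allP => j; rewrite mem_filter => /andP[].
Qed.

(** Equal letters of a sorted word are adjacent, so an exceeded exponent shows up as a consecutive
    power. *)
Lemma not_nrm w : (forall i, 0 < cp i)%N -> ~~ nrm w ->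
  (exists u v (i j : I), (i < j)%N /\ w = u ++ [:: j; i] ++ v) \/
  (exists u v (i : I), w = u ++ nseq (cp i) i ++ v).
Proof.
move=> cp0; rewrite /nrm; case hs: (sorted _ w) => /=; last first.
  by move=> _; left; apply: not_sorted_descent; rewrite hs.
rewrite negb_forall => /existsP[i]; rewrite -leqNgt => hi; right.
have [u [v e]] := sorted_count i hs.
exists u, (nseq (count_mem i w - cp i) i ++ v), i.
by rewrite {1}e [nseq (cp i) i ++ _ ++ _]catA -nseqD subnKC.
Qed.

Lemma nrm_no_descent u v (i j : I) : (i < j)%N -> ~~ nrm (u ++ [:: j; i] ++ v).
Proof.
move=> ij; apply/negP => /andP[hs _].
have := subseq_sorted ord_le_trans (suffix_subseq u _) hs.
rewrite /ord_le => /= /andP[]; by rewrite leqNgt ij.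
Qed.

Lemma nrm_no_power u v (i : I) : ~~ nrm (u ++ nseq (cp i) i ++ v).
Proof.
apply/negP => /andP[_ /forallP/(_ i)].
rewrite !count_cat count_nseq /= eqxx mul1n; lia.
Qed.

Lemma nrm_cat (P : pred I) u v :
  (forall i j : I, (i <= j)%N -> P j -> P i) -> all P u -> all (predC P) v ->
  nrm u -> nrm v -> nrm (u ++ v).
Proof.
move=> hP hu hv /andP[su cu] /andP[sv cv]; apply/andP; split.
  case: u su hu {cu} => // a u su hu; rewrite /= cat_path; move: su => /= -> /=.
  case: v sv hv {cv} => // b v sv /= /andP[hb _]; move: sv => /= ->; rewrite andbT.
  rewrite leqNgt; apply/negP => /ltnW h; have := hP _ _ h.
  have := allP hu _ (mem_last a u) => h1 /(_ h1); exact/negP.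
apply/forallP => i; rewrite count_cat.
have [Pi|Pi] := boolP (P i).
  rewrite (_ : count_mem i v = 0)%N ?addn0 ?(forallP cu) //.
  by apply/count_memPn/negP => /(allP hv) /=; rewrite Pi.
rewrite (_ : count_mem i u = 0)%N ?add0n ?(forallP cv) //.
by apply/count_memPn/negP => /(allP hu); apply/negP.
Qed.

Lemma nrm_filter (P : pred I) w : nrm w -> nrm (filter P w).
Proof.
move=> /andP[hs hc]; apply/andP; split.
  by apply: sorted_filter => //; exact: ord_le_trans.
apply/forallP => i; apply: leq_ltn_trans (forallP hc i).
by apply: leq_count_subseq; exact: filter_subseq.
Qed.

(** The bound is uniform in w, so normal words live in a finite type of bounded sequences. *)
Lemma nrm_size w : nrm w -> (size w <= \sum_i cp i)%N.
Proof.
move=> /andP[_ hc]; suff -> : size w = (\sum_(i : I) count_mem i w)%N.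
  by apply: leq_sum => i _; apply: ltnW; exact: (forallP hc).
elim: w {hc} => [|a w IH]; first by rewrite big1.
rewrite /= big_split /= -IH (bigD1 a) //= eqxx big1 // => i ai.
by rewrite eq_sym (negPf ai).
Qed.

End NormalWords.

Section LinearSpan.
Variables (K : pzRingType) (V : lmodType K).

Inductive lspan (S : V -> Prop) : V -> Prop :=
| lspan0 : lspan S 0
| lspanD c s x : S s -> lspan S x -> lspan S (c *: s + x).

Lemma lspan_in (S : V -> Prop) s : S s -> lspan S s.
Proof. by move=> h; rewrite -[s]addr0 -[s]scale1r; apply: lspanD => //; exact: lspan0. Qed.

Lemma lspan_add S x y : lspan S x -> lspan S y -> lspan S (x + y).
Proof.
by move=> hx hy; elim: hx => [|c s z hs _ IH]; rewrite ?add0r // -addrA; apply: lspanD.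
Qed.

Lemma lspan_scale S c x : lspan S x -> lspan S (c *: x).
Proof.
elim=> [|e s z hs _ IH]; first by rewrite scaler0; exact: lspan0.
by rewrite scalerDr scalerA; apply: lspanD.
Qed.

Lemma lspan_sum S (J : finType) (P : pred J) (F : J -> V) :
  (forall j, P j -> lspan S (F j)) -> lspan S (\sum_(j | P j) F j).
Proof.
move=> h; elim/big_ind: _ => //; [exact: lspan0|exact: lspan_add].
Qed.

Lemma lspan_sub (S S' : V -> Prop) x : (forall s, S s -> lspan S' s) -> lspan S x -> lspan S' x.
Proof.
move=> h; elim=> [|c s z hs _ IH]; first exact: lspan0.
by apply: lspan_add => //; apply: lspan_scale; exact: h.
Qed.
End LinearSpan.

(** * Spanning by normal monomials *)

Section Span.
Variables (K : fieldType) (p : nat) (g l : restrictedLSA K p).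
Local Notation I := 'I_(\dim {:g}).
Variables (D : pred I) (d : I -> bool) (e : I -> l).
Hypothesis e_gr : forall i, D i -> e i \in gr l (d i).
Hypothesis e_span : forall j x, x \in gr l j ->
  exists c : I -> K, x = \sum_(i | D i && (d i == j)) c i *: e i.
Implicit Types (u v w : seq I).

Local Notation nm := (nrm (cap d)).
Definition parity w : bool := foldr (fun i b => d i (+) b) false w.

Lemma parity_cat u v : parity (u ++ v) = parity u (+) parity v.
Proof. by elim: u => //= i u ->; rewrite addbA. Qed.

Definition mon w : renv l := \prod_(i <- w) uiota (e i).

Lemma mon_cat u v : mon (u ++ v) = mon u * mon v.
Proof. by rewrite /mon big_cat. Qed.

Lemma mon1 i : mon [:: i] = uiota (e i).
Proof. by rewrite /mon big_seq1. Qed.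

Definition normal_mon (j : bool) (a : renv l) : Prop :=
  exists w, [/\ nm w, all D w, parity w = j & a = mon w].

Lemma mon_ctx u v x j : x \in gr l j -> exists c : I -> K,
  mon u * uiota x * mon v = \sum_(i | D i && (d i == j)) c i *: mon (u ++ [:: i] ++ v).
Proof.
move=> /e_span[c ->]; exists c; rewrite linear_sum mulr_sumr mulr_suml.
apply: eq_bigr => i _.
by rewrite linearZ -scalerAr -scalerAl !mon_cat mon1 mulrA.
Qed.

(** Induction on [mu], with the relations of u(l) as rules. The parity can be carried along because
    each relation is homogeneous. *)
Lemma mon_span w : all D w -> lspan (normal_mon (parity w)) (mon w).
Proof.
have [m] := ubnP (mu w); elim: m w => // m IH w hm hD.
have [hn|hn] := boolP (nm w); first by apply: lspan_in; exists w.
have hcp i : (0 < cap (g := g) d i)%N.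
  by rewrite /cap; case: (d i) => //; rewrite prime_gt0 // (lsa_prime g).
have lower u v i j x : all D (u ++ v) -> x \in gr l j -> D i ->
    (size (u ++ [:: i] ++ v) < size w)%N -> parity u (+) j (+) parity v = parity w ->
    lspan (normal_mon (parity w)) (mon u * uiota x * mon v).
  move=> huv hx Di hs hp; have [c ->] := mon_ctx u v hx.
  apply: lspan_sum => k /andP[Dk /eqP dk]; apply: lspan_scale.
  rewrite -hp; have -> : parity u (+) j (+) parity v = parity (u ++ [:: k] ++ v).
    by rewrite !parity_cat /= addbF dk addbA.
  apply: IH; last by move: huv; rewrite !all_cat /= Dk.
  apply: (@leq_trans (mu w)) => //.
  by apply: mu_size; move: hs; rewrite !size_cat.
case: (not_nrm hcp hn) => [[u [v [i [j [ij ew]]]]]|[u [v [i ew]]]].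
- move: hD; rewrite ew !all_cat /= => /and3P[Du /and3P[Dj Di _] Dv].
  have hsw : mon [:: j; i] = (-1) ^+ (d j && d i) *: mon [:: i; j] + uiota (br (e j) (e i)).
    rewrite -[[:: j; i]]/([:: j] ++ [:: i]) -[[:: i; j]]/([:: i] ++ [:: j]) !mon_cat !mon1.
    by rewrite -(uiota_br (e_gr Dj) (e_gr Di)) addrC subrK.
  rewrite -ew; have -> : mon w = (-1) ^+ (d j && d i) *: mon (u ++ [:: i; j] ++ v)
     + mon u * uiota (br (e j) (e i)) * mon v.
    by rewrite ew !mon_cat hsw mulrDl mulrDr -scalerAl -scalerAr !mulrA.
  apply: lspan_add; last first.
    apply: (@lower u v i (d j (+) d i)) => //; first by rewrite all_cat Du.
    - exact: (br_gr (lsaP l)) (e_gr Dj) (e_gr Di).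
    - by rewrite ew !size_cat /= ltn_add2l.
    by rewrite ew !parity_cat /= addbF !addbA.
  apply: lspan_scale; have -> : parity w = parity (u ++ [:: i; j] ++ v).
    by rewrite ew !parity_cat /= !addbF [d j (+) d i]addbC.
  apply: IH; last by rewrite !all_cat /= Du Di Dj.
  by apply: (@leq_trans (mu w)) => //; rewrite ew; exact: mu_swap.
- have hc2 : (2 <= cap (g := g) d i)%N.
    by rewrite /cap; case: (d i) => //; rewrite prime_gt1 // (lsa_prime g).
  have Di : D i by move: hD; rewrite ew !all_cat; case: (cap _ _) hc2 => // c _ /= /and3P[_ /andP[]].
  have [y [hy ey]] : exists y, y \in gr l false /\ mon (nseq (cap (g := g) d i) i) = uiota y.
    have -> : mon (nseq (cap (g := g) d i) i) = uiota (e i) ^+ (cap (g := g) d i).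
      by rewrite /mon big_nseq -Monoid.iteropE.
    move: (e_gr Di); rewrite /cap; case: (d i) => he.
      by exists (sq (e i)); rewrite (uiota_sq he); split => //; exact: (sq_gr (lsaP l)).
    by exists (pm (e i)); rewrite (uiota_pm he); split => //; exact: (pm_gr (lsaP l)).
  rewrite {2}ew !mon_cat ey mulrA; apply: (@lower u v i false) => //.
  + by move: hD; rewrite ew !all_cat => /and3P[-> _ ->].
  + by rewrite ew !size_cat size_nseq /= ltn_add2l ltn_add2r.
  rewrite ew !parity_cat addbF addbA; congr (_ (+) _).
  have pn k : parity (nseq k i) = odd k && d i.
    by elim: k => //= k ->; case: (d i); case: (odd k).
  rewrite pn /cap; case di: (d i); last by rewrite andbF addbF.
  by rewrite addbF.
Qed.

Lemma renv_span j a : renv_gr j a -> lspan (normal_mon j) a.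
Proof.
elim=> {j a} [i|||||].
- exact: lspan0.
- have <- : mon [::] = 1 by rewrite /mon big_nil.
  exact: (mon_span (w := [::])).
- by move=> i a b _ ha _ hb; exact: lspan_add.
- by move=> i c a _ ha; exact: lspan_scale.
- move=> i j a b _ ha _ hb; elim: ha => [|c s x [w [_ Dw <- ->]] _ IHx].
    by rewrite mul0r; exact: lspan0.
  rewrite mulrDl; apply: lspan_add => //; rewrite -scalerAl; apply: lspan_scale.
  elim: hb => [|c' s' x' [w' [_ Dw' <- ->]] _ IHx']; first by rewrite mulr0; exact: lspan0.
  rewrite mulrDr; apply: lspan_add => //; rewrite -scalerAr; apply: lspan_scale.
  by rewrite -mon_cat -parity_cat; apply: mon_span; rewrite all_cat Dw.
- move=> i x hx; have [c ec] := mon_ctx [::] [::] hx.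
  move: ec; rewrite /mon big_nil mul1r mulr1 -/(mon _) => ->.
  apply: lspan_sum => k /andP[Dk /eqP <-]; apply: lspan_scale.
  by rewrite -[d k]addbF; apply: (mon_span (w := [:: k])); rewrite /= Dk.
Qed.

End Span.

(** * From relations between basis vectors to relations on all of g *)

Section IdealExtension.
Variables (K : fieldType) (p : nat) (g : restrictedLSA K p).
Local Notation I := 'I_(\dim {:g}).
Variables (X : (\dim {:g}).-tuple g) (d : I -> bool).
Hypothesis X_basis : basis_of {:g} X.
Hypothesis X_gr : forall i : I, X`_i \in gr g (d i).
Variables (A : algType K) (lin : {linear g -> A}) (J : A -> Prop).
Hypothesis J0 : J 0.
Hypothesis JD : forall a b, J a -> J b -> J (a + b).
Hypothesis JZ : forall (c : K) a, J a -> J (c *: a).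
Hypothesis JMl : forall a b, J b -> J (a * b).
Hypothesis JMr : forall a b, J a -> J (a * b).
Hypothesis J_br : forall i j : I,
  J (lin X`_i * lin X`_j - (-1) ^+ (d i && d j) *: (lin X`_j * lin X`_i) - lin (br X`_i X`_j)).
Hypothesis J_pow : forall i : I, J (lin X`_i ^+ cap d i - lin (pow_val X d i)).

Lemma gr_ind_mem (j : bool) (P : g -> Prop) : P 0 ->
  (forall c (k : I) y, d k = j -> y \in gr g j -> P y -> P (c *: X`_k + y)) ->
  forall x, x \in gr g j -> P x.
Proof.
move=> P0 PD x hx; suff [] : x \in gr g j /\ P x by [].
move: x hx; apply: (gr_ind X_basis X_gr) => [|c k y dk [hy Py]]; first by rewrite mem0v.
by split; [rewrite memvD // memvZ // -dk; exact: X_gr|exact: PD].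
Qed.

Let lP c x y : lin (c *: x + y) = c *: lin x + lin y. Proof. exact: linearP. Qed.
Let l0 : lin 0 = 0. Proof. exact: linear0. Qed.

Lemma ideal_br i j x y : x \in gr g i -> y \in gr g j ->
  J (lin x * lin y - (-1) ^+ (i && j) *: (lin y * lin x) - lin (br x y)).
Proof.
move=> hx hy; move: x hx; apply: (gr_ind X_basis X_gr) => [|c k x dk IHx].
  by rewrite br0l !l0 mul0r mulr0 scaler0 !subr0.
rewrite brDl brZl !lP mul_lcomb1 mul_lcomb2 scaler_lcomb !sub_lcomb.
apply: JD => //; apply: JZ.
move: y hy {x IHx}; apply: (gr_ind X_basis X_gr) => [|c' l y dl IHy].
  by rewrite br0r !l0 mul0r mulr0 scaler0 !subr0.
rewrite brDr brZr !lP mul_lcomb1 mul_lcomb2 scaler_lcomb !sub_lcomb.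
by apply: JD => //; apply: JZ; rewrite -dk -dl; exact: J_br.
Qed.

(** On a sum x + y, both x^2 and [sq] x change by the same polar form, x y + y x = [x, y] modulo J.
    Basis vectors therefore suffice, in characteristic 2 too. *)
Lemma ideal_sq x : x \in gr g true -> J (lin x ^+ 2 - lin (sq x)).
Proof.
move: x; apply: gr_ind_mem => [|c k y dk hy IH].
  rewrite (_ : sq 0 = 0); first by rewrite !l0 expr2 mul0r subr0.
  by have := sqZ (lsaP g) 0 (mem0v (gr g true)); rewrite scaler0 expr2 mul0r scale0r.
have hk : X`_k \in gr g true by rewrite -dk; exact: X_gr.
rewrite (sqD (lsaP g)) ?memvZ // (sqZ (lsaP g)) // brZl.
have := J_pow k; rewrite /cap /pow_val dk => Jk.
have := ideal_br hk hy; rewrite expr1 scaleN1r opprK => Jb.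
have -> : lin (c *: X`_k + y) ^+ 2 - lin (c ^+ 2 *: sq X`_k + sq y + c *: br X`_k y) =
  c ^+ 2 *: (lin X`_k ^+ 2 - lin (sq X`_k)) + (lin y ^+ 2 - lin (sq y)) +
  c *: (lin X`_k * lin y + lin y * lin X`_k - lin (br X`_k y)).
  have -> : lin (c *: X`_k + y) ^+ 2 =
     (c ^+ 2 *: lin X`_k ^+ 2 + lin y ^+ 2) + c *: (lin X`_k * lin y + lin y * lin X`_k).
    rewrite lP !expr2 mulrDl !mulrDr -!scalerAl -!scalerAr scalerA scalerDr.
    by rewrite -!addrA; congr (_ + _); rewrite addrA addrC.
  rewrite [c ^+ 2 *: sq _ + _ + _]addrC lP [lin (_ + sq y)]lP.
  by rewrite [c *: lin _ + _]addrC opprD addrACA sub_lcomb -scalerBr.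
by apply: JD; [apply: JD => //; apply: JZ|apply: JZ].
Qed.

Lemma ad_coef_even x y n j : x \in gr g false -> y \in gr g false ->
  ad_coef (@br _ _ g) x y n j \in gr g false.
Proof.
move=> hx hy; have he u v : u \in gr g false -> v \in gr g false -> br u v \in gr g false.
  exact: (br_gr (lsaP g)).
elim: n j => [|n IH] [|j] //=; rewrite ?mem0v // ?add0r ?he //.
by rewrite memvD // he.
Qed.

Lemma ideal_comm x y : x \in gr g false -> y \in gr g false ->
  J (comm_br (lin x) (lin y) - lin (br x y)).
Proof. by move=> hx hy; have := ideal_br hx hy; rewrite expr0 scale1r. Qed.

Lemma ideal_ad_coef x y n j : x \in gr g false -> y \in gr g false ->
  J (ad_coef (@comm_br K A) (lin x) (lin y) n j - lin (ad_coef (@br _ _ g) x y n j)).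
Proof.
move=> hx hy; elim: n j => [|n IH] j.
  by case: j => [|j] /=; rewrite ?l0 subrr.
have step z k : z \in gr g false ->
    J (comm_br (lin z) (ad_coef (@comm_br K A) (lin x) (lin y) n k)
       - lin (br z (ad_coef (@br _ _ g) x y n k))).
  move=> hz; set a := ad_coef _ _ _ _ _; set b := ad_coef _ _ _ _ _.
  have hb : b \in gr g false by exact: ad_coef_even.
  have -> : comm_br (lin z) a - lin (br z b) =
     (lin z * (a - lin b) + (-1) *: ((a - lin b) * lin z)) + (comm_br (lin z) (lin b) - lin (br z b)).
    rewrite /comm_br scaleN1r mulrBr mulrBl addrA; congr (_ - _).
    by rewrite addrACA subrK -opprD subrK.
  apply: JD; last exact: ideal_comm.
  by apply: JD; [exact: JMl (IH k)|apply: JZ; exact: JMr (IH k)].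
rewrite /= linearD opprD addrACA; apply: JD; last exact: step.
by case: j => [|j]; [rewrite l0 subrr|exact: step].
Qed.

(** Jacobson's formula in A and the axiom [pmD] in g have the same correction terms modulo J. The
    difference is thus additive and p-semilinear modulo J, and basis vectors suffice. *)
Lemma ideal_pm x : x \in gr g false -> J (lin x ^+ p - lin (pm x)).
Proof.
have p0 := prime_gt0 (lsa_prime g).
move: x; apply: gr_ind_mem => [|c k y dk hy IH].
  rewrite (_ : pm 0 = 0); first by rewrite !l0 expr0n gtn_eqF // subr0.
  have := pmZ (lsaP g) 0 (mem0v (gr g false)).
  by rewrite scaler0 expr0n gtn_eqF // scale0r.
have hk : X`_k \in gr g false by rewrite -dk; exact: X_gr.
have hck : c *: X`_k \in gr g false by exact: memvZ.
have lD u v : lin (u + v) = lin u + lin v by exact: linearD.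
have lZ a u : lin (a *: u) = a *: lin u by exact: linearZ_LR.
rewrite (pmD (lsaP g)) // 3!lD (Jacobson_formula (lsa_pchar g)) opprD addrACA; apply: JD.
  rewrite opprD addrACA; apply: JD => //.
  rewrite (pmZ (lsaP g)) // !lZ exprZn -scalerBr; apply: JZ.
  by have := J_pow k; rewrite /cap /pow_val dk.
rewrite linear_sum -sumrB; elim/big_ind: _ => // i _.
by rewrite /jacobson_s [lin (_^-1 *: _)]lZ -scalerBr; apply: JZ; exact: ideal_ad_coef.
Qed.

End IdealExtension.

Section WordIdeal.
Variables (K : fieldType) (I : Type) (A : algType K) (W : seq I -> A).
Hypothesis W_ind : forall P : A -> Prop, P 0 -> (forall s t, P s -> P t -> P (s + t)) ->
  (forall (c : K) t, P t -> P (c *: t)) -> (forall w, P (W w)) -> forall t, P t.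

Lemma sandwich_words (Phi : {linear A -> K^o}) t :
  (forall u v, Phi (W u * t * W v) = 0) -> forall a b, Phi (a * t * b) = 0.
Proof.
move=> h a b; elim/W_ind: a => [|x y hx hy|c x hx|u].
- by rewrite !mul0r linear0.
- by rewrite !mulrDl linearD hx hy addr0.
- by rewrite -!scalerAl linearZ /= hx scaler0.
elim/W_ind: b => [|x y hx hy|c x hx|v] //.
- by rewrite mulr0 linear0.
- by rewrite mulrDr linearD hx hy addr0.
by rewrite -scalerAr linearZ /= hx scaler0.
Qed.

(** The largest two-sided ideal on which a linear [Phi] vanishes. *)
Definition two_sided (Phi : A -> K^o) (t : A) := forall a b, Phi (a * t * b) = 0.

Variable Phi : {linear A -> K^o}.

Lemma two_sided0 : two_sided Phi 0.
Proof. by move=> a b; rewrite mulr0 mul0r linear0. Qed.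
Lemma two_sidedD s t : two_sided Phi s -> two_sided Phi t -> two_sided Phi (s + t).
Proof. by move=> hs ht a b; rewrite mulrDr mulrDl linearD hs ht addr0. Qed.
Lemma two_sidedZ (c : K) t : two_sided Phi t -> two_sided Phi (c *: t).
Proof. by move=> ht a b; rewrite -scalerAr -scalerAl linearZ /= ht scaler0. Qed.
Lemma two_sidedMl s t : two_sided Phi t -> two_sided Phi (s * t).
Proof. by move=> ht a b; rewrite mulrA ht. Qed.
Lemma two_sidedMr s t : two_sided Phi s -> two_sided Phi (s * t).
Proof. by move=> ht a b; rewrite -!mulrA mulrA ht. Qed.
End WordIdeal.

(** * Linear forms on u(g) with prescribed values on normal monomials *)

Section Functional.
Variables (K : fieldType) (p : nat) (g : restrictedLSA K p).
Local Notation I := 'I_(\dim {:g}).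
Local Notation T := (tensor_alg g).
Variables (X : (\dim {:g}).-tuple g) (d : I -> bool).
Hypothesis X_basis : basis_of {:g} X.
Hypothesis X_gr : forall i : I, X`_i \in gr g (d i).
Variable tau : seq I -> K.
Implicit Types (u v w l : seq I) (t r : T) (x y : g).
Local Notation N := (nf X d tau).

Lemma ext_nf_swap C B (a b : I) : (b < a)%N ->
  ext N (word (C ++ [:: a; b] ++ B)) =
  (-1) ^+ (d a && d b) * ext N (word (C ++ [:: b; a] ++ B))
  + ext N (word C * lin X (br X`_a X`_b) * word B).
Proof.
move=> ba; rewrite ext_word (nf_rule X_basis X_gr tau _ _ (rule_swap X d ba)).
by rewrite mul_lcomb linearD linearZ /= -!word_cat -!catA.
Qed.

Lemma ext_nf_pow C B (a : I) :
  ext N (word (C ++ nseq (cap d a) a ++ B)) = ext N (word C * lin X (pow_val X d a) * word B).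
Proof. by rewrite ext_word (nf_rule X_basis X_gr tau _ _ (rule_pow X d a)). Qed.

Local Notation J := (two_sided (ext N)).

Lemma J_words t : (forall u v, ext N (word u * t * word v) = 0) -> J t.
Proof. exact: (sandwich_words (@tensor_ind K g)). Qed.

Lemma J_br (i j : I) : J (lin X X`_i * lin X X`_j
  - (-1) ^+ (d i && d j) *: (lin X X`_j * lin X X`_i) - lin X (br X`_i X`_j)).
Proof.
apply: J_words => u v.
(* Confluence makes the rules valid on all words, so [lt] is everything and s is merely taken large
   enough for the side condition. *)
have := @Phi_comm_letters K p g T (@word K g) (lin X) X d X_basis X_gr (ext N) xpredT
  (size u + size v + 3) (fun _ _ => isT) (fun C B a b h _ => ext_nf_swap C B h)
  (fun C B a _ => ext_nf_pow C B a) u v i j.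
rewrite addn3 addn2 ltnSn => /(_ isT).
rewrite !(lin_letter X_basis) => e.
have -> : word u * (word [:: i] * word [:: j] - (-1) ^+ (d i && d j) *: (word [:: j] * word [:: i])
      - lin X (br X`_i X`_j)) * word v =
   word (u ++ [:: i; j] ++ v) - (-1) ^+ (d i && d j) *: word (u ++ [:: j; i] ++ v)
   - word u * lin X (br X`_i X`_j) * word v.
  rewrite -[[:: i; j]]/([:: i] ++ [:: j]) -[[:: j; i]]/([:: j] ++ [:: i]) !word_cat.
  exact: mul_comb3.
rewrite !linearB linearZ /= e; rewrite /GRing.scale /=; ring.
Qed.

Lemma J_pow (i : I) : J (lin X X`_i ^+ cap d i - lin X (pow_val X d i)).
Proof.
apply: J_words => u v; rewrite (lin_letter X_basis).
have -> : word [:: i] ^+ cap d i = word (nseq (cap d i) i).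
  by elim: (cap d i) => [|k IH]; rewrite ?expr0 ?word_nil // exprS IH -word_cat.
by rewrite mul_subm linearB /= -!word_cat -catA ext_nf_pow subrr.
Qed.

Let J0 : J 0. Proof. exact: two_sided0. Qed.
Let JD a b : J a -> J b -> J (a + b). Proof. exact: two_sidedD. Qed.
Let JZ (c : K) a : J a -> J (c *: a). Proof. exact: two_sidedZ. Qed.
Let JMl a b : J b -> J (a * b). Proof. exact: two_sidedMl. Qed.
Let JMr a b : J a -> J (a * b). Proof. exact: two_sidedMr. Qed.

Local Notation theta := (tlift (lin X)).

Let thB a b : theta (a - b) = theta a - theta b. Proof. exact: rmorphB. Qed.
Let thM a b : theta (a * b) = theta a * theta b. Proof. exact: rmorphM. Qed.

Let thX a n : theta (a ^+ n) = theta a ^+ n. Proof. exact: rmorphXn. Qed.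

(** [theta] passes from [vbasis], in which [tvar] expands elements of g, to the homogeneous basis X
    of the rules. The relations of U(g), known in the ideal for vectors of X, then follow for all
    elements. *)
Lemma Uenv_kernel t : ideal_gen (@Uenv_rel K p g) t -> J (theta t).
Proof.
elim=> {t} [t [i j x y hx hy|x hx]||a b _ ha _ hb|a b _ hb|a b _ ha].
- rewrite 2!thB tlift_is_scalable 2!thM !tlift_tvar.
  exact: (ideal_br X_basis X_gr J0 JD JZ J_br).
- rewrite thB expr2 thM !tlift_tvar -expr2.
  exact: (ideal_sq X_basis X_gr J0 JD JZ J_br J_pow).
- by rewrite rmorph0; exact: J0.
- by rewrite thB -scaleN1r; apply: JD => //; exact: JZ.
- by rewrite thM; exact: JMl.
- by rewrite thM; exact: JMr.
Qed.

Definition renv_pi t : renv g := quo (@renv_rel K p g) (quo (@Uenv_rel K p g) t).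

Lemma renv_ideal q : ideal_gen (@renv_rel K p g) q ->
  exists2 s, quo (@Uenv_rel K p g) s = q & J (theta s).
Proof.
elim=> {q} [q [x hx]||a b _ [s <- hs] _ [s' <- hs']|a b _ [s <- hs]|a b _ [s <- hs]].
- exists (tvar x ^+ p - tvar (pm x)); first by rewrite (raddfB (quo _)) /Uiota -(rmorphXn (quo (@Uenv_rel K p g))).
  rewrite thB thX !tlift_tvar.
  exact: (ideal_pm X_basis X_gr J0 JD JZ JMl JMr J_br J_pow).
- by exists 0; rewrite ?raddf0 //; exact: J0.
- exists (s - s'); first exact: raddfB.
  by rewrite thB -scaleN1r; apply: JD => //; exact: JZ.
- exists (quo_repr a * s); first by rewrite (rmorphM (quo (@Uenv_rel K p g))) /= quo_reprK.
  by rewrite thM; exact: JMl.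
- exists (s * quo_repr b); first by rewrite (rmorphM (quo (@Uenv_rel K p g))) /= quo_reprK.
  by rewrite thM; exact: JMr.
Qed.

Lemma renv_kernel t : renv_pi t = 0 -> J (theta t).
Proof.
rewrite /renv_pi -[RHS](raddf0 (quo (@renv_rel K p g))) => /quo_eq; rewrite subr0.
move=> /renv_ideal[s es hs].
have : J (theta (t - s)) by apply: Uenv_kernel; apply/quo_eq; rewrite es.
by move=> /JD/(_ hs); rewrite thB subrK.
Qed.

(** The choice of representatives is harmless, because [ext N] after [theta] vanishes on the kernel
    of the projection to u(g). As [tau] is arbitrary, these forms give the linear independence of
    normal monomials. *)
Definition pbw_form (a : renv g) : K^o := ext N (theta (quo_repr (quo_repr a))).

Lemma pbw_form_pi t : pbw_form (renv_pi t) = ext N (theta t).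
Proof.
rewrite /pbw_form; set s := quo_repr _.
have : J (theta (s - t)).
  by apply: renv_kernel; rewrite /renv_pi !raddfB /s /= !quo_reprK subrr.
move=> /(_ 1 1); rewrite mul1r mulr1 thB linearB => /eqP.
by rewrite subr_eq0 => /eqP.
Qed.

Lemma renv_piK (a : renv g) : renv_pi (quo_repr (quo_repr a)) = a.
Proof. by rewrite /renv_pi !quo_reprK. Qed.

Fact pbw_form_is_linear : linear pbw_form.
Proof.
move=> c a b; rewrite -[a]renv_piK -[b]renv_piK.
set s := quo_repr _; set t := quo_repr _.
have -> : c *: renv_pi s + renv_pi t = renv_pi (c *: s + t).
  by rewrite /renv_pi !raddfD /= !quo_is_scalable.
by rewrite !pbw_form_pi raddfD /= tlift_is_scalable linearP.
Qed.
HB.instance Definition _ := GRing.isLinear.Build K (renv g) K^o *:%R pbw_form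
  pbw_form_is_linear.

Lemma pbw_form_mon w : nrm (cap d) w -> pbw_form (mon (tnth X) w) = tau w.
Proof.
move=> hw; have -> : mon (tnth X) w = renv_pi (\prod_(i <- w) tvar (tnth X i)).
  by rewrite /mon /renv_pi !rmorph_prod.
rewrite pbw_form_pi rmorph_prod /=.
have -> : \prod_(i <- w) theta (tvar (tnth X i)) = word w.
  elim: w {hw} => [|i w IH]; first by rewrite big_nil word_nil.
  by rewrite big_cons IH tlift_tvar (tnth_nth 0) /= (lin_letter X_basis) -word_cat.
rewrite ext_word; have := @nf_normal K p g X d tau w; apply=> t [u l r v hr ew _].
case: hr ew => [i j ij|i] ew; move: hw; rewrite ew.
  by apply/negP; exact: nrm_no_descent.
by apply/negP; exact: nrm_no_power.
Qed.

End Functional.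

(** * Freeness of u(g) over u(l) *)

Section RenvInd.
Variables (K : fieldType) (p : nat) (g : restrictedLSA K p).

Lemma tvar_letter (i : 'I_(\dim {:g})) : tvar (vbasis {:g})`_i = word [:: i] :> tensor_alg g.
Proof.
rewrite [@tvar _ _]unlock (bigD1 i) //= word_fmu coord_free ?(basis_free (vbasisP _)) //.
rewrite eqxx scale1r big1 ?addr0 // => j ji.
by rewrite coord_free ?(basis_free (vbasisP _)) // eq_sym (negPf ji) scale0r.
Qed.

Lemma renv_ind (Q : renv g -> Prop) : Q 0 -> Q 1 -> (forall a b, Q a -> Q b -> Q (a + b)) ->
  (forall (c : K) a, Q a -> Q (c *: a)) -> (forall a b, Q a -> Q b -> Q (a * b)) ->
  (forall i x, x \in gr g i -> Q (uiota x)) -> forall a, Q a.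
Proof.
move=> Q0 Q1 QD QZ QM Qu a; rewrite -[a]renv_piK; move: (quo_repr _) => t.
have Qx x : Q (uiota x).
  have : x \in (gr g false + gr g true)%VS by rewrite (gr_sum (lsaP g)) memvf.
  by case/memv_addP=> y hy [z hz ->]; rewrite linearD; apply: QD; [apply: Qu hy|apply: Qu hz].
elim/tensor_ind: t => [|s t hs ht|c t ht|w].
- by rewrite /renv_pi !raddf0.
- by rewrite /renv_pi !raddfD; exact: QD.
- by rewrite /renv_pi !quo_is_scalable; exact: QZ.
elim: w => [|i w IH]; first by rewrite word_nil /renv_pi !rmorph1.
rewrite word_cons -tvar_letter /renv_pi !rmorphM; apply: QM => //; exact: Qx.
Qed.

Lemma renv_gr_sum (a : renv g) : exists a0 a1,
  [/\ renv_gr false a0, renv_gr true a1 & a = a0 + a1].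
Proof.
elim/renv_ind: a => [||a b [a0 [a1 [h0 h1 ->]]] [b0 [b1 [k0 k1 ->]]]|
  c a [a0 [a1 [h0 h1 ->]]]|a b [a0 [a1 [h0 h1 ->]]] [b0 [b1 [k0 k1 ->]]]|[] x hx].
- by exists 0, 0; split; rewrite ?addr0 //; exact: renv_gr0.
- by exists 1, 0; split; rewrite ?addr0 //; [exact: renv_gr1|exact: renv_gr0].
- by exists (a0 + b0), (a1 + b1); split; [exact: renv_grD|exact: renv_grD|rewrite addrACA].
- by exists (c *: a0), (c *: a1); split; [exact: renv_grZ|exact: renv_grZ|rewrite scalerDr].
- exists (a0 * b0 + a1 * b1), (a0 * b1 + a1 * b0); split.
  + by apply: renv_grD; [exact: (renv_grM h0 k0)|exact: (renv_grM h1 k1)].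
  + by apply: renv_grD; [exact: (renv_grM h0 k1)|exact: (renv_grM h1 k0)].
  by rewrite mulrDl !mulrDr [a1 * b0 + _]addrC addrACA.
- by exists 0, (uiota x); split; rewrite ?add0r //; [exact: renv_gr0|exact: renv_gr_uiota].
- by exists (uiota x), 0; split; rewrite ?addr0 //; [exact: renv_gr_uiota|exact: renv_gr0].
Qed.

Lemma renv_morph_eq (A : algType K) (f h : {lrmorphism renv g -> A}) :
  (forall x, f (uiota x) = h (uiota x)) -> forall a, f a = h a.
Proof.
move=> e; elim/renv_ind=> [||a b ha hb|c a ha|a b ha hb|i x _] //.
- by rewrite !rmorph0.
- by rewrite !rmorph1.
- by rewrite !rmorphD /= ha hb.
- by rewrite !linearZ /= ha.
- by rewrite !rmorphM /= ha hb.
Qed.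

End RenvInd.

(** Finitely generated projectivity of A as a right B-module, with homogeneous data. Some [db_m] may
    be 0, so that the index type can consist of all words of bounded length. *)
Record dual_basis (K : fieldType) (B A : superalg K) (phi : {lrmorphism B -> A}) := DualBasis {
  db_idx : finType;
  db_m : db_idx -> A;
  db_par : db_idx -> bool;
  db_rho : db_idx -> A -> B;
  db_rhoD : forall j a b, db_rho j (a + b) = db_rho j a + db_rho j b;
  db_rhoM : forall j a b, db_rho j (a * phi b) = db_rho j a * b;
  db_sum : forall a, a = \sum_j db_m j * phi (db_rho j a);
  db_m_gr : forall j, sa_gr (db_par j) (db_m j);
  db_rho_gr : forall i j a, sa_gr i a -> sa_gr (i (+) db_par j) (db_rho j a)
}.

Arguments db_m {K B A phi} _ _.
Arguments db_par {K B A phi} _ _.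
Arguments db_rho {K B A phi} _ _ _.

(** * Coordinates of u(g) over a subalgebra *)

Section AdaptedDualBasis.
Variables (K : fieldType) (p : nat) (l g : restrictedLSA K p).
Variables (f : {linear l -> g}) (phi : {lrmorphism renv l -> renv g}).
Hypothesis phi_uiota : forall x, phi (uiota x) = uiota (f x).
Local Notation I := 'I_(\dim {:g}).
Variables (X : (\dim {:g}).-tuple g) (d : I -> bool) (D : pred I) (e : I -> l).
Hypothesis X_basis : basis_of {:g} X.
Hypothesis X_gr : forall i : I, X`_i \in gr g (d i).
Hypothesis D_up : forall i j : I, (i <= j)%N -> D i -> D j.
Hypothesis f_e : forall i, D i -> f (e i) = X`_i.
Hypothesis e_gr : forall i, D i -> e i \in gr l (d i).
Hypothesis e_span : forall j x, x \in gr l j ->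
  exists c : I -> K, x = \sum_(i | D i && (d i == j)) c i *: e i.

Local Notation B := (\sum_(i : I) cap (g := g) d i)%N.
Local Notation nm := (nrm (cap (g := g) d)).
Local Notation monX := (mon (tnth X)).
Local Notation mone := (mon e).

Lemma X_gr_tnth i : tnth X i \in gr g (d i).
Proof. by rewrite (tnth_nth 0); exact: X_gr. Qed.

Lemma X_span j x : x \in gr g j ->
  exists c : I -> K, x = \sum_(i | xpredT i && (d i == j)) c i *: tnth X i.
Proof.
move=> hx; exists (fun i => coord X i x).
rewrite {1}(coord_basis X_basis (memvf x)) (bigID (fun i => d i == j)) /=.
rewrite [X in _ + X]big1 ?addr0 => [|i di].
  by apply: eq_bigr => i _; rewrite (tnth_nth 0).
by rewrite (coord_gr_eq0 X_basis X_gr hx di) scale0r.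
Qed.

Lemma phi_mon t : all D t -> phi (mone t) = monX t.
Proof.
elim: t => [|i t IH] /=; first by rewrite /mon !big_nil rmorph1.
move=> /andP[Di ht]; have := IH ht; rewrite /mon !big_cons rmorphM /= phi_uiota f_e // => ->.
by rewrite (tnth_nth 0).
Qed.

(** The letters in D come last, so a normal word is an outer word followed by an inner one. Outer
    monomials therefore form a basis of u(g) as a right module over u(l). *)
Definition outer (c : seq I) := nm c && all (predC D) c.
Definition inner (t : seq I) := nm t && all D t.

Lemma outer_inner_nm c t : outer c -> inner t -> nm (c ++ t).
Proof.
move=> /andP[nc hc] /andP[nt ht]; apply: (@nrm_cat _ _ (predC D)) => //.
  by move=> i j ij; apply: contra; exact: D_up.
by apply: sub_all ht => i Di /=; rewrite Di.
Qed.

Lemma cat_outer_inner c c' t t' : all (predC D) c -> all (predC D) c' ->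
  all D t -> all D t' -> (c ++ t == c' ++ t') = (c == c') && (t == t').
Proof.
move=> hc hc' ht ht'; apply/eqP/andP => [h|[/eqP-> /eqP->]//].
have fl s s' : all (predC D) s -> all D s' -> filter D (s ++ s') = s'.
  move=> hs hs'; rewrite filter_cat (all_filterP hs') (_ : filter D s = [::]) //.
  by apply/eqP; rewrite -[_ == _]negbK -has_filter -all_predC.
have fr s s' : all (predC D) s -> all D s' -> filter (predC D) (s ++ s') = s.
  move=> hs hs'; rewrite filter_cat (all_filterP hs) (_ : filter (predC D) s' = [::]) ?cats0 //.
  apply/eqP; rewrite -[_ == _]negbK -has_filter -all_predC.
  by apply: sub_all hs' => i /=; rewrite negbK.
split; apply/eqP.
  by rewrite -(fr c t) // h fr.
by rewrite -(fl c t) // h fl.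
Qed.

Lemma nm_split w : nm w -> exists c t, [/\ w = c ++ t, outer c & inner t].
Proof.
move=> hw; exists (filter (predC D) w), (filter D w); split.
- have <- : filter (predC (predC D)) w = filter D w.
    by apply: eq_filter => i /=; rewrite negbK.
  apply: sorted_split; last by case/andP: hw.
  by move=> i j ij; apply: contra; exact: D_up.
- by rewrite /outer nrm_filter // filter_all.
- by rewrite /inner nrm_filter // filter_all.
Qed.

Lemma nm_bseq w : nm w -> exists t : B.-bseq I, w = t.
Proof. by move=> hw; exists (Bseq (nrm_size hw)). Qed.

(** With the indicator of c ++ t as prescribed values, [pbw_form] is the coefficient of that normal
    word. Collecting all inner t gives the coefficient of c in u(l). *)
Definition rho (c : B.-bseq I) (a : renv g) : renv l :=
  if outer c then \sum_(t : B.-bseq I | inner t)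
     (pbw_form X d (fun w => (w == c ++ t)%:R) a : K) *: mone t
  else 0.

Lemma rhoD c a b : rho c (a + b) = rho c a + rho c b.
Proof.
rewrite /rho; case: ifP => _; last by rewrite addr0.
by rewrite -big_split; apply: eq_bigr => t _; rewrite linearD scalerDl.
Qed.

Lemma rhoZ c k a : rho c (k *: a) = k *: rho c a.
Proof.
rewrite /rho; case: ifP => _; last by rewrite scaler0.
by rewrite scaler_sumr; apply: eq_bigr => t _; rewrite linearZ scalerA.
Qed.

Lemma rho0 c : rho c 0 = 0.
Proof. by rewrite -[0 in LHS](scale0r 0) rhoZ scale0r. Qed.

Lemma renv_l_span b : lspan (fun a => exists2 t, inner t & a = mone t) b.
Proof.
have [b0 [b1 [h0 h1 ->]]] := renv_gr_sum b.
have sub j a : normal_mon D d e j a -> lspan (fun a => exists2 t, inner t & a = mone t) a.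
  by case=> t [h1' h2 _ ->]; apply: lspan_in; exists t => //; rewrite /inner h1'.
apply: lspan_add; first exact: (lspan_sub (sub false) (renv_span e_gr e_span h0)).
exact: (lspan_sub (sub true) (renv_span e_gr e_span h1)).
Qed.

Let phiP (k : K) a b : phi (k *: a + b) = k *: phi a + phi b.
Proof. by rewrite linearP. Qed.

Lemma rho_mon (c : B.-bseq I) c' b : outer c -> outer c' ->
  rho c (monX c' * phi b) = if c' == c :> seq I then b else 0.
Proof.
move=> oc oc'; elim: (renv_l_span b) => [|k s x [t' it' ->] _ IH].
  by rewrite rmorph0 mulr0 rho0 if_same.
rewrite phiP mulrDr -scalerAr rhoD rhoZ {}IH.
suff -> : rho c (monX c' * phi (mone t')) = if c' == c :> seq I then mone t' else 0.
  by case: ifP => _ //; rewrite scaler0 addr0.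
have /andP[nt' Dt'] := it'; have /andP[nc' Dc'] := oc'; have /andP[nc Dc] := oc.
rewrite phi_mon // -mon_cat /rho oc.
have -> : \sum_(t : B.-bseq I | inner t) (pbw_form X d (fun w => (w == c ++ t)%:R)
    (monX (c' ++ t')) : K) *: mone t =
    \sum_(t : B.-bseq I | inner t) ((c' == c :> seq I) && (t' == t :> seq I))%:R *: mone t.
  apply: eq_bigr => t /andP[_ Dt].
  by rewrite (pbw_form_mon X_basis X_gr) ?outer_inner_nm // cat_outer_inner.
have [t0 et0] := nm_bseq nt'.
case: eqP => _ /=; last by rewrite big1 // => t _; rewrite scale0r.
rewrite (bigD1 t0) /=; last by rewrite -et0.
rewrite et0 eqxx scale1r [X in _ + X]big1 ?addr0 // => t /andP[_ tt0].
by rewrite eq_sym val_eqE (negPf tt0) scale0r.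
Qed.

Lemma renv_g_span j a : renv_gr j a ->
  lspan (fun a => exists c b, [/\ outer c, renv_gr (j (+) parity d c) b & a = monX c * phi b]) a.
Proof.
move=> ha; have := @renv_span _ _ g g xpredT d (tnth X) (fun i _ => X_gr_tnth i) X_span j a ha.
apply: lspan_sub => s [w [nw _ pw ->]]; have [c [t [ew oc it]]] := nm_split nw.
  apply: lspan_in; exists c, (mone t); split=> //; last by rewrite ew mon_cat phi_mon //; case/andP: it.
  have -> : j (+) parity d c = parity d t.
    by rewrite -pw ew parity_cat addbC addbA addbb addFb.
  case/andP: it => _; elim: t {ew} => [_|i t IH] /=.
    by rewrite /mon big_nil; exact: renv_gr1.
  move=> /andP[Di /IH ht]; rewrite /mon big_cons; apply: renv_grM ht.
  by apply: renv_gr_uiota; exact: e_gr.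
Qed.

Lemma renv_g_span_all a :
  lspan (fun a => exists c b, outer c /\ a = monX c * phi b) a.
Proof.
have [a0 [a1 [h0 h1 ->]]] := renv_gr_sum a.
by apply: lspan_add; [move: (renv_g_span h0)|move: (renv_g_span h1)];
  apply: lspan_sub => s [c [b [oc _ ->]]]; apply: lspan_in; exists c, b.
Qed.

Lemma outer_bseq c : outer c -> exists t : B.-bseq I, c = t.
Proof. by case/andP=> /nm_bseq. Qed.

Lemma rho_mulr c a b : rho c (a * phi b) = rho c a * b.
Proof.
have [oc|oc] := boolP (outer c); last by rewrite /rho (negPf oc) mul0r.
elim: (renv_g_span_all a) => [|k s x [c' [b' [oc' ->]]] _ IH].
  by rewrite mul0r rho0 mul0r.
rewrite mulrDl -scalerAl !rhoD !rhoZ IH mulrDl -scalerAl -mulrA -rmorphM !rho_mon //.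
by case: ifP; rewrite ?mul0r.
Qed.

Definition outer_mon (c : B.-bseq I) : renv g := if outer c then monX c else 0.

Lemma rho_sum a : a = \sum_c outer_mon c * phi (rho c a).
Proof.
elim: (renv_g_span_all a) => [|k s x [c' [b' [oc' ->]]] _ IH].
  by rewrite big1 // => c _; rewrite rho0 rmorph0 mulr0.
have -> : \sum_c outer_mon c * phi (rho c (k *: (monX c' * phi b') + x)) =
   k *: \sum_c outer_mon c * phi (rho c (monX c' * phi b')) + \sum_c outer_mon c * phi (rho c x).
  rewrite scaler_sumr -big_split; apply: eq_bigr => c _.
  by rewrite rhoD rhoZ phiP mulrDr scalerAr.
rewrite -IH; congr (k *: _ + _).
have [c0 ec0] := outer_bseq oc'.
rewrite (bigD1 c0) //= [X in _ + X]big1 => [|c hc].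
  by rewrite /outer_mon -ec0 oc' rho_mon -?ec0 // eqxx addr0.
rewrite /outer_mon; case: ifP => oc; last by rewrite mul0r.
by rewrite rho_mon // ec0 eq_sym val_eqE (negPf hc) rmorph0 mulr0.
Qed.

Lemma mon_gr w : renv_gr (parity d w) (monX w).
Proof.
elim: w => [|i w IH] /=; first by rewrite /mon big_nil; exact: renv_gr1.
by rewrite /mon big_cons; apply: renv_grM IH; apply: renv_gr_uiota; exact: X_gr_tnth.
Qed.

Lemma outer_mon_gr (c : B.-bseq I) : renv_gr (parity d c) (outer_mon c).
Proof. by rewrite /outer_mon; case: ifP => _; [exact: mon_gr|exact: renv_gr0]. Qed.

Lemma rho_gr j (c : B.-bseq I) a : renv_gr j a -> renv_gr (j (+) parity d c) (rho c a).
Proof.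
move=> ha; have [oc|oc] := boolP (outer c); last first.
  by rewrite /rho (negPf oc); exact: renv_gr0.
elim: (renv_g_span ha) => [|k s x [c' [b' [oc' hb ->]]] _ IH].
  by rewrite rho0; exact: renv_gr0.
rewrite rhoD rhoZ; apply: renv_grD => //; apply: renv_grZ.
rewrite rho_mon //; case: eqP => [e'|_]; last exact: renv_gr0.
by rewrite -e'.
Qed.

Definition adapted_dual_basis : @dual_basis K (usuper l) (usuper g) phi :=
  @DualBasis K (usuper l) (usuper g) phi (B.-bseq I) outer_mon (fun c => parity d c) rho
    rhoD rho_mulr rho_sum outer_mon_gr rho_gr.

Lemma outer_nil : outer [::].
Proof. by rewrite /outer /nrm /= andbT; apply/forallP => i; exact: leq_trans (cap_ge2 d i). Qed.

Lemma outer_seq1 i : ~~ D i -> outer [:: i].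
Proof.
move=> Di; rewrite /outer /nrm /= Di /= andbT; apply/forallP => j; rewrite addn0.
by apply: leq_trans (cap_ge2 d j); case: eqP.
Qed.

Lemma adapted_one : exists j, db_rho adapted_dual_basis j 1 = 1.
Proof.
have [c0 ec0] := outer_bseq outer_nil; exists c0 => /=.
have -> : (1 : renv g) = monX [::] * phi 1 by rewrite /mon big_nil rmorph1 mulr1.
by rewrite rho_mon -?ec0 ?outer_nil // eqxx.
Qed.

(** Such an x has a nonzero coordinate at a letter outside D, and this letter alone is an outer
    word. This is what makes x (x) v nonzero in an induced module. *)
Lemma adapted_out x : (forall y, f y <> x) ->
  exists j (k : K), k != 0 /\ db_rho adapted_dual_basis j (uiota x) = k%:A.
Proof.
move=> hx; have [i Di ci] : exists2 i, ~~ D i & coord X i x != 0.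
  apply: contrapT => h; apply: (hx (\sum_(i | D i) coord X i x *: e i)).
  rewrite [RHS](coord_basis X_basis (memvf x)) linear_sum [in RHS](bigID D) /=.
  rewrite [X in _ = _ + X]big1 ?addr0 => [|i Di].
    by apply: eq_bigr => i Di; rewrite linearZ /= f_e.
  have [->|ci] := eqVneq (coord X i x) 0; first by rewrite scale0r.
  by case: h; exists i.
have oi := outer_seq1 Di; have [c0 ec0] := outer_bseq oi.
exists c0, (coord X i x); split=> //=.
have r0 := rho0 c0; have rD := rhoD c0; have rZ := rhoZ c0.
rewrite {1}(coord_basis X_basis (memvf x)) linear_sum.
rewrite (big_morph (rho c0) rD r0) (bigD1 i) //= linearZ /= rZ.
have uX (k : I) : uiota X`_k = monX [:: k] * phi 1 :> renv g.
  by rewrite /mon big_seq1 rmorph1 mulr1 (tnth_nth 0).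
rewrite uX rho_mon -?ec0 // eqxx [X in _ + X]big1 => [|k ki]; first by rewrite addr0.
rewrite linearZ /= rZ; have [Dk|Dk] := boolP (D k).
  have -> : uiota X`_k = monX [::] * phi (uiota (e k)).
    by rewrite /mon big_nil mul1r phi_uiota f_e.
  by rewrite rho_mon -?ec0 ?outer_nil //= scaler0.
by rewrite uX rho_mon -?ec0 ?outer_seq1 // eqseq_cons (negPf ki) scaler0.
Qed.

End AdaptedDualBasis.

(** * A homogeneous basis of g extending one of l *)

Section Existence.
Variables (K : fieldType) (p : nat) (l g : restrictedLSA K p).
Variables (f : {linear l -> g}) (phi : {lrmorphism renv l -> renv g}).
Hypothesis phi_uiota : forall x, phi (uiota x) = uiota (f x).
Hypothesis f_inj : injective f.
Hypothesis f_gr : forall i x, x \in gr l i -> f x \in gr g i.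

Let F : 'Hom(l, g) := linfun f.
Let U (j : bool) : {vspace g} := (F @: gr l j)%VS.

Let U_sub j : (U j <= gr g j)%VS.
Proof. by apply/subvP => x /memv_imgP[y hy ->]; rewrite lfunE; exact: f_gr. Qed.

Let dim_U j : \dim (U j) = \dim (gr l j).
Proof.
rewrite /U limg_dim_eq //; apply/eqP; rewrite -subv0; apply/subvP => x.
rewrite memv_cap memv_ker lfunE => /andP[_ /eqP h].
by rewrite memv0 -(inj_eq f_inj) h linear0.
Qed.

(** An entry holds a basis vector of g, its parity, a flag telling whether it comes from l, and its
    preimage in l (0 if there is none). One list then yields X, d, D and e as projections, and
    listing the complements first puts the letters of l last. *)
Definition outer_entries (j : bool) : seq (g * (bool * (bool * l))) :=
  [seq (x, (j, (false, 0))) | x <- vbasis (gr g j :\: U j)%VS].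
Definition inner_entries (j : bool) : seq (g * (bool * (bool * l))) :=
  [seq (f y, (j, (true, y))) | y <- vbasis (gr l j)].
Definition entries := (outer_entries false ++ outer_entries true) ++
  (inner_entries false ++ inner_entries true).

Let dim_diff j : \dim (gr g j :\: U j)%VS = (\dim (gr g j) - \dim (gr l j))%N.
Proof. by rewrite -(dimv_cap_compl (gr g j) (U j)) (capv_idPr (U_sub j)) dim_U addKn. Qed.

Let dim_le j : (\dim (gr l j) <= \dim (gr g j))%N.
Proof. by rewrite -dim_U dimvS. Qed.

Lemma dim_gr (h : restrictedLSA K p) : (\dim (gr h false) + \dim (gr h true))%N = \dim {:h}.
Proof. by rewrite -(gr_sum (lsaP h)) dimv_disjoint_sum // (gr_cap (lsaP h)). Qed.

Lemma size_entries : size (map fst entries) = \dim {:g}.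
Proof.
rewrite size_map !size_cat !size_map !size_tuple !dim_diff -dim_gr.
by have := dim_le false; have := dim_le true; lia.
Qed.

Let X : (\dim {:g}).-tuple g := Tuple (introT eqP size_entries).
Local Notation I := 'I_(\dim {:g}).
Let s0 : g * (bool * (bool * l)) := (0, (false, (false, 0))).
Let ent (i : I) := nth s0 entries i.
Let d (i : I) := (ent i).2.1.
Let D : pred I := fun i => (ent i).2.2.1.
Let e (i : I) := (ent i).2.2.2.

Let size_ent : size entries = \dim {:g}.
Proof. by rewrite -size_entries size_map. Qed.

Let ent_in i : ent i \in entries.
Proof. by rewrite mem_nth // size_ent. Qed.

Let XE (i : I) : X`_i = (ent i).1.
Proof. by rewrite /X /= (nth_map s0) // size_ent. Qed.

Let entriesP s : s \in entries ->
  (exists j x, x \in vbasis (gr g j :\: U j)%VS /\ s = (x, (j, (false, 0)))) \/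
  (exists j y, y \in vbasis (gr l j) /\ s = (f y, (j, (true, y)))).
Proof.
rewrite !mem_cat -!orbA => /or4P[] /mapP[x hx ->]; [left|left|right|right].
- by exists false, x.
- by exists true, x.
- by exists false, x.
- by exists true, x.
Qed.

Let X_gr (i : I) : X`_i \in gr g (d i).
Proof.
rewrite XE /d; case: (entriesP (ent_in i)) => [[j [x [hx ->]]]|[j [y [hy ->]]]] /=.
  exact: (subvP (diffvSl _ _) _ (vbasis_mem hx)).
exact/f_gr/vbasis_mem.
Qed.

Let DE (i : I) : D i = (size (outer_entries false ++ outer_entries true) <= i)%N.
Proof.
have ho s : s \in outer_entries false ++ outer_entries true -> s.2.2.1 = false.
  by rewrite mem_cat => /orP[] /mapP[x _ ->].
have hi s : s \in inner_entries false ++ inner_entries true -> s.2.2.1 = true.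
  by rewrite mem_cat => /orP[] /mapP[x _ ->].
have := size_ent; rewrite /D /ent /entries; move: (_ ++ _) ho (_ ++ _) hi => s1 ho s2 hi.
rewrite size_cat nth_cat => hs; case: ltnP => h; first by rewrite ho // mem_nth.
by rewrite hi // mem_nth // ltn_subLR // hs.
Qed.

Let D_up (i j : I) : (i <= j)%N -> D i -> D j.
Proof. by rewrite !DE => ij h; exact: leq_trans h ij. Qed.

Let f_e (i : I) : D i -> f (e i) = X`_i.
Proof.
by rewrite XE /D /e; case: (entriesP (ent_in i)) => [[j [x [hx ->]]]|[j [y [hy ->]]]].
Qed.

Let e_gr (i : I) : D i -> e i \in gr l (d i).
Proof.
rewrite /D /e /d; case: (entriesP (ent_in i)) => [[j [x [hx ->]]]|[j [y [hy ->]]]] //= _.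
exact: vbasis_mem.
Qed.

Let ent_onto s : s \in entries -> exists i, ent i = s.
Proof.
move=> hs; have hi : (index s entries < \dim {:g})%N by rewrite -size_ent index_mem.
by exists (Ordinal hi); rewrite /ent /= nth_index.
Qed.

Let e_span j x : x \in gr l j ->
  exists c : I -> K, x = \sum_(i | D i && (d i == j)) c i *: e i.
Proof.
move=> hx; have : x \in (\sum_(i | D i && (d i == j)) <[e i]>)%VS.
  have : (gr l j <= \sum_(i | D i && (d i == j)) <[e i]>)%VS.
    rewrite -(span_basis (vbasisP (gr l j))); apply/span_subvP => y hy.
    have [i ei] : exists i, ent i = (f y, (j, (true, y))).
      apply: ent_onto; rewrite !mem_cat; case: (j) hy => hy.
        by rewrite [X in _ || (_ || X)](_ : _ = true) ?orbT //; apply/mapP; exists y.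
      by rewrite [X in _ || (X || _)](_ : _ = true) ?orbT //; apply/mapP; exists y.
    have := memv_line (e i); rewrite {1}/e ei /=; apply: (subvP _).
    by apply: (sumv_sup i) => //; rewrite /D /d ei /= eqxx.
  by move/subvP/(_ _ hx).
case/memv_sumP => v hv ->.
have hc i : exists c, D i && (d i == j) -> v i = c *: e i.
  have [hi|_] := boolP (D i && (d i == j)); last by exists 0.
  by have /vlineP[c ->] := hv i hi; exists c.
exists (fun i => projT1 (cid (hc i))); apply: eq_bigr => i hi.
exact: (projT2 (cid (hc i))).
Qed.

Let X_basis : basis_of {:g} X.
Proof.
rewrite basisEdim size_tuple leqnn andbT.
have hx s : s \in entries -> s.1 \in <<X>>%VS.
  by move=> hs; apply: memv_span; apply/mapP; exists s.
have gj j : (gr g j <= <<X>>)%VS.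
  rewrite -(addv_diff_cap (gr g j) (U j)) subv_add; apply/andP; split.
    rewrite -(span_basis (vbasisP (gr g j :\: U j)%VS)); apply/span_subvP => x hx'.
    apply: (hx (x, (j, (false, 0)))); rewrite !mem_cat.
    case: (j) hx' => hx'.
      by rewrite [X in _ || X || _](_ : _ = true) ?orbT //; apply/mapP; exists x.
    by rewrite [X in X || _ || _](_ : _ = true) ?orbT //; apply/mapP; exists x.
  apply: subv_trans (capvSr _ _) _; rewrite /U -(span_basis (vbasisP (gr l j))) limg_span.
  apply/span_subvP => _ /mapP[y hy ->]; rewrite lfunE.
  apply: (hx (f y, (j, (true, y)))); rewrite !mem_cat; case: (j) hy => hy.
    by rewrite [X in _ || (_ || X)](_ : _ = true) ?orbT //; apply/mapP; exists y.
  by rewrite [X in _ || (X || _)](_ : _ = true) ?orbT //; apply/mapP; exists y.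
have : (gr g false + gr g true <= <<X>>)%VS by rewrite subv_add !gj.
by rewrite (gr_sum (lsaP g)).
Qed.

Lemma renv_dual_basis : exists Db : @dual_basis K (usuper l) (usuper g) phi,
  (exists j, db_rho Db j 1 = 1) /\
  forall x, (forall y, f y <> x) ->
    exists j (k : K), k != 0 /\ db_rho Db j (uiota x) = k%:A.
Proof.
exists (adapted_dual_basis phi_uiota X_basis X_gr D_up f_e e_gr e_span); split.
  exact: adapted_one.
exact: adapted_out.
Qed.

(** The coordinates of x are read off by [pbw_form] at the one-letter words, which are normal as
    [cap] is at least 2. *)
Lemma uiota_injective : injective (@uiota K p g).
Proof.
suff h x : uiota x = 0 :> renv g -> x = 0.
  by move=> x y e0; apply/eqP; rewrite -subr_eq0; apply/eqP/h; rewrite linearB /= e0 subrr.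
move=> hx; rewrite (coord_basis X_basis (memvf x)) big1 // => i _.
suff -> : coord X i x = 0 by rewrite scale0r.
pose tau (w : seq I) : K := (w == [:: i])%:R.
have <- : pbw_form X d tau (uiota x) = coord X i x.
  rewrite {1}(coord_basis X_basis (memvf x)) !linear_sum (bigD1 i) //=.
  have pX (k : I) : pbw_form X d tau (uiota X`_k) = tau [:: k].
    have := @pbw_form_mon K p g X d X_basis X_gr tau [:: k].
    rewrite /mon big_seq1 (tnth_nth 0) => -> //.
    rewrite /nrm /=; apply/forallP => j; rewrite addn0.
    by apply: leq_trans (cap_ge2 d j); case: eqP.
  rewrite linearZ /= linearZ /= pX /tau eqxx big1 => [|k ki]; first by rewrite addr0 /GRing.scale /= mulr1.
  by rewrite linearZ /= linearZ /= pX /tau eqseq_cons (negPf ki) scaler0.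
by rewrite hx linear0.
Qed.

Lemma renv_fin_span : exists (J : finType) (v : J -> renv g),
  forall a, exists c : J -> K, a = \sum_j c j *: v j.
Proof.
exists ((\sum_(i : I) cap (g := g) d i)%N.-bseq I), (fun w => mon (tnth X) (bseqval w)) => a.
have [a0 [a1 [h0 h1 ->]]] := renv_gr_sum a.
have xs j b : renv_gr j b -> exists c : (\sum_(i : I) cap (g := g) d i)%N.-bseq I -> K,
    b = \sum_j c j *: mon (tnth X) j.
  move=> hb; have := @renv_span _ _ g g xpredT d (tnth X) (fun i _ => X_gr_tnth X_gr i)
    (X_span X_basis X_gr) j b hb.
  elim=> [|k s x [w [nw _ _ ->]] _ [c ->]].
    by exists (fun _ => 0); rewrite big1 // => i _; rewrite scale0r.
  have [w0 ew] := nm_bseq nw.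
  exists (fun i => (if i == w0 then k else 0) + c i).
  under [RHS]eq_bigr do rewrite scalerDl.
  rewrite big_split /=; congr (_ + _).
  rewrite (bigD1 w0) //= eqxx [X in _ + X]big1 ?addr0 ?ew // => i /negPf ->.
  by rewrite scale0r.
have [c0 ->] := xs _ _ h0; have [c1 ->] := xs _ _ h1.
exists (fun j => c0 j + c1 j); rewrite -big_split; apply: eq_bigr => i _.
by rewrite scalerDl.
Qed.

End Existence.

(** * Subquotients and composition factors *)

Section Subquotients.
Variables (K : fieldType) (A : superalg K).
Implicit Types (M N S : gmodule A).

(* An isomorphism from a section P / Q of M onto S, of parity e, is encoded by *)
(* its graph G in M x S, so that composing and inducing need no quotients.     *)
Record correspondence M S (G : M -> S -> Prop) (e : bool) : Prop := {
  corr0 : G 0 0;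
  corrB : forall x y s t, G x s -> G y t -> G (x - y) (s - t);
  corrZ : forall (a : A) x s, G x s -> G (a *: x) (a *: s);
  corr_gr : forall x s, G x s -> exists x0 x1 s0 s1,
    [/\ G x0 s0, G x1 s1, gm_gr false x0 /\ gm_gr true x1,
        gm_gr e s0 /\ gm_gr (~~ e) s1 & x = x0 + x1 /\ s = s0 + s1]
}.

(** G is defined on a submodule of M, onto S and single-valued: a homomorphism from that submodule
    onto S, possibly with a shift of parity. *)
Definition subquo S M : Prop := exists (G : M -> S -> Prop) (e : bool),
  [/\ correspondence G e, forall s, exists x, G x s & forall s, G 0 s -> s = 0].

Lemma corrD M S (G : M -> S -> Prop) e : correspondence G e ->
  forall x y s t, G x s -> G y t -> G (x + y) (s + t).
Proof.
move=> h x y s t hx hy; rewrite -[y]opprK -[t]opprK; apply: (corrB h) => //.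
by rewrite -[- y]sub0r -[- t]sub0r; apply: (corrB h) => //; exact: corr0 h.
Qed.

Lemma ss_D M (P : M -> Prop) x y : is_subsupermodule P -> P x -> P y -> P (x + y).
Proof.
move=> h hx hy; rewrite -[y]opprK; apply: (ss_B h) => //.
by rewrite -sub0r; apply: (ss_B h) => //; exact: ss_0 h.
Qed.

Lemma gm_grD M i (x y : M) : is_supermodule M -> gm_gr i x -> gm_gr i y -> gm_gr i (x + y).
Proof.
move=> h hx hy; rewrite -[y]opprK; apply: (gm_grB h) => //.
by rewrite -sub0r; apply: (gm_grB h) => //; exact: (gm_gr0 h).
Qed.

Lemma gm_cap2 M i (x : M) : is_supermodule M -> gm_gr i x -> gm_gr (~~ i) x -> x = 0.
Proof. by move=> h; case: i => /= a b; exact: (gm_cap h). Qed.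

Lemma gm_decomp_uniq M i (x y x' y' : M) : is_supermodule M ->
  gm_gr i x -> gm_gr i x' -> gm_gr (~~ i) y -> gm_gr (~~ i) y' -> x + y = x' + y' ->
  x = x' /\ y = y'.
Proof.
move=> h hx hx' hy hy' e.
have e1 : x - x' = y' - y.
  have -> : x = x' + y' - y by rewrite -e addrK.
  by rewrite addrAC [x' + _]addrC addrK.
have z : x - x' = 0.
  apply: (gm_cap2 h); first exact: (gm_grB h hx hx').
  by rewrite e1; exact: (gm_grB h).
split; apply/eqP; rewrite -subr_eq0; first by rewrite z.
by rewrite -oppr_eq0 opprB -e1 z.
Qed.

Lemma gm_sum_par M e (x : M) : is_supermodule M ->
  exists x0 x1, [/\ gm_gr e x0, gm_gr (~~ e) x1 & x = x0 + x1].
Proof.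
move=> h; have [x0 [x1 [h0 h1 ex]]] := gm_sum h x.
by case: e; [exists x1, x0; rewrite addrC|exists x0, x1].
Qed.

Lemma subquo_refl M : is_supermodule M -> subquo M M.
Proof.
move=> h; exists (fun x s => x = s), false; split=> [|s|s ->//]; last by exists s.
split=> [//|x y s t -> ->//|a x s -> //|x s <-].
have [x0 [x1 [h0 h1 ->]]] := gm_sum h x.
by exists x0, x1, x0, x1.
Qed.

(** Relations compose and parities add. The two relations decompose the middle element separately;
    uniqueness of homogeneous components in N makes these decompositions agree. *)
Lemma subquo_trans N S M : is_supermodule N -> subquo S N -> subquo N M -> subquo S M.
Proof.
move=> hN [G [e [hG sG fG]]] [H [e' [hH sH fH]]].
exists (fun x s => exists2 y, H x y & G y s), (e' (+) e); split; last first.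
- by move=> s [y /fH -> /fG].
- by move=> s; have [y hy] := sG s; have [x hx] := sH y; exists x, y.
split.
- by exists 0; [exact: corr0 hH|exact: corr0 hG].
- move=> x y s t [z hz1 hz2] [w hw1 hw2].
  by exists (z - w); [exact: (corrB hH)|exact: (corrB hG)].
- by move=> a x s [z h1 h2]; exists (a *: z); [exact: (corrZ hH)|exact: (corrZ hG)].
move=> x s [y hxy hys].
have [x0 [x1 [y0 [y1 [Hx0 Hx1 [gx0 gx1] [gy0 gy1] [ex ey]]]]]] := corr_gr hH hxy.
have [z0 [z1 [s0 [s1 [Hz0 Hz1 [gz0 gz1] [gs0 gs1] [ez es]]]]]] := corr_gr hG hys.
case: e' hH gy0 gy1 => hH gy0 gy1; rewrite /= in gy0 gy1 *.
  have [ey0 ey1] : y0 = z1 /\ y1 = z0.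
    by apply: (gm_decomp_uniq (i := true) hN) => //; rewrite -ey ez addrC.
  exists x0, x1, s1, s0; split=> //; try by split=> //; rewrite addrC.
  - by exists y0 => //; rewrite ey0.
  - by exists y1 => //; rewrite ey1.
  by split=> //; rewrite negbK.
have [ey0 ey1] : y0 = z0 /\ y1 = z1.
  by apply: (gm_decomp_uniq (i := false) hN) => //; rewrite -ey ez.
exists x0, x1, s0, s1; split=> //.
  by exists y0 => //; rewrite ey0.
by exists y1 => //; rewrite ey1.
Qed.

Lemma iso_par_subquo M N : is_supermodule M -> is_supermodule N -> iso_par M N ->
  subquo M N /\ subquo N M.
Proof.
move=> hM hN [f [e [[f' fK f'K] fgr]]].
have fg i x : gm_gr i x -> gm_gr (e (+) i) (f x) by rewrite addbC; exact: fgr.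
have dec x : exists x0 x1, [/\ gm_gr false x0, gm_gr true x1, x = x0 + x1,
    gm_gr e (f x0) & gm_gr (~~ e) (f x1)].
  have [x0 [x1 [h0 h1 ex]]] := gm_sum hM x; exists x0, x1; split=> //.
    by rewrite -[e]addbF; exact: fg.
  by rewrite -addbT; exact: fg.
split.
  exists (fun n m => n = f m), e; split; last first.
  - by move=> s h; apply: (can_inj fK); rewrite linear0 h.
  - by move=> s; exists (f s).
  split=> [|x y s t -> ->|a x s ->|x s ->].
  - by rewrite linear0.
  - by rewrite linearB.
  - by rewrite linearZ.
  have [x0 [x1 [h0 h1 ex k0 k1]]] := dec s.
  case: (e) k0 k1 => k0 k1.
    by exists (f x1), (f x0), x1, x0; rewrite ex linearD; split=> //; split=> //; rewrite addrC.
  by exists (f x0), (f x1), x0, x1; rewrite ex linearD.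
exists (fun m n => n = f m), e; split; last first.
- by move=> s ->; rewrite linear0.
- by move=> s; exists (f' s).
split=> [|x y s t -> ->|a x s ->|x s ->].
- by rewrite linear0.
- by rewrite linearB.
- by rewrite linearZ.
have [x0 [x1 [h0 h1 ex k0 k1]]] := dec x.
by exists x0, x1, (f x0), (f x1); rewrite ex linearD.
Qed.

Lemma submod_gen_sub M (Q : M -> Prop) x : is_subsupermodule Q -> submod_gen Q x -> Q x.
Proof.
move=> h; elim=> {x} [x //||x y _ hx _ hy|a x _ hx].
- exact: ss_0 h.
- exact: (ss_B h).
- exact: (ss_Z h).
Qed.

Lemma mquo_eqP M (Q : M -> Prop) x y : is_subsupermodule Q ->
  mquo Q x = mquo Q y <-> Q (x - y).
Proof.
by move=> h; split=> [/mquo_eq/(submod_gen_sub h)//|hq]; apply/mquo_eq; exact: sg_in.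
Qed.

Lemma mquo_eq0P M (Q : M -> Prop) x : is_subsupermodule Q -> mquo Q x = 0 <-> Q x.
Proof. by move=> h; rewrite -(raddf0 (mquo Q)) mquo_eqP // subr0. Qed.

Definition subquot_corr S M (P Q : M -> Prop) (f : S -> quot_mod Q) : M -> S -> Prop :=
  fun x s => P x /\ f s = mquo Q x.

Lemma subquot_correspondence S M P Q (f : {linear S -> quot_mod Q}) e :
  is_supermodule S -> is_supermodule M ->
  is_subsupermodule P -> is_subsupermodule Q -> (forall x, Q x -> P x) ->
  (forall i s, gm_gr i s -> exists x, [/\ P x, gm_gr (i (+) e) x & f s = mquo Q x]) ->
  @correspondence M S (@subquot_corr S M P Q f) e.
Proof.
move=> hS hM hP hQ QP hf; split.
- by split; [exact: ss_0 hP|rewrite !linear0].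
- by move=> x y s t [px fx] [py fy]; split; [exact: (ss_B hP)|rewrite !linearB fx fy].
- by move=> a x s [px fx]; split; [exact: (ss_Z hP)|rewrite !linearZ /= fx].
move=> x s [px fx].
have [s0 [s1 [g0 g1 es]]] := gm_sum_par e s hS.
have [y0 [py0 gy0 fy0]] := hf _ _ g0; have [y1 [py1 gy1 fy1]] := hf _ _ g1.
rewrite addbb in gy0; rewrite addNb addbb /= in gy1.
have hq : Q (x - (y0 + y1)).
  by apply/(mquo_eqP _ _ hQ); rewrite -fx es !linearD fy0 fy1.
have [q0 [q1 [Q0 Q1 gq0 gq1 eq]]] := ss_gr hQ hq.
exists (y0 + q0), (y1 + q1), s0, s1; split=> //.
- split; first exact: (ss_D hP py0 (QP _ Q0)).
  by rewrite linearD fy0 /= (_ : mquo Q q0 = 0) ?addr0 //; apply/(mquo_eq0P _ hQ).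
- split; first exact: (ss_D hP py1 (QP _ Q1)).
  by rewrite linearD fy1 /= (_ : mquo Q q1 = 0) ?addr0 //; apply/(mquo_eq0P _ hQ).
- by split; exact: (gm_grD hM).
by split=> //; rewrite addrACA -eq addrCA subrr addr0.
Qed.

Lemma subquot_corr_ker S M P Q (f : {linear S -> quot_mod Q}) x : injective f ->
  is_subsupermodule Q -> (forall x, Q x -> P x) ->
  (@subquot_corr S M P Q f) x 0 <-> Q x.
Proof.
move=> fi hQ QP; rewrite /subquot_corr linear0; split=> [[_ /esym /(mquo_eq0P _ hQ)]//|hx].
by split; [exact: QP|apply/esym/(mquo_eq0P _ hQ)].
Qed.

Lemma subquot_corr_fun S M P Q (f : {linear S -> quot_mod Q}) s : injective f ->
  (@subquot_corr S M P Q f) 0 s -> s = 0.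
Proof. by move=> fi [_ h]; apply: fi; rewrite h !linear0. Qed.

End Subquotients.

(** * Sections P / Q as modules *)

Section SubquotientModule.
Variables (K : fieldType) (A : superalg K) (M : gmodule A) (P Q : M -> Prop).

(** [submod_gen P] in place of P makes this a submodule for every predicate P, so that the module
    structure exists before any hypothesis on P. *)
Definition sqm_pred : {pred quot_mod Q} :=
  fun q => `[< exists2 x, submod_gen P x & q = mquo Q x >].

Fact sqm_submod : submod_closed sqm_pred.
Proof.
split; first by apply/asboolP; exists 0; [exact: sg_0|rewrite linear0].
move=> a u v /asboolP[x hx ->] /asboolP[y hy ->]; apply/asboolP.
exists (a *: x + y); last by rewrite linearP.
rewrite -[y]opprK -[- y]sub0r; apply: sg_B; first exact: sg_Z.
by apply: sg_B => //; exact: sg_0.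
Qed.
HB.instance Definition _ := GRing.isSubmodClosed.Build A (quot_mod Q) sqm_pred
  (GRing.submod_closed_semi sqm_submod).

Record sqm_type := SqmType { sqm_val : quot_mod Q; _ : sqm_val \in sqm_pred }.
HB.instance Definition _ := [isSub for sqm_val].
HB.instance Definition _ := [Choice of sqm_type by <:].
HB.instance Definition _ := [SubChoice_isSubLmodule of sqm_type by <:].

Lemma sqm_valB (s t : sqm_type) : val (s - t) = val s - val t. Proof. exact: raddfB. Qed.
Lemma sqm_valD (s t : sqm_type) : val (s + t) = val s + val t. Proof. exact: raddfD. Qed.
Lemma sqm_valZ a (s : sqm_type) : val (a *: s) = a *: val s. Proof. exact: linearZ. Qed.
Lemma sqm_val0 : val (0 : sqm_type) = 0. Proof. exact: raddf0. Qed.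

Definition sqm_gr (i : bool) (s : sqm_type) : Prop :=
  exists x, [/\ P x, gm_gr i x & val s = mquo Q x].

Definition sqm : gmodule A := Gmodule sqm_gr.

Hypotheses (hM : is_supermodule M) (hP : is_subsupermodule P) (hQ : is_subsupermodule Q).
Hypothesis QP : forall x, Q x -> P x.

Lemma sqm_elt x : P x -> exists s : sqm, val (s : sqm_type) = mquo Q x.
Proof.
move=> px; have h : mquo Q x \in sqm_pred by apply/asboolP; exists x => //; exact: sg_in.
by exists (SqmType h).
Qed.

Lemma sqmP (s : sqm) : exists2 x, P x & val (s : sqm_type) = mquo Q x.
Proof.
case: s => q h /=; have /asboolP[x hx ->] := h.
by exists x => //; exact: (submod_gen_sub hP).
Qed.

Lemma sqm_supermodule : is_supermodule sqm.
Proof.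
split.
- by move=> i; exists 0; split; [exact: ss_0 hP|exact: (gm_gr0 hM)|rewrite !linear0].
- move=> i s t [x [px gx ex]] [y [py gy ey]]; exists (x - y).
  by split; [exact: (ss_B hP)|exact: (gm_grB hM)|rewrite sqm_valB linearB ex ey].
- move=> s; have [x px ex] := sqmP s.
  have [x0 [x1 [p0 p1 g0 g1 exx]]] := ss_gr hP px.
  have [s0 e0] := sqm_elt p0; have [s1 e1] := sqm_elt p1.
  exists s0, s1; split; [by exists x0|by exists x1|].
  by apply: val_inj; rewrite sqm_valD ex exx linearD e0 e1.
- move=> s [x [px gx ex]] [y [py gy ey]]; apply: val_inj; rewrite sqm_val0 ex.
  apply/(mquo_eq0P _ hQ).
  have : Q (x - y) by apply/(mquo_eqP _ _ hQ); rewrite -ex -ey.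
  move=> hxy; have [z0 [z1 [q0 q1 g0 g1 ez]]] := ss_gr hQ hxy.
  have gy' : gm_gr (~~ false) (- y).
    by rewrite -sub0r; apply: (gm_grB hM) => //; exact: (gm_gr0 hM).
  by have [-> _] := gm_decomp_uniq (i := false) hM gx g0 gy' g1 ez.
- move=> i j a s ha [x [px gx ex]]; exists (a *: x).
  by split; [exact: (ss_Z hP)|exact: (gm_act hM)|rewrite sqm_valZ ex linearZ].
Qed.

Definition sqm_incl : sqm -> quot_mod Q := fun s => val (s : sqm_type).
Fact sqm_incl_linear : linear sqm_incl.
Proof. by move=> a x y; rewrite /sqm_incl sqm_valD sqm_valZ. Qed.
HB.instance Definition _ := GRing.isLinear.Build A sqm (quot_mod Q) *:%R sqm_incl sqm_incl_linear.

Lemma sqm_iso_subquot : iso_subquot sqm P Q.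
Proof.
exists sqm_incl, false; split.
- by move=> s t h; exact: val_inj.
- by move=> x px; have [s es] := sqm_elt px; exists s.
- by move=> i s [x [px gx ex]]; exists x; rewrite addbF.
Qed.

Lemma sqm_simple x0 : P x0 -> ~ Q x0 ->
  (forall R : M -> Prop, is_subsupermodule R -> (forall x, Q x -> R x) ->
     (forall x, R x -> P x) -> (forall x, R x -> Q x) \/ (forall x, P x -> R x)) ->
  simple sqm.
Proof.
move=> px0 qx0 hmax; split; first exact: sqm_supermodule.
  have [s es] := sqm_elt px0; exists s; apply/eqP => h; apply: qx0.
  by apply/(mquo_eq0P _ hQ); rewrite -es h sqm_val0.
move=> T hT.
pose R x := P x /\ exists2 s : sqm, T s & val (s : sqm_type) = mquo Q x.
have hR : is_subsupermodule R.
  split.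
  - by split; [exact: ss_0 hP|exists 0; [exact: ss_0 hT|rewrite sqm_val0 linear0]].
  - move=> x y [px [s ts es]] [py [t tt et]]; split; first exact: (ss_B hP).
    by exists (s - t); [exact: (ss_B hT)|rewrite sqm_valB linearB es et].
  - move=> a x [px [s ts es]]; split; first exact: (ss_Z hP).
    by exists (a *: s); [exact: (ss_Z hT)|rewrite sqm_valZ linearZ /= es].
  move=> x [px [s ts es]].
  have [s0 [s1 [t0 t1 [y0 [py0 gy0 ey0]] [y1 [py1 gy1 ey1]] ess]]] := ss_gr hT ts.
  have hq : Q (x - (y0 + y1)).
    by apply/(mquo_eqP _ _ hQ); rewrite -es ess sqm_valD linearD ey0 ey1.
  have [q0 [q1 [Q0 Q1 gq0 gq1 eq]]] := ss_gr hQ hq.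
  have z0 : mquo Q q0 = 0 by apply/(mquo_eq0P _ hQ).
  have z1 : mquo Q q1 = 0 by apply/(mquo_eq0P _ hQ).
  exists (y0 + q0), (y1 + q1); split.
  - split; first exact: (ss_D hP py0 (QP Q0)).
    by exists s0 => //; rewrite linearD /= ey0 z0 addr0.
  - split; first exact: (ss_D hP py1 (QP Q1)).
    by exists s1 => //; rewrite linearD /= ey1 z1 addr0.
  - exact: (gm_grD hM).
  - exact: (gm_grD hM).
  - by rewrite addrACA -eq addrCA subrr addr0.
case: (hmax R hR) => [x qx|x []//|h|h].
- split; first exact: QP.
  by exists 0; [exact: ss_0 hT|rewrite sqm_val0; apply/esym/(mquo_eq0P _ hQ)].
- left => s ts; have [x px ex] := sqmP s.
  apply: val_inj; rewrite sqm_val0 ex; apply/(mquo_eq0P _ hQ)/h.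
  by split=> //; exists s.
right => s; have [x px ex] := sqmP s; have [_ [t tt et]] := h x px.
by have -> : s = t by apply: val_inj; rewrite ex et.
Qed.

End SubquotientModule.

(** * A dimension function and composition series *)

Section Rank.
Variables (K : fieldType) (A : superalg K) (M : gmodule A) (n : nat) (v : 'I_n -> M).
Hypothesis v_span : forall x : M, exists c : 'I_n -> K, x = \sum_i ((c i)%:A : A) *: v i.
Implicit Types (P Q : M -> Prop).

Definition comb (c : 'rV[K]_n) : M := \sum_i ((c 0 i)%:A : A) *: v i.

Lemma comb_linear k c e : comb (k *: c + e) = (k%:A : A) *: comb c + comb e.
Proof.
rewrite /comb scaler_sumr -big_split; apply: eq_bigr => i _ /=.
by rewrite !mxE scalerDl scalerDl scalerA -scalerAl mul1r scalerA.
Qed.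

Lemma comb_onto x : exists c, x = comb c.
Proof.
have [c ->] := v_span x; exists (\row_i c i); apply: eq_bigr => i _.
by rewrite mxE.
Qed.

(** M comes only with n spanning vectors, so dimensions are measured in the coordinate space K^n, by
    subspaces whose combinations fall into P. The resulting [rk] is strictly increasing on
    submodules. *)
Definition rank_ge P (d : nat) : bool :=
  `[< exists U : {vspace 'rV[K]_n}, (forall c, c \in U -> P (comb c)) /\ \dim U = d >].

Definition rk P : nat := \max_(d < n.+1 | rank_ge P d) d.

Lemma rank_ge0 P : is_subsupermodule P -> rank_ge P 0.
Proof.
move=> hP; apply/asboolP; exists 0%VS; rewrite dimv0; split=> // c.
rewrite memv0 => /eqP ->; rewrite /comb big1; first exact: ss_0 hP.
by move=> i _; rewrite mxE scale0r scale0r.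
Qed.

Lemma rk_attained P : is_subsupermodule P -> exists U : {vspace 'rV[K]_n},
  (forall c, c \in U -> P (comb c)) /\ \dim U = rk P.
Proof.
move=> hP; have : (0 < #|[pred d : 'I_n.+1 | rank_ge P d]|)%N.
  by apply/card_gt0P; exists ord0; exact: rank_ge0.
case/(eq_bigmax_cond (fun d : 'I_n.+1 => d : nat)) => d hd e.
rewrite /rk e; exact: (asboolW hd).
Qed.

Lemma rk_max P (U : {vspace 'rV[K]_n}) : (forall c, c \in U -> P (comb c)) ->
  (\dim U <= rk P)%N.
Proof.
move=> hU; have hd : (\dim U < n.+1)%N.
  by rewrite ltnS (leq_trans (dimvS (subvf U))) // dimvf /dim /= mul1n.
by apply: (@leq_bigmax_cond _ (fun d : 'I_n.+1 => rank_ge P d) (fun d => d : nat) (Ordinal hd));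
  apply/asboolP; exists U.
Qed.

Lemma rk_lt P Q x : is_subsupermodule P -> is_subsupermodule Q ->
  (forall y, Q y -> P y) -> P x -> ~ Q x -> (rk Q < rk P)%N.
Proof.
move=> hP hQ QP px qx; have [U [hU <-]] := rk_attained hQ; have [c ec] := comb_onto x.
have cU : c \notin U by apply/negP => /hU; rewrite -ec.
have lt : (\dim U < \dim (U + <[c]>)%VS)%N.
  rewrite ltn_neqAle dimvS ?addvSl // andbT; apply/negP => /eqP e.
  have : (U == U + <[c]>)%VS by rewrite eqEdim addvSl e leqnn.
  by move=> /eqP e'; move: cU; rewrite e' (subvP (addvSr _ _)) // memv_line.
apply: leq_trans lt _; apply: rk_max => y /memv_addP[u hu [w /vlineP[k ->] ->]].
rewrite addrC comb_linear -ec; apply: (ss_D hP); first exact: (ss_Z hP).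
exact/QP/hU.
Qed.

Lemma rk_le P Q : (forall y, Q y -> P y) -> is_subsupermodule Q -> (rk Q <= rk P)%N.
Proof.
move=> QP hQ; have [U [hU <-]] := rk_attained hQ; apply: rk_max => c /hU; exact: QP.
Qed.
End Rank.

Section CompositionSeries.
Variables (K : fieldType) (A : superalg K) (M : gmodule A).
Hypotheses (hM : is_supermodule M) (fdM : finite_dim M).
Implicit Types (P Q R : M -> Prop).

Definition cstep Q (F : gmodule A) P : Prop :=
  [/\ is_subsupermodule Q, is_subsupermodule P, forall x, Q x -> P x, simple F & iso_subquot F P Q].

Fixpoint cpath Q (s : seq (gmodule A * (M -> Prop))) R : Prop :=
  if s is (F, P) :: s' then cstep Q F P /\ cpath P s' R else Q = R.

Lemma cpath_cat Q s R s' T : cpath Q s R -> cpath R s' T -> cpath Q (s ++ s') T.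
Proof.
by elim: s Q => [|[F P] s IH] Q /= => [->//|[h1 h2] h3]; split=> //; exact: IH h3.
Qed.

(** Induction on the difference of the ranks: a submodule of least rank among those between Q and P
    and larger than Q gives a simple section. *)
Lemma cpath_exists Q P : is_subsupermodule Q -> is_subsupermodule P ->
  (forall x, Q x -> P x) -> exists s, cpath Q s P.
Proof.
have [n [v hv]] := fdM => hQ hP QP.
have [m] := ubnP (rk v P - rk v Q); elim: m Q hQ QP => // m IH Q hQ QP hm.
have [[x px qx]|h] := pselect (exists2 x, P x & ~ Q x); last first.
  exists [::] => /=; apply/funext => x; apply/propext; split; first exact: QP.
  by move=> px; apply: contrapT => qx; apply: h; exists x.
pose good R := [/\ is_subsupermodule R, forall y, Q y -> R y, forall y, R y -> P y & exists2 y, R y & ~ Q y].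
have ex : exists k, `[< exists2 R, good R & rk v R = k >].
  by exists (rk v P); apply/asboolP; exists P => //; split=> //; exists x.
case: (ex_minnP ex) => k /asboolP[R [hR QR RP [y ry qy]] ek] kmin.
have hs : simple (sqm R Q).
  apply: (sqm_simple hM hR hQ QR ry qy) => R' hR' QR' R'R.
  have [[z rz qz]|h'] := pselect (exists2 z, R' z & ~ Q z); last first.
    by left => z rz; apply: contrapT => qz; apply: h'; exists z.
  right; apply: contrapT => h'.
  have [w rw rw'] : exists2 w, R w & ~ R' w.
    by apply: contrapT => hw; apply: h' => w rw; apply: contrapT => rw'; apply: hw; exists w.
  have := rk_lt hv hR hR' R'R rw rw'; rewrite ek ltnNge => /negP; apply.
  apply: kmin; apply/asboolP; exists R' => //; split=> //; last by exists z.
  by move=> u /R'R /RP.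
have [s hsR] : exists s, cpath R s P.
  apply: IH => //; have := rk_lt hv hR hQ QR ry qy; have := rk_le v RP hR.
  by move: hm; lia.
exists ((sqm R Q, R) :: s); split=> //; split=> //.
exact: sqm_iso_subquot.
Qed.

Lemma cpath_sub Q s P : cpath Q s P -> is_subsupermodule Q ->
  forall i, is_subsupermodule (nth Q (Q :: map snd s) i).
Proof.
elim: s Q => [|[F R] s IH] Q /= => [_ hQ [|[|i]] //|[[_ hR _ _ _] hp] hQ [|i]] //=.
have := IH R hp hR i; rewrite /=.
case: (ltnP i (size s).+1) => hi h; last by rewrite nth_default //= size_map.
by rewrite (set_nth_default R) //= size_map.
Qed.

Lemma cpath_last Q s P : cpath Q s P -> nth Q (Q :: map snd s) (size s) = P.
Proof.
elim: s Q => [|[F R] s IH] Q //= [_ hp]; rewrite -(IH R hp).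
by apply: set_nth_default; rewrite /= size_map.
Qed.

Lemma cpath_step Q s P i x0 : cpath Q s P -> (i < size s)%N ->
  cstep (nth Q (Q :: map snd s) i) (nth x0 s i).1 (nth Q (Q :: map snd s) i.+1).
Proof.
elim: s Q i => [|[F R] s IH] Q i //= [hst hp]; case: i => [|i] //= hi.
have := IH R i hp hi; rewrite /=.
rewrite (set_nth_default Q) /=; last by rewrite size_map ltnW.
by rewrite [nth R (map _ _) i](set_nth_default Q) // size_map.
Qed.

(** The domain P of the relation and its kernel Q lie between 0 and M. Refining the gaps below Q and
    above P leaves S itself as the factor P / Q of a composition series. *)
Lemma subquo_comp_factor (S : gmodule A) : simple S -> subquo S M -> comp_factor M S.
Proof.
move=> simS [G [e [cG sG fG]]].
have [hS _ _] := simS.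
pose P x := exists s, G x s.
pose Q x := G x 0.
have hP : is_subsupermodule P.
  split.
  - by exists 0; exact: corr0 cG.
  - by move=> x y [s hs] [t ht]; exists (s - t); exact: (corrB cG).
  - by move=> a x [s hs]; exists (a *: s); exact: (corrZ cG).
  move=> x [s hs]; have [x0 [x1 [s0 [s1 [h0 h1 [g0 g1] _ [ex _]]]]]] := corr_gr cG hs.
  by exists x0, x1; split=> //; [exists s0|exists s1].
have hQ : is_subsupermodule Q.
  split.
  - exact: corr0 cG.
  - by move=> x y hx hy; rewrite /Q -[0]subr0; exact: (corrB cG).
  - by move=> a x hx; rewrite /Q -[0](scaler0 _ a); exact: (corrZ cG).
  move=> x hs; have [x0 [x1 [s0 [s1 [h0 h1 [g0 g1] [k0 k1] [ex es]]]]]] := corr_gr cG hs.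
  have [e0 e1] : 0 = s0 /\ 0 = s1.
    by apply: (gm_decomp_uniq (i := e) hS) => //; rewrite ?addr0 //; exact: (gm_gr0 hS).
  by exists x0, x1; split=> //; [rewrite /Q e0|rewrite /Q e1].
have QP x : Q x -> P x by move=> hx; exists 0.
pose f s := mquo Q (projT1 (cid (sG s))).
have fE x s : G x s -> f s = mquo Q x.
  move=> h; apply/(mquo_eqP _ _ hQ); rewrite /Q -(subrr s).
  by apply: (corrB cG) => //; exact: (projT2 (cid (sG s))).
have f_lin : linear f.
  move=> a s t; have [x hx] := sG s; have [y hy] := sG t.
  rewrite (fE _ _ hx) (fE _ _ hy) -linearP; apply: fE.
  by apply: (corrD cG) => //; exact: (corrZ cG).
pose fL := GRing.isLinear.Build A S (quot_mod Q) *:%R f f_lin.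
pose F : {linear S -> quot_mod Q} := HB.pack f fL.
have hiso : iso_subquot S P Q.
  exists F, e; split.
  - move=> s t h; have [x hx] := sG s; have [y hy] := sG t.
    have hq : Q (x - y) by apply/(mquo_eqP _ _ hQ); rewrite -(fE _ _ hx) -(fE _ _ hy).
    have := corrB cG (corrB cG hx hy) hq; rewrite subrr subr0 => /fG /eqP.
    by rewrite subr_eq0 => /eqP.
  - by move=> x [s hs]; exists s; exact: fE.
  move=> i s gs; have [x hx] := sG s.
  have [x0 [x1 [s0 [s1 [h0 h1 [g0 g1] [k0 k1] [ex es]]]]]] := corr_gr cG hx.
  have [ie|ie] : i = e \/ i = ~~ e by case: (i) (e) => [] []; [left|right|right|left].
    have [e0 e1] : s = s0 /\ 0 = s1.
      by apply: (gm_decomp_uniq (i := e) hS) => //; rewrite ?addr0 -?ie //; exact: (gm_gr0 hS).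
    exists x0; rewrite ie addbb; split=> //; first by exists s0.
    by apply: fE; rewrite e0.
  have [e0 e1] : 0 = s0 /\ s = s1.
    by apply: (gm_decomp_uniq (i := e) hS) => //; rewrite ?add0r -?ie //; exact: (gm_gr0 hS).
  exists x1; rewrite ie addNb addbb; split=> //; first by exists s1.
  by apply: fE; rewrite e1.
pose Z0 (x : M) := x = 0; pose T0 (x : M) := True.
have hZ : is_subsupermodule Z0.
  split=> [//|x y -> ->|a x ->|x ->]; rewrite /Z0 ?subr0 ?scaler0 //.
  by exists 0, 0; split; rewrite ?addr0 //; exact: (gm_gr0 hM).
have hT : is_subsupermodule T0.
  by split=> // x _; have [x0 [x1 [g0 g1 ex]]] := gm_sum hM x; exists x0, x1.
have [s1 p1] := cpath_exists hZ hQ (fun x (h : Z0 x) => eq_ind_r Q (ss_0 hQ) h).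
have [s2 p2] := cpath_exists hP hT (fun x _ => I).
have pth : cpath Z0 (s1 ++ (S, P) :: s2) T0 by apply: (cpath_cat p1); split.
set s := s1 ++ _ in pth; set ns := size s.
have hi : (size s1 < ns)%N by rewrite /ns /s size_cat /= -addSnnS leq_addr.
exists ns, (fun i : 'I_ns => (nth (S, P) s i).1), (Ordinal hi); split; last first.
  rewrite /= /s nth_cat ltnn subnn /=; exists idfun, false; split; first by exists id.
  by move=> i x; rewrite addbF.
exists (fun i => nth Z0 (Z0 :: map snd s) i); split.
- by [].
- by rewrite (cpath_last pth).
- by move=> i _; exact: (cpath_sub pth hZ).
move=> i; have [] := cpath_step (S, P) pth (ltn_ord i).
by move=> h1 h2 h3 h4 h5; split.
Qed.

End CompositionSeries.

(** * Induced modules *)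

Record graded_algebra (K : fieldType) (A : superalg K) : Prop := {
  sa_gr0 : forall i, sa_gr i (0 : A);
  sa_gr1 : sa_gr false (1 : A);
  sa_grM : forall i j (a b : A), sa_gr i a -> sa_gr j b -> sa_gr (i (+) j) (a * b);
  sa_sum : forall a : A, exists a0 a1, [/\ sa_gr false a0, sa_gr true a1 & a = a0 + a1]
}.

Lemma finite_dimP (K : fieldType) (A : superalg K) (M : gmodule A) (J : finType) (v : J -> M) :
  (forall x, exists c : J -> K, x = \sum_j ((c j)%:A : A) *: v j) -> finite_dim M.
Proof.
move=> h; exists #|J|, (fun i => v (enum_val i)) => x; have [c ->] := h x.
exists (fun i => c (enum_val i)); rewrite (reindex (@enum_val J predT)) //.
exact/onW_bij/enum_val_bij.
Qed.

Section Tensor.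
Variables (K : fieldType) (B A : superalg K) (phi : {lrmorphism B -> A}).
Variable (N : gmodule B).
Implicit Types (a : A) (n : N).
Local Notation tens := (@tens A B phi N).
Local Notation TP := (tensor_prod phi N).

Lemma tens_scale a b n : a *: tens b n = tens (a * b) n.
Proof. by rewrite /Defs.tens -mquo_is_scalable scalerA. Qed.

Lemma tensDl a b n : tens (a + b) n = tens a n + tens b n.
Proof. by rewrite /Defs.tens scalerDl raddfD. Qed.

Lemma tens0l n : tens 0 n = 0.
Proof. by rewrite /Defs.tens scale0r raddf0. Qed.

Lemma tens_suml (J : finType) (F : J -> A) n : tens (\sum_j F j) n = \sum_j tens (F j) n.
Proof. exact: (big_morph (fun a => tens a n) (fun a b => tensDl a b n) (tens0l n)). Qed.

Lemma tensDr a n n' : tens a (n + n') = tens a n + tens a n'.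
Proof.
rewrite /Defs.tens -raddfD; apply/mquo_eq; rewrite -scalerDr -scalerBr; apply: sg_Z.
by rewrite opprD addrA; apply: sg_in; exact: tensor_relD.
Qed.

Lemma tens_phi a (b : B) n : tens (a * phi b) n = tens a (b *: n).
Proof.
rewrite /Defs.tens; apply/esym/mquo_eq; rewrite -scalerA -scalerBr; apply: sg_Z.
by apply: sg_in; exact: tensor_relZ.
Qed.

Lemma tens0r a : tens a 0 = 0.
Proof. by apply: (addrI (tens a 0)); rewrite -tensDr !addr0. Qed.

Lemma tens_ind (P : TP -> Prop) : P 0 -> (forall x y, P x -> P y -> P (x + y)) ->
  (forall a n, P (tens a n)) -> forall z, P z.
Proof.
move=> P0 PD PT; elim/mquo_ind => t; rewrite (monalgE t) raddf_sum /=.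
elim/big_ind: _ => // n _.
suff -> : << t@_n *g n >> = t@_n *: << n >> by exact: PT.
by apply/malgP => k; rewrite mcoeffZ !mcoeffU mulrnAr mulr1.
Qed.

Hypothesis gA : graded_algebra A.
Hypothesis hN : is_supermodule N.

Lemma tensor_grD i (x y : induced phi N) : gm_gr i x -> gm_gr i y -> gm_gr i (x + y).
Proof.
move=> hx hy; rewrite -[y]opprK; apply: tensor_grB => //.
by rewrite -[- y]sub0r; apply: tensor_grB => //; exact: tensor_gr0.
Qed.

Lemma ind_sum (z : induced phi N) : exists z0 z1,
  [/\ gm_gr false z0, gm_gr true z1 & z = z0 + z1].
Proof.
elim/tens_ind: z => [|x y [x0 [x1 [h0 h1 ->]]] [y0 [y1 [k0 k1 ->]]]|a n].
- by exists 0, 0; split; rewrite ?addr0 //; exact: tensor_gr0.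
- exists (x0 + y0), (x1 + y1); split; last by rewrite addrACA.
  + exact: tensor_grD.
  + exact: tensor_grD.
have [a0 [a1 [ha0 ha1 ->]]] := sa_sum gA a.
have [n0 [n1 [hn0 hn1 ->]]] := gm_sum hN n.
exists (tens a0 n0 + tens a1 n1), (tens a0 n1 + tens a1 n0); split.
- by apply: tensor_grD; [exact: (tensor_gr_tens phi ha0 hn0)|exact: (tensor_gr_tens phi ha1 hn1)].
- by apply: tensor_grD; [exact: (tensor_gr_tens phi ha0 hn1)|exact: (tensor_gr_tens phi ha1 hn0)].
by rewrite tensDl !tensDr [tens a1 n0 + _]addrC addrACA.
Qed.

Lemma ind_act i j a (x : induced phi N) : sa_gr i a -> gm_gr j x -> gm_gr (i (+) j) (a *: x).
Proof.
move=> ha; elim=> {j x} [j|j x y _ hx _ hy|k j b n hb hn].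
- by rewrite scaler0; exact: tensor_gr0.
- by rewrite scalerBr; exact: tensor_grB.
rewrite tens_scale addbA; apply: tensor_gr_tens => //; exact: (sa_grM gA).
Qed.

Variable Db : dual_basis phi.
Local Notation rho := (db_rho Db).
Local Notation mb := (db_m Db).

Lemma db_rho0 j : rho j 0 = 0.
Proof. by apply: (addrI (rho j 0)); rewrite -db_rhoD !addr0. Qed.

Lemma db_rho_sum j (J : finType) (F : J -> A) : rho j (\sum_k F k) = \sum_k rho j (F k).
Proof. exact: (big_morph (rho j) (db_rhoD (d := Db) j) (db_rho0 j)). Qed.

Lemma db_rho_mul j a b : rho j (a * b) = \sum_k rho j (a * mb k) * rho k b.
Proof.
rewrite {1}(db_sum Db b) mulr_sumr db_rho_sum; apply: eq_bigr => k _.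
by rewrite mulrA db_rhoM.
Qed.

(** This is rho_j tensored with the identity, on formal sums; right linearity of rho_j makes it
    vanish on the tensor relations. *)
Definition raw_coord j (t : {malg A[N]}) : N := \sum_(n <- msupp t) rho j t@_n *: n.

Lemma raw_coordE j (D : {fset N}) (t : {malg A[N]}) : (msupp t `<=` D)%fset ->
  raw_coord j t = \sum_(n <- D) rho j t@_n *: n.
Proof.
move=> hD; rewrite /raw_coord (big_fset_incl _ hD) //= => n _ /mcoeff_outdom ->.
by rewrite db_rho0 scale0r.
Qed.

Lemma raw_coordD j (s t : {malg A[N]}) : raw_coord j (s + t) = raw_coord j s + raw_coord j t.
Proof.
have h := fsubset_trans (msuppD_le s t) (fsubset_refl _).
rewrite (raw_coordE j h) (raw_coordE j (fsubsetUl (msupp s) (msupp t))).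
rewrite (raw_coordE j (fsubsetUr (msupp s) (msupp t))) -big_split.
by apply: eq_bigr => n _; rewrite mcoeffD db_rhoD scalerDl.
Qed.

Lemma raw_coord0 j : raw_coord j 0 = 0.
Proof. by rewrite /raw_coord msupp0 big_seq_fset0. Qed.

Lemma raw_coordN j (t : {malg A[N]}) : raw_coord j (- t) = - raw_coord j t.
Proof. by apply: (addrI (raw_coord j t)); rewrite -raw_coordD !subrr raw_coord0. Qed.

Lemma raw_coordZ j a (t : {malg A[N]}) :
  raw_coord j (a *: t) = \sum_k rho j (a * mb k) *: raw_coord k t.
Proof.
rewrite (raw_coordE j (msuppZ_le a t)) /raw_coord.
under [RHS]eq_bigr do rewrite scaler_sumr.
rewrite exchange_big; apply: eq_bigr => n _.
by rewrite mcoeffZ db_rho_mul scaler_suml; apply: eq_bigr => k _; rewrite scalerA.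
Qed.

Lemma raw_coordU j a n : raw_coord j (a *: << n >>) = rho j a *: n.
Proof.
have h : (msupp (a *: << n >> : {malg A[N]}) `<=` [fset n])%fset.
  by apply: fsubset_trans (msuppZ_le _ _) _; exact: msuppU_le.
by rewrite (raw_coordE j h) big_seq_fset1 mcoeffZ mcoeffUU mulr1.
Qed.

Lemma raw_coord1 j n : raw_coord j << n >> = rho j 1 *: n.
Proof. by rewrite -[<< n >>]scale1r raw_coordU. Qed.

Lemma raw_coordB j (s t : {malg A[N]}) : raw_coord j (s - t) = raw_coord j s - raw_coord j t.
Proof. by rewrite raw_coordD raw_coordN. Qed.

(** All coordinates have to vanish at once, since multiplication by a mixes them through the matrix
    with entries rho_j(a m_k). *)
Lemma raw_coord_gen (t : {malg A[N]}) :
  submod_gen (@tensor_rel A B phi N) t -> forall j, raw_coord j t = 0.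
Proof.
elim=> {t} [t [n n'|b n]||x y _ hx _ hy|a x _ hx] j.
- by rewrite 2!raw_coordB 3!raw_coord1 scalerDr addrAC addrK subrr.
- have := db_rhoM (d := Db) j 1 b; rewrite mul1r => e.
  by rewrite raw_coordB raw_coord1 raw_coordU e scalerA subrr.
- exact: raw_coord0.
- by rewrite raw_coordB hx hy subr0.
by rewrite raw_coordZ big1 // => k _; rewrite hx scaler0.
Qed.

Definition coordI j (z : induced phi N) : N := raw_coord j (mquo_repr z).

Lemma coordI_mquo j t : coordI j (mquo _ t) = raw_coord j t.
Proof.
apply/eqP; rewrite -subr_eq0 -raw_coordB; apply/eqP.
by apply: raw_coord_gen; apply/mquo_eq; rewrite mquo_reprK.
Qed.

Lemma coordI_tens j a n : coordI j (tens a n) = rho j a *: n.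
Proof. by rewrite /Defs.tens coordI_mquo raw_coordU. Qed.

Lemma coordID j (z w : induced phi N) : coordI j (z + w) = coordI j z + coordI j w.
Proof.
elim/mquo_ind: z => s; elim/mquo_ind: w => t.
by rewrite -raddfD !coordI_mquo raw_coordD.
Qed.

Lemma coordI0 j : coordI j 0 = 0.
Proof. by apply: (addrI (coordI j 0)); rewrite -coordID !addr0. Qed.

Lemma coordIN j (z : induced phi N) : coordI j (- z) = - coordI j z.
Proof. by apply: (addrI (coordI j z)); rewrite -coordID !subrr coordI0. Qed.

Lemma coordIB j (z w : induced phi N) : coordI j (z - w) = coordI j z - coordI j w.
Proof. by rewrite coordID coordIN. Qed.

Lemma coordIZ j a (z : induced phi N) :
  coordI j (a *: z) = \sum_k rho j (a * mb k) *: coordI k z.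
Proof.
elim/mquo_ind: z => t; rewrite -mquo_is_scalable coordI_mquo raw_coordZ.
by apply: eq_bigr => k _; rewrite coordI_mquo.
Qed.

Lemma coordI_sum (z : induced phi N) : z = \sum_j tens (mb j) (coordI j z).
Proof.
elim/tens_ind: z => [|x y ex ey|a n].
- by rewrite big1 // => j _; rewrite coordI0 tens0r.
- rewrite {1}ex {1}ey -big_split; apply: eq_bigr => j _.
  by rewrite coordID tensDr.
rewrite {1}(db_sum Db a) tens_suml; apply: eq_bigr => j _.
by rewrite tens_phi coordI_tens.
Qed.

Lemma coordI_gr i j (z : induced phi N) : gm_gr i z -> gm_gr (i (+) db_par Db j) (coordI j z).
Proof.
elim=> {i z} [i|i x y _ hx _ hy|k i a n ha hn].
- by rewrite coordI0; exact: (gm_gr0 hN).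
- by rewrite coordIB; exact: (gm_grB hN).
rewrite coordI_tens -addbA [i (+) _]addbC addbA; apply: (gm_act hN) => //.
exact: db_rho_gr.
Qed.

Lemma coordI_eq0 (z : induced phi N) : (forall j, coordI j z = 0) -> z = 0.
Proof. by move=> h; rewrite [z]coordI_sum big1 // => j _; rewrite h tens0r. Qed.

Lemma ind_supermodule : is_supermodule (induced phi N).
Proof.
split.
- exact: tensor_gr0.
- exact: tensor_grB.
- exact: ind_sum.
- move=> x h0 h1; apply: coordI_eq0 => j.
  apply: (@gm_cap2 _ _ N (false (+) db_par Db j)) => //; first exact: coordI_gr.
  by rewrite -addNb; exact: coordI_gr.
- exact: ind_act.
Qed.

Lemma ind_eta (F : db_idx Db -> N) k :
  coordI k (\sum_j tens (mb j) (F j)) = \sum_j rho k (mb j) *: F j.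
Proof.
rewrite (big_morph (coordI k) (coordID k) (coordI0 k)).
by apply: eq_bigr => j _; rewrite coordI_tens.
Qed.

(** The map is defined through coordinates, so it is well defined from the start. The ring map [psi]
    lets one statement serve both stages of a twofold induction. *)
Lemma ind_univ (C : pzRingType) (X : lmodType C) (psi : {rmorphism A -> C}) (f : N -> X) :
  (forall m n, f (m + n) = f m + f n) -> (forall b n, f (b *: n) = psi (phi b) *: f n) ->
  exists F : induced phi N -> X, [/\ forall z w, F (z + w) = F z + F w,
    forall a z, F (a *: z) = psi a *: F z & forall a n, F (tens a n) = psi a *: f n].
Proof.
move=> fD fZ; have f0 : f 0 = 0 by apply: (addrI (f 0)); rewrite -fD !addr0.
pose F (z : induced phi N) := \sum_j psi (mb j) *: f (coordI j z).
have FD z w : F (z + w) = F z + F w.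
  by rewrite /F -big_split; apply: eq_bigr => j _; rewrite coordID fD scalerDr.
have FT a n : F (tens a n) = psi a *: f n.
  rewrite /F {2}(db_sum Db a) rmorph_sum scaler_suml; apply: eq_bigr => j _.
  by rewrite coordI_tens fZ rmorphM scalerA.
exists F; split=> // a z; elim/tens_ind: z => [|x y ex ey|b n].
- by rewrite scaler0 /F big1 ?scaler0 // => j _; rewrite coordI0 f0 scaler0.
- by rewrite scalerDr !FD ex ey scalerDr.
by rewrite tens_scale !FT rmorphM scalerA.
Qed.

(** The image of A (x) P in A (x) N, since z is the sum of the m_j (x) z_j over its coordinates
    z_j. *)
Definition ind_pred (P : N -> Prop) (z : induced phi N) : Prop := forall j, P (coordI j z).

Lemma subsuper_sum (M : gmodule B) (P : M -> Prop) (J : finType) (F : J -> M) :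
  is_subsupermodule P -> (forall j, P (F j)) -> P (\sum_j F j).
Proof.
move=> hP hF; elim/big_ind: _ => //; first exact: ss_0 hP.
by move=> x y hx hy; exact: (ss_D hP).
Qed.

Lemma ind_pred_sub (P : N -> Prop) : is_subsupermodule P -> is_subsupermodule (ind_pred P).
Proof.
move=> hP; split.
- by move=> j; rewrite coordI0; exact: ss_0 hP.
- by move=> x y hx hy j; rewrite coordIB; apply: (ss_B hP); [exact: hx|exact: hy].
- move=> a x hx j; rewrite coordIZ; apply: subsuper_sum => // k; apply: (ss_Z hP); exact: hx.
move=> z hz; have [z0 [z1 [g0 g1 ez]]] := ind_sum z; exists z0, z1.
have h j : P (coordI j z0) /\ P (coordI j z1).
  have [x0 [x1 [p0 p1 k0 k1 ex]]] := ss_gr hP (hz j).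
  have := coordI_gr j g0; have := coordI_gr j g1; rewrite /=.
  have e : coordI j z0 + coordI j z1 = x0 + x1 by rewrite -ex {1}ez coordID.
  case: (db_par Db j) => /= c1 c0.
    have [e1 e0] : coordI j z1 = x0 /\ coordI j z0 = x1.
      by apply: (gm_decomp_uniq (i := false) hN) => //; rewrite addrC.
    by rewrite e0 e1.
  by have [-> ->] := gm_decomp_uniq (i := false) hN c0 k0 c1 k1 e.
by split=> // j; case: (h j).
Qed.

End Tensor.

Arguments coordI {K B A phi N} Db j z.
Arguments ind_pred {K B A phi N} Db P z.
Arguments coordI_sum {K B A phi N} Db z.

(** * Exactness of induction *)

Section InducedSubquotients.
Variables (K : fieldType) (B A : superalg K) (phi : {lrmorphism B -> A}).
Variable Db : dual_basis phi.
Hypothesis gA : graded_algebra A.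
Implicit Types (N E : gmodule B).

Definition ind_corr E N (G : E -> N -> Prop) (z : induced phi E) (w : induced phi N) : Prop :=
  forall j, G (coordI Db j z) (coordI Db j w).

Lemma corr_sum (M S : gmodule B) (G : M -> S -> Prop) e (J : finType) (F : J -> M) (H : J -> S) :
  correspondence G e -> (forall j, G (F j) (H j)) -> G (\sum_j F j) (\sum_j H j).
Proof.
move=> hG h; elim/big_ind2: _ => //; first exact: corr0 hG.
by move=> x s y t hx hy; exact: (corrD hG).
Qed.

Lemma ind_correspondence E N (G : E -> N -> Prop) e : is_supermodule E -> is_supermodule N ->
  correspondence G e -> correspondence (ind_corr G) e.
Proof.
move=> hE hN hG; split.
- by move=> j; rewrite !coordI0; exact: corr0 hG.
- by move=> x y s t h1 h2 j; rewrite !coordIB; apply: (corrB hG); [exact: h1|exact: h2].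
- move=> a x s h j; rewrite !coordIZ; apply: (corr_sum hG) => k; exact: (corrZ hG).
move=> z w h.
have [z0 [z1 [g0 g1 ez]]] := ind_sum gA hE z.
have [w0 [w1 [k0 k1 ew]]] := gm_sum_par e w (ind_supermodule gA hN Db).
have hj j : G (coordI Db j z0) (coordI Db j w0) /\ G (coordI Db j z1) (coordI Db j w1).
  have [x0 [x1 [s0 [s1 [h0 h1 [a0 a1] [b0 b1] [ex es]]]]]] := corr_gr hG (h j).
  have := coordI_gr hE j g0; have := coordI_gr hE j g1.
  have := coordI_gr hN j k0; have := coordI_gr hN j k1.
  have e1 : coordI Db j z0 + coordI Db j z1 = x0 + x1 by rewrite -ex {1}ez coordID.
  have e2 : coordI Db j w0 + coordI Db j w1 = s0 + s1 by rewrite -es {1}ew coordID.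
  case: (db_par Db j); rewrite /= ?addbT ?addbF ?negbK => c3 c2 c1 c0.
    have [e3 e4] : coordI Db j z1 = x0 /\ coordI Db j z0 = x1.
      by apply: (gm_decomp_uniq (i := false) hE) => //; rewrite addrC.
    have [e5 e6] : coordI Db j w1 = s0 /\ coordI Db j w0 = s1.
      by apply: (gm_decomp_uniq (i := e) hN) => //; rewrite addrC.
    by rewrite e3 e4 e5 e6.
  have [-> ->] := gm_decomp_uniq (i := false) hE c0 a0 c1 a1 e1.
  by have [-> ->] := gm_decomp_uniq (i := e) hN c2 b0 c3 b1 e2.
by exists z0, z1, w0, w1; split=> // j; case: (hj j).
Qed.

(** Coordinates cannot be prescribed at will in a mere dual basis: those of \sum_j m_j (x) F_j are
    combinations of the F_j. Expanding w in the same way produces the same combinations, which G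
    respects. *)
Lemma ind_corr_onto E N (G : E -> N -> Prop) e (w : induced phi N) : correspondence G e ->
  (forall j, exists x, G x (coordI Db j w)) -> exists z, ind_corr G z w.
Proof.
move=> hG h; pose F j := projT1 (cid (h j)).
exists (\sum_j tens phi (db_m Db j) (F j)) => k.
rewrite {1}[w](coordI_sum Db) !ind_eta; apply: (corr_sum hG) => j; apply: (corrZ hG).
exact: (projT2 (cid (h j))).
Qed.

Lemma ind_corr_lift E N (G : E -> N -> Prop) e (z : induced phi E) : correspondence G e ->
  (forall j, exists y, G (coordI Db j z) y) -> exists w, ind_corr G z w.
Proof.
move=> hG h; pose F j := projT1 (cid (h j)).
exists (\sum_j tens phi (db_m Db j) (F j)) => k.
rewrite {1}[z](coordI_sum Db) !ind_eta; apply: (corr_sum hG) => j; apply: (corrZ hG).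
exact: (projT2 (cid (h j))).
Qed.

Lemma ind_subquo E N : is_supermodule E -> is_supermodule N ->
  subquo N E -> subquo (induced phi N) (induced phi E).
Proof.
move=> hE hN [G [e [hG sG fG]]]; exists (ind_corr G), e; split.
- exact: ind_correspondence.
- by move=> w; apply: ind_corr_onto hG _ => j; exact: sG.
move=> w h; apply: (coordI_eq0 (Db := Db)) => j; apply: fG.
by have := h j; rewrite coordI0.
Qed.

(* The factors of a composition series are induced to sections of a filtration *)
(* of the induced module, and a simple subquotient lives in one section.      *)
Lemma ind_simple_subquo E n (F : 'I_n -> gmodule B) (S : gmodule A) :
  is_supermodule E -> comp_series E F -> simple S -> subquo S (induced phi E) ->
  exists i, subquo S (induced phi (F i)).
Proof.
move=> hE [P [P0 Pn Psub Pstep]] [hS [s0 s0n] Smin] [G [e [hG sG fG]]].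
have hI := ind_supermodule gA hE Db.
pose T k s := exists2 z, ind_pred Db (P k) z & G z s.
have hT k : (k <= n)%N -> is_subsupermodule (T k).
  move=> kn; have hk := ind_pred_sub gA hE Db (Psub k kn); split.
  - by exists 0; [exact: ss_0 hk|exact: corr0 hG].
  - by move=> s t [x hx1 hx2] [y hy1 hy2]; exists (x - y); [exact: (ss_B hk)|exact: (corrB hG)].
  - by move=> a s [x hx1 hx2]; exists (a *: x); [exact: (ss_Z hk)|exact: (corrZ hG)].
  move=> s [x hx hxs].
  have [x0 [x1 [t0 [t1 [h0 h1 [a0 a1] [b0 b1] [ex es]]]]]] := corr_gr hG hxs.
  have [y0 [y1 [p0 p1 c0 c1 ey]]] := ss_gr hk hx.
  have [e0 e1] : x0 = y0 /\ x1 = y1.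
    by apply: (gm_decomp_uniq (i := false) hI) => //; rewrite -ex.
  have T0 : T k t0 by exists x0 => //; rewrite e0.
  have T1 : T k t1 by exists x1 => //; rewrite e1.
  by case: (e) b0 b1 => b0 b1; [exists t1, t0; rewrite addrC|exists t0, t1].
have ex : exists k, (k <= n)%N && `[< forall s, T k s >].
  exists n; rewrite leqnn; apply/asboolP => s; have [z hz] := sG s.
  by exists z => // j; exact: Pn.
(* For the least k whose induced step still maps onto S, the preceding step has a proper submodule
   of S as image, which is 0 by simplicity. *)
case: (ex_minnP ex) => k /andP[kn /asboolP Tk] kmin.
case: k => [|k] in kn Tk kmin *.
  have [z hz hzs] := Tk s0; case/eqP: s0n; apply: fG.
  suff <- : z = 0 by [].
  by apply: (coordI_eq0 (Db := Db)) => j; apply/P0; exact: hz.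
have Tk0 s : T k s -> s = 0.
  case: (Smin (T k) (hT k (ltnW kn))) => [h|h]; first exact: h.
  suff : (k.+1 <= k)%N by rewrite ltnn.
  by apply: kmin; rewrite (ltnW kn); exact/asboolP.
pose i : 'I_n := Ordinal kn; exists i.
have [Pi simF [f [e' [fi fs fgr]]]] := Pstep i.
have hF : is_supermodule (F i) by case: simF.
have hPi := Psub i (ltnW kn); have hPi1 := Psub i.+1 kn.
have hTh := @subquot_correspondence _ _ (F i) E (P i.+1) (P i) f e' hF hE hPi1 hPi Pi fgr.
set Th := subquot_corr _ _ in hTh.
have hTI := ind_correspondence hE hF hTh.
exists (fun w s => exists2 z, ind_corr Th z w & G z s), (e' (+) e); split.
- split.
  + by exists 0; [exact: corr0 hTI|exact: corr0 hG].
  + by move=> x y s t [z z1 z2] [w w1 w2]; exists (z - w); [exact: (corrB hTI)|exact: (corrB hG)].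
  + by move=> a x s [z z1 z2]; exists (a *: z); [exact: (corrZ hTI)|exact: (corrZ hG)].
  move=> x s [z hzx hzs].
  have [z0 [z1 [x0 [x1 [h0 h1 [a0 a1] [b0 b1] [ez exx]]]]]] := corr_gr hTI hzx.
  have [z0' [z1' [t0 [t1 [h0' h1' [a0' a1'] [b0' b1'] [ez' es]]]]]] := corr_gr hG hzs.
  have [e0 e1] : z0 = z0' /\ z1 = z1'.
    by apply: (gm_decomp_uniq (i := false) hI) => //; rewrite -ez.
  have d0 : exists2 z, ind_corr Th z x0 & G z t0 by exists z0 => //; rewrite e0.
  have d1 : exists2 z, ind_corr Th z x1 & G z t1 by exists z1 => //; rewrite e1.
  case: (e') b0 b1 => b0 b1; rewrite /= in b0 b1 *.
    by exists x1, x0, t1, t0; rewrite negbK exx es; split=> //; split=> //; rewrite addrC.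
  by exists x0, x1, t0, t1.
- move=> s; have [z hz hzs] := Tk s.
  suff [w hw] : exists w, ind_corr Th z w by exists w, z.
  apply: ind_corr_lift hTh _ => j; have [y hy] := fs _ (hz j).
  by exists y; split=> //; exact: hz.
move=> s [z hz hzs]; apply: Tk0; exists z => // j.
have := hz j; rewrite coordI0 => h.
by apply/(subquot_corr_ker (f := f) (P := P i.+1) _ fi hPi Pi).
Qed.

End InducedSubquotients.

(** * Engel's theorem *)

Section Graded.
Variables (K : fieldType) (p : nat) (g : restrictedLSA K p).
Implicit Types (U N M : {vspace g}) (x y z : g).

Lemma gr_disjoint i x : x \in gr g i -> x \in gr g (~~ i) -> x = 0.
Proof.
move=> h h'; apply/eqP; rewrite -memv0 -(gr_cap (lsaP g)) memv_cap.
by case: i h h' => /= -> ->.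
Qed.

Lemma gr_decomp x : exists x0 x1, [/\ x0 \in gr g false, x1 \in gr g true & x = x0 + x1].
Proof.
have : x \in (gr g false + gr g true)%VS by rewrite (gr_sum (lsaP g)) memvf.
by case/memv_addP=> y hy [z hz ->]; exists y, z.
Qed.

Lemma gr_decomp_uniq i x y x' y' : x \in gr g i -> x' \in gr g i -> y \in gr g (~~ i) ->
  y' \in gr g (~~ i) -> x + y = x' + y' -> x = x' /\ y = y'.
Proof.
move=> hx hx' hy hy' e.
have e1 : x - x' = y' - y.
  have -> : x = x' + y' - y by rewrite -e addrK.
  by rewrite addrAC [x' + _]addrC addrK.
have z : x - x' = 0.
  apply: (gr_disjoint (i := i)); first exact: memvB.
  by rewrite e1; exact: memvB.
split; apply/eqP; rewrite -subr_eq0; first by rewrite z.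
by rewrite -oppr_eq0 opprB -e1 z.
Qed.

Lemma gradedP U : graded U -> forall x, x \in U -> exists x0 x1,
  [/\ x0 \in U /\ x1 \in U, x0 \in gr g false, x1 \in gr g true & x = x0 + x1].
Proof.
move=> h x; rewrite {1}h => /memv_addP[y /[!memv_cap]/andP[yU y0] [z /[!memv_cap]/andP[zU z1] ->]].
by exists y, z.
Qed.

Lemma graded_comp U x y i : graded U -> x \in gr g i -> y \in gr g (~~ i) -> x + y \in U ->
  x \in U /\ y \in U.
Proof.
move=> h hx hy hxy; have [x0 [x1 [[h0 h1] g0 g1 e]]] := gradedP h hxy.
case: i hx hy => /= hx hy.
  by have [-> ->] := gr_decomp_uniq (i := true) hx g1 hy g0 (etrans e (addrC _ _)).
by have [-> ->] := gr_decomp_uniq (i := false) hx g0 hy g1 e.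
Qed.

Lemma graded_intro U : (forall x, x \in U -> exists x0 x1,
  [/\ x0 \in U /\ x1 \in U, x0 \in gr g false, x1 \in gr g true & x = x0 + x1]) -> graded U.
Proof.
move=> h; apply/eqP; rewrite eqEsubv; apply/andP; split; apply/subvP => x.
  move=> /h[x0 [x1 [[a0 a1] b0 b1 ->]]].
  by apply: memv_add; rewrite memv_cap ?a0 ?a1.
case/memv_addP => y; rewrite memv_cap => /andP[yU _] [z]; rewrite memv_cap => /andP[zU _] ->.
exact: memvD.
Qed.

Lemma graded_add U M : graded U -> graded M -> graded (U + M)%VS.
Proof.
move=> hU hM; apply: graded_intro => x /memv_addP[u hu [m hm ->]].
have [u0 [u1 [[a0 a1] b0 b1 ->]]] := gradedP hU hu.
have [m0 [m1 [[c0 c1] d0 d1 ->]]] := gradedP hM hm.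
exists (u0 + m0), (u1 + m1); split; [by split; exact: memv_add| | |by rewrite addrACA].
  exact: memvD.
exact: memvD.
Qed.

Lemma graded_hom U i : (U <= gr g i)%VS -> graded U.
Proof.
move=> h; apply: graded_intro => x hx; have hx' := subvP h _ hx.
case: i h hx' => h hx'; first by exists 0, x; rewrite !mem0v add0r.
by exists x, 0; rewrite !mem0v addr0.
Qed.

End Graded.

Section Engel.
Variables (K : fieldType) (p : nat) (g : restrictedLSA K p).
Implicit Types (N M : {vspace g}) (x y z : g).

Record representation (V : lmodType K) (rho : g -> V -> V) : Prop := {
  rep_r : forall x c v w, rho x (c *: v + w) = c *: rho x v + rho x w;
  rep_l : forall c x y v, rho (c *: x + y) v = c *: rho x v + rho y v;
  rep_br : forall i j x y v, x \in gr g i -> y \in gr g j ->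
    rho (br x y) v = rho x (rho y v) - (-1) ^+ (i && j) *: rho y (rho x v)
}.

Record subspace (V : lmodType K) (P : V -> Prop) : Prop := {
  sub0 : P 0;
  subC : forall c v w, P v -> P w -> P (c *: v + w)
}.

Definition ad_nilpotent N := forall i x, x \in gr g i -> x \in N ->
  exists k, forall y, iter k (br x) y = 0.

Lemma ad_representation : representation (@br _ _ g).
Proof.
split.
- by move=> x c v w; rewrite brDr brZr.
- by move=> c x y v; rewrite brDl brZl.
by move=> i j x y v hx hy; rewrite (br_jacobi (lsaP g) v hx hy) addrK.
Qed.

Lemma vspace_subspace (U : {vspace g}) : subspace (fun x => x \in U).
Proof. by split=> [|c v w hv hw]; rewrite ?mem0v // memvD // memvZ. Qed.

Lemma rep_l0 (V : lmodType K) (rho : g -> V -> V) v : representation rho -> rho 0 v = 0.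
Proof. by move=> h; have := rep_l h (-1) 0 0 v; rewrite scaleN1r addNr scaleN1r addNr. Qed.

Lemma rep_D (V : lmodType K) (rho : g -> V -> V) x y v : representation rho ->
  rho (x + y) v = rho x v + rho y v.
Proof. by move=> h; have := rep_l h 1 x y v; rewrite !scale1r. Qed.

Lemma subspace_add (V : lmodType K) (P : V -> Prop) (x y : V) : subspace P -> P x -> P y -> P (x + y).
Proof. by move=> h hx hy; rewrite -[x]scale1r; exact: (subC h). Qed.

Lemma subspace_scale (V : lmodType K) (P : V -> Prop) c (x : V) : subspace P -> P x -> P (c *: x).
Proof. by move=> h hx; rewrite -[_ *: _]addr0; apply: (subC h) => //; exact: (sub0 h). Qed.

(* The next element to adjoin to a proper subalgebra M of N. *)
Lemma engel_extend M N : (M <= N)%VS -> graded M -> br_closed M -> graded N -> br_closed N ->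
  (exists x, [/\ x \in N, x \notin M & forall m, m \in M -> br m x \in M]) ->
  exists i x, [/\ x \in gr g i /\ x \in N, x \notin M, forall m, m \in M -> br m x \in M
    & br x x \in M].
Proof.
move=> MN gM bM gN bN [x [xN xM hx]].
have [i [y [[yi yN] yM hy]]] : exists i y, [/\ y \in gr g i /\ y \in N, y \notin M
    & forall m, m \in M -> br m y \in M].
  have [x0 [x1 [[n0 n1] g0 g1 ex]]] := gradedP gN xN.
  have hm m : m \in M -> br m x0 \in M /\ br m x1 \in M.
    move=> hm; have [m0 [m1 [[a0 a1] b0 b1 ->]]] := gradedP gM hm.
    have h0 : br m0 x0 \in M /\ br m0 x1 \in M.
      apply: (graded_comp (i := false) gM); last by rewrite -brDr -ex; exact: hx.
        exact: (br_gr (lsaP g) b0 g0).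
      exact: (br_gr (lsaP g) b0 g1).
    have h1 : br m1 x0 \in M /\ br m1 x1 \in M.
      apply: (graded_comp (i := true) gM); last by rewrite -brDr -ex; exact: hx.
        exact: (br_gr (lsaP g) b1 g0).
      exact: (br_gr (lsaP g) b1 g1).
    by rewrite !brDl; case: h0 h1 => ? ? [? ?]; split; exact: memvD.
  have [x0M|x0M] := boolP (x0 \in M).
    exists true, x1; split=> //; last by move=> m /hm[].
    by apply: contra xM => h; rewrite ex memvD.
  by exists false, x0; split=> // m /hm[].
(* If y is odd and [y, y] escapes M, this even element replaces y: it normalizes M by the Jacobi
   identity, and its bracket with itself is 0. *)
have [h|h] := boolP (br y y \in M); first by exists i, y.
case: i yi => yi; last by rewrite (br_alt (lsaP g)) ?mem0v in h.
have y2 : br y y \in gr g false by exact: (br_gr (lsaP g) yi yi).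
exists false, (br y y); split=> //; last by rewrite (br_alt (lsaP g)) ?mem0v.
  by split=> //; exact: bN.
move=> m hm; have [m0 [m1 [[a0 a1] b0 b1 ->]]] := gradedP gM hm.
have hk k z : z \in M -> z \in gr g k -> br z (br y y) \in M.
  move=> zM zk; rewrite (br_jacobi (lsaP g) y zk yi).
  apply: memvD; first exact: (hy _ (hy _ zM)).
  apply: memvZ; rewrite (br_skew (lsaP g) yi (br_gr (lsaP g) zk yi)).
  by rewrite memvN memvZ //; exact: (hy _ (hy _ zM)).
by rewrite brDl memvD //; [exact: hk b0|exact: hk b1].
Qed.

(** The relative form, P modulo U, avoids quotient representations and lets the induction on dim N
    be used twice for a maximal proper graded subalgebra M: on N modulo M, to find x normalizing M
    with N = M + <x>, and on P modulo U. The vectors that M sends into U are stable under x, and the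
    last iterate of x outside U is the required one. *)
Lemma engel N (V : lmodType K) (rho : g -> V -> V) (P U : V -> Prop) :
  graded N -> br_closed N -> ad_nilpotent N -> representation rho ->
  (forall i x v, x \in gr g i -> x \in N -> exists k, iter k (rho x) v = 0) ->
  subspace P -> subspace U ->
  (forall x v, x \in N -> P v -> P (rho x v)) ->
  (forall x v, x \in N -> U v -> U (rho x v)) ->
  (exists v, P v /\ ~ U v) ->
  exists v, [/\ P v, ~ U v & forall x, x \in N -> U (rho x v)].
Proof.
have [n] := ubnP (\dim N); elim: n N V rho P U => // n IH N V rho P U hn
  gN bN adN hrho nilN sP sU NP NU hPU.
have [N0|N0] := eqVneq N 0%VS.
  have [v [Pv Uv]] := hPU; exists v; split=> // x; rewrite N0 memv0 => /eqP ->.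
  by rewrite rep_l0 //; exact: (sub0 sU).
pose good (M : {vspace g}) := [/\ (M <= N)%VS, M != N, graded M & br_closed M].
have ex : exists k, `[< exists2 M, good M & \dim M = k >].
  exists 0%N; apply/asboolP; exists 0%VS; last by rewrite dimv0.
  split; rewrite ?sub0v // 1?eq_sym //.
    by apply: (graded_hom (i := false)); exact: sub0v.
  by move=> x y; rewrite !memv0 => /eqP -> _; rewrite br0l.
have bnd k : `[< exists2 M, good M & \dim M = k >] -> (k <= \dim N)%N.
  by move=> /asboolP[M [MN _ _ _] <-]; exact: dimvS.
case: (ex_maxnP ex bnd) => k /asboolP[M [MN MneN gM bM] dM] kmax.
have ltM : (\dim M < \dim N)%N.
  rewrite ltn_neqAle dimvS // andbT; apply: contra MneN => /eqP e.
  by rewrite eqEdim MN e leqnn.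
have ltn' : (\dim M < n)%N by apply: leq_trans ltM _.
have sMN x : x \in M -> x \in N by exact: (subvP MN).
have adM : ad_nilpotent M by move=> i x xi /sMN; exact: (adN i).
have [i [x [[xi xN] xM hx hxx]]] : exists i x, [/\ x \in gr g i /\ x \in N, x \notin M,
    forall m, m \in M -> br m x \in M & br x x \in M].
  apply: engel_extend => //.
  have [||||x [xN xM hx]] := IH M g (@br _ _ g) (fun x => x \in N) (fun x => x \in M)
    ltn' gM bM adM ad_representation _ (vspace_subspace N) (vspace_subspace M).
  - by move=> i x v xi xM; have [m hm] := adM i x xi xM; exists m.
  - by move=> x v /sMN; exact: bN.
  - by move=> x v; exact: bM.
  - have : ~~ (N <= M)%VS by apply: contra MneN => h; rewrite eqEsubv MN.
    by move=> /subvPn[x xN xM]; exists x; split=> //; exact/negP.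
  by exists x; split=> //; exact/negP.
have brx m : m \in M -> br x m \in M.
  move=> hm; have [m0 [m1 [[a0 a1] b0 b1 ->]]] := gradedP gM hm.
  rewrite brDr memvD //.
    by rewrite (br_skew (lsaP g) xi b0) memvN memvZ // hx.
  by rewrite (br_skew (lsaP g) xi b1) memvN memvZ // hx.
have eN : (M + <[x]>)%VS = N.
  have gM' : graded (M + <[x]>)%VS.
    by apply: graded_add => //; apply: (graded_hom (i := i)); rewrite -memvE.
  have bM' : br_closed (M + <[x]>)%VS.
    move=> a b /memv_addP[m hm [_ /vlineP[c ->] ->]] /memv_addP[m' hm' [_ /vlineP[c' ->] ->]].
    rewrite -[br _ _]addr0; apply: memv_add; last exact: mem0v.
    rewrite brDl !brDr !brZl !brZr !memvD ?memvZ //; [exact: bM|exact: hx|exact: brx].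
  have sM' : (M + <[x]> <= N)%VS by rewrite subv_add MN -memvE.
  apply/eqP; apply: contraT => ne.
  have : (\dim (M + <[x]>) <= k)%N by apply: kmax; apply/asboolP; exists (M + <[x]>)%VS.
  rewrite -dM leqNgt => /negP; case.
  rewrite ltn_neqAle dimvS ?addvSl // andbT; apply/negP => /eqP e.
  have : (M == M + <[x]>)%VS by rewrite eqEdim addvSl e leqnn.
  by move=> /eqP e'; move: xM; rewrite e' (subvP (addvSr _ _)) // memv_line.
have [v [Pv Uv Mv]] : exists v, [/\ P v, ~ U v & forall m, m \in M -> U (rho m v)].
  apply: (IH M) => //.
  - by move=> j y w yj /sMN; exact: nilN yj.
  - by move=> y w /sMN; exact: NP.
  - by move=> y w /sMN; exact: NU.
pose W w := P w /\ forall m, m \in M -> U (rho m w).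
have Wx w : W w -> W (rho x w).
  move=> [Pw Mw]; split; first exact: NP.
  have hom j m : m \in gr g j -> m \in M -> U (rho m (rho x w)).
    move=> mj mM; have e := rep_br hrho w mj xi.
    have -> : rho m (rho x w) = (-1) ^+ (j && i) *: rho x (rho m w) + rho (br m x) w.
      by rewrite e addrC subrK.
    apply: (subC sU); last by apply: Mw; exact: hx.
    by apply: NU => //; exact: Mw.
  move=> m hm; have [m0 [m1 [[a0 a1] b0 b1 ->]]] := gradedP gM hm.
  by rewrite rep_D //; apply: subspace_add => //; [exact: hom b0 a0|exact: hom b1 a1].
have Wk m : W (iter m (rho x) v) by elim: m => [|m ih] //=; exact: Wx.
have [m hm] := nilN i x v xi xN.
have exm : exists m, `[< U (iter m (rho x) v) >].
  by exists m; apply/asboolP; rewrite hm; exact: (sub0 sU).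
case: (ex_minnP exm) => -[/asboolP //|q] /asboolP Uq qmin.
exists (iter q (rho x) v); have [Pq Mq] := Wk q; split=> //.
  by move=> h; have := qmin q (asboolT h); rewrite ltnn.
move=> y; rewrite -eN => /memv_addP[m' hm' [_ /vlineP[c ->] ->]].
by rewrite addrC rep_l //; apply: (subC sU) => //; exact: Mq.
Qed.

End Engel.

(** * Nilpotency in u(g) *)

Section Nilpotent.
Variables (K : fieldType) (p : nat) (g : restrictedLSA K p).
Implicit Types (x y z : g) (a b n : renv g).

Record nil_datum (N : {vspace g}) : Prop := {
  nd_graded : graded N;
  nd_br : br_closed N;
  nd_sq : forall x, x \in (N :&: gr g true)%VS -> sq x \in N;
  nd_nil : p_nilpotent N
}.

Lemma pm_iter_gr r x : x \in gr g false -> iter r (@pm _ _ g) x \in gr g false.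
Proof. by move=> h; elim: r => //= r IH; exact: (pm_gr (lsaP g)). Qed.

Lemma ad_pm_iter r x y : x \in gr g false ->
  br (iter r (@pm _ _ g) x) y = iter (p ^ r) (br x) y.
Proof.
move=> h; elim: r y => [|r IH] y //=.
rewrite (ad_pm (lsaP g)); last exact: pm_iter_gr.
by rewrite (eq_iter IH) expnS iterM.
Qed.

Lemma uiota_pm_iter r x : x \in gr g false ->
  uiota (iter r (@pm _ _ g) x) = uiota x ^+ (p ^ r) :> renv g.
Proof.
move=> h; elim: r => [|r IH] /=; first by rewrite expr1.
by rewrite -uiota_pm ?pm_iter_gr // IH -exprM -expnSr.
Qed.

Section Datum.
Variables (N : {vspace g}).
Hypothesis hN : nil_datum N.

(** For even x, ad(x)^(p^r) is ad of the r-th iterate of the p-map at x, which is 0 for some r. An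
    odd x is reduced to [sq] x in N by ad(x)^2 = ad([sq] x). *)
Lemma nd_ad : ad_nilpotent N.
Proof.
have ev x : x \in gr g false -> x \in N -> exists k, forall y, iter k (br x) y = 0.
  move=> x0 xN; have [|r hr] := nd_nil hN (x := x); first by rewrite memv_cap xN.
  by exists (p ^ r)%N => y; rewrite -ad_pm_iter // hr br0l.
case=> x xi xN; last exact: ev.
have [||k hk] := ev (sq x); first exact: (sq_gr (lsaP g)).
  by apply: (nd_sq hN); rewrite memv_cap xN.
exists (k * 2)%N => y; rewrite iterM -[RHS](hk y); apply: eq_iter => z.
by rewrite (ad_sq (lsaP g)).
Qed.

Lemma nd_uiota i x : x \in gr g i -> x \in N -> exists k, uiota x ^+ k = 0 :> renv g.
Proof.
have ev y : y \in gr g false -> y \in N -> exists k, uiota y ^+ k = 0 :> renv g.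
  move=> y0 yN; have [|r hr] := nd_nil hN (x := y); first by rewrite memv_cap yN.
  by exists (p ^ r)%N; rewrite -uiota_pm_iter // hr linear0.
case: i => xi xN; last exact: ev.
have [||k hk] := ev (sq x); first exact: (sq_gr (lsaP g)).
  by apply: (nd_sq hN); rewrite memv_cap xN.
by exists (2 * k)%N; rewrite exprM uiota_sq.
Qed.

(** The ascending annihilator filtration of u(g) for left multiplication by N, an analogue of the
    upper central series. *)
Fixpoint kills k a : Prop :=
  if k is k'.+1 then forall x, x \in N -> kills k' (uiota x * a) else a = 0.

Lemma kills_subspace k : subspace (kills k).
Proof.
elim: k => [|k IH]; first by split=> [//|c v w /= -> ->]; rewrite scaler0 addr0.
split=> [x xN|c v w hv hw x xN] /=; first by rewrite mulr0; exact: sub0 IH.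
by rewrite mulrDr -scalerAr; apply: (subC IH); [exact: hv|exact: hw].
Qed.

Lemma killsS k a : kills k a -> kills k.+1 a.
Proof.
elim: k a => [a /= -> x _|k IH a h x xN]; first by rewrite mulr0.
exact: (IH _ (h x xN)).
Qed.

Lemma uiota_rep : representation (fun x (a : renv g) => uiota x * a).
Proof.
split.
- by move=> x c v w; rewrite mulrDr -scalerAr.
- by move=> c x y v; rewrite linearD linearZ /= mulrDl -scalerAl.
by move=> i j x y v hx hy; rewrite -(uiota_br hx hy) mulrBl mulrA -scalerAl mulrA.
Qed.

(** Engel's theorem for left multiplication, relative to [kills k], yields a new element of
    [kills k.+1] as long as [kills k] is proper. As u(g) is finite-dimensional, this stops. *)
Lemma kills_all : exists k, forall a, kills k a.
Proof.
have [J [v hv]] := @renv_fin_span K p g g idfun (fun x y e => e)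
  (fun i x h => h).
pose cb (c : 'rV[K]_#|J|) : renv g := \sum_j c 0 (enum_rank j) *: v j.
have cbL k c d : cb (k *: c + d) = k *: cb c + cb d.
  rewrite /cb scaler_sumr -big_split; apply: eq_bigr => i _ /=.
  by rewrite !mxE scalerDl scalerA.
have cbO a : exists c, a = cb c.
  have [c ->] := hv a; exists (\row_i c (enum_val i)); apply: eq_bigr => i _.
  by rewrite mxE enum_rankK.
have H k : (forall a, kills k a) \/ exists U : {vspace 'rV[K]_#|J|},
    (forall c, c \in U -> kills k (cb c)) /\ (k <= \dim U)%N.
  elim: k => [|k [IH|[U [hU dU]]]].
  - right; exists 0%VS; split=> // c; rewrite memv0 => /eqP ->.
    by rewrite /cb big1 // => j _; rewrite mxE scale0r.
  - by left=> a; apply: killsS; exact: IH.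
  have [h|/existsNP[w hw]] := pselect (forall a, kills k a).
    by left=> a; apply: killsS; exact: h.
  right; have [|||||u [_ uk ku]] := @engel _ _ g N _ _ (fun _ => True) (kills k)
    (nd_graded hN) (nd_br hN) nd_ad uiota_rep _ _ (kills_subspace k).
  - move=> i x b xi xN; have [m hm] := nd_uiota xi xN; exists m.
    have -> : iter m ( *%R (uiota x)) b = uiota x ^+ m * b.
      by elim: m {hm} => [|m IHm]; rewrite ?mul1r // iterS IHm exprS mulrA.
    by rewrite hm mul0r.
  - by split.
  - by [].
  - by move=> x b xN /killsS; exact.
  - by exists w.
  have [c ec] := cbO u; exists (U + <[c]>)%VS; split.
    move=> _ /memv_addP[y hy [z /vlineP[q ->] ->]]; rewrite addrC cbL -ec.
    apply: (subC (kills_subspace k.+1)); first exact: ku.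
    exact/killsS/hU.
  have cU : c \notin U by apply/negP => /hU; rewrite -ec.
  apply: leq_ltn_trans dU _; rewrite ltn_neqAle dimvS ?addvSl // andbT; apply/negP => /eqP e.
  have : (U == U + <[c]>)%VS by rewrite eqEdim addvSl e leqnn.
  by move=> /eqP e'; move: cU; rewrite e' (subvP (addvSr _ _)) // memv_line.
have [h|[U [_ hU]]] := H #|J|.+1; first by exists #|J|.+1.
have := leq_trans hU (dimvS (subvf U)).
by rewrite dimvf /dim /= mul1n ltnn.
Qed.

(* The elements that lower the filtration by the [kills k]; these contain the *)
(* augmentation ideal of u(N) and are nilpotent.                              *)
Definition aug n : Prop := forall k a, kills k.+1 a -> kills k (n * a).

Lemma aug_uiota x : x \in N -> aug (uiota x).
Proof. by move=> xN k a; exact. Qed.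

Lemma augD n m : aug n -> aug m -> aug (n + m).
Proof.
move=> hn hm k a h; rewrite mulrDl; apply: subspace_add; first exact: kills_subspace.
  exact: hn.
exact: hm.
Qed.

Lemma augZ (c : K) n : aug n -> aug (c *: n).
Proof.
move=> hn k a h; rewrite -scalerAl; apply: subspace_scale; first exact: kills_subspace.
exact: hn.
Qed.

Lemma augM n m : aug n -> aug m -> aug (n * m).
Proof. by move=> hn hm k a h; rewrite -mulrA; apply/hn/killsS/hm. Qed.

Lemma aug_nilp n : aug n -> exists k, n ^+ k = 0.
Proof.
move=> hn; have [k hk] := kills_all; exists k.
have H m a : kills m a -> n ^+ m * a = 0.
  elim: m a => [a /= ->|m IH a h]; first by rewrite mulr0.
  by rewrite exprSr -mulrA; apply: IH; exact: hn.
by rewrite -[_ ^+ _]mulr1; exact: H.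
Qed.

Lemma aug_cancel (M : lmodType (renv g)) (c : K) n (v : M) : aug n -> c != 0 ->
  (c%:A + n) *: v = 0 -> v = 0.
Proof.
move=> hn c0 h; have [k hk] := aug_nilp (augZ (- c^-1) hn).
have e : v = (- c^-1 *: n) *: v.
  move: h; rewrite scalerDl => /eqP; rewrite addr_eq0 => /eqP h.
  have : (c^-1%:A : renv g) *: ((c%:A : renv g) *: v) = v.
    by rewrite scalerA -scalerAl mul1r scalerA mulVf // !scale1r.
  by rewrite h scalerN scalerA mulr_algl -scaleNr -scaleNr.
have H m : v = (- c^-1 *: n) ^+ m *: v.
  by elim: m => [|m IH]; rewrite ?expr0 ?scale1r // exprSr -scalerA -e.
by rewrite (H k) hk scale0r.
Qed.

(** The element c + n is inverted by the geometric series in - n / c, which is finite as n is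
    nilpotent. *)
Lemma aug_unit (M : lmodType (renv g)) (c : K) n (v : M) : aug n -> c != 0 ->
  exists a, v = a *: ((c%:A + n) *: v).
Proof.
move=> hn c0; have [k hk] := aug_nilp (augZ (- c^-1) hn).
set m := - c^-1 *: n in hk.
have e : c%:A + n = c *: (1 - m) by rewrite /m scaleNr opprK scalerDr scalerA mulfV // scale1r.
exists (c^-1 *: \sum_(i < k) m ^+ i).
rewrite scalerA e -scalerAl -scalerAr scalerA mulVf // scale1r.
have -> : (\sum_(i < k) m ^+ i) * (1 - m) = 1.
  have := subrX1 m k; rewrite hk sub0r => h.
  have cm : GRing.comm (\sum_(i < k) m ^+ i) (1 - m).
    apply: commr_sym; apply: commr_sum => i _; apply: commr_sym; apply: commrB; first exact: commr1.
    by apply: commr_sym; exact: commrX.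
  by rewrite cm -opprB mulNr -h opprK.
by rewrite scale1r.
Qed.

Inductive nspan : renv g -> Prop :=
| nspan0 : nspan 0
| nspan1 : nspan 1
| nspanD a b : nspan a -> nspan b -> nspan (a + b)
| nspanZ (c : K) a : nspan a -> nspan (c *: a)
| nspanM x a : x \in N -> nspan a -> nspan (uiota x * a).

Lemma nspan_aug a : nspan a -> exists (c : K) n, aug n /\ a = c%:A + n.
Proof.
have aug0 : aug 0 by rewrite -(scale0r (uiota 0)); apply: augZ; apply: aug_uiota; exact: mem0v.
elim=> {a} [||a b _ [c [n [hn ->]]] _ [d [m [hm ->]]]|k a _ [c [n [hn ->]]]|x a xN _ [c [n [hn ->]]]].
- by exists 0, 0; rewrite scale0r addr0.
- by exists 1, 0; rewrite scale1r addr0.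
- by exists (c + d), (n + m); split; [exact: augD|rewrite scalerDl addrACA].
- by exists (k * c), (k *: n); split; [exact: augZ|rewrite scalerDr scalerA].
exists 0, (c *: uiota x + uiota x * n); rewrite scale0r add0r mulrDr mulr_algr; split=> //.
by apply: augD; [apply/augZ/aug_uiota|apply: augM => //; exact: aug_uiota].
Qed.

(* By induction on the length of a word in N, as z x w = +-x z w + [z, x] w.    *)
Lemma reduce_mod_left_ideal (L : {vspace g}) (J : renv g -> Prop) :
  (N + L = fullv)%VS -> J 0 -> (forall a b, J a -> J b -> J (a + b)) ->
  (forall a b, J b -> J (a * b)) ->
  (forall t, t \in L -> exists c : K, J (uiota t - c%:A)) ->
  forall a, exists (c : K) n, aug n /\ J (a - (c%:A + n)).
Proof.
move=> NL J0 JD JM Jh.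
pose Y a := exists2 b, nspan b & J (a - b).
have JZ (c : K) b : J b -> J (c *: b) by move=> h; rewrite -[b]mul1r scalerAl; exact: JM.
have YD a b : Y a -> Y b -> Y (a + b).
  move=> [a' ha ja] [b' hb jb]; exists (a' + b'); first exact: nspanD.
  by rewrite opprD addrACA; exact: JD.
have YZ (c : K) a : Y a -> Y (c *: a).
  by move=> [a' ha ja]; exists (c *: a'); [exact: nspanZ|rewrite -scalerBr; exact: JZ].
have YM x a : x \in N -> Y a -> Y (uiota x * a).
  by move=> xN [a' ha ja]; exists (uiota x * a'); [exact: nspanM|rewrite -mulrBr; exact: JM].
have Y0 : Y 0 by exists 0; [exact: nspan0|rewrite subr0].
have Y1 : Y 1 by exists 1; [exact: nspan1|rewrite subrr].
have Yz b : nspan b -> forall z, Y (uiota z * b).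
  elim=> {b} [z|z|a b _ ha _ hb z|c a _ ha z|x a xN _ ha z].
  - by rewrite mulr0.
  - rewrite mulr1; have : z \in (N + L)%VS by rewrite NL memvf.
    case/memv_addP=> y yN [t tL ->]; rewrite linearD; apply: YD.
      by have := YM y 1 yN Y1; rewrite mulr1.
    by have [c hc] := Jh t tL; exists c%:A => //; apply: nspanZ; exact: nspan1.
  - by rewrite mulrDr; apply: YD.
  - by rewrite -scalerAr; apply: YZ.
  have hom i j y z' : y \in N -> y \in gr g i -> z' \in gr g j -> Y (uiota z' * (uiota y * a)).
    move=> yN yi zj; have e := uiota_br zj yi.
    have -> : uiota z' * (uiota y * a)
        = (-1) ^+ (j && i) *: (uiota y * (uiota z' * a)) + uiota (br z' y) * a.
      by rewrite -e mulrBl -scalerAl !mulrA addrC subrK.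
    by apply: YD => //; apply/YZ/YM.
  have [x0 [x1 [[n0 n1] g0 g1 ->]]] := gradedP (nd_graded hN) xN.
  have [z0 [z1 [k0 k1 ->]]] := gr_decomp z.
  rewrite !linearD /= mulrDl [X in uiota z0 * X]mulrDl [X in uiota z1 * X]mulrDl !mulrDr.
  exact: (YD _ _ (YD _ _ (hom _ _ _ _ n0 g0 k0) (hom _ _ _ _ n1 g1 k0))
    (YD _ _ (hom _ _ _ _ n0 g0 k1) (hom _ _ _ _ n1 g1 k1))).
have YS z a : Y a -> Y (uiota z * a).
  move=> [b hb jb]; have [b' hb' jb'] := Yz b hb z; exists b' => //.
  have -> : uiota z * a - b' = uiota z * (a - b) + (uiota z * b - b').
    by rewrite mulrBr addrA subrK.
  by apply: JD => //; exact: JM.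
have YR a : forall b, Y b -> Y (a * b).
  elim/renv_ind: a => [b _|b //|a a' ha ha' b hb|c a ha b hb|a a' ha ha' b hb|i x _ b hb].
  - by rewrite mul0r.
  - by rewrite mul1r.
  - by rewrite mulrDl; apply: YD; [exact: ha|exact: ha'].
  - by rewrite -scalerAl; apply: YZ; exact: ha.
  - by rewrite -mulrA; apply: ha; exact: ha'.
  - exact: YS.
move=> a; have [b hb jb] : Y a.
  by have := YR a 1 Y1; rewrite mulr1.
by have [c [n [hn e]]] := nspan_aug hb; exists c, n; rewrite -e.
Qed.

End Datum.
End Nilpotent.

(** * Highest weight modules *)

Lemma renv_graded (K : fieldType) (p : nat) (g : restrictedLSA K p) : graded_algebra (usuper g).
Proof.
split.
- exact: renv_gr0.
- exact: renv_gr1.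
- by move=> i j a b; exact: renv_grM.
- exact: renv_gr_sum.
Qed.

Lemma ss_all (K : fieldType) (A : superalg K) (M : gmodule A) :
  is_supermodule M -> @is_subsupermodule _ _ M (fun _ => True).
Proof.
by move=> h; split=> // x _; have [x0 [x1 [h0 h1 e]]] := gm_sum h x; exists x0, x1.
Qed.

Lemma ss_zero (K : fieldType) (A : superalg K) (M : gmodule A) :
  is_supermodule M -> @is_subsupermodule _ _ M (fun x => x = 0).
Proof.
move=> h; split=> [//|x y -> ->|a x ->|x ->]; rewrite ?subr0 ?scaler0 //.
by exists 0, 0; rewrite addr0; split=> //; exact: (gm_gr0 h).
Qed.

Lemma ss_sum (K : fieldType) (A : superalg K) (M : gmodule A) (P Q : M -> Prop) :
  is_supermodule M -> is_subsupermodule P -> is_subsupermodule Q ->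
  is_subsupermodule (fun x => exists y z, [/\ P y, Q z & x = y + z]).
Proof.
move=> hM hP hQ; split.
- by exists 0, 0; rewrite addr0; split=> //; [exact: ss_0 hP|exact: ss_0 hQ].
- move=> x x' [y [z [py qz ->]]] [y' [z' [py' qz' ->]]]; exists (y - y'), (z - z').
  by split; [exact: (ss_B hP)|exact: (ss_B hQ)|rewrite opprD addrACA].
- move=> a x [y [z [py qz ->]]]; exists (a *: y), (a *: z).
  by split; [exact: (ss_Z hP)|exact: (ss_Z hQ)|rewrite scalerDr].
move=> x [y [z [py qz ->]]].
have [y0 [y1 [p0 p1 g0 g1 ->]]] := ss_gr hP py.
have [z0 [z1 [q0 q1 k0 k1 ->]]] := ss_gr hQ qz.
exists (y0 + z0), (y1 + z1); split; first by exists y0, z0.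
- by exists y1, z1.
- exact: (gm_grD hM).
- exact: (gm_grD hM).
by rewrite addrACA.
Qed.

Section Cyclic.
Variables (K : fieldType) (A : superalg K) (M : gmodule A).

Lemma cyclic_sub (v : M) i : graded_algebra A -> is_supermodule M -> gm_gr i v ->
  is_subsupermodule (fun x : M => exists a : A, x = a *: v).
Proof.
move=> gA hM hv; split.
- by exists 0; rewrite scale0r.
- by move=> x y [a ->] [b ->]; exists (a - b); rewrite scalerBl.
- by move=> a x [b ->]; exists (a * b); rewrite scalerA.
move=> x [a ->]; have [a0 [a1 [h0 h1 ->]]] := sa_sum gA a.
have k0 := gm_act hM h0 hv; have k1 := gm_act hM h1 hv.
case: i hv k0 k1 => hv k0 k1.
  exists (a1 *: v), (a0 *: v); split=> //; [by exists a1|by exists a0|].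
  by rewrite scalerDl addrC.
exists (a0 *: v), (a1 *: v); split=> //; [by exists a0|by exists a1|].
by rewrite scalerDl.
Qed.

Lemma simple_cyclic (v : M) i : graded_algebra A -> simple M -> gm_gr i v -> v != 0 ->
  forall x, exists a : A, x = a *: v.
Proof.
move=> gA [hM _ hmin] hv v0; case: (hmin _ (cyclic_sub gA hM hv)) => // h.
by case/eqP: v0; apply: h; exists 1; rewrite scale1r.
Qed.

Lemma simple_indecomposable : simple M -> indecomposable M.
Proof.
move=> [hM nz hmin]; split=> // P Q hP hQ sPQ cPQ.
case: (hmin P hP) => h; first by left.
by right=> x qx; apply: cPQ.
Qed.

End Cyclic.

(* What highest weight theory needs of u(g), for g = Nop + L: modulo the left   *)
(* ideal that reduces L to scalars, A is spanned by 1 and nilpotent elements. *)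
Record reduction (K : fieldType) (A : superalg K) (V : vectType K) (u : V -> A)
    (L : {vspace V}) (nil : A -> Prop) : Prop := {
  rd_graded : graded_algebra A;
  rd_uD : forall x y, u (x + y) = u x + u y;
  rd_red : forall J : A -> Prop, J 0 -> (forall a b, J a -> J b -> J (a + b)) ->
    (forall a b, J b -> J (a * b)) ->
    (forall t, t \in L -> exists c : K, J (u t - c%:A)) ->
    forall a, exists (c : K) n, nil n /\ J (a - (c%:A + n));
  rd_D : forall n m, nil n -> nil m -> nil (n + m);
  rd_N : forall n, nil n -> nil (- n);
  rd_cancel : forall (M : gmodule A) (c : K) n (v : M), nil n -> c != 0 ->
    (c%:A + n) *: v = 0 -> v = 0;
  rd_unit : forall (M : gmodule A) (c : K) n (v : M), nil n -> c != 0 ->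
    exists a, v = a *: ((c%:A + n) *: v);
  rd_fin : exists (J : finType) (w : J -> A), forall a, exists c : J -> K,
    a = \sum_j (c j)%:A * w j
}.

Lemma renv_reduction (K : fieldType) (p : nat) (g : restrictedLSA K p) (N L : {vspace g}) :
  nil_datum N -> (N + L = fullv)%VS -> @reduction K (usuper g) g (@uiota _ _ g) L (aug N).
Proof.
move=> hN NL; split.
- exact: renv_graded.
- exact: (linearD (@uiota _ _ g)).
- by move=> J; exact: reduce_mod_left_ideal.
- exact: augD.
- by move=> n hn; have := augZ (-1) hn; rewrite scaleN1r.
- by move=> M; exact: aug_cancel.
- by move=> M; exact: aug_unit.
have [J [w hw]] := @renv_fin_span K p g g idfun (fun x y e => e) (fun i x e => e).
exists J, w => a; have [c ->] := hw a; exists c.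
by apply: eq_bigr => j _; rewrite (mulr_algl (c j) (w j : renv g)).
Qed.

Section HighestWeight.
Variables (K : fieldType) (A : superalg K) (g : vectType K) (u : g -> A).
Implicit Types (N h : {vspace g}) (lam : g -> K) (M S : gmodule A).

Definition weight_in h lam M (v : M) : Prop :=
  forall t, t \in h -> u t *: v = (lam t)%:A *: v.

Record hw_vector N h lam M (v : M) : Prop := {
  hw_gr : exists i, gm_gr i v;
  hw_neq0 : v != 0;
  hw_N : forall x, x \in N -> u x *: v = 0;
  hw_h : weight_in h lam v
}.

Variables (h Nup : {vspace g}) (nil : A -> Prop).
Hypothesis R : reduction u (h + Nup) nil.

Lemma cyclic_finite_dim M (v : M) : (forall x, exists a : A, x = a *: v) -> finite_dim M.
Proof.
move=> hv; have [J [w hw]] := rd_fin R; apply: (@finite_dimP _ _ M J (fun j => w j *: v)) => x.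
have [a ->] := hv x; have [c ->] := hw a; exists c.
by rewrite scaler_suml; apply: eq_bigr => j _; rewrite scalerA.
Qed.

(** The common annihilator of both vectors is a left ideal reducing h + Nup to scalars, so a single
    c and n describe the action of a on v and on s. *)
Lemma hw_reduce2 lam M S (v : M) (s : S) :
  (forall x, x \in Nup -> u x *: v = 0) -> weight_in h lam v ->
  (forall x, x \in Nup -> u x *: s = 0) -> weight_in h lam s ->
  forall a : A, exists (c : K) (n : A), [/\ nil n, a *: v = (c%:A + n) *: v
    & a *: s = (c%:A + n) *: s].
Proof.
move=> nv wv ns ws a.
have [|||t tL|c [n [hn [e1 e2]]]] := rd_red R
  (J := fun b => b *: v = 0 /\ b *: s = 0) _ _ _ _ a.
- by rewrite !scale0r.
- by move=> b c [h1 h2] [h3 h4]; rewrite !scalerDl h1 h2 h3 h4 !addr0.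
- by move=> b c [h1 h2]; rewrite -!scalerA h1 h2 !scaler0.
- case/memv_addP: tL => t' t'h [x xN ->]; exists (lam t').
  by split; rewrite (rd_uD R) scalerBl scalerDl ?(nv x) ?(ns x) ?(wv t') ?(ws t') // addr0 subrr.
by exists c, n; split=> //; apply/eqP; rewrite -subr_eq0 -scalerBl; apply/eqP.
Qed.

Lemma hw_reduce lam M (v : M) : hw_vector Nup h lam v ->
  forall a : A, exists (c : K) (n : A), nil n /\ a *: v = (c%:A + n) *: v.
Proof.
case=> _ _ nv wv a; have [c [n [hn e _]]] := hw_reduce2 nv wv nv wv a.
by exists c, n.
Qed.

Section Module.
Variables (lam : g -> K) (M : gmodule A) (v : M).
Hypotheses (hM : is_supermodule M) (hv : hw_vector Nup h lam v).
Hypothesis v_cyc : forall x, exists a : A, x = a *: v.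
Implicit Types (P Q : M -> Prop).

Lemma hw_sum_proper P Q : is_subsupermodule P -> is_subsupermodule Q ->
  (exists y z, [/\ P y, Q z & v = y + z]) -> P v \/ Q v.
Proof.
move=> hP hQ [y [z [py qz e]]].
have [a ea] := v_cyc y; have [c [n [hn e1]]] := hw_reduce hv a.
have [b eb] := v_cyc z; have [d [m [hm e2]]] := hw_reduce hv b.
have unit (T : M -> Prop) k (q : A) : is_subsupermodule T -> nil q -> k != 0 ->
    T ((k%:A + q) *: v) -> T v.
  by move=> hR hq k0 hr; have [f ->] := rd_unit R v hq k0; exact: (ss_Z hR).
have [c0|c0] := eqVneq c 0; last by left; apply: (unit P c n) => //; rewrite -e1 -ea.
right; apply: (unit Q d m) => //; last by rewrite -e2 -eb.
(* If both scalars vanish, then v = (n + m) v, which forces v = 0. *)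
apply/eqP => d0; case/eqP: (hw_neq0 hv).
have hnm := rd_N R (rd_D R hn hm).
apply: (rd_cancel R hnm (oner_neq0 K)).
rewrite scalerDl !scale1r scaleNr; apply/eqP; rewrite subr_eq0; apply/eqP.
by rewrite {1}e ea e1 eb e2 c0 d0 scale0r !add0r scalerDl.
Qed.

Lemma hw_full P : is_subsupermodule P -> P v -> forall x, P x.
Proof. by move=> hP pv x; have [a ->] := v_cyc x; exact: (ss_Z hP). Qed.

Lemma hw_indecomposable : indecomposable M.
Proof.
split=> //; first by exists v; exact: (hw_neq0 hv).
move=> P Q hP hQ sPQ cPQ; case: (hw_sum_proper hP hQ (sPQ v)) => /hw_full H.
  by right=> x qx; apply: cPQ => //; exact: H.
by left=> x px; apply: cPQ => //; exact: H.
Qed.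

(** The sum of two submodules missing v misses v by [hw_sum_proper], so the union of all of them is
    the largest submodule missing v; the quotient by it is simple. *)
Lemma hw_simple_quotient : exists S (s : S), simple S /\ hw_vector Nup h lam s.
Proof.
pose T (x : M) := exists P, [/\ is_subsupermodule P, ~ P v & P x].
have hR : is_subsupermodule T.
  split.
  - exists (fun x => x = 0); split=> //; first exact: ss_zero.
    by apply/eqP; exact: (hw_neq0 hv).
  - move=> x y [P [hP pv px]] [Q [hQ qv qy]].
    exists (fun x => exists y z, [/\ P y, Q z & x = y + z]); split.
    + exact: ss_sum.
    + by move=> /(hw_sum_proper hP hQ)[].
    by exists x, (- y); split=> //; rewrite -sub0r; apply: (ss_B hQ) => //; exact: ss_0 hQ.
  - by move=> a x [P [hP pv px]]; exists P; split=> //; exact: (ss_Z hP).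
  move=> x [P [hP pv px]]; have [x0 [x1 [p0 p1 g0 g1 e]]] := ss_gr hP px.
  by exists x0, x1; split=> //; exists P.
have Rv : ~ T v by case=> P [].
have hU := ss_all hM.
have TR x : T x -> True by [].
have [s es] := @sqm_elt _ _ M (fun _ => True) T v I.
have act (a : A) : a *: v = 0 -> a *: s = 0.
  by move=> e; apply: val_inj; rewrite sqm_val0 sqm_valZ es -linearZ /= e (raddf0 (mquo T)).
exists (sqm (fun _ => True) T), s; split.
  apply: (sqm_simple hM hU hR TR I Rv) => Q hQ RQ _.
  case: (pselect (Q v)) => Qv; first by right=> x _; exact: hw_full.
  by left=> x qx; exists Q.
have [i gv] := hw_gr hv; split.
- by exists i, v.
- apply/eqP => s0; apply: Rv; apply/(mquo_eq0P _ hR).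
  by rewrite -es s0 sqm_val0.
- by move=> x xN; apply: act; exact: (hw_N hv).
move=> t th; apply/eqP; rewrite -subr_eq0 -scalerBl; apply/eqP; apply: act.
by rewrite scalerBl (hw_h hv) // subrr.
Qed.

(** The relation sends a v to a s. Its values at 0 form a submodule of S. Were it all of S, some a
    would satisfy a v = 0 and a s = s; but a acts on both as the same c + n, and the first equation
    forces c = 0, the second then s = 0. *)
Lemma hw_simple_subquo S (s : S) : simple S -> hw_vector Nup h lam s -> subquo S M.
Proof.
move=> simS hs; have [hS _ hmin] := simS; have gA := rd_graded R.
have [i gv] := hw_gr hv; have [j gs] := hw_gr hs.
have red := hw_reduce2 (hw_N hv) (hw_h hv) (hw_N hs) (hw_h hs).
pose G (m : M) (w : S) := exists a : A, m = a *: v /\ w = a *: s.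
have Ggr m w : G m w -> exists x0 x1 s0 s1, [/\ G x0 s0, G x1 s1,
    gm_gr false x0 /\ gm_gr true x1, gm_gr (i (+) j) s0 /\ gm_gr (~~ (i (+) j)) s1
    & m = x0 + x1 /\ w = s0 + s1].
  move=> [a [-> ->]]; have [a0 [a1 [h0 h1 ->]]] := sa_sum gA a.
  have k0 := gm_act hM h0 gv; have k1 := gm_act hM h1 gv.
  have l0 := gm_act hS h0 gs; have l1 := gm_act hS h1 gs.
  have G0 : G (a0 *: v) (a0 *: s) by exists a0.
  have G1 : G (a1 *: v) (a1 *: s) by exists a1.
  case: i gv k0 k1 => /= _ k0 k1.
    exists (a1 *: v), (a0 *: v), (a1 *: s), (a0 *: s); rewrite negbK; split=> //.
    by rewrite !scalerDl addrC [a0 *: s + _]addrC.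
  by exists (a0 *: v), (a1 *: v), (a0 *: s), (a1 *: s); rewrite !scalerDl.
have GB x y t w : G x t -> G y w -> G (x - y) (t - w).
  by move=> [a [-> ->]] [b [-> ->]]; exists (a - b); rewrite !scalerBl.
have GZ (a : A) x t : G x t -> G (a *: x) (a *: t).
  by move=> [b [-> ->]]; exists (a * b); rewrite !scalerA.
have G00 : G 0 0 by exists 0; rewrite !scale0r.
exists G, (i (+) j); split=> //.
  by move=> w; have [a ->] := simple_cyclic gA simS gs (hw_neq0 hs) w; exists (a *: v), a.
have hK : is_subsupermodule (fun w => G 0 w).
  split=> //.
  - by move=> x y hx hy; rewrite -[0](subrr 0); exact: GB.
  - by move=> a x hx; rewrite -(scaler0 _ a); exact: GZ.
  move=> w /Ggr[x0 [x1 [s0 [s1 [h0 h1 [a0 a1] [b0 b1] [e ->]]]]]].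
  have [z0 z1] : 0 = x0 /\ 0 = x1.
    apply: (gm_decomp_uniq (i := false) hM) => //; try exact: (gm_gr0 hM).
    by rewrite addr0.
  rewrite -z0 in h0; rewrite -z1 in h1.
  case: (i (+) j) b0 b1 => /= b0 b1; last by exists s0, s1.
  by exists s1, s0; rewrite addrC.
case: (hmin _ hK) => // all; case/eqP: (hw_neq0 hs).
have [a [e1 e2]] := all s; have [c [n [hn f1 f2]]] := red a.
have [c0|c0] := eqVneq c 0; last first.
  by case/eqP: (hw_neq0 hv); apply: (rd_cancel R hn c0); rewrite -f1 -e1.
apply: (rd_cancel R (rd_N R hn) (oner_neq0 K)).
rewrite scalerDl !scale1r scaleNr; apply/eqP; rewrite subr_eq0; apply/eqP.
by rewrite {1}e2 f2 c0 scale0r add0r.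
Qed.

End Module.

Lemma linked_subquo S T M : simple S -> simple T -> indecomposable M -> finite_dim M ->
  subquo S M -> subquo T M -> linked S T.
Proof.
move=> hS hT hM fM sS sT; have [sM _ _] := hM.
by apply: (linked_indec hS hT hM fM); exact: subquo_comp_factor.
Qed.

Lemma linked_same_weight lam S (T : gmodule A) (s : S) (t : T) : simple S -> simple T ->
  hw_vector Nup h lam s -> hw_vector Nup h lam t -> linked S T.
Proof.
move=> hS hT hs ht; have [sS _ _] := hS; have [i gs] := hw_gr hs.
have cyc := simple_cyclic (rd_graded R) hS gs (hw_neq0 hs).
apply: (linked_subquo hS hT (simple_indecomposable hS) (cyclic_finite_dim cyc)).
  exact: subquo_refl.
exact: (hw_simple_subquo sS hs hT ht).
Qed.

End HighestWeight.

Notation hwv N h lam v :=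
  (@hw_vector _ (usuper _) _ (@uiota _ _ _ : _ -> usuper _) N h lam _ v).

(** * Existence of highest weight vectors *)

Lemma scalar_inj (K : fieldType) (A : algType K) (M : lmodType A) (c d : K) (y : M) :
  y != 0 -> (c%:A : A) *: y = (d%:A : A) *: y -> c = d.
Proof.
move=> y0 /eqP; rewrite -subr_eq0 -scalerBl -scalerBl => /eqP h.
apply/eqP; rewrite -subr_eq0; apply: contraNT y0 => cd.
rewrite -[y]scale1r -[X in X *: y](scale1r (1 : A)) -(mulVf cd) -scalerA.
by rewrite -[(c - d) *: 1]mul1r scalerAl -scalerA h scaler0.
Qed.

Lemma scalar_comm (K : fieldType) (A : algType K) (M : lmodType A) (a : A) (c : K) (y : M) :
  a *: ((c%:A : A) *: y) = (c%:A : A) *: (a *: y).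
Proof. by rewrite !scalerA mulr_algr mulr_algl. Qed.

Lemma scalar_mul (K : fieldType) (A : algType K) (M : lmodType A) (c d : K) (y : M) :
  (c%:A : A) *: ((d%:A : A) *: y) = ((c * d)%:A : A) *: y.
Proof. by rewrite scalerA mulr_algl scalerA. Qed.

Lemma scalar_act (K : fieldType) (A : algType K) (M : lmodType A) (a : A) (c : K) (y : M) :
  (c *: a) *: y = (c%:A : A) *: (a *: y).
Proof. by rewrite scalerA mulr_algl. Qed.

Lemma eigen_exp (K : fieldType) (A : algType K) (M : lmodType A) (a : A) (c : K) n (y : M) :
  a *: y = (c%:A : A) *: y -> a ^+ n *: y = ((c ^+ n)%:A : A) *: y.
Proof.
move=> e; elim: n => [|n IH]; first by rewrite !expr0 !scale1r.
by rewrite exprSr -scalerA e scalar_comm IH scalar_mul -exprS.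
Qed.

Section Eigenvector.
Variables (K : closedFieldType) (A : algType K) (M : lmodType A) (T : A) (Q : M -> Prop).
Hypothesis QC : forall (c : K) y z, Q y -> Q z -> Q ((c%:A : A) *: y + z).
Hypothesis QT : forall y, Q y -> Q (T *: y).

(** Apply the linear factors to y one after another: the last nonzero vector reached is an
    eigenvector. *)
Lemma eigenvector_roots (rs : seq K) y : Q y -> y != 0 ->
  horner_alg T (\prod_(r <- rs) ('X - r%:P)) *: y = 0 ->
  exists y' (r : K), [/\ Q y', y' != 0 & T *: y' = (r%:A : A) *: y'].
Proof.
elim: rs y => [|r rs IH] y Qy y0.
  by rewrite big_nil rmorph1 scale1r => e; rewrite e eqxx in y0.
rewrite big_cons mulrC rmorphM -scalerA rmorphB /= horner_algX horner_algC => e.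
have [z0|z0] := eqVneq ((T - r%:A) *: y) 0; last first.
  apply: IH e => //; rewrite scalerBl -scaleNr -scaleNr addrC; apply: QC => //.
  exact: QT.
exists y, r; split=> //; apply/eqP; rewrite -subr_eq0 -scalerBl; exact/eqP.
Qed.

Lemma eigenvector (q : {poly K}) y : Q y -> y != 0 -> q != 0 -> horner_alg T q = 0 ->
  exists y' (r : K), [/\ Q y', y' != 0 & T *: y' = (r%:A : A) *: y'].
Proof.
move=> Qy y0 q0 hq; have [rs e] := closed_field_poly_normal q.
apply: (eigenvector_roots (rs := rs) Qy y0).
set P := \prod_(r <- rs) _ in e *; suff -> : horner_alg T P = 0 by rewrite scale0r.
have <- : (lead_coef q)^-1 *: q = P.
  by rewrite [X in _ *: X]e scalerA mulVf ?lead_coef_eq0 // scale1r.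
by rewrite -mul_polyC rmorphM /= hq mulr0.
Qed.

End Eigenvector.

(** The joint eigenspace found for the earlier operators is stable under the next one, which
    commutes with them, and takes the role of Q. *)
Lemma joint_eigenvector (K : closedFieldType) (A : algType K) (M : lmodType A) (Q : M -> Prop)
    (ts : seq A) y :
  (forall (c : K) y z, Q y -> Q z -> Q ((c%:A : A) *: y + z)) ->
  (forall T y, T \in ts -> Q y -> Q (T *: y)) ->
  {in ts &, forall T U, T * U = U * T} ->
  (forall T, T \in ts -> exists q : {poly K}, q != 0 /\ horner_alg T q = 0) ->
  Q y -> y != 0 -> exists z, [/\ Q z, z != 0
    & forall T, T \in ts -> exists c : K, T *: z = (c%:A : A) *: z].
Proof.
move=> QC; elim: ts => [|T ts IH] QT com ann Qy y0; first by exists y.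
have ts_in U : U \in ts -> U \in T :: ts by rewrite inE => ->; rewrite orbT.
have T_in : T \in T :: ts by rewrite inE eqxx.
have [|U V /ts_in hU /ts_in hV|U /ts_in|z [Qz z0 ez]] := IH _ _ _ Qy y0.
- by move=> U w /ts_in; exact: QT.
- exact: com.
- exact: ann.
have /choice[d hd] U : exists d : K, U \in ts -> U *: z = (d%:A : A) *: z.
  by case: (boolP (U \in ts)) => hU; [have [d hd] := ez U hU; exists d|exists 0].
have [q [q0 hq]] := ann T T_in.
pose R w := Q w /\ forall U, U \in ts -> U *: w = ((d U)%:A : A) *: w.
have [k w w' [h1 h2] [h3 h4]|w [h1 h2]||z' [k [[Q1 R1] z'0 ez']]] :=
  eigenvector (T := T) (Q := R) _ _ _ z0 q0 hq.
- split=> [|U hU]; first exact: QC.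
  by rewrite !scalerDr scalar_comm (h2 U hU) (h4 U hU) scalar_comm.
- split=> [|U hU]; first exact: QT.
  by rewrite scalerA (com U T (ts_in U hU) T_in) -scalerA (h2 U hU) scalar_comm.
- by split.
exists z'; split=> // U; rewrite inE => /orP[/eqP ->|hU]; first by exists k.
by exists (d U); exact: R1.
Qed.

(** The relation gives X - \sum_i c_i X^(n_i), whose coefficient at X is 1 because all n_i exceed
    1. *)
Lemma annihilating_poly (K : fieldType) (A : algType K) (T : A) r (c : 'I_r -> K) (n : 'I_r -> nat) :
  (forall i, (1 < n i)%N) -> T = \sum_i c i *: T ^+ n i ->
  exists q : {poly K}, q != 0 /\ horner_alg T q = 0.
Proof.
move=> n2 e; exists ('X - \sum_i c i *: 'X^(n i)); split.
  apply/eqP => /(congr1 (fun q : {poly K} => q`_1)); rewrite coefB coefX coef_sum coef0.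
  rewrite big1 ?subr0 => [|i _]; first by move/eqP; rewrite oner_eq0.
  by rewrite coefZ coefXn; case: eqP (n2 i) => [<-//|_ _]; rewrite mulr0.
rewrite rmorphB /= horner_algX rmorph_sum /= {1}e; apply/eqP; rewrite subr_eq0; apply/eqP.
by apply: eq_bigr => i _; rewrite -mul_polyC rmorphM rmorphXn /= horner_algX horner_algC mulr_algl.
Qed.

(** The relation reads T = T (T w) with w commuting with T, hence T = T (T w)^k = 0. *)
Lemma nilpotent_annihilated (K : fieldType) (A : algType K) (T : A) r (c : 'I_r -> K)
    (n : 'I_r -> nat) k :
  (forall i, (1 < n i)%N) -> T = \sum_i c i *: T ^+ n i -> T ^+ k = 0 -> T = 0.
Proof.
move=> n2 e hk; pose w := \sum_i c i *: T ^+ (n i).-2.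
have ew : T = T * (T * w).
  rewrite {1}e !mulr_sumr; apply: eq_bigr => i _; rewrite -!scalerAr -!exprS.
  by case: (n i) (n2 i) => [|[|m]].
have H m : T = T * (T * w) ^+ m.
  by elim: m => [|m IH]; rewrite ?expr0 ?mulr1 // exprS mulrA -ew.
have cm : GRing.comm T w.
  by apply: commr_sum => i _; rewrite /GRing.comm -scalerAr -scalerAl -exprS -exprSr.
by rewrite (H k) exprMn_comm // hk mul0r mulr0.
Qed.

(** * Semisimple elements and tori *)

Section Torus.
Variables (K : fieldType) (p : nat) (g : restrictedLSA K p).
Implicit Types (N h : {vspace g}).

Lemma p_gt1 : (1 < p)%N.
Proof. exact: prime_gt1 (pcharf_prime (lsa_pchar g)). Qed.

Lemma semisimpleE (t : g) : semisimple_elt t ->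
  exists r (c : 'I_r -> K), t = \sum_i c i *: iter i.+1 (@pm _ _ g) t.
Proof.
case=> r; set s := map _ _ => ht.
have sz : size s = r by rewrite size_map size_iota.
have /coord_span -> : t \in <<in_tuple s>>%VS by [].
exists (size s), (fun i => coord (in_tuple s) i t); apply: eq_bigr => i _.
congr (_ *: _); rewrite -tnth_nth (tnth_nth 0) /= (nth_map 0%N) ?size_iota -?sz //.
by rewrite nth_iota -?sz // add0n; have /coord_span <- : t \in <<in_tuple s>>%VS by [].
Qed.

Lemma semisimple_uiota (t : g) : t \in gr g false -> semisimple_elt t ->
  exists r (c : 'I_r -> K) (n : 'I_r -> nat), (forall i, (1 < n i)%N) /\
    (uiota t : renv g) = \sum_i c i *: uiota t ^+ n i.
Proof.
move=> t0 /semisimpleE[r [c e]]; exists r, c, (fun i => p ^ i.+1)%N; split.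
  by move=> i; rewrite -[1%N](expn0 p) ltn_exp2l ?p_gt1.
rewrite {1}e linear_sum; apply: eq_bigr => i _; rewrite linearZ /=.
by rewrite -(uiota_pm_iter i.+1 t0).
Qed.

(** In u(g) such an element is nilpotent, and by semisimplicity it is a combination of higher powers
    of itself. *)
Lemma torus_aug N h t : nil_datum N -> is_torus h -> t \in h -> aug N (uiota t) -> t = 0.
Proof.
move=> hN hh th ht; have t0 := subvP (torus_even hh) _ th.
have [r [c [n [n2 e]]]] := semisimple_uiota t0 (torus_semisimple hh th).
have [k hk] := aug_nilp hN ht.
apply: (@uiota_injective K p g g idfun (fun x y e => e) (fun i x e => e)).
by rewrite (nilpotent_annihilated n2 e hk) linear0.
Qed.

(** Closure under the p-map is not part of [nil_datum]. The torus component of [pm n] is, in u(g),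
    n^p minus an element of N; hence it satisfies [aug] and vanishes. *)
Lemma torus_sum_pm N h n : nil_datum N -> is_torus h -> (N + h = fullv)%VS ->
  n \in N -> n \in gr g false -> pm n \in N.
Proof.
move=> hN hh Nh nN n0.
have : pm n \in (N + h)%VS by rewrite Nh memvf.
case/memv_addP=> n' n'N [t th e].
suff t0 : t = 0 by rewrite e t0 addr0.
apply: (torus_aug hN hh th).
have -> : t = pm n - n' by rewrite e addrC addKr.
rewrite linearB /= -uiota_pm //; apply: augD => //.
  have H m : (0 < m)%N -> aug N (uiota n ^+ m).
    case: m => // m _; elim: m => [|m IH]; first exact: aug_uiota.
    by rewrite exprS; apply: augM => //; exact: aug_uiota.
  exact/H/ltnW/p_gt1.
by have := augZ (-1) (aug_uiota n'N); rewrite scaleN1r.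
Qed.

End Torus.

Lemma gr_annihilated (K : fieldType) (A : superalg K) (M : gmodule A) i (a : A) (x y : M) :
  is_supermodule M -> sa_gr i a -> gm_gr false x -> gm_gr true y -> a *: (x + y) = 0 ->
  a *: x = 0 /\ a *: y = 0.
Proof.
move=> hM ha hx hy; rewrite scalerDr => e.
have h1 := gm_act hM ha hx; have h2 := gm_act hM ha hy; rewrite addbF in h1; rewrite addbT in h2.
have [|-> -> //] := gm_decomp_uniq hM h1 (gm_gr0 hM i) h2 (gm_gr0 hM (~~ i)).
by rewrite e addr0.
Qed.

(** N is graded and h is even, so both homogeneous components of y satisfy the same conditions, and
    one of them is nonzero. *)
Lemma homogeneous_hw (K : fieldType) (p : nat) (g : restrictedLSA K p) (A : superalg K) (u : g -> A)
    (N h : {vspace g}) lam (M : gmodule A) (y : M) :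
  (forall x z, u (x + z) = u x + u z) -> (forall i x, x \in gr g i -> sa_gr i (u x)) ->
  (forall (c : K) (a : A), sa_gr false a -> sa_gr false (a - c%:A)) ->
  graded N -> (h <= gr g false)%VS -> is_supermodule M ->
  y != 0 -> (forall x, x \in N -> u x *: y = 0) -> weight_in u h lam y ->
  exists s : M, hw_vector u N h lam s.
Proof.
move=> uD ugr gc gN h0 hM y0 yN yh; have [y1 [y2 [g1 g2 e]]] := gm_sum hM y.
have kN x : x \in N -> u x *: y1 = 0 /\ u x *: y2 = 0.
  move=> xN; have [x0 [x1 [[n0 n1] k0 k1 ->]]] := gradedP gN xN.
  have [|a1 a2] := gr_annihilated hM (ugr _ _ k0) g1 g2; first by rewrite -e yN.
  have [|b1 b2] := gr_annihilated hM (ugr _ _ k1) g1 g2; first by rewrite -e yN.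
  by rewrite uD !scalerDl a1 a2 b1 b2 !addr0.
have kh t : t \in h -> u t *: y1 = (lam t)%:A *: y1 /\ u t *: y2 = (lam t)%:A *: y2.
  move=> th; have ut := gc (lam t) _ (ugr _ _ (subvP h0 _ th)).
  have [|/eqP e1 /eqP e2] := gr_annihilated hM ut g1 g2.
    by rewrite -e scalerBl yh // subrr.
  by move: e1 e2; rewrite !scalerBl !subr_eq0 => /eqP -> /eqP ->.
have [y10|y10] := eqVneq y1 0; last first.
  by exists y1; split=> //; [exists false|move=> x /kN[]|move=> t /kh[]].
exists y2; split; [by exists true| |by move=> x /kN[]|by move=> t /kh[]].
by apply: contra y0 => /eqP y20; rewrite e y10 y20 addr0.
Qed.

Section WeightVectors.
Variables (K : closedFieldType) (p : nat) (g : restrictedLSA K p).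
Variables (N h : {vspace g}).
Hypotheses (hh : is_torus h).

(** The eigenvalue is linear in t, and it is restricted because [pm t] acts as the p-th power of
    t. *)
Lemma weight_exists (M : lmodType (renv g)) (y : M) : y != 0 ->
  (forall t, t \in h -> exists c : K, (uiota t : renv g) *: y = (c%:A : renv g) *: y) ->
  exists lam : Lambda h,
    forall t, t \in h -> (uiota t : renv g) *: y = ((wt (sval lam) t)%:A : renv g) *: y.
Proof.
move=> y0 H.
have /choice[c hc] : forall t, exists c : K, t \in h -> (uiota t : renv g) *: y = (c%:A : renv g) *: y.
  move=> t; case: (boolP (t \in h)) => th; last by exists 0.
  by have [c hc] := H t th; exists c.
pose F (w : subvs_of h) : K^o := c (vsval w).
have Flin : linear F.
  move=> k w z; apply: (scalar_inj (A := renv g) y0); rewrite /F -hc ?subvsP //.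
  have -> : uiota (vsval (k *: w + z)) = k *: uiota (vsval w) + uiota (vsval z) :> renv g.
    have -> : vsval (k *: w + z) = k *: vsval w + vsval z by exact: linearP.
    exact: (linearP (@uiota K p g)).
  by rewrite scalerDl scalar_act !hc ?subvsP // scalar_mul -scalerDl -scalerDl.
pose FL : {linear subvs_of h -> K^o} := HB.pack F (GRing.isLinear.Build _ _ _ _ F Flin).
have wF t : t \in h -> wt (linfun FL) t = c t by move=> th; rewrite /wt lfunE /= /F vsprojK.
have hp t : t \in h -> wt (linfun FL) (pm t) = wt (linfun FL) t ^+ p.
  move=> th; have pth := torus_pm hh th; rewrite !wF //; apply: (scalar_inj (A := renv g) y0).
  rewrite -hc // -uiota_pm; last exact: (subvP (torus_even hh)).
  by apply: eigen_exp; exact: hc.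
by exists (exist _ _ hp) => t th /=; rewrite wF // hc.
Qed.

Hypothesis hN : nil_datum N.
Hypothesis h_ad : stable h N.

(** Products of k0 elements of N vanish in u(g), hence on every module. A nonzero vector of least
    depth in the filtration [mk] is killed by N. *)
Lemma killed_vector (M : lmodType (renv g)) (z : M) : z != 0 ->
  exists y : M, y != 0 /\ forall x, x \in N -> (uiota x : renv g) *: y = 0.
Proof.
pose mk := fix mk k (y : M) : Prop :=
  if k is k'.+1 then forall x, x \in N -> mk k' ((uiota x : renv g) *: y) else y = 0.
have mkP k a (y : M) : kills N k a -> mk k (a *: y).
  elim: k a => [a /= ->|k IH a hk x xN]; first by rewrite scale0r.
  by rewrite scalerA; apply: IH; exact: hk.
have [k0 hk0] := kills_all hN.
move=> z0; have ex : exists k, `[< exists y, y != 0 /\ mk k y >].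
  by exists k0; apply/asboolP; exists z; split=> //; rewrite -[z]scale1r; exact: mkP.
case: (ex_minnP ex) => -[|k] /asboolP[y [y0 hy]] kmin; first by rewrite hy eqxx in y0.
exists y; split=> // x xN; apply/eqP; apply: contraT => xy0.
have : (k.+1 <= k)%N by apply: kmin; apply/asboolP; exists ((uiota x : renv g) *: y); split=> //; exact: hy.
by rewrite ltnn.
Qed.

Lemma killed_torus (M : lmodType (renv g)) (y : M) t :
  (forall x, x \in N -> (uiota x : renv g) *: y = 0) -> t \in h ->
  forall x, x \in N -> (uiota x : renv g) *: ((uiota t : renv g) *: y) = 0.
Proof.
move=> hy th x xN; have t0 := subvP (torus_even hh) _ th.
have hom i z : z \in N -> z \in gr g i -> (uiota z : renv g) *: ((uiota t : renv g) *: y) = 0.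
  move=> zN zi; have e := uiota_br t0 zi; rewrite /= expr0 scale1r in e.
  have -> : (uiota z : renv g) *: ((uiota t : renv g) *: y)
     = (uiota t : renv g) *: ((uiota z : renv g) *: y) - (uiota (br t z) : renv g) *: y.
    by rewrite -e scalerBl !scalerA opprB addrC subrK.
  by rewrite !hy ?scaler0 ?subr0 //; exact: h_ad.
have [x0 [x1 [[n0 n1] g0 g1 ->]]] := gradedP (nd_graded hN) xN.
by rewrite linearD /= scalerDl (hom _ _ n0 g0) (hom _ _ n1 g1) addr0.
Qed.

Lemma uiota_torus_comm t t' : t \in h -> t' \in h -> uiota t * uiota t' = uiota t' * uiota t :> renv g.
Proof.
move=> th th'; have := uiota_br (subvP (torus_even hh) _ th) (subvP (torus_even hh) _ th').
by rewrite (torus_abelian hh th th') /= expr0 scale1r linear0 => /eqP; rewrite subr_eq0 => /eqP.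
Qed.

Lemma eigen_list (M : lmodType (renv g)) (z : M) (s : seq g) : z != 0 ->
  (forall t, t \in s -> t \in h) ->
  exists y : M, [/\ y != 0, forall x, x \in N -> (uiota x : renv g) *: y = 0
    & forall t, t \in s -> exists c : K, (uiota t : renv g) *: y = (c%:A : renv g) *: y].
Proof.
move=> z0 hs; have [y [y0 yN]] := killed_vector z0.
have tsP (T : renv g) : T \in map (@uiota _ _ g) s -> exists2 t, t \in h & T = uiota t.
  by case/mapP=> t /hs th ->; exists t.
have [|T w /tsP[t th ->] hw|T U /tsP[t th ->] /tsP[t' th' ->]|T /tsP[t th ->]|w [Qw w0 ew]] :=
  @joint_eigenvector K (renv g) M (fun w => forall x, x \in N -> (uiota x : renv g) *: w = 0)
    (map (@uiota _ _ g) s) y _ _ _ _ yN y0.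
- move=> c w w' h1 h2 x xN.
  apply: (etrans (scalerDr _ _ _)); rewrite h2 // addr0 scalar_comm h1 //; exact: scaler0.
- exact: killed_torus.
- exact: uiota_torus_comm.
- have [r [c [n [n2 e]]]] := semisimple_uiota (subvP (torus_even hh) _ th) (torus_semisimple hh th).
  exact: (annihilating_poly n2 e).
by exists w; split=> // t ts; apply: ew; exact: map_f.
Qed.

Lemma weight_vector_exists (M : lmodType (renv g)) (z : M) : z != 0 ->
  exists (y : M) (lam : Lambda h), [/\ y != 0, forall x, x \in N -> (uiota x : renv g) *: y = 0
    & forall t, t \in h -> (uiota t : renv g) *: y = ((wt (sval lam) t)%:A : renv g) *: y].
Proof.
move=> z0; have [|y [y0 hy ey]] := @eigen_list M z (vbasis h) z0; first by move=> t; exact: vbasis_mem.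
have [|lam hl] := weight_exists y0; last by exists y, lam.
move=> t th; rewrite (coord_vbasis th).
elim/big_ind: _ => [|a b [c hc] [d hd]|i _].
- by exists 0; rewrite linear0 scale0r !scale0r.
- by exists (c + d); rewrite linearD /= scalerDl hc hd scalerDl scalerDl.
have [|c hc] := ey (vbasis h)`_i; first by rewrite mem_nth // size_tuple.
exists (coord (vbasis h) i t * c).
by rewrite linearZ /= scalar_act hc scalar_mul.
Qed.

Lemma simple_hw_vector (S : gmodule (usuper g)) : simple S -> exists (lam : Lambda h) (s : S),
  hwv N h (wt (sval lam)) s.
Proof.
move=> hS; have [sS [z z0] _] := hS.
have [y [lam [y0 yN yh]]] := @weight_vector_exists (gm_mod S) z z0.
exists lam; apply: (@homogeneous_hw K p g (usuper g) (@uiota _ _ g)) y0 yN yh => //.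
- exact: (linearD (@uiota _ _ g)).
- by move=> i x; exact: renv_gr_uiota.
- by move=> c a ha; rewrite -scaleNr; apply: renv_grD => //; exact: (renv_grZ _ (renv_gr1 g)).
- exact: nd_graded.
- exact: torus_even.
Qed.

End WeightVectors.

(** * One-dimensional modules over Borel subalgebras *)

Lemma regular_scale1 (R : pzRingType) (a : R) : a *: (1 : R^o) = a :> R.
Proof. exact: mulr1. Qed.

Section CharacterModule.
Variables (K : fieldType) (p : nat) (g : restrictedLSA K p) (eps : {lrmorphism renv g -> K^o}).
Hypothesis eps_odd : forall a, renv_gr true a -> eps a = 0.

(** The line on which u(g) acts through [eps], realized as the regular module modulo the kernel so
    that it is a left module by construction. *)
Definition char_mod := @quot_mod (renv g) ((renv g)^o) (fun a => eps a = 0).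

Definition character_module : gmodule (usuper g) :=
  @Gmodule K (usuper g) char_mod (fun i x => if i then x = 0 else True).

Lemma char_mod_gen a : submod_gen (fun a : (renv g)^o => eps a = 0) a -> eps a = 0.
Proof.
elim=> {a} [a //||x y _ hx _ hy|a x _ hx].
- exact: raddf0.
- by rewrite raddfB /= hx hy subrr.
- by rewrite rmorphM /= hx mulr0.
Qed.

Lemma char_mod_scale (x : char_mod) : exists c : K,
  x = (c%:A : renv g) *: (mquo _ (1 : (renv g)^o) : char_mod).
Proof.
elim/mquo_ind: x => a; exists (eps a); rewrite -mquo_is_scalable; apply/mquo_eq; apply: sg_in.
by rewrite regular_scale1 raddfB /= linearZ /= rmorph1 [X in _ - X]mulr1 subrr.
Qed.

Lemma char_mod_act a : a *: (mquo _ (1 : (renv g)^o) : char_mod)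
  = ((eps a : K)%:A : renv g) *: (mquo _ (1 : (renv g)^o) : char_mod).
Proof.
rewrite -!mquo_is_scalable; apply/mquo_eq; apply: sg_in.
by rewrite !regular_scale1 raddfB /= linearZ /= rmorph1 [X in _ - X]mulr1 subrr.
Qed.

Lemma char_mod_neq0 : (mquo _ (1 : (renv g)^o) : char_mod) != 0.
Proof.
apply/eqP; rewrite -(raddf0 (mquo (fun a : (renv g)^o => eps a = 0))) => /mquo_eq.
by rewrite subr0 => /char_mod_gen; rewrite rmorph1 => /eqP; rewrite oner_eq0.
Qed.

Lemma character_module_supermodule : is_supermodule character_module.
Proof.
split.
- by case.
- by case=> //= x y -> ->; rewrite subr0.
- by move=> x; exists x, 0; rewrite addr0.
- by [].
move=> i j a x ha; case: j => [-> /=|_]; first by rewrite scaler0; case: i ha.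
rewrite addbF; case: i ha => //= ha.
have [c ->] := char_mod_scale x.
have := scalar_comm (A := renv g) a c (mquo _ (1 : (renv g)^o) : char_mod).
by rewrite (char_mod_act a) (eps_odd ha) scale0r scale0r scaler0.
Qed.

End CharacterModule.

Lemma line_simple (K : fieldType) (A : superalg K) (M : gmodule A) (v : M) :
  is_supermodule M -> v != 0 -> (forall x, exists c : K, x = (c%:A : A) *: v) -> simple M.
Proof.
move=> hM v0 hv; split=> //; first by exists v.
move=> P hP; have [h|/existsNP[x /not_implyP[px /eqP x0]]] := pselect (forall x, P x -> x = 0).
  by left.
right=> y; have [c ec] := hv x; have [d ->] := hv y.
have c0 : c != 0 by apply: contraNneq x0 => c0; rewrite ec c0 scale0r scale0r.
have -> : v = ((c^-1)%:A : A) *: x by rewrite ec scalar_mul mulVf // scale1r scale1r.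
by apply: (ss_Z hP); exact: (ss_Z hP).
Qed.

Lemma line_homogeneous (K : fieldType) (A : superalg K) (M : gmodule A) (v : M) :
  is_supermodule M -> v != 0 -> (forall x, exists c : K, x = (c%:A : A) *: v) ->
  exists i c, gm_gr i ((c%:A : A) *: v) /\ (c%:A : A) *: v != 0.
Proof.
move=> hM v0 hv; have [y [z [hy hz e]]] := gm_sum hM v.
have [c ec] := hv y; have [d ed] := hv z.
have [y0|y0] := eqVneq y 0; last by exists false, c; rewrite -ec.
by exists true, d; rewrite -ed; split=> //; move: v0; rewrite e y0 add0r.
Qed.

Section Characters.
Variables (K : fieldType) (p : nat) (g : restrictedLSA K p) (N h : {vspace g}).

Record borel : Prop := {
  bo_sum : (N + h = fullv)%VS;
  bo_cap : (N :&: h = 0)%VS;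
  bo_nil : nil_datum N;
  bo_torus : is_torus h;
  bo_ideal : forall x y, y \in N -> br x y \in N
}.

Hypothesis B : borel.

Lemma borel_decomp x : exists n t, [/\ n \in N, t \in h & x = n + t].
Proof.
have : x \in (N + h)%VS by rewrite (bo_sum B) memvf.
by case/memv_addP=> n hn [t ht ->]; exists n, t.
Qed.

Lemma borel_ideal_l x y : y \in N -> br y x \in N.
Proof.
have hom i j u v : u \in N -> u \in gr g i -> v \in gr g j -> br u v \in N.
  move=> uN ui vj; rewrite (br_skew (lsaP g) ui vj) memvN memvZ //; exact: (bo_ideal B).
move=> yN; have [y0 [y1 [[n0 n1] g0 g1 ->]]] := gradedP (nd_graded (bo_nil B)) yN.
have [x0 [x1 [k0 k1 ->]]] := gr_decomp x.
by rewrite !brDl !brDr !memvD //; [exact: hom n0 g0 k0|exact: hom n0 g0 k1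
  |exact: hom n1 g1 k0|exact: hom n1 g1 k1].
Qed.

Lemma borel_odd x : x \in gr g true -> x \in N.
Proof.
move=> x1; have [n [t [nN th e]]] := borel_decomp x.
have [n0 [n1 [[a0 a1] g0 g1 en]]] := gradedP (nd_graded (bo_nil B)) nN.
have t0 := subvP (torus_even (bo_torus B)) _ th.
have ex : x + 0 = n1 + (n0 + t) by rewrite addr0 e en [n0 + n1]addrC addrA.
have [-> //] := gr_decomp_uniq (i := true) x1 g1 (mem0v _) (memvD g0 t0) ex.
Qed.

(** Every correction term in Jacobson's formula is an iterated bracket starting from n, hence lies
    in the ideal N. *)
Lemma borel_pm n t : n \in N -> n \in gr g false -> t \in h -> exists n',
  n' \in N /\ pm (n + t) = n' + pm t.
Proof.
move=> nN n0 th; have t0 := subvP (torus_even (bo_torus B)) _ th.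
exists (pm n + \sum_(1 <= i < p) jacobson_s (@br _ _ g) p i n t); split; last first.
  by rewrite (pmD (lsaP g)) // -!addrA; congr (_ + _); rewrite addrC.
apply: memvD.
  by apply: (torus_sum_pm (bo_nil B) (bo_torus B) (bo_sum B)).
apply: rpred_sum => i _; apply: memvZ.
elim: (p.-1) (i.-1) => [|m IH] [|j] //=; rewrite ?mem0v //.
  by rewrite add0r; exact: (bo_ideal B).
by apply: memvD; exact: (bo_ideal B).
Qed.

Variable lam : {linear g -> K^o}.
Hypothesis lam_pm : forall t, t \in h -> lam (pm t) = lam t ^+ p.

Definition lam_ext (x : g) : K^o := lam (daddv_pi h N x).

Fact lam_ext_linear : linear lam_ext.
Proof. by move=> c x y; rewrite /lam_ext !linearP. Qed.
HB.instance Definition _ := GRing.isLinear.Build K g K^o *:%R lam_ext lam_ext_linear.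

Lemma lam_extE n t : n \in N -> t \in h -> lam_ext (n + t) = lam t.
Proof.
move=> nN th; have hN : (h :&: N = 0)%VS by rewrite capvC; exact: bo_cap B.
rewrite /lam_ext linearD /= (daddv_pi_id hN th).
have := daddv_pi_add hN (w := n); rewrite (daddv_pi_id (bo_cap B) nN).
rewrite addvC (bo_sum B) memvf => /(_ isT); rewrite -[X in _ = X]add0r => /addIr ->.
by rewrite add0r.
Qed.

Lemma lam_extN n : n \in N -> lam_ext n = 0.
Proof. by move=> nN; rewrite -[n]addr0 lam_extE ?mem0v // linear0. Qed.

Lemma lam_ext_compat : Uenv_compat lam_ext.
Proof.
split=> [i j x y xi yj|x x1]; last first.
  have xN := borel_odd x1; rewrite /= lam_extN // expr2 mul0r lam_extN //.
  by apply: (nd_sq (bo_nil B)); rewrite memv_cap xN.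
case: i xi => xi.
  have xN := borel_odd xi; rewrite /= lam_extN // mulr0 mul0r scaler0 subrr lam_extN //.
  exact: borel_ideal_l.
case: j yj => yj.
  have yN := borel_odd yj; rewrite /= (lam_extN yN) mulr0 mul0r scaler0 subrr lam_extN //.
  exact: (bo_ideal B).
rewrite /= expr0 scale1r.
have -> : (lam_ext y : K) * lam_ext x = (lam_ext x : K) * lam_ext y by exact: mulrC.
rewrite subrr; have [n [t [nN th ->]]] := borel_decomp x; have [m [s [mN sh ->]]] := borel_decomp y.
rewrite brDl !brDr (torus_abelian (bo_torus B) th sh) addr0 lam_extN //.
by rewrite !memvD //; [exact: (bo_ideal B)|exact: borel_ideal_l|exact: (bo_ideal B)].
Qed.

Lemma lam_ext_pm x : x \in gr g false -> lam_ext x ^+ p = lam_ext (pm x).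
Proof.
move=> x0; have [n [t [nN th e]]] := borel_decomp x.
have t0 := subvP (torus_even (bo_torus B)) _ th.
have n0 : n \in gr g false by rewrite -(addrK t n) -e memvB.
have [n' [n'N e']] := borel_pm nN n0 th.
by rewrite e e' !lam_extE ?lam_pm // (torus_pm (bo_torus B)).
Qed.

Definition lam_char : {lrmorphism renv g -> K^o} := rlift lam_ext_compat lam_ext_pm.

Lemma lam_char_uiota x : lam_char (uiota x) = lam_ext x.
Proof. exact: rlift_uiota. Qed.

Lemma lam_char_odd a : renv_gr true a -> lam_char a = 0.
Proof.
suff H i b : renv_gr i b -> i -> lam_char b = 0 by move=> h0; exact: (H _ _ h0).
elim=> {i b} [i _|//|i a' b _ ha _ hb hi|i c a' _ ha hi|i j a' b _ ha _ hb|i x xi hi].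
- exact: raddf0.
- by rewrite raddfD /= ha // hb // addr0.
- by rewrite linearZ /= ha // scaler0.
- rewrite rmorphM /=; case: i ha => /= ha hi; first by rewrite ha // mul0r.
  by rewrite hb // mulr0.
by rewrite lam_char_uiota lam_extN //; apply: borel_odd; rewrite hi in xi.
Qed.

Lemma lam_module_exists : exists M : gmodule (usuper g), is_supermodule M /\ exists v : M,
  [/\ v != 0, forall x, exists c : K, x = (c%:A : usuper g) *: v,
    forall t, t \in h -> (uiota t : usuper g) *: v = ((lam t)%:A : usuper g) *: v
  & forall x, x \in N -> (uiota x : usuper g) *: v = 0].
Proof.
exists (character_module lam_char); split.
  exact: character_module_supermodule lam_char_odd.
exists (mquo _ (1 : (renv g)^o) : char_mod lam_char); split.
- exact: char_mod_neq0.
- exact: char_mod_scale.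
- move=> t th; have := char_mod_act lam_char (uiota t); rewrite lam_char_uiota.
  by rewrite -[t in lam_ext t]add0r lam_extE ?mem0v.
move=> x xN; have := char_mod_act lam_char (uiota x); rewrite lam_char_uiota lam_extN //.
by rewrite scale0r scale0r.
Qed.

End Characters.

(** * Passing between g and its subalgebras *)

Section Transfer.
Variables (K : fieldType) (p : nat) (g : restrictedLSA K p).
Implicit Types (b : rsubalg g) (N h V : {vspace g}).

Definition sub_vs b V : {vspace sub_lsa b} := (linfun (@vsval _ _ b) @^-1: V)%VS.

Lemma mem_sub_vs b V (u : sub_lsa b) : (u \in sub_vs b V) = (vsval u \in V).
Proof. by rewrite -memv_preim lfunE. Qed.

Lemma mem_gr_sub b i (u : sub_lsa b) : (u \in gr (sub_lsa b) i) = (vsval u \in gr g i).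
Proof. exact: sub_grE. Qed.

Record borel_in b N h : Prop := {
  bi_sum : (N + h)%VS = b;
  bi_cap : (N :&: h = 0)%VS;
  bi_nil : nil_datum N;
  bi_torus : is_torus h;
  bi_ideal : forall x y, x \in b -> y \in N -> br x y \in N
}.

Lemma val_iter_pm b r (u : sub_lsa b) : u \in gr (sub_lsa b) false ->
  vsval (iter r (@pm _ _ (sub_lsa b)) u) = iter r (@pm _ _ g) (vsval u).
Proof.
move=> hu; elim: r => //= r IH; rewrite val_sub_pm ?IH //; exact: (@pm_iter_gr _ _ (sub_lsa b)).
Qed.

Lemma sub_vs_nil b N : (N <= b)%VS -> nil_datum N -> @nil_datum K p (sub_lsa b) (sub_vs b N).
Proof.
move=> Nb [hg hb hs hn]; split.
- apply: graded_intro => u; rewrite mem_sub_vs => uN.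
  have [x0 [x1 [[n0 n1] g0 g1 e]]] := gradedP hg uN.
  have b0 := subvP Nb _ n0; have b1 := subvP Nb _ n1.
  exists (vsproj b x0), (vsproj b x1); rewrite !mem_sub_vs ?mem_gr_sub !vsprojK //; split=> //.
  by apply: subvs_inj; rewrite linearD /= !vsprojK.
- by move=> u v; rewrite !mem_sub_vs val_sub_br; exact: hb.
- move=> u; rewrite memv_cap mem_sub_vs => /andP[uN u1]; rewrite mem_sub_vs val_sub_sq //.
  by apply: hs; rewrite memv_cap uN -mem_gr_sub.
move=> u; rewrite memv_cap mem_sub_vs => /andP[uN u0].
have [|r hr] := hn (vsval u); first by rewrite memv_cap uN -mem_gr_sub.
by exists r; apply: subvs_inj; rewrite val_iter_pm // hr linear0.
Qed.

Lemma sub_vs_torus b h : (h <= b)%VS -> is_torus h -> @is_torus K p (sub_lsa b) (sub_vs b h).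
Proof.
move=> hb H; split.
- by apply/subvP => u; rewrite mem_sub_vs mem_gr_sub; exact: (subvP (torus_even H)).
- move=> u; rewrite !mem_sub_vs => uh; rewrite val_sub_pm; first exact: (torus_pm H).
  by rewrite mem_gr_sub; exact: (subvP (torus_even H)).
- move=> u v; rewrite !mem_sub_vs => uh vh; apply: subvs_inj.
  by rewrite val_sub_br (torus_abelian H) // linear0.
move=> u; rewrite mem_sub_vs => uh.
have u0 : u \in gr (sub_lsa b) false by rewrite mem_gr_sub; exact: (subvP (torus_even H)).
have [r [c e]] := semisimpleE (torus_semisimple H uh).
exists r; have eu : u = \sum_i c i *: iter i.+1 (@pm _ _ (sub_lsa b)) u.
  apply: subvs_inj; rewrite {1}e linear_sum; apply: eq_bigr => i _.
  by rewrite linearZ; congr (_ *: _); exact: (esym (val_iter_pm i.+1 u0)).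
rewrite {1}eu; apply: rpred_sum => i _; apply: memvZ; apply: memv_span; apply/mapP.
exists (i : nat) => //; by rewrite mem_iota add0n ltn_ord.
Qed.

Lemma borel_in_borel b N h : borel_in b N h -> @borel K p (sub_lsa b) (sub_vs b N) (sub_vs b h).
Proof.
case=> hs hc hn ht hi; have Nb : (N <= b)%VS by rewrite -hs addvSl.
have hb : (h <= b)%VS by rewrite -hs addvSr.
split.
- apply/eqP; rewrite eqEsubv subvf /=; apply/subvP => u _.
  have : vsval u \in (N + h)%VS by rewrite hs subvsP.
  case/memv_addP=> x xN [y yh e].
  have -> : u = vsproj b x + vsproj b y.
    by apply: subvs_inj; rewrite linearD /= !vsprojK ?(subvP Nb _ xN) ?(subvP hb _ yh).
  by apply: memv_add; rewrite mem_sub_vs vsprojK ?(subvP Nb _ xN) ?(subvP hb _ yh).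
- apply/eqP; rewrite -subv0; apply/subvP => u; rewrite memv_cap !mem_sub_vs -memv_cap hc !memv0.
  by move=> /eqP e; apply/eqP/subvs_inj; rewrite e linear0.
- exact: sub_vs_nil.
- exact: sub_vs_torus.
by move=> u v; rewrite !mem_sub_vs val_sub_br; apply: hi; exact: subvsP.
Qed.

Section Klam.
Variables (b : rsubalg g) (N h : {vspace g}).
Hypothesis B : borel_in b N h.
Implicit Types (lam : Lambda h).

Lemma klam_exists lam : exists M : gmodule (usuper (sub_lsa b)), is_Klam N lam M.
Proof.
have hb : (h <= b)%VS by rewrite -(bi_sum B) addvSr.
have Nb : (N <= b)%VS by rewrite -(bi_sum B) addvSl.
pose F (u : subvs_of b) : K^o := wt (sval lam) (vsval u).
have Flin : linear F by move=> c u v; rewrite /F /wt !linearP.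
pose FL : {linear sub_lsa b -> K^o} := HB.pack F (GRing.isLinear.Build _ _ _ _ F Flin).
have FLpm (t : sub_lsa b) : t \in sub_vs b h -> FL (pm t) = FL t ^+ p.
  rewrite mem_sub_vs /= /F => th; rewrite val_sub_pm; first exact: (svalP lam).
  by rewrite mem_gr_sub; exact: (subvP (torus_even (bi_torus B))).
have [M [hM [v [v0 vs vh vN]]]] := lam_module_exists (borel_in_borel B) FLpm.
exists M; split=> //; exists v; split=> //.
  move=> t th; have := vh (vsproj b t); rewrite mem_sub_vs vsprojK ?(subvP hb) // => /(_ th) ->.
  by rewrite /= /F vsprojK ?(subvP hb).
by move=> t tN; apply: vN; rewrite mem_sub_vs vsprojK // (subvP Nb).
Qed.

Definition sub_weight lam (u : sub_lsa b) : K := wt (sval lam) (vsval u).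

Definition Klam_generator lam (M : gmodule (usuper (sub_lsa b))) (v : M) : Prop :=
  (forall x, exists c : K, x = (c%:A : usuper (sub_lsa b)) *: v) /\
  hwv (sub_vs b N) (sub_vs b h) (sub_weight lam) v.

Lemma klam_generator lam M : is_Klam N lam M -> simple M /\ exists v, Klam_generator lam (M := M) v.
Proof.
case=> hM [v [v0 vs vh vN]]; split; first exact: line_simple vs.
have [i [c [gc c0]]] := line_homogeneous hM v0 vs.
have cn0 : c != 0 by apply: contraNneq c0 => ->; rewrite scale0r scale0r.
have sw := fun a => scalar_comm (A := sa_alg (usuper (sub_lsa b))) a c v.
exists (((c%:A : usuper (sub_lsa b))) *: v); split.
  move=> x; have [d ->] := vs x; exists (d / c).
  by rewrite scalar_mul mulfVK.
split=> //; first by exists i.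
- move=> u; rewrite mem_sub_vs => uN; rewrite sw.
  by have := vN _ uN; rewrite vsvalK => ->; rewrite scaler0.
move=> u; rewrite mem_sub_vs => uh; rewrite sw.
have := vh _ uh; rewrite vsvalK => ->.
by rewrite !scalar_mul mulrC.
Qed.

(** Highest weight theory is applied to b itself with upper part 0 and with N in the role of the
    opposite part. Any homogeneous weight vector then counts as a highest weight vector, and the
    line is a simple module of that weight. *)
Lemma klam_subquo lam M (E : gmodule (usuper (sub_lsa b))) (y : E) :
  is_Klam N lam M -> is_supermodule E -> (exists i, gm_gr i y) -> y != 0 ->
  (forall t, t \in h -> (uiota (vsproj b t : sub_lsa b) : usuper (sub_lsa b)) *: y
     = ((wt (sval lam) t)%:A : usuper (sub_lsa b)) *: y) -> subquo M E.
Proof.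
move=> hM hE yg y0 yh; have [sM [v [_ hv]]] := klam_generator hM.
have B' := borel_in_borel B.
have R : reduction (@uiota _ _ (sub_lsa b) : _ -> usuper (sub_lsa b)) (sub_vs b h + 0)
    (aug (sub_vs b N)).
  by apply: renv_reduction; [exact: bo_nil B'|rewrite addv0; exact: bo_sum B'].
have z0 (X : gmodule (usuper (sub_lsa b))) (w : X) x : x \in (0%VS : {vspace sub_lsa b}) ->
    (uiota x : usuper (sub_lsa b)) *: w = 0.
  by rewrite memv0 => /eqP ->; rewrite (linear0 (@uiota _ _ (sub_lsa b))); exact: scale0r.
apply: (hw_simple_subquo (lam := sub_weight lam) (h := sub_vs b h) R hE (v := y) _ sM (s := v)).
  split=> //; first exact: z0.
  move=> u; rewrite mem_sub_vs => uh; have := yh _ uh; rewrite vsvalK; exact.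
case: hv => h1 h2 h3 h4; split=> //; exact: z0.
Qed.

End Klam.

Section Embedding.
Variable b : rsubalg g.

Definition sub_emb : {linear sub_lsa b -> g} := @vsval _ _ b.

Definition uiota_emb (x : sub_lsa b) : renv g := uiota (sub_emb x).
Fact uiota_emb_is_linear : linear uiota_emb.
Proof. by move=> c x y; rewrite /uiota_emb !linearP. Qed.
HB.instance Definition _ := GRing.isLinear.Build K _ _ *:%R uiota_emb uiota_emb_is_linear.

Lemma sub_emb_gr i x : x \in gr (sub_lsa b) i -> sub_emb x \in gr g i.
Proof. by rewrite mem_gr_sub. Qed.

Lemma uiota_emb_compat : Uenv_compat uiota_emb.
Proof.
split=> [i j x y hx hy | x hx].
  rewrite [LHS](uiota_br (sub_emb_gr hx) (sub_emb_gr hy)); congr uiota.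
  exact/esym/val_sub_br.
by rewrite [LHS](uiota_sq (sub_emb_gr hx)); congr uiota; exact/esym/val_sub_sq.
Qed.

Lemma uiota_emb_pm x : x \in gr (sub_lsa b) false -> uiota_emb x ^+ p = uiota_emb (pm x).
Proof.
by move=> hx; rewrite [LHS](uiota_pm (sub_emb_gr hx)); congr uiota; exact/esym/val_sub_pm.
Qed.

Definition renv_emb : {lrmorphism renv (sub_lsa b) -> renv g} := rlift uiota_emb_compat uiota_emb_pm.

Lemma renv_emb_uiota x : renv_emb (uiota x) = uiota (vsval x).
Proof. exact: rlift_uiota. Qed.

Lemma renv_emb_dual_basis : exists Db : @dual_basis K (usuper (sub_lsa b)) (usuper g) renv_emb,
  (exists j, db_rho Db j 1 = 1) /\
  forall x, x \notin b -> exists j (k : K), k != 0 /\ db_rho Db j (uiota x) = k%:A.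
Proof.
have [Db [h1 h2]] := @renv_dual_basis K p (sub_lsa b) g sub_emb renv_emb renv_emb_uiota
  (@subvs_inj _ _ b) sub_emb_gr.
exists Db; split=> // x xb; apply: h2 => y e; case/negP: xb; rewrite -e; exact: subvsP.
Qed.

End Embedding.

Lemma renv_incl_dual_basis (b l : rsubalg g) (bl : (b <= l)%VS) :
  exists Db : @dual_basis K (usuper (sub_lsa b)) (usuper (sub_lsa l)) (renv_incl bl),
  (exists j, db_rho Db j 1 = 1) /\
  forall x : sub_lsa l, vsval x \notin b ->
    exists j (k : K), k != 0 /\ db_rho Db j (uiota x) = k%:A.
Proof.
have inj : injective (@sub_incl K p g b l).
  by move=> x y e; apply: subvs_inj; rewrite -!(val_sub_incl bl) e.
have [Db [h1 h2]] := @renv_dual_basis K p (sub_lsa b) (sub_lsa l) (@sub_incl K p g b l)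
  (renv_incl bl) (renv_incl_uiota bl) inj (@sub_incl_gr K p g b l bl).
exists Db; split=> // x xb; apply: h2 => y e; case/negP: xb.
by rewrite -e (val_sub_incl bl); exact: subvsP.
Qed.

Lemma renv_emb_incl (b l : rsubalg g) (bl : (b <= l)%VS) a :
  renv_emb l (renv_incl bl a) = renv_emb b a.
Proof.
apply: (@renv_morph_eq K p (sub_lsa b) (renv g) (renv_emb l \o renv_incl bl) (renv_emb b)) => x.
apply: (etrans (congr1 (renv_emb l) (renv_incl_uiota bl x))).
apply: (etrans (renv_emb_uiota _)); rewrite (val_sub_incl bl).
exact/esym/renv_emb_uiota.
Qed.

End Transfer.

(** * Restricted weights *)

(** The p multiples of 1 are distinct roots of X^p - X, whose degree leaves no room for another. *)
Lemma frobenius_fixed (K : fieldType) (p : nat) (c : K) : p \in [pchar K] -> c ^+ p = c ->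
  exists n : 'F_p, c = (n : nat)%:R.
Proof.
move=> hp e; have pr := pcharf_prime hp; have p1 := prime_gt1 pr.
suff [n np ->] : exists2 n, (n < p)%N & c = n%:R.
  by exists n%:R; rewrite val_Fp_nat // modn_small.
pose rs := [seq i%:R | i <- iota 0 p] : seq K.
have szP : size ('X^p - 'X : {poly K}) = p.+1.
  by rewrite size_polyDl size_polyXn // size_polyN size_polyX ltnS.
have P0 : ('X^p - 'X : {poly K}) != 0 by rewrite -size_poly_eq0 szP.
have rt (x : K) : x ^+ p = x -> root ('X^p - 'X) x.
  by move=> ex; rewrite rootE !hornerE ex subrr.
have urs : uniq rs.
  rewrite map_inj_in_uniq ?iota_uniq // => i j; rewrite !mem_iota !add0n /= => ip jp.
  wlog ij : i j ip jp / (i <= j)%N.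
    by move=> H ej; case/orP: (leq_total i j) => k; [exact: H|exact/esym/H].
  move=> /esym/eqP; rewrite -subr_eq0 -natrB // -(dvdn_pcharf hp) => /dvdnP[k ek].
  case: k ek => [|k] ek; first by apply/eqP; rewrite eqn_leq ij -subn_eq0 ek.
  by have : (j - i < p)%N; [apply: leq_ltn_trans (leq_subr _ _) jp|rewrite ek mulSn ltnNge leq_addr].
have [/mapP[n]|crs] := boolP (c \in rs); first by rewrite mem_iota add0n => np ->; exists n.
have := max_poly_roots (rs := c :: rs) P0; rewrite /= urs crs rt //= szP size_map size_iota ltnn.
move=> H; suff: false by []; apply: H => //; apply/allP => _ /mapP[n _ ->]; apply: rt.
by rewrite -(pFrobenius_autE hp) pFrobenius_aut_nat.
Qed.

Section Weights.
Variables (K : fieldType) (p : nat) (g : restrictedLSA K p) (h : {vspace g}).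
Hypothesis hp : p \in [pchar K].
Hypothesis hh : is_torus h.
Implicit Types (lam mu al : Lambda h).

Lemma Lambda_eq lam mu : sval lam = sval mu -> lam = mu.
Proof. by case: lam mu => l hl [m hm] /= e; subst m; congr exist; exact: Prop_irrelevance. Qed.

Lemma wtD (f k : 'Hom(subvs_of h, K^o)) t : wt (f + k) t = wt f t + wt k t.
Proof. by rewrite /wt add_lfunE. Qed.

Fact Lambda_add_subproof lam mu t : t \in h ->
  wt (sval lam + sval mu) (pm t) = wt (sval lam + sval mu) t ^+ p.
Proof.
move=> th; rewrite !wtD (svalP lam t th) (svalP mu t th) -!(pFrobenius_autE hp).
by rewrite rmorphD.
Qed.
Definition Lambda_add lam mu : Lambda h := exist _ _ (@Lambda_add_subproof lam mu).

Fact Lambda_zero_subproof t : t \in h ->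
  wt (0 : 'Hom(subvs_of h, K^o)) (pm t) = wt (0 : 'Hom(subvs_of h, K^o)) t ^+ p.
Proof.
by move=> th; rewrite /wt !lfunE /= expr0n; case: p (prime_gt0 (pcharf_prime hp)).
Qed.
Definition Lambda_zero : Lambda h := exist _ _ Lambda_zero_subproof.

(** By semisimplicity each t is a combination of its iterated p-th powers, so the image of the p-map
    spans h. *)
Lemma wt_pm_spans (f : 'Hom(subvs_of h, K^o)) : (forall t, t \in h -> wt f (pm t) = 0) -> f = 0.
Proof.
move=> H; apply/lfunP => w; rewrite lfunE /=.
have th := subvsP w; have [r [c e]] := semisimpleE (torus_semisimple hh th).
have -> : f w = wt f (vsval w) by rewrite /wt vsvalK.
rewrite e /wt linear_sum linear_sum big1 // => i _.
rewrite !linearZ /=.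
have -> : f (vsproj h (pm (iter i (@pm _ _ g) (vsval w)))) = 0; last by rewrite scaler0.
apply: H; elim: (nat_of_ord i) => //= q; exact: (torus_pm hh).
Qed.

Section Combination.
Variables (d : nat) (al : 'I_d -> Lambda h).

Lemma wt_comb (c : 'I_d -> K) t : wt (\sum_i c i *: sval (al i)) t = \sum_i c i * wt (sval (al i)) t.
Proof. by rewrite /wt sum_lfunE; apply: eq_bigr => i _; rewrite scale_lfunE. Qed.

(* Frobenius applied to a linear relation among restricted weights. *)
Lemma weight_relation lam (c : 'I_d -> K) : sval lam = \sum_i c i *: sval (al i) ->
  \sum_i (c i ^+ p - c i) *: sval (al i) = 0.
Proof.
move=> e; apply: wt_pm_spans => t th; rewrite wt_comb.
have : wt (sval lam) (pm t) = wt (sval lam) t ^+ p := svalP lam t th.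
rewrite e !wt_comb -(pFrobenius_autE hp) rmorph_sum => e'.
under eq_bigr do rewrite mulrBl.
rewrite sumrB e'; apply/eqP; rewrite subr_eq0; apply/eqP/eq_bigr => i _.
by rewrite rmorphM /= !pFrobenius_autE (svalP (al i) t th).
Qed.

Hypothesis ind : Fp_independent al.

(** As in the independence of characters: normalize the last coefficient to 1 and subtract the
    relation from its Frobenius transform. The result is shorter, so the coefficients are fixed by
    Frobenius and lie in F_p, where independence is the hypothesis. *)
Lemma weights_independent (c : 'I_d -> K) : \sum_i c i *: sval (al i) = 0 -> forall i, c i = 0.
Proof.
have H m : forall c : 'I_d -> K, (forall i : 'I_d, (m <= i)%N -> c i = 0) ->
    \sum_i c i *: sval (al i) = 0 -> forall i, c i = 0.
  elim: m => [c' h0 _ i|m IH c' h0 e i]; first exact: h0.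
  have [lt|ge] := ltnP m d; last first.
    by apply: IH => // j mj; case/negP: (ltn_geF (ltn_ord j)); exact: leq_trans ge mj.
  pose k := Ordinal lt.
  have [ck|ck] := eqVneq (c' k) 0.
    apply: IH => // j; rewrite leq_eqVlt => /orP[/eqP ej|]; last exact: h0.
    by have -> : j = k by exact: val_inj.
  pose f j := c' j / c' k.
  have ef : sval Lambda_zero = \sum_j f j *: sval (al j).
    transitivity ((c' k)^-1 *: \sum_j c' j *: sval (al j)); first by rewrite e scaler0.
    by rewrite scaler_sumr; apply: eq_bigr => j _; rewrite scalerA /f mulrC.
  have fk : f k = 1 by rewrite /f mulfV.
  have fp j : f j ^+ p = f j.
    apply/eqP; rewrite -subr_eq0; apply/eqP.
    apply: (IH (fun j => f j ^+ p - f j)) (weight_relation ef) _ => q.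
    rewrite leq_eqVlt => /orP[/eqP eq|mq].
      by have -> : q = k; [exact: val_inj|rewrite fk expr1n subrr].
    rewrite /f h0 // mul0r expr0n subr0.
    by case: p (prime_gt0 (pcharf_prime hp)).
  have /choice[n hn] j := frobenius_fixed hp (fp j).
  have n0 : n k = 0.
    apply: (ind (c := n)); rewrite -[RHS]/(sval Lambda_zero) ef.
    by apply: eq_bigr => j _; rewrite -hn.
  by have := hn k; rewrite fk n0 => /eqP; rewrite oner_eq0.
apply: (H d) => i hi; have := ltn_ord i; by rewrite ltnNge hi.
Qed.

End Combination.

(** Independence over K makes the [al i] a basis of the dual of h, and applied to [weight_relation]
    it shows that the coordinates of a restricted weight are fixed by Frobenius. *)
Lemma weights_span (al : 'I_(\dim h) -> Lambda h) lam : Fp_independent al ->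
  exists n : 'I_(\dim h) -> nat, sval lam = \sum_i (n i)%:R *: sval (al i).
Proof.
move=> ind; pose X := [tuple sval (al i) | i < \dim h].
have fX : free X.
  apply/freeP => k e i; apply: (weights_independent ind) => //.
  by rewrite -[RHS]e; apply: eq_bigr => j _; rewrite -tnth_nth tnth_mktuple.
have bX : basis_of fullv X.
  rewrite basisEfree fX subvf /= size_tuple dimvf /dim /= card_ord.
  by rewrite -[X in (_ * X)%N]/1%N muln1.
pose c i := coord X i (sval lam).
have e : sval lam = \sum_i c i *: sval (al i).
  rewrite [LHS](coord_basis bX (memvf _)); apply: eq_bigr => j _.
  by rewrite -tnth_nth tnth_mktuple.
have cp i : exists n : 'F_p, c i = (n : nat)%:R.
  apply: (frobenius_fixed hp); apply/eqP; rewrite -subr_eq0; apply/eqP.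
  exact: (weights_independent ind (weight_relation e)).
have /choice[n hn] := cp; exists (fun i => n i : nat).
by rewrite e; apply: eq_bigr => i _; rewrite hn.
Qed.

(** With natural numbers as coefficients every weight is reached from 0 by adding the [al i] one at
    a time; the induction is on the sum of the coefficients. *)
Lemma Lambda_connected (al : 'I_(\dim h) -> Lambda h) (P : Lambda h -> Prop) :
  Fp_independent al -> P Lambda_zero -> (forall i mu, P mu -> P (Lambda_add mu (al i))) ->
  forall lam, P lam.
Proof.
move=> ind P0 PA lam; have [n] := weights_span lam ind.
move: {2}(\sum_i n i)%N (erefl (\sum_i n i)%N) => m; elim: m n lam => [|m IH] n lam en e.
  suff -> : lam = Lambda_zero by [].
  apply: Lambda_eq; rewrite e big1 // => i _.
  have : (n i <= \sum_j n j)%N by rewrite (bigD1 i) //= leq_addr.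
  by rewrite en leqn0 => /eqP ->; rewrite scale0r.
have [i ni] : exists i, (0 < n i)%N.
  apply/existsP; apply: contraPT en => /existsPn H; rewrite big1 // => i _.
  by apply/eqP; rewrite -leqn0 leqNgt H.
pose n' j := (n j - (j == i))%N.
pose c j : K := (n' j)%:R.
(* The combination with one summand [al i] removed is again restricted, as Frobenius fixes natural
   multiples of 1. *)
have [mu emu] : exists mu, sval mu = \sum_j (n' j)%:R *: sval (al j).
  have hmu t : t \in h -> wt (\sum_j c j *: sval (al j)) (pm t) = wt (\sum_j c j *: sval (al j)) t ^+ p.
    move=> th; rewrite !wt_comb -(pFrobenius_autE hp) rmorph_sum; apply: eq_bigr => j _.
    by rewrite rmorphM /= pFrobenius_aut_nat pFrobenius_autE (svalP (al j) t th).
  by exists (exist _ _ hmu).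
have -> : lam = Lambda_add mu (al i).
  apply: Lambda_eq; rewrite /= emu e (bigD1 i) //= [X in _ = X + _](bigD1 i) //=.
  rewrite /n' eqxx addrAC; congr (_ + _).
    by rewrite -[X in _ + X]scale1r -scalerDl natr1 subn1 prednK.
  by apply: eq_bigr => j /negPf ->; rewrite subn0.
apply: PA; apply: (IH n') emu.
move: en; rewrite (bigD1 i) //= [X in _ -> X = _](bigD1 i) //= /n' eqxx.
have -> : (\sum_(j | j != i) (n j - (j == i)) = \sum_(j | j != i) n j)%N.
  by apply: eq_bigr => j /negPf ->; rewrite subn0.
by case: (n i) ni => // q _; rewrite addSn subn1 => -[].
Qed.

End Weights.

(** * Linkage *)

Section InducedVectors.
Variables (K : fieldType) (B A : superalg K) (phi : {lrmorphism B -> A}) (X : gmodule B).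
Hypothesis gA : graded_algebra A.
Local Notation T := (tens phi (1 : A)).

Lemma tens1_act (b : B) (e : X) : phi b *: T e = T (b *: e).
Proof. by rewrite tens_scale mulr1 -(mul1r (phi b)) tens_phi. Qed.

Lemma tens1_gr i (e : X) : gm_gr i e -> @gm_gr _ _ (induced phi X) i (T e).
Proof. by move=> h; exact: (tensor_gr_tens phi (sa_gr1 gA) h). Qed.

Lemma tens1_cyclic (e : X) : (forall x, exists b : B, x = b *: e) ->
  forall z : induced phi X, exists a : A, z = a *: T e.
Proof.
move=> h; elim/tens_ind => [|x y [a ->] [b ->]|a n].
- by exists 0; rewrite scale0r.
- by exists (a + b); rewrite scalerDl.
by have [b ->] := h n; exists (a * phi b); rewrite tens_scale mulr1 tens_phi.
Qed.

Lemma tens_neq0 (Db : dual_basis phi) j a (k : K) (e : X) : db_rho Db j a = k%:A -> k != 0 ->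
  e != 0 -> tens phi a e != 0.
Proof.
move=> h k0; apply: contraNneq => z; have := coordI_tens j a e; rewrite z h coordI0 => /esym h'.
rewrite -[e]scale1r -[1 : B]scale1r -(mulVf k0) -scalar_mul.
by rewrite h' scaler0.
Qed.

Lemma tens1_neq0 (Db : dual_basis phi) j (e : X) : db_rho Db j 1 = 1 -> e != 0 -> T e != 0.
Proof.
by move=> h; apply: (tens_neq0 (Db := Db) (j := j) (k := 1)); rewrite ?scale1r ?oner_neq0.
Qed.

Lemma tens1_hw (VB VA : vectType K) (uB : VB -> B) (uA : VA -> A) (NB hB : {vspace VB})
    (NA hA : {vspace VA}) lamB lamA (Db : dual_basis phi) j (e : X) :
  db_rho Db j 1 = 1 ->
  (forall x, x \in NA -> exists2 y, y \in NB & phi (uB y) = uA x) ->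
  (forall t, t \in hA -> exists s, [/\ s \in hB, phi (uB s) = uA t & lamB s = lamA t]) ->
  hw_vector uB NB hB lamB e -> @hw_vector K A VA uA NA hA lamA (induced phi X) (T e).
Proof.
move=> hj hN hh [[i ge] e0 eN eh]; split.
- by exists i; exact: tens1_gr.
- exact: tens1_neq0 hj e0.
- by move=> x /hN[y yN <-]; rewrite tens1_act eN // tens0r.
move=> t /hh[s [sh <- <-]]; rewrite tens1_act eh // -tens1_act; congr (_ *: _).
by rewrite linearZ /= rmorph1.
Qed.

End InducedVectors.

Lemma weight_shift (K : fieldType) (A : superalg K) (X : gmodule A) (t x : A) (c d : K) (v : X) :
  t * x - x * t = d *: x -> t *: v = (c%:A : A) *: v ->
  t *: (x *: v) = ((c + d)%:A : A) *: (x *: v).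
Proof.
move=> e ev; have -> : t *: (x *: v) = x *: (t *: v) + (d *: x) *: v.
  by rewrite -e scalerBl !scalerA addrC subrK.
by rewrite ev scalar_comm scalar_act -scalerDl -scalerDl.
Qed.

Section Blocks.
Variables (K : closedFieldType) (p : nat) (g : restrictedLSA K p).
Hypothesis hp : p \in [pchar K].
Variables (b : rsubalg g) (N h Nop : {vspace g}).
Hypothesis B : borel_in b N h.
Hypothesis hNop : nil_datum Nop.
Hypothesis g_sum : (Nop + (h + N) = fullv)%VS.
Implicit Types (lam mu : Lambda h) (S T M : gmodule (usuper g)).

Let R := renv_reduction hNop g_sum.

(** Highest with respect to b = N + h, where N may be the negative or the positive part of g. *)
Definition has_hw lam S := exists s, hwv N h (wt (sval lam)) (s : S).

Lemma borel_stable : stable h N.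
Proof.
move=> x y xh yN; apply: (bi_ideal B) => //.
by apply: (subvP _ _ xh); rewrite -(bi_sum B) addvSr.
Qed.

Lemma simple_has_hw S : simple S -> exists lam, has_hw lam S.
Proof.
move=> hS; have [lam [s hs]] := simple_hw_vector (bi_torus B) (bi_nil B) borel_stable hS.
by exists lam, s.
Qed.

Lemma emb_hw (c : rsubalg g) (N' : {vspace g}) lam (X : gmodule (usuper (sub_lsa c))) (e : X) :
  (N <= N')%VS -> (N' <= c)%VS -> (h <= c)%VS ->
  hwv (sub_vs c N') (sub_vs c h) (@sub_weight _ _ _ c h lam) e ->
  hwv N h (wt (sval lam)) (tens (renv_emb c : usuper (sub_lsa c) -> usuper g) 1 e
    : induced (renv_emb c : {lrmorphism usuper (sub_lsa c) -> usuper g}) X).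
Proof.
move=> NN N'c hc; have [Db [[j hj] _]] := renv_emb_dual_basis c.
apply: (tens1_hw (renv_graded g) hj) => [x xN|t th].
  have xN' := subvP NN _ xN; have xc := subvP N'c _ xN'.
  exists (vsproj c x); first by rewrite mem_sub_vs vsprojK.
  by apply: (etrans (renv_emb_uiota _)); rewrite vsprojK.
have tc := subvP hc _ th; exists (vsproj c t); split.
- by rewrite mem_sub_vs vsprojK.
- by apply: (etrans (renv_emb_uiota _)); rewrite vsprojK.
by rewrite /sub_weight vsprojK.
Qed.

Lemma has_hw_subquo lam S M (m : M) : is_supermodule M -> hwv N h (wt (sval lam)) m ->
  simple S -> has_hw lam S -> subquo S M.
Proof. by move=> hM hm hS [s hs]; exact: (hw_simple_subquo R hM hm hS hs). Qed.

Lemma induced_cyclic_hw (c : rsubalg g) (N' : {vspace g}) lam (X : gmodule (usuper (sub_lsa c))) (e : X) :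
  (N <= N')%VS -> (N' <= c)%VS -> (h <= c)%VS -> is_supermodule X ->
  (forall x, exists a : usuper (sub_lsa c), x = a *: e) ->
  hwv (sub_vs c N') (sub_vs c h) (@sub_weight _ _ _ c h lam) e ->
  let M := induced (renv_emb c : {lrmorphism usuper (sub_lsa c) -> usuper g}) X in
  exists m : M, [/\ is_supermodule M, hwv N h (wt (sval lam)) m
    & forall x : M, exists a : usuper g, x = a *: m].
Proof.
move=> NN N'c hc hX cyc he M; have [Db _] := renv_emb_dual_basis c.
exists (tens (renv_emb c : usuper (sub_lsa c) -> usuper g) 1 e); split.
- exact: (ind_supermodule (renv_graded g) hX Db).
- exact: (emb_hw NN N'c hc he).
- exact: tens1_cyclic.
Qed.

(** Such a module is a simple quotient of the one induced from [K_lam] over b, which is cyclic on a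
    highest weight vector. *)
Lemma has_hw_exists lam : exists S, simple S /\ has_hw lam S.
Proof.
have hb : (h <= b)%VS by rewrite -(bi_sum B) addvSr.
have Nb : (N <= b)%VS by rewrite -(bi_sum B) addvSl.
have [M hM] := klam_exists B lam; have [sM [v [vs hv]]] := klam_generator hM.
have cyc x : exists a : usuper (sub_lsa b), x = a *: v by have [k ->] := vs x; exists k%:A.
have [m [hI hm mc]] := induced_cyclic_hw (subvv N) Nb hb (let: And3 q _ _ := sM in q) cyc hv.
have [S [s [sS hs]]] := hw_simple_quotient R hI hm mc.
by exists S; split=> //; exists s.
Qed.

(** The weight vector makes [K_lam] a subquotient of E over c, and exactness carries this to g. The
    generator of the induced [K_lam] is killed by N, which lies in N', so S is a subquotient of that
    module. *)
Lemma weighted_subquo (c : rsubalg g) (N' : {vspace g}) lam S (E : gmodule (usuper (sub_lsa c))) (y : E) :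
  borel_in c N' h -> (N <= N')%VS -> is_supermodule E -> (exists i, gm_gr i y) -> y != 0 ->
  (forall t, t \in h -> (uiota (vsproj c t : sub_lsa c) : usuper (sub_lsa c)) *: y
     = ((wt (sval lam) t)%:A : usuper (sub_lsa c)) *: y) ->
  simple S -> has_hw lam S ->
  subquo S (induced (renv_emb c : {lrmorphism usuper (sub_lsa c) -> usuper g}) E).
Proof.
move=> Bc NN hE yg y0 yh hS sS.
have hc : (h <= c)%VS by rewrite -(bi_sum Bc) addvSr.
have Nc : (N' <= c)%VS by rewrite -(bi_sum Bc) addvSl.
have [M hM] := klam_exists Bc lam; have [sM [v [vs hv]]] := klam_generator hM.
have smM : is_supermodule M by case: sM.
have [Db _] := renv_emb_dual_basis c.
have hI := ind_supermodule (renv_graded g) smM Db.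
apply: (subquo_trans hI); last first.
  by apply: (ind_subquo Db (renv_graded g) hE smM); exact: (klam_subquo Bc hM hE yg y0 yh).
exact: (has_hw_subquo hI (emb_hw NN Nc hc hv) hS sS).
Qed.

(** In the inner induced module 1 (x) v and x (x) v have the weights lam and lam + al, and the
    latter is nonzero as x lies outside bb. *)
Lemma has_hw_tower (bb c : rsubalg g) (bc : (bb <= c)%VS) (Nb Nc : {vspace g}) lam al mu S
    (M : gmodule (usuper (sub_lsa bb))) i x :
  borel_in bb Nb h -> borel_in c Nc h -> (N <= Nc)%VS -> is_Klam Nb lam M ->
  x \in c -> x \notin bb -> x \in gr g i -> weight_vector al x ->
  simple S -> has_hw mu S -> mu = lam \/ mu = Lambda_add hp lam al ->
  subquo S (induced (renv_emb c : {lrmorphism usuper (sub_lsa c) -> usuper g})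
    (induced (renv_incl bc : {lrmorphism usuper (sub_lsa bb) -> usuper (sub_lsa c)}) M)).
Proof.
move=> Bb Bc NN hM xc xb xi xal hS hmu.
have [sM [v [vs [[j gv] v0 _ vh]]]] := klam_generator hM.
have smM : is_supermodule M by case: sM.
have [Db [[k hk] hout]] := renv_incl_dual_basis bc.
have gc := renv_graded (sub_lsa c).
have hI := ind_supermodule gc smM Db.
have hbb : (h <= bb)%VS by rewrite -(bi_sum Bb) addvSr.
pose T e : induced (renv_incl bc : {lrmorphism usuper (sub_lsa bb) -> usuper (sub_lsa c)}) M :=
  tens (renv_incl bc : usuper (sub_lsa bb) -> usuper (sub_lsa c)) 1 e.
have Tv0 : T v != 0 := tens1_neq0 hk v0.
have Tvg : gm_gr j (T v) := tens1_gr (renv_incl bc : {lrmorphism usuper (sub_lsa bb) -> usuper (sub_lsa c)}) gc gv.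
have wT t : t \in h -> (uiota (vsproj c t : sub_lsa c) : usuper (sub_lsa c)) *: T v
    = ((wt (sval lam) t)%:A : usuper (sub_lsa c)) *: T v.
  move=> th; have tb := subvP hbb _ th; have tc := subvP bc _ tb.
  have e : vsproj c t = sub_incl c (vsproj bb t : sub_lsa bb).
    by rewrite /sub_incl vsprojK.
  rewrite e; have e' := renv_incl_uiota bc (vsproj bb t : sub_lsa bb).
  apply: (etrans (congr1 (fun a : usuper (sub_lsa c) => a *: T v) (esym e'))).
  have vt := vh (vsproj bb t : sub_lsa bb); rewrite mem_sub_vs vsprojK // in vt.
  apply: (etrans (tens1_act _ _ v)); rewrite vt // /sub_weight vsprojK //.
  rewrite -tens1_act; congr (_ *: _); rewrite linearZ /=; congr (_ *: _); exact: rmorph1.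
case=> emu; rewrite emu in hmu => {emu}.
  by apply: (weighted_subquo Bc NN hI _ Tv0 wT hS hmu); exists j.
pose X : usuper (sub_lsa c) := uiota (vsproj c x : sub_lsa c).
have xc' : vsval (vsproj c x) = x by rewrite vsprojK.
have gX : sa_gr i X by apply: renv_gr_uiota; rewrite mem_gr_sub xc'.
apply: (weighted_subquo (y := X *: T v) Bc NN hI _ _ _ hS hmu).
- by exists (i (+) j); exact: (gm_act hI).
- have [|k' [q [q0 hq]]] := hout (vsproj c x); first by rewrite xc'.
  by rewrite /T tens_scale mulr1; exact: (tens_neq0 hq q0 v0).
move=> t th; apply: (etrans (@weight_shift K (usuper (sub_lsa c)) _ (uiota (vsproj c t : sub_lsa c)) X
  (wt (sval lam) t) (wt (sval al) t) (T v) _ (wT t th))); last first.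
  by congr ((_ *: 1) *: _); exact: (esym (wtD _ _ _)).
have tc : t \in c by apply: (subvP bc); exact: (subvP hbb).
have t0 : (vsproj c t : sub_lsa c) \in gr (sub_lsa c) false.
  by rewrite mem_gr_sub vsprojK // (subvP (torus_even (bi_torus B))).
have xi' : (vsproj c x : sub_lsa c) \in gr (sub_lsa c) i by rewrite mem_gr_sub xc'.
have := uiota_br t0 xi'; rewrite expr0 scale1r => e; apply: (etrans e).
have -> : br (vsproj c t : sub_lsa c) (vsproj c x) = wt (sval al) t *: (vsproj c x : sub_lsa c).
  by apply: subvs_inj; rewrite val_sub_br linearZ /= !vsprojK // xal.
exact: linearZ.
Qed.

Lemma has_hw_linked lam S T : simple S -> simple T -> has_hw lam S -> has_hw lam T -> linked S T.
Proof. by move=> hS hT [s hs] [t ht]; exact: (linked_same_weight R hS hT hs ht). Qed.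

Lemma one_block_of_linked (al : 'I_(\dim h) -> Lambda h) : Fp_independent al ->
  (forall i mu S T, simple S -> simple T -> has_hw mu S -> has_hw (Lambda_add hp mu (al i)) T ->
     linked S T) -> one_block (usuper g).
Proof.
move=> ind step; pose z := Lambda_zero h hp.
have H : forall lam S T, simple S -> simple T -> has_hw z S -> has_hw lam T -> linked S T.
  apply: (@Lambda_connected _ _ _ _ hp (bi_torus B) al (fun lam => forall S T, simple S ->
    simple T -> has_hw z S -> has_hw lam T -> linked S T) ind) => [S T|i mu IH S T] hS hT hs ht.
    exact: (has_hw_linked hS hT hs ht).
  have [U [hU hu]] := has_hw_exists mu.
  by apply: (linked_trans (IH S U hS hU hs hu)); exact: (step i mu).
have [U [hU hu]] := has_hw_exists z.
split; first by exists U.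
move=> S T hS hT; have [lam hlam] := simple_has_hw hS; have [mu hmu] := simple_has_hw hT.
by apply: (linked_trans (linked_sym (H _ _ _ hU hS hu hlam))); exact: (H _ _ _ hU hT hu hmu).
Qed.

End Blocks.

(** * Induction in stages *)

Section Transitivity.
Variables (K : fieldType) (B1 B2 C A : superalg K).
Variables (i1 : {lrmorphism B1 -> C}) (i2 : {lrmorphism B1 -> B2}).
Variables (e1 : {lrmorphism C -> A}) (e2 : {lrmorphism B2 -> A}).
Hypothesis e12 : forall b, e1 (i1 b) = e2 (i2 b).
Hypothesis e1_gr : forall i c, sa_gr i c -> sa_gr i (e1 c).
Hypotheses (gB2 : graded_algebra B2) (gA : graded_algebra A) (gC : graded_algebra C).
Variables (D1 : dual_basis i1) (De : dual_basis e1) (D2 : dual_basis i2) (De2 : dual_basis e2).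
Variable N : gmodule B1.
Hypothesis hN : is_supermodule N.
Local Notation X := (induced e2 (induced i2 N)).
Local Notation Y := (induced e1 (induced i1 N)).

(** The universal property, used in two stages, sends a (x) c (x) n to a e1(c) (x) 1 (x) n. This is
    onto, as a (x) b (x) n equals a e2(b) (x) 1 (x) n. *)
Lemma ind_trans_subquo : subquo X Y.
Proof.
have hY := ind_supermodule gA (ind_supermodule gC hN D1) De.
have hX := ind_supermodule gA (ind_supermodule gB2 hN D2) De2.
pose f (n : N) : X := tens e2 1 (tens i2 1 n).
have fD m n : f (m + n) = f m + f n by rewrite /f (tensDr i2); exact: (@tensDr _ _ _ e2 (induced i2 N)).
have fZ (b : B1) n : f (b *: n) = e1 (i1 b) *: f n.
  by rewrite /f e12 tens1_act; congr (tens _ _ _); rewrite tens1_act.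
have fgr i n : gm_gr i n -> gm_gr i (f n) by move=> hn; apply: tens1_gr => //; exact: tens1_gr.
have [F1 [F1D F1Z F1T]] := @ind_univ _ _ _ i1 N D1 _ X e1 f fD fZ.
have [F [FD FZ FT]] := @ind_univ _ _ _ e1 (induced i1 N) De _ X idfun F1 F1D F1Z.
have F10 : F1 0 = 0 by apply: (addrI (F1 0)); rewrite -F1D !addr0.
have F0 : F 0 = 0 by apply: (addrI (F 0)); rewrite -FD !addr0.
have F1B x y : F1 (x - y) = F1 x - F1 y by apply: (addIr (F1 y)); rewrite -F1D !subrK.
have FB x y : F (x - y) = F x - F y by apply: (addIr (F y)); rewrite -FD !subrK.
have F1gr i z : gm_gr i z -> gm_gr i (F1 z).
  elim=> {i z} [i|i x y _ hx _ hy|i j c n hc hn].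
  - by rewrite F10; exact: (gm_gr0 hX).
  - by rewrite F1B; exact: (gm_grB hX).
  by rewrite F1T; apply: (gm_act hX); [exact: e1_gr|exact: fgr].
have Fgr i z : gm_gr i z -> gm_gr i (F z).
  elim=> {i z} [i|i x y _ hx _ hy|i j c n hc hn].
  - by rewrite F0; exact: (gm_gr0 hX).
  - by rewrite FB; exact: (gm_grB hX).
  by rewrite FT; apply: (gm_act hX) => //; exact: F1gr.
have Fonto (w : X) : exists z, F z = w.
  elim/tens_ind: w => [|x y [x' <-] [y' <-]|a w].
  - by exists 0.
  - by exists (x' + y').
  elim/tens_ind: w => [|x y [x' ex] [y' ey]|b n].
  - by exists 0; rewrite tens0r.
  - by exists (x' + y'); rewrite FD ex ey tensDr.
  exists (tens e1 (a * e2 b) (tens i1 1 n)); rewrite FT F1T rmorph1 scale1r.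
  apply: (etrans (@tens_scale _ _ _ e2 (induced i2 N) (a * e2 b) 1 (tens i2 1 n))).
  rewrite mulr1 (@tens_phi _ _ _ e2 (induced i2 N)); congr (tens e2 a _).
  by apply: (etrans (@tens_scale _ _ _ i2 N b 1 n)); rewrite mulr1.
exists (fun x s => F x = s), false; split=> [|s|s <-//]; last exact: Fonto.
split=> [//|x y s t <- <-|a x s <-|x s <-].
- exact: FB.
- exact: FZ.
have [x0 [x1 [g0 g1 ->]]] := gm_sum hY x.
by exists x0, x1, (F x0), (F x1); split=> //; split=> //; exact: Fgr.
Qed.

End Transitivity.

Lemma comp_series_subquo (K : fieldType) (A : superalg K) (M : gmodule A) n (F : 'I_n -> gmodule A) i :
  is_supermodule M -> comp_series M F -> subquo (F i) M.
Proof.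
move=> hM [P [_ _ Psub Pstep]]; have [Pi [hF _ _] [f [e [fi fs fgr]]]] := Pstep i.
have h0 := Psub i (ltnW (ltn_ord i)); have h1 := Psub i.+1 (ltn_ord i).
exists (subquot_corr (P i.+1) f), e; split.
- exact: subquot_correspondence.
- move=> s; have [s0 [s1 [g0 g1 es]]] := gm_sum hF s.
  have [x0 [p0 _ e0]] := fgr _ _ g0; have [x1 [p1 _ e1]] := fgr _ _ g1.
  exists (x0 + x1); split; first exact: (ss_D h1).
  by rewrite es !linearD /= e0 e1.
- by move=> s; exact: subquot_corr_fun.
Qed.

Section Tower.
Variables (K : closedFieldType) (p : nat) (g : restrictedLSA K p).

Lemma renv_emb_gr (c : rsubalg g) i a : renv_gr i a -> renv_gr i (renv_emb c a).
Proof.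
elim=> {i a} [i||i a b _ ha _ hb|i k a _ ha|i j a b _ ha _ hb|i x xi].
- by rewrite raddf0; exact: renv_gr0.
- by rewrite rmorph1; exact: renv_gr1.
- by rewrite raddfD; exact: renv_grD.
- by rewrite linearZ; exact: renv_grZ.
- by rewrite rmorphM; exact: renv_grM.
by rewrite renv_emb_uiota; apply: renv_gr_uiota; rewrite -mem_gr_sub.
Qed.

Variables (b c : rsubalg g) (bc : (b <= c)%VS) (N h Nop : {vspace g}).
Hypothesis B : borel_in b N h.
Hypothesis hNop : nil_datum Nop.
Hypothesis g_sum : (Nop + (h + N) = fullv)%VS.

(** The module is cyclic on 1 (x) 1 (x) v, which is killed by N and has weight lam. *)
Lemma tower_indecomposable (lam : Lambda h) (M : gmodule (usuper (sub_lsa b))) : is_Klam N lam M ->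
  let E := induced (renv_emb c : {lrmorphism usuper (sub_lsa c) -> usuper g})
    (induced (renv_incl bc : {lrmorphism usuper (sub_lsa b) -> usuper (sub_lsa c)}) M) in
  indecomposable E /\ finite_dim E.
Proof.
move=> hM E; have [sM [v [vs hv]]] := klam_generator hM.
have smM : is_supermodule M by case: sM.
have hb : (h <= b)%VS by rewrite -(bi_sum B) addvSr.
have Nb : (N <= b)%VS by rewrite -(bi_sum B) addvSl.
have [Db [[k hk] _]] := renv_incl_dual_basis bc.
have gc := renv_graded (sub_lsa c).
have hI := ind_supermodule gc smM Db.
have cyc x : exists a : usuper (sub_lsa b), x = a *: v by have [q ->] := vs x; exists q%:A.
have conv x : x \in b -> renv_incl bc (uiota (vsproj b x : sub_lsa b)) = uiota (vsproj c x : sub_lsa c).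
  move=> xb; apply: (etrans (renv_incl_uiota bc _)); congr uiota.
  by rewrite /sub_incl vsprojK.
have hw := @tens1_hw K (usuper (sub_lsa b)) (usuper (sub_lsa c)) (renv_incl bc) M gc
  (sub_lsa b) (sub_lsa c) (@uiota _ _ _) (@uiota _ _ _) (sub_vs b N) (sub_vs b h) (sub_vs c N) (sub_vs c h)
  (@sub_weight _ _ _ b h lam) (@sub_weight _ _ _ c h lam) Db k v hk.
have R := renv_reduction hNop g_sum.
have [|m [sI hm mc]] := induced_cyclic_hw (lam := lam) (subvv N) (subv_trans Nb bc) (subv_trans hb bc)
  hI (tens1_cyclic cyc).
  apply: hw hv => [x|t]; rewrite mem_sub_vs => xN.
    have xb := subvP Nb _ xN; exists (vsproj b (vsval x)); first by rewrite mem_sub_vs vsprojK.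
    by apply: (etrans (conv _ xb)); rewrite vsvalK.
  have xb := subvP hb _ xN; exists (vsproj b (vsval t)); split.
  - by rewrite mem_sub_vs vsprojK.
  - by apply: (etrans (conv _ xb)); rewrite vsvalK.
  by rewrite /sub_weight vsprojK.
split; first exact: (hw_indecomposable R sI hm mc).
exact: (cyclic_finite_dim R mc).
Qed.

End Tower.

(** * Triangular decompositions *)

Section TriangularDecomposition.
Variables (K : fieldType) (p : nat) (g : restrictedLSA K p).
Implicit Types (l : rsubalg g) (h : {vspace g}).

Lemma ideal_nil (U I : {vspace g}) : is_ideal U I -> p_nilpotent I -> nil_datum I.
Proof.
case=> IU gI bI sI nI; split=> // x y xI yI; apply: bI => //; exact: (subvP IU).
Qed.

Lemma td_h_torus l h (T : triangular_decomposition l h) : is_torus h.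
Proof. by case: (td_torus T). Qed.

Lemma td_unique l h (T : triangular_decomposition l h) a t n o :
  a \in (om T + nm T)%VS -> t \in h -> n \in np T -> o \in op T -> a + t + n + o = 0 ->
  [/\ a = 0, t = 0, n = 0 & o = 0].
Proof.
have := td_direct T; rewrite directv_addE => /and3P[]; rewrite directv_addE => /and3P[].
rewrite directv_addE => /and3P[_ _ /eqP c1] _ /eqP c2 _ /eqP c3 ha ht hn ho e.
have zero (U V : {vspace g}) u v : (U :&: V = 0)%VS -> u \in U -> v \in V -> u + v = 0 -> v = 0.
  move=> c hu hv /eqP; rewrite addr_eq0 => /eqP euv.
  by apply/eqP; rewrite -memv0 -c memv_cap hv andbT -(opprK v) -euv memvN.
have o0 : o = 0 by apply: (zero _ _ _ _ c3 _ ho e); do 2!apply: memv_add => //.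
rewrite o0 addr0 in e.
have n0 : n = 0 by apply: (zero _ _ _ _ c2 _ hn e); apply: memv_add.
rewrite n0 addr0 in e.
have t0 : t = 0 := zero _ _ _ _ c1 ha ht e.
by split=> //; rewrite t0 addr0 in e.
Qed.

Lemma td_om_odd l h (T : triangular_decomposition l h) : (om T <= gr g true)%VS.
Proof. by apply: subv_trans (capvSr l _); rewrite -(td_odd T) addvSl. Qed.

Lemma td_op_odd l h (T : triangular_decomposition l h) : (op T <= gr g true)%VS.
Proof. by apply: subv_trans (capvSr l _); rewrite -(td_odd T) addvSr. Qed.

Lemma td_nm_even l h (T : triangular_decomposition l h) : (nm T <= gr g false)%VS.
Proof. by apply: subv_trans (capvSr l _); rewrite -(td_even T) -addvA addvSl. Qed.

Lemma td_np_even l h (T : triangular_decomposition l h) : (np T <= gr g false)%VS.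
Proof. by apply: subv_trans (capvSr l _); rewrite -(td_even T) addvSr. Qed.

(** An even element of O + N has no component in O. *)
Lemma p_nilpotent_add (O N : {vspace g}) : (O <= gr g true)%VS -> (N <= gr g false)%VS ->
  p_nilpotent N -> p_nilpotent (O + N)%VS.
Proof.
move=> hO hN nN x; rewrite memv_cap => /andP[/memv_addP[o oO [n nI e]] x0]; apply: nN.
have n0 := subvP hN _ nI.
have o0 : o = 0.
  apply: (gr_disjoint (i := true)); first exact: (subvP hO).
  by rewrite -(addrK n o) -e memvB.
by rewrite memv_cap x0 andbT e o0 add0r.
Qed.

Lemma td_minus_borel l h (T : triangular_decomposition l h) : borel_in (bm T) (om T + nm T)%VS h.
Proof.
have hi := td_bm_ideal T; split.
- exact: td_bm.
- apply/eqP; rewrite -subv0; apply/subvP => x; rewrite memv_cap => /andP[xa xh].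
  have [|||||-> _ _ _] := @td_unique _ _ T x (- x) 0 0; rewrite ?memvN ?mem0v //.
  by rewrite !addr0 subrr.
- apply: (ideal_nil hi); apply: p_nilpotent_add; [exact: td_om_odd|exact: td_nm_even|].
  by case: (td_nm T).
- exact: td_h_torus T.
- exact: (id_br hi).
Qed.

Lemma td_plus_borel l h (T : triangular_decomposition l h) : borel_in (bp T) (op T + np T)%VS h.
Proof.
have hi := td_bp_ideal T; split.
- exact: td_bp.
- apply/eqP; rewrite -subv0; apply/subvP => x; rewrite memv_cap => /andP[/memv_addP[o oO [n nN e]] xh].
  have [|||||_ t0 n0 o0] := @td_unique _ _ T 0 (- x) n o; rewrite ?memvN ?mem0v //.
    by rewrite add0r -addrA [n + o]addrC -e addNr.
  by rewrite e n0 o0 addr0 mem0v.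
- apply: (ideal_nil hi); apply: p_nilpotent_add; [exact: td_op_odd|exact: td_np_even|].
  by case: (td_np T).
- exact: td_h_torus T.
- exact: (id_br hi).
Qed.

Lemma td_np_notin l h (T : triangular_decomposition l h) x : x \in np T -> x != 0 -> x \notin bm T.
Proof.
move=> xn; apply: contraNN; rewrite -(td_bm T) => /memv_addP[a ha [t ht e]].
have [|||||_ _ n0 _] := @td_unique _ _ T a t (- x) 0; rewrite ?memvN ?mem0v //.
  by rewrite addr0 e subrr.
by rewrite -oppr_eq0 n0.
Qed.

(** The force of (A): l itself is a p-nilpotent ideal plus the torus, so what holds for Borel
    subalgebras holds for l. *)
Lemma td_ideal_borel l h (T : triangular_decomposition l h) :
  is_ideal l (om T + nm T + np T + op T)%VS -> p_nilpotent (om T + nm T + np T + op T)%VS ->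
  borel_in l (om T + nm T + np T + op T)%VS h.
Proof.
move=> hi hn; split.
- have AC (U V W : {vspace g}) : (U + V + W = U + W + V)%VS by rewrite -!addvA [(V + W)%VS]addvC.
  by rewrite -(td_sum T) AC [(_ + np T + h)%VS]AC.
- apply/eqP; rewrite -subv0; apply/subvP => x.
  rewrite memv_cap => /andP[/memv_addP[y /memv_addP[a ha [n nN ->]] [o oO e]] xh].
  have [|||||a0 _ n0 o0] := @td_unique _ _ T a (- x) n o; rewrite ?memvN //.
    by rewrite e [a - _]addrC -!addrA addNr.
  by rewrite e a0 n0 o0 !addr0 mem0v.
- exact: (ideal_nil hi).
- exact: td_h_torus T.
- exact: (id_br hi).
Qed.

Lemma td_full h (T : triangular_decomposition (rs_full g) h) :
  (bm T + (op T + np T) = fullv)%VS /\ (bp T + (om T + nm T) = fullv)%VS.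
Proof.
have e : fullv = (om T + nm T + h + np T + op T)%VS by rewrite (td_sum T).
rewrite -(td_bm T) -(td_bp T) e; split; first by rewrite [(op T + _)%VS]addvC addvA.
rewrite addvC [(op T + np T)%VS]addvC -!addvA; do 2!congr (_ + _)%VS.
by rewrite addvA addvC.
Qed.

(** The vector x is replaced by its component in the positive part along b_g^-. It keeps its weight
    because both summands are h-stable, and it stays outside l because b_g^- lies in l; then one of
    its homogeneous components does too. *)
Lemma td_outside h (T : triangular_decomposition (rs_full g) h) (l : rsubalg g) (al : Lambda h) x :
  (bm T <= l)%VS -> x \notin l -> weight_vector al x ->
  exists i z, [/\ z \in (op T + np T)%VS, z \notin l, z \in gr g i & weight_vector al z].
Proof.
move=> bl xl wx; have [full _] := td_full T; have Bp := td_plus_borel T.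
have hm : (h <= bm T)%VS by rewrite -(td_bm T) addvSr.
have hb : (h <= bp T)%VS by rewrite -(td_bp T) addvSr.
have cap u : u \in bm T -> u \in (op T + np T)%VS -> u = 0.
  rewrite -(td_bm T) => /memv_addP[a ha [t ht ->]] /memv_addP[o ho [n hn e]].
  have [|||||-> -> _ _] := @td_unique _ _ T a t (- n) (- o); rewrite ?memvN ?addr0 //.
  by rewrite e addrK subrr.
have : x \in (bm T + (op T + np T))%VS by rewrite full memvf.
case/memv_addP=> y ym [z zp e].
have wz : weight_vector al z.
  move=> t th; apply/eqP; rewrite -subr_eq0; apply/eqP; apply: cap.
    (* As x = y + z has weight al, the defects of z and y cancel: the vector lies in the positive
       part by its first expression and in b_g^- by its second, so it is 0. *)
    have -> : br t z - wt (sval al) t *: z = wt (sval al) t *: y - br t y.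
      have := wx t th; rewrite e brDr scalerDr => wx'.
      by rewrite -[br t z](addKr (br t y)) wx' addrA addrK addrC.
    apply: memvB; first exact: memvZ.
    by apply: (rs_br (rsP (bm T))) => //; exact: (subvP hm).
  by apply: memvB; [apply: (bi_ideal Bp) => //; exact: (subvP hb)|exact: memvZ].
have zl : z \notin l by apply: contra xl => zl; rewrite e memvD // (subvP bl).
have [z0 [z1 [[p0 p1] g0 g1 ez]]] := gradedP (nd_graded (bi_nil Bp)) zp.
have wz01 t : t \in h -> br t z0 = wt (sval al) t *: z0 /\ br t z1 = wt (sval al) t *: z1.
  move=> th; have t0 := subvP (torus_even (td_h_torus T)) _ th.
  apply: (gr_decomp_uniq (g := g) (i := false)).
  - exact: (br_gr (lsaP g) t0 g0).
  - exact: memvZ.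
  - exact: (br_gr (lsaP g) t0 g1).
  - exact: memvZ.
  by rewrite -brDr -scalerDr -ez; exact: wz.
have [z0l|z0l] := boolP (z0 \in l); last by exists false, z0; split=> // t /wz01[].
exists true, z1; split=> //; last by move=> t /wz01[].
by apply: contra zl => z1l; rewrite ez memvD.
Qed.

End TriangularDecomposition.

(** * The two cases *)

Section Cases.
Variables (K : closedFieldType) (p : nat) (g : restrictedLSA K p) (h : {vspace g}).
Hypothesis hp : p \in [pchar K].
Variable Tg : triangular_decomposition (rs_full g) h.
Variables (l : rsubalg g) (Tl : triangular_decomposition l h).
Hypothesis ebm : bm Tl = bm Tg :> {vspace g}.

Lemma minus_sum : ((op Tg + np Tg) + (h + (om Tl + nm Tl)) = fullv)%VS.
Proof. by rewrite [(h + _)%VS]addvC (td_bm Tl) ebm addvC; case: (td_full Tg). Qed.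

Lemma plus_sum : ((om Tg + nm Tg) + (h + (op Tg + np Tg)) = fullv)%VS.
Proof. by rewrite [(h + _)%VS]addvC (td_bp Tg) addvC; case: (td_full Tg). Qed.

(** Weights are taken relative to b_g^-. The role of the intermediate Borel subalgebra is played by
    l, whose nilpotent ideal contains both the negative part and the vectors of n_l^+ that shift the
    weight. *)
Lemma ideal_case : is_ideal l (om Tl + nm Tl + np Tl + op Tl)%VS ->
  p_nilpotent (om Tl + nm Tl + np Tl + op Tl)%VS -> has_independent_weights h (np Tl) ->
  one_block (usuper g).
Proof.
move=> hi hn [xs [al [fx xn wx ind]]].
have Bm := td_minus_borel Tl; have Bl := td_ideal_borel hi hn.
have hNop := bi_nil (td_plus_borel Tg).
apply: (one_block_of_linked (hp := hp) Bm hNop minus_sum ind) => i lam S T hS hT hs ht.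
have [M hM] := klam_exists Bm lam.
have x0 : tnth xs i != 0 by apply: (free_not0 fx); exact: mem_tnth.
have [iE fE] := tower_indecomposable (bm_sub Tl) Bm hNop minus_sum hM.
have NN : (om Tl + nm Tl <= om Tl + nm Tl + np Tl + op Tl)%VS by rewrite -!addvA !addvA -addvA addvSl.
have xl : tnth xs i \in l.
  rewrite -(td_sum Tl); apply: (subvP (addvSl _ _)); apply: (subvP (addvSr _ _)); exact: xn.
have xb := td_np_notin (xn i) x0.
have x00 : tnth xs i \in gr g false := subvP (td_np_even Tl) _ (xn i).
have tower U nu (hU : simple U) (hu : has_hw (om Tl + nm Tl)%VS nu U) :=
  has_hw_tower (hp := hp) Bm hNop minus_sum (bm_sub Tl) Bm Bl NN hM xl xb x00 (wx i) hU hu.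
apply: (linked_subquo hS hT iE fE); first by apply: tower hs _; [|left].
by apply: tower ht _; [|right].
Qed.

(** Two opposite Borel subalgebras act at once: the linking module is indecomposable through b_l^-,
    whereas the simple modules are labelled through b_g^+. Equality of composition factors over l
    transports subquotients between the two sides. *)
Lemma classical_case : np Tl = (l :&: np Tg)%VS -> op Tl = (l :&: op Tg)%VS ->
  (exists psi : Lambda h -> Lambda h, bijective psi /\
     forall (lam : Lambda h)
       (Nm : gmodule (usuper (sub_lsa (bm Tl))))
       (Np : gmodule (usuper (sub_lsa (bp Tl)))),
       is_Klam (om Tl + nm Tl)%VS lam Nm ->
       is_Klam (op Tl + np Tl)%VS (psi lam) Np ->
       same_comp_factors (Ind_minus Nm) (Ind_plus Np)) ->
  (exists C : {vspace g}, [/\ (l + C = fullv)%VS, (l :&: C = 0)%VS & has_independent_weights h C]) ->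
  one_block (usuper g).
Proof.
move=> enp eop [psi [[psi' _ psiK] same]] [C [_ lC [xs [al [fx xC wx ind]]]]].
have Bm := td_minus_borel Tl; have Bpl := td_plus_borel Tl; have Bpg := td_plus_borel Tg.
have hNm := bi_nil (td_minus_borel Tg); have hNp := bi_nil Bpg.
apply: (one_block_of_linked (hp := hp) Bpg hNm plus_sum ind) => i mu S T hS hT hs ht.
(* As [psi] is onto, lam can be chosen so that the positive side starts at the given weight mu. *)
pose lam := psi' mu; have elam : psi lam = mu by exact: psiK.
have [Nm hNmm] := klam_exists Bm lam; have [Np hNpp] := klam_exists Bpl (psi lam).
have [iE fE] := tower_indecomposable (bm_sub Tl) Bm hNp minus_sum hNmm.
have [n [F [G [s [cF cG iso]]]]] := same lam Nm Np hNmm hNpp.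
have x0 : tnth xs i != 0 by apply: (free_not0 fx); exact: mem_tnth.
have xl : tnth xs i \notin l.
  by apply: contra x0 => xl; rewrite -memv0 -lC memv_cap xl xC.
have bl : (bm Tg <= l)%VS by rewrite -ebm; exact: bm_sub.
have [j [z [zN zl zj wz]]] := td_outside bl xl (wx i).
have bc : (bp Tl <= bp Tg)%VS.
  rewrite -(td_bp Tl) -(td_bp Tg); apply: addvS => //; apply: addvS.
    by rewrite eop capvSr.
  by rewrite enp capvSr.
have zc : z \in bp Tg by rewrite -(td_bp Tg); apply: (subvP (addvSl _ _)).
have zb : z \notin bp Tl by apply: contra zl; exact: (subvP (bp_sub Tl)).
have gl := renv_graded (sub_lsa l); have gg := renv_graded g.
have sNm : is_supermodule Nm by case: hNmm.
have sNp : is_supermodule Np by case: hNpp.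
have [Dm _] := renv_incl_dual_basis (bm_sub Tl).
have [Dp _] := renv_incl_dual_basis (bp_sub Tl).
have [Dl _] := renv_emb_dual_basis l.
have [Dc _] := renv_incl_dual_basis bc.
have [Dg _] := renv_emb_dual_basis (bp Tg).
have hEm : is_supermodule (Ind_minus Nm) := ind_supermodule gl sNm Dm.
have hEp : is_supermodule (Ind_plus Np) := ind_supermodule gl sNp Dp.
(* U occurs in the module induced through b_g^+, hence in the one induced through l. Being simple,
   it occurs in the induction of one composition factor over l, which is also a factor on the b_l^-
   side. *)
have transfer U nu : simple U -> has_hw (op Tg + np Tg)%VS nu U ->
    nu = psi lam \/ nu = Lambda_add hp (psi lam) (al i) ->
    subquo U (induced (renv_emb l : {lrmorphism usuper (sub_lsa l) -> usuper g}) (Ind_minus Nm)).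
  move=> hU hu enu.
  have h1 := has_hw_tower (hp := hp) Bpg hNm plus_sum bc Bpl Bpg (subvv _) hNpp zc zb zj wz hU hu enu.
  have e12 a : renv_emb l (renv_incl (bp_sub Tl) a) = renv_emb (bp Tg) (renv_incl bc a).
    by rewrite !renv_emb_incl.
  have h2 := @ind_trans_subquo K (usuper (sub_lsa (bp Tl))) (usuper (sub_lsa (bp Tg)))
    (usuper (sub_lsa l)) (usuper g) (renv_incl (bp_sub Tl)) (renv_incl bc) (renv_emb l)
    (renv_emb (bp Tg)) e12 (@renv_emb_gr _ _ _ l) (renv_graded _) gg gl Dp Dl Dc Dg Np sNp.
  have sX := ind_supermodule gg (ind_supermodule (renv_graded (sub_lsa (bp Tg))) sNp Dc) Dg.
  have h3 := subquo_trans sX h1 h2.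
  have [k hk] := ind_simple_subquo Dl gg hEp cG hU h3.
  pose k' := (s^-1)%g k; have ek : s k' = k by rewrite /k' permKV.
  have sG : is_supermodule (G k) by case: cG => P [_ _ _ /(_ k)[_ []]].
  have sF : is_supermodule (F k') by case: cF => P [_ _ _ /(_ k')[_ []]].
  have iso' : subquo (G k) (F k').
    have := iso k'; rewrite ek => e; by have [] := iso_par_subquo sF sG e.
  have h4 := subquo_trans sF iso' (comp_series_subquo k' hEm cF).
  exact: (subquo_trans (ind_supermodule gg sG Dl) hk (ind_subquo Dl gg hEm sG h4)).
apply: (linked_subquo hS hT iE fE); first by apply: transfer hs _ => //; left.
by apply: transfer ht _ => //; right; rewrite elam.
Qed.

End Cases.

Theorem corollary2p5 (K : closedFieldType) (p : nat) (hp : p \in [pchar K])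
    (g : restrictedLSA K p) (h : {vspace g})
    (Tg : triangular_decomposition (rs_full g) h) :
  (* (A) *)
  (long Tg /\
   exists (l : rsubalg g) (Tl : triangular_decomposition l h),
     [/\ is_ideal l (om Tl + nm Tl + np Tl + op Tl)%VS
           /\ p_nilpotent (om Tl + nm Tl + np Tl + op Tl)%VS,
         has_independent_weights h (np Tl),
         bm Tl = bm Tg :> {vspace g},
         nm Tl = nm Tg
       & has_independent_weights h (nm Tl)])
  \/
  (* (B) *)
  (exists (l : rsubalg g) (Tl : triangular_decomposition l h),
     [/\ [/\ nm Tl = (l :&: nm Tg)%VS, np Tl = (l :&: np Tg)%VS,
             om Tl = (l :&: om Tg)%VS & op Tl = (l :&: op Tg)%VS],
         bm Tl = bm Tg :> {vspace g},
         classical l,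
         exists psi : Lambda h -> Lambda h, bijective psi /\
           forall (lam : Lambda h)
             (Nm : gmodule (usuper (sub_lsa (bm Tl))))
             (Np : gmodule (usuper (sub_lsa (bp Tl)))),
             is_Klam (om Tl + nm Tl)%VS lam Nm ->
             is_Klam (op Tl + np Tl)%VS (psi lam) Np ->
             same_comp_factors (Ind_minus Nm) (Ind_plus Np)
       & exists C : {vspace g},
           [/\ (l + C = fullv)%VS, (l :&: C = 0)%VS
             & has_independent_weights h C]]) ->
  one_block (usuper g).
Proof.
case=> [[_ [l [Tl [[hi hn] hw ebm _ _]]]]|[l [Tl [[_ enp _ eop] ebm _ hpsi hC]]]].
  exact: (ideal_case hp ebm hi hn hw).
exact: (classical_case hp ebm enp eop hpsi hC).
Qed.
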